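(* Let $a\in C^\infty(\mathbb T;\mathbb R)$ be not identically zero, and set $D_0u=a^2u$ and $D_1u=-\partial_x(a^2u_x)$. For $j\in\{0,1\}$ and every real $u_0\in H^1(\mathbb T)$, the problem $$(1-\partial_x^2)u_t+\partial_x\Big(u+\frac{u^2}{2}\Big)+D_ju=0,\qquad u(0)=u_0,$$ has a unique global solution in $C^1([0,\infty);H^1(\mathbb T))$. As $t\to\infty$, $$u(t)\rightharpoonup m_j\ \text{ weakly in }H^1(\mathbb T),\qquad \|u(t)-m_j\|_{H^s(\mathbb T)}\to0\quad\text{for every }s<1,$$ where $m_0=0$ and $m_1=\dfrac1{2\pi}\displaystyle\int_{\mathbb T}u_0\,dx$.
   Context: $\mathbb T=\mathbb R/(2\pi\mathbb Z)$. Solutions are real valued; the equation is understood in $H^{-1}(\mathbb T)$ for each $t\ge0$, i.e. $u_t=-(1-\partial_x^2)^{-1}\big(\partial_x(u+u^2/2)+D_ju\big)$ in $H^1(\mathbb T)$, where $(1-\partial_x^2)^{-1}:H^{-1}(\mathbb T)\to H^1(\mathbb T)$ is the Fourier multiplier $(1+k^2)^{-1}$. The number $m_j$ is identified with the constant function. *)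

(* Defs.v *)
From HB Require Import structures.
From mathcomp Require Import all_boot all_order all_algebra.
From mathcomp Require Import all_classical all_reals all_analysis.
From mathcomp Require Import complex.
Set Implicit Arguments.
Unset Strict Implicit.
Unset Printing Implicit Defensive.
Import Order.TTheory GRing.Theory Num.Theory.
Import numFieldNormedType.Exports.
Local Open Scope classical_set_scope.
Local Open Scope ring_scope.

(* Functions on the torus are 2pi-periodic functions R -> R, identified almost
   everywhere; distributions on the torus are given by their sequence of Fourier
   coefficients int -> R[i]. *)

Section Torus.
Variable R : realType.
Implicit Types (f g a : R -> R) (c : int -> R[i]) (s : R).

Definition torus_int f : R := \int[lebesgue_measure]_(x in `[0, pi *+ 2]) f x.

(* (2 pi)^-1 \int f(x) e^{-ikx} dx *)
Definition fcoef f (k : int) : R[i] :=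
  Complex (torus_int (fun x => f x * cos (k%:~R * x)) / (pi *+ 2))
          (- (torus_int (fun x => f x * sin (k%:~R * x)) / (pi *+ 2))).

(* distributional derivative *)
Definition dx c : int -> R[i] := fun k => 'i * k%:~R * c k.

Definition Hnorm s f : \bar R :=
  sqrte (\esum_(k in [set: int])
    ((1 + k%:~R ^+ 2) `^ s *
     (complex.Re (fcoef f k) ^+ 2 + complex.Im (fcoef f k) ^+ 2))%:E).

Definition L2T : set (R -> R) :=
  [set f : R -> R | [/\ periodic f (pi *+ 2), measurable_fun [set: R] f &
    lebesgue_measure.-integrable `[0, pi *+ 2] (fun x => (f x ^+ 2)%:E)]].

Definition H1T : set (R -> R) := [set f : R -> R | L2T f /\ (Hnorm 1 f < +oo)%E].

Definition aeq f g : Prop := {ae lebesgue_measure, forall x : R, f x = g x}.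

(* The derivative in L^2 of f in H^1: by Riesz-Fischer the set below is then
   nonempty, and any two of its elements agree almost everywhere. *)
Definition wderiv f : R -> R := xget 0 [set g : R -> R | L2T g /\ fcoef g = dx (fcoef f)].

Definition smoothT a : Prop :=
  periodic a (pi *+ 2) /\ forall (n : nat) (x : R), derivable (derive1n n a) x 1.

Definition damping (j : 'I_2) a f : int -> R[i] :=
  if j == 0 :> nat then fcoef (fun x => a x ^+ 2 * f x)
  else - dx (fcoef (fun x => a x ^+ 2 * wderiv f x)).

(* u belongs to C^1([0, +oo); H^1) with derivative ut, one-sided at 0 *)
Definition C1_H1 (u ut : R -> R -> R) : Prop :=
  [/\ forall t, 0 <= t -> H1T (u t) /\ H1T (ut t),
      forall t, 0 <= t ->
        Hnorm 1 ((r - t)^-1 *: (u r - u t) - ut t)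
          @[r --> within `[0, +oo[ t^'] --> 0%E &
      forall t, 0 <= t ->
        Hnorm 1 (ut r - ut t) @[r --> within `[0, +oo[ (nbhs t)] --> 0%E].

Definition solution (j : 'I_2) a (u0 : R -> R) (u : R -> R -> R) : Prop :=
  exists ut : R -> R -> R,
  [/\ C1_H1 u ut,
      forall t, 0 <= t ->
        (fcoef (ut t) - dx (dx (fcoef (ut t))))
        + dx (fcoef (fun x => u t x + u t x ^+ 2 / 2)) + damping j a (u t) = 0 &
      aeq (u 0) u0].

Definition H1_functional (L : (R -> R) -> R) : Prop :=
  (forall (b : R) f g, H1T f -> H1T g -> L (b *: f + g) = b * L f + L g) /\
  exists C : R, forall f, H1T f -> (`|L f|%:E <= C%:E * Hnorm 1 f)%E.

Definition weak_cvg_H1 (u : R -> R -> R) (l : R -> R) : Prop :=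
  forall L, H1_functional L -> L (u t) @[t --> +oo] --> L l.

Definition limit_mean (j : 'I_2) (u0 : R -> R) : R :=
  if j == 0 :> nat then 0 else (pi *+ 2)^-1 * torus_int u0.

End Torus.

(* Main.v *)
Require Import Defs.
From mathcomp Require Import all_boot all_order all_algebra.
From mathcomp Require Import all_classical all_reals all_analysis.
From mathcomp Require Import measurable_realfun.
From mathcomp Require Import complex zify ring lra.
Set Implicit Arguments.
Unset Strict Implicit.
Unset Printing Implicit Defensive.
Import Order.TTheory GRing.Theory Num.Theory.
Import numFieldNormedType.Exports.
Local Open Scope classical_set_scope.
Local Open Scope ring_scope.

(* Idea. With K = (1 - dx^2)^-1 (convolution with a positive kernel on the circle) and b = a^2, the
   problem becomes an ODE u_t = - dx K (u + u^2/2) - K D_j u in C(T), where K D_j is a bounded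
   operator that involves no derivative of u.  It is solved by Picard iteration with a truncated
   flux; the energy identity for |u|_{H^1}^2, whose loss rate is 2 \int b u^2 or 2 \int b u_x^2,
   bounds u uniformly, so that the truncation is inactive.  It also bounds \int_0^oo (K D_j u)^2 dt
   at every point, and the time integral of the squared deviation of u from a constant on an arc
   where b > 0.

   Hence any limit v of u(t + .) along an ultrafilter at +oo solves the undamped equation for all
   times and is a constant c on that arc.  Put f(v) = v + v^2/2, k = f(c), phi = K f(v) and
   G' = f - k.  Then d/dt G(v) + 1/2 dx ((phi - k)^2 - phi_x^2) = 0, and (phi - k)^2 - phi_x^2
   vanishes on the arc, so its time averages over [0, T] are O(1/T) everywhere; a Gronwall
   argument in x shows the same for (phi - k)^2 and phi_x^2.  So phi - k tends to 0 along some
   times, f(v) = k in the limit, and conservation of \int v and \int G(v) together with backward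
   uniqueness forces v = c, where c is 0 or the mean of u0.  Thus u(t, x) converges pointwise, and
   boundedness in H^1 upgrades this to weak H^1 and strong H^s convergence, s < 1.

   Since the statement is about Fourier coefficients of classes of measurable functions, it also
   needs the Fourier side: uniqueness of coefficients in L^1, Riesz-Fischer for the weak derivative
   in D_1, and the identification of H^1 functions with uniform limits of smooth functions of
   bounded energy. *)

(** * Continuity and derivative rules *)

(** The damping acts only where [b > 0], and limits of trajectories are merely locally uniform,
    which does not preserve the energy; only quantities free of derivatives survive. Hence [dampK]
    and [obs] avoid [u_x], and bounds proved for C^1 data reach H^1 data by continuous dependence.
    Ultrafilters make all limits of [u (t + s) x] exist at once, and equicontinuity makes them
    locally uniform, so no subsequence is extracted.

    In the rigidity step G has at c a critical point with second derivative 1 + c. If 1 + c is not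
    0, G - G(c) has a sign near c, and its vanishing integral forces v = c at a time when v is
    uniformly close to c. At c = -1 the sign is lost, but there f(v) - k = (v + 1)^2 / 2 is
    nonnegative and (1 - dx)^-1 of it vanishes at one point of the arc, so it vanishes everywhere.
    This is where the splitting of K into first-order resolvents pays.

    That u is a C^1 curve in H^1 rests on Duhamel's formula: u is the fixed datum times a factor
    that is C^1 in x, plus a term that is C^1 in x. *)

Lemma ct_cst (T U : topologicalType) (a : U) : continuous (fun _ : T => a).
Proof. by move=> x; exact: cvg_cst. Qed.

Section ContinuityRules.
Context {R : realType} {T : topologicalType}.
Implicit Types f g : T -> R.

Lemma ctD f g : continuous f -> continuous g -> continuous (fun x => f x + g x).
Proof. by move=> cf cg x; apply: cvgD; [exact: cf | exact: cg]. Qed.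

Lemma ctN f : continuous f -> continuous (fun x => - f x).
Proof. by move=> cf x; apply: cvgN; exact: cf. Qed.

Lemma ctM f g : continuous f -> continuous g -> continuous (fun x => f x * g x).
Proof. by move=> cf cg x; apply: cvgM; [exact: cf | exact: cg]. Qed.

Lemma ctX f n : continuous f -> continuous (fun x => f x ^+ n).
Proof.
move=> cf; elim: n => [|n IHn]; first exact: ct_cst.
by under [fun _ => _]funext do rewrite exprS; exact: ctM.
Qed.

Lemma ct_norm f : continuous f -> continuous (fun x => `|f x|).
Proof. by move=> cf x; apply: cvg_norm; exact: cf. Qed.

Lemma ct_comp (U : topologicalType) (h : U -> R) (f : T -> U) :
  continuous h -> continuous f ->
  continuous (fun x => h (f x)).
Proof. by move=> ch cf x; apply: (continuous_comp (cf x)); exact: ch. Qed.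

Lemma ct_expR f : continuous f -> continuous (fun x => expR (f x)).
Proof. exact/ct_comp/continuous_expR. Qed.

Lemma ct_cos f : continuous f -> continuous (fun x => cos (f x)).
Proof. exact/ct_comp/continuous_cos. Qed.

Lemma ct_sin f : continuous f -> continuous (fun x => sin (f x)).
Proof. exact/ct_comp/continuous_sin. Qed.

Lemma ct_pair (U V : topologicalType) (f : T -> U) (g : T -> V) :
  continuous f -> continuous g -> continuous (fun x => (f x, g x)).
Proof. by move=> cf cg x; apply: cvg_pair; [exact: cf | exact: cg]. Qed.

Lemma ct_comp2 (U V : topologicalType) (u : U -> V -> R) (f : T -> U) (g : T -> V) :
  continuous (fun z : U * V => u z.1 z.2) -> continuous f -> continuous g ->
  continuous (fun x => u (f x) (g x)).
Proof.
move=> cu cf cg x.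
exact: (@continuous_comp _ _ _ (fun x => (f x, g x)) (fun z => u z.1 z.2) x
  (ct_pair cf cg (x:=x)) (cu (f x, g x))).
Qed.

End ContinuityRules.

Lemma ct_id (T : topologicalType) : continuous (fun x : T => x).
Proof. by move=> x; exact: cvg_id. Qed.

Lemma ct_fst (T U V : topologicalType) (f : T -> U * V) :
  continuous f -> continuous (fun x => (f x).1).
Proof. by move=> cf x; apply: (continuous_comp (cf x)); exact: cvg_fst. Qed.

Lemma ct_snd (T U V : topologicalType) (f : T -> U * V) :
  continuous f -> continuous (fun x => (f x).2).
Proof. by move=> cf x; apply: (continuous_comp (cf x)); exact: cvg_snd. Qed.

(** Continuity of explicit terms by recursion on the head symbol. Functions of two variables enter
    through a context hypothesis of the form [fun z => u z.1 z.2], from which every slice is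
    obtained; hence the form in which joint continuity is stated throughout. *)
Ltac ct1 := lazymatch goal with
  | |- forall z, continuous_at z (fun x => (@?f x + @?g x)%R) => refine (@ctD _ _ f g _ _)
  | |- forall z, continuous_at z (fun x => (- @?f x)%R) => refine (@ctN _ _ f _)
  | |- forall z, continuous_at z (fun x => (@?f x * @?g x)%R) => refine (@ctM _ _ f g _ _)
  | |- forall z, continuous_at z (fun x => (@?f x ^+ ?n)%R) => refine (@ctX _ _ f n _)
  | |- forall z, continuous_at z (fun x => (`| @?f x |)%R) => refine (@ct_norm _ _ f _)
  | |- forall z, continuous_at z (fun x => expR (@?f x)) => refine (@ct_expR _ _ f _)
  | |- forall z, continuous_at z (fun x => cos (@?f x)) => refine (@ct_cos _ _ f _)
  | |- forall z, continuous_at z (fun x => sin (@?f x)) => refine (@ct_sin _ _ f _)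
  | |- forall z, continuous_at z (fun x => (@?f x).1) => refine (@ct_fst _ _ _ f _)
  | |- forall z, continuous_at z (fun x => (@?f x).2) => refine (@ct_snd _ _ _ f _)
  | |- forall z, continuous_at z (fun x => (@?f x, @?g x)) => refine (@ct_pair _ _ _ f g _ _)
  | |- forall z, continuous_at z fst => refine (@ct_fst _ _ _ (fun x => x) (@ct_id _))
  | |- forall z, continuous_at z snd => refine (@ct_snd _ _ _ (fun x => x) (@ct_id _))
  | |- forall z, continuous_at z expR => exact (@continuous_expR _)
  | |- forall z, continuous_at z cos => exact (@continuous_cos _)
  | |- forall z, continuous_at z sin => exact (@continuous_sin _)
  | |- forall z, continuous_at z (GRing.add ?a) => refine (@ctD _ _ (fun _ => a) (fun x => x) _ _)
  | |- forall z, continuous_at z (GRing.mul ?a) => refine (@ctM _ _ (fun _ => a) (fun x => x) _ _)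
  | |- forall z, continuous_at z (GRing.opp) => refine (@ctN _ _ (fun x => x) _)
  | |- forall z, continuous_at z (fun x => x) => refine (@ct_id _)
  | |- forall z, continuous_at z (fun _ => ?a) => refine (@ct_cst _ _ a)
  | |- forall z, continuous_at z (fun x => ?u (@?g x) (@?h x)) => match goal with
      | H : forall z, continuous_at z (fun z => u z.1 z.2) |- _ => refine (ct_comp2 H _ _)
      | H : forall t, forall z, continuous_at z (u t) |- _ => refine (ct_comp (H _) _)
      | H : forall z, continuous_at z (u ?t) |- _ => refine (ct_comp H _)
      end
  | |- forall z, continuous_at z (fun x => ?u (@?g x)) => match goal with
      | H : forall z, continuous_at z u |- _ => refine (ct_comp H _)
      | H : forall t, forall z, continuous_at z _ |- _ => refine (ct_comp (H _) _)
      end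
  | |- forall z, continuous_at z (?u ?t) => match goal with
      | H : forall z, continuous_at z (fun z => u z.1 z.2) |- _ =>
           refine (ct_comp2 H (@ct_cst _ _ t) (@ct_id _))
      | H : forall t, forall z, continuous_at z (u t) |- _ => exact (H t)
      end
  end.
Ltac ct := cbv beta; repeat first [ assumption | ct1 ].

Section Derivatives.
Context {R : realType}.
Implicit Types (f g : R -> R) (x l m : R).

Lemma dvD f g x l m : is_derive x 1 f l -> is_derive x 1 g m ->
  is_derive x (1 : R) (fun y => f y + g y) (l + m).
Proof. by move=> *; exact: is_deriveD. Qed.

Lemma dvN f x l : is_derive x 1 f l -> is_derive x (1 : R) (fun y => - f y) (- l).
Proof. by move=> *; exact: is_deriveN. Qed.

Lemma dvB f g x l m : is_derive x 1 f l -> is_derive x 1 g m ->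
  is_derive x (1 : R) (fun y => f y - g y) (l - m).
Proof. by move=> *; exact: is_deriveB. Qed.

Lemma dvM f g x l m : is_derive x 1 f l -> is_derive x 1 g m ->
  is_derive x (1 : R) (fun y => f y * g y) (l * g x + f x * m).
Proof.
move=> hf hg; apply: is_derive_eq (is_deriveM hf hg) _.
by rewrite /GRing.scale /= addrC mulrC.
Qed.

Lemma dv_cst (a x : R) : is_derive x (1 : R) (fun=> a) 0.
Proof. exact: is_derive_cst. Qed.

Lemma dv_id (x : R) : is_derive x (1 : R) (fun y => y) 1.
Proof. exact: is_derive_id. Qed.

Lemma dvZ f a x l : is_derive x 1 f l -> is_derive x (1 : R) (fun y => a * f y) (a * l).
Proof.
move=> hf; apply: is_derive_eq (dvM (dv_cst a x) hf) _.
by rewrite mul0r add0r.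
Qed.

Lemma dvX f n x l : is_derive x 1 f l ->
  is_derive x (1 : R) (fun y => f y ^+ n) (n%:R * f x ^+ n.-1 * l).
Proof.
move=> hf; elim: n => [|n IHn]; first by rewrite !mul0r; exact: dv_cst.
under [fun _ => _]funext do rewrite exprS.
apply: is_derive_eq (dvM hf IHn) _ => /=.
case: n IHn => [|n] _ /=; first by rewrite expr0; ring.
by rewrite [in LHS]exprS [in RHS]exprS -[n.+2]addn1 natrD; ring.
Qed.

Lemma dv_comp f g x l m : is_derive x 1 f l -> is_derive (f x) 1 g m ->
  is_derive x (1 : R) (fun y => g (f y)) (m * l).
Proof. by move=> hf hg; exact: (is_derive1_comp hg). Qed.

Lemma dv_expR f x l : is_derive x 1 f l ->
  is_derive x (1 : R) (fun y => expR (f y)) (expR (f x) * l).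
Proof. by move=> hf; apply: dv_comp. Qed.

Lemma dv_cos f x l : is_derive x 1 f l ->
  is_derive x (1 : R) (fun y => cos (f y)) (- sin (f x) * l).
Proof. by move=> hf; apply: dv_comp. Qed.

Lemma dv_sin f x l : is_derive x 1 f l ->
  is_derive x (1 : R) (fun y => sin (f y)) (cos (f x) * l).
Proof. by move=> hf; apply: dv_comp. Qed.

Lemma dv_ct f df : (forall x : R, is_derive x 1 f (df x)) -> continuous f.
Proof.
by move=> h x; apply: differentiable_continuous; apply/derivable1_diffP; case: (h x).
Qed.

Lemma dv_unique f x l m : is_derive x (1 : R) f l -> is_derive x (1 : R) f m -> l = m.
Proof. by move=> [_ <-] [_ <-]. Qed.

Lemma dv_ext f g x l : f =1 g -> is_derive x (1 : R) f l -> is_derive x (1 : R) g l.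
Proof. by move=> /funext ->. Qed.

Lemma dv_shift f a x l : is_derive (a + x) 1 f l ->
  is_derive x (1 : R) (fun y => f (a + y)) l.
Proof.
move=> h; apply: is_derive_eq (dv_comp (dvD (dv_cst a x) (dv_id x)) h) _.
by rewrite add0r mulr1.
Qed.

Lemma dv_mvt f df a b : a <= b ->
    (forall x, a <= x <= b -> is_derive x (1 : R) f (df x)) ->
  exists2 c, a <= c <= b & f b - f a = df c * (b - a).
Proof.
move=> ab h; have h1 x : x \in `]a, b[ -> is_derive x (1 : R) f (df x).
  by rewrite in_itv /= => /andP[/ltW ax /ltW xb]; apply: h; rewrite ax.
have [|c] := MVT_segment ab h1.
  apply: derivable_within_continuous => x; rewrite in_itv /= => xab.
  by case: (h x xab).
by rewrite in_itv => cab fab; exists c.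
Qed.

Lemma dv_le f df g dg a b : a <= b ->
    (forall x, a <= x <= b -> is_derive x (1 : R) f (df x)) ->
    (forall x, a <= x <= b -> is_derive x (1 : R) g (dg x)) ->
    (forall x, a <= x <= b -> df x <= dg x) ->
  f b - f a <= g b - g a.
Proof.
move=> ab hf hg hle.
have h x : a <= x <= b -> is_derive x (1 : R) (fun y => g y - f y) (dg x - df x).
  by move=> xab; apply: dvB; [exact: hg | exact: hf].
have [c cab E] := dv_mvt ab h.
have : 0 <= (dg c - df c) * (b - a) by rewrite mulr_ge0 // subr_ge0 // hle.
rewrite -E; lra.
Qed.

Lemma dv0_cst f : (forall x, is_derive x (1 : R) f 0) -> forall x y, f x = f y.
Proof.
by move=> h x y; exact: is_derive_0_is_cst.
Qed.

Lemma dv_eq f g df : (forall x, is_derive x (1 : R) f (df x)) ->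
  (forall x, is_derive x (1 : R) g (df x)) -> forall a b, f b - f a = g b - g a.
Proof.
move=> hf hg a b.
have h x : is_derive x (1 : R) (fun y => f y - g y) 0.
  by apply: is_derive_eq (dvB (hf x) (hg x)) _; rewrite subrr.
have := dv0_cst h a b; lra.
Qed.

End Derivatives.

Lemma dv_to (R : realType) (f : R -> R) (x l m : R) :
  is_derive x 1 f l -> l = m -> is_derive x 1 f m.
Proof. by move=> h <-. Qed.

(* Reduces [is_derive x 1 f l], for an explicit [f], to an equation on [l]. *)
Ltac dv1 := lazymatch goal with
  | |- is_derive ?x _ (fun y => (@?f y - @?g y)%R) _ => notypeclasses refine (@dvB _ f g x _ _ _ _)
  | |- is_derive ?x _ (fun y => (@?f y + @?g y)%R) _ => notypeclasses refine (@dvD _ f g x _ _ _ _)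
  | |- is_derive ?x _ (fun y => (- @?f y)%R) _ => notypeclasses refine (@dvN _ f x _ _)
  | |- is_derive ?x _ (fun y => (@?f y * @?g y)%R) _ => notypeclasses refine (@dvM _ f g x _ _ _ _)
  | |- is_derive ?x _ (fun y => (@?f y ^+ ?n)%R) _ => notypeclasses refine (@dvX _ f n x _ _)
  | |- is_derive ?x _ (fun y => expR (@?f y)) _ => notypeclasses refine (@dv_expR _ f x _ _)
  | |- is_derive ?x _ (fun y => cos (@?f y)) _ => notypeclasses refine (@dv_cos _ f x _ _)
  | |- is_derive ?x _ (fun y => sin (@?f y)) _ => notypeclasses refine (@dv_sin _ f x _ _)
  | |- is_derive ?x _ (GRing.add ?a) _ => notypeclasses refine (@dvD _ (fun _ => a) (fun y => y) x _ _ _ _)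
  | |- is_derive ?x _ (GRing.mul ?a) _ => notypeclasses refine (@dvM _ (fun _ => a) (fun y => y) x _ _ _ _)
  | |- is_derive ?x _ GRing.opp _ => notypeclasses refine (@dvN _ (fun y => y) x _ _)
  | |- is_derive ?x _ (fun y => y) _ => notypeclasses refine (@dv_id _ x)
  | |- is_derive ?x _ (fun _ => ?a) _ => notypeclasses refine (@dv_cst _ a x)
  | |- is_derive ?x _ ?f _ => match goal with
    | H : forall x, is_derive x _ ?g _ |- _ => notypeclasses refine (H x)
    | H : forall z y, is_derive _ _ _ _ |- _ => notypeclasses refine (H _ _)
    | H : is_derive x _ ?g _ |- _ => notypeclasses refine H
    end
  end.
Ltac dv := notypeclasses refine (@dv_to _ _ _ _ _ _ _); [ by repeat dv1 | cbv beta ].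

(** * Integrals of continuous functions *)

Section Primitive.
Context {R : realType}.
Notation mu := (@lebesgue_measure R).
Implicit Types (f g F G : R -> R) (a b c x : R).

Lemma ct_integrable f a b : continuous f -> mu.-integrable `[a, b] (EFin \o f).
Proof.
move=> cf; apply: continuous_compact_integrable; first exact: segment_compact.
exact: continuous_subspaceT.
Qed.

(** The fundamental theorem of calculus on a segment gives a derivative only to the right of a fixed
    base point. Near [x], the primitive based at 0 differs by a constant from the one based at [a],
    a point chosen to the left of both 0 and [x]. *)
Lemma continuous_primitive f : continuous f ->
  exists F, forall x, is_derive x (1 : R) F (f x).
Proof.
move=> cf.
pose F x := if 0 <= x then \int[mu]_(t in `[0, x]) f t else - \int[mu]_(t in `[x, 0]) f t.
exists F => x; pose a : R := - `|x| - 1.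
have ax : a < x by rewrite /a; have := ler_norm (- x); rewrite normrN; lra.
have a0 : a < 0 by rewrite /a; have := normr_ge0 x; lra.
have [] := @continuous_FTC1_closed R f a x (x + 1) _ (ct_integrable _ _ cf) ax (cf x).
  by rewrite ltrDl.
set G := fun _ => _ => dG G'; have {dG G'}hG : is_derive x 1 G (f x).
  by rewrite derive1E in G'; rewrite -G'; exact: derivableP.
have split_int p q r : p <= q <= r ->
    \int[mu]_(t in `[p, r]) f t - \int[mu]_(t in `[p, q]) f t = \int[mu]_(t in `[q, r]) f t.
  move=> /andP[pq qr]; rewrite Rintegral_itvB ?bnd_simp //; last exact: ct_integrable.
  rewrite Rintegral_itv_obnd_cbnd //.
  by apply: integrableS (ct_integrable q r cf) => //; apply: subset_itvr; rewrite bnd_simp.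
apply: (near_eq_is_derive _ (f := fun y => G y - \int[mu]_(t in `[a, 0]) f t)).
- near=> y; have ay : a < y by near: y; exact: lt_nbhsr.
  rewrite /F; case: leP => y0.
    by rewrite -(split_int a 0 y) // (ltW a0) y0.
  by rewrite -(split_int a y 0) ?(ltW ay) ?(ltW y0) // opprB.
- by apply: dv_to (dvB hG (dv_cst _ _)) _; rewrite subr0.
Unshelve. all: by end_near. Qed.

(* Junk value 0 when [f] has no antiderivative. *)
Definition prim f : R -> R :=
  xget (fun=> 0) [set F | forall x, is_derive x (1 : R) F (f x)].

(** An integral defined by an antiderivative is oriented, so endpoints need no order, and its rules
    become comparisons of derivatives. [Rintegral_intg] ties it to the Lebesgue integral. *)
Definition intg f a b := prim f b - prim f a.

Lemma dv_prim f x : continuous f -> is_derive x (1 : R) (prim f) (f x).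
Proof.
move=> /continuous_primitive[F hF]; rewrite /prim.
by case: xgetP => [G -> /(_ x) //|/(_ F) /(_ hF)].
Qed.

Lemma intgE F f a b : (forall x, is_derive x (1 : R) F (f x)) ->
  intg f a b = F b - F a.
Proof.
move=> hF; apply: (@dv_eq _ _ _ f) => // x; rewrite /prim.
by case: xgetP => [G -> /(_ x) //|/(_ F) /(_ hF)].
Qed.

Lemma intg_ext f g a b : f =1 g -> intg f a b = intg g a b.
Proof. by move=> /funext ->. Qed.

Lemma dv_intg f a x : continuous f -> is_derive x (1 : R) (intg f a) (f x).
Proof.
by move=> cf; apply: dv_to (dvB (dv_prim x cf) (dv_cst (prim f a) x)) _; rewrite subr0.
Qed.

Lemma intgxx f a : intg f a a = 0. Proof. exact: subrr. Qed.

Lemma intg_cat f a b c : intg f a b + intg f b c = intg f a c.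
Proof. by rewrite /intg; ring. Qed.

Lemma intg_swap f a b : intg f a b = - intg f b a.
Proof. by rewrite /intg; ring. Qed.

Lemma intgD f g a b : continuous f -> continuous g ->
  intg (fun x => f x + g x) a b = intg f a b + intg g a b.
Proof.
move=> cf cg; have h x := dvD (dv_prim x cf) (dv_prim x cg).
by rewrite (intgE _ _ h) /intg; ring.
Qed.

Lemma intgN f a b : continuous f -> intg (fun x => - f x) a b = - intg f a b.
Proof.
move=> cf; have h x := dvN (dv_prim x cf).
by rewrite (intgE _ _ h) /intg; ring.
Qed.

Lemma intgB f g a b : continuous f -> continuous g ->
  intg (fun x => f x - g x) a b = intg f a b - intg g a b.
Proof. by move=> cf cg; rewrite intgD ?intgN //; ct. Qed.

Lemma intgZ k f a b : continuous f -> intg (fun x => k * f x) a b = k * intg f a b.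
Proof.
move=> cf; have h x := dvZ k (dv_prim x cf).
by rewrite (intgE _ _ h) /intg; ring.
Qed.

Lemma intg_cst k a b : intg (fun=> k) a b = k * (b - a).
Proof.
have h (x : R) : is_derive x (1 : R) (fun y => k * y) k by dv; ring.
by rewrite (intgE _ _ h); ring.
Qed.

Lemma intg_le f g a b : a <= b -> continuous f -> continuous g ->
  (forall x, a <= x <= b -> f x <= g x) -> intg f a b <= intg g a b.
Proof.
move=> ab cf cg fg; apply: (dv_le ab (df := f) (dg := g)) => // x _; exact: dv_prim.
Qed.

Lemma intg_ge0 f a b : a <= b -> continuous f ->
  (forall x, a <= x <= b -> 0 <= f x) -> 0 <= intg f a b.
Proof.
move=> ab cf f0; rewrite -[leLHS](_ : intg (fun=> 0) a b = 0); last first.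
  by rewrite intg_cst mul0r.
by apply: intg_le => //; ct.
Qed.

Lemma intg_abs_le f g a b : a <= b -> continuous f -> continuous g ->
  (forall x, a <= x <= b -> `|f x| <= g x) -> `|intg f a b| <= intg g a b.
Proof.
move=> ab cf cg fg; rewrite ler_norml -intgN //; apply/andP; split.
  by apply: intg_le => //; [ct | move=> x /fg; rewrite ler_norml => /andP[]].
by apply: intg_le => // x /fg; rewrite ler_norml => /andP[].
Qed.

Lemma intg_abs_le_cst f M a b : a <= b -> continuous f ->
  (forall x, a <= x <= b -> `|f x| <= M) -> `|intg f a b| <= M * (b - a).
Proof. by move=> ab cf fM; rewrite -intg_cst; apply: intg_abs_le => //; ct. Qed.

Lemma intg_le_sub f a b c d : a <= c -> c <= d -> d <= b -> continuous f ->
  (forall x, a <= x <= b -> 0 <= f x) -> intg f c d <= intg f a b.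
Proof.
move=> ac cd db cf f0.
have h1 : 0 <= intg f a c.
  by apply: intg_ge0 => // x /andP[ax xc]; apply: f0; rewrite ax /=; lra.
have h2 : 0 <= intg f d b.
  by apply: intg_ge0 => // x /andP[ax xc]; apply: f0; rewrite xc andbT; lra.
by rewrite -(intg_cat f a c b) -(intg_cat f c d b); lra.
Qed.

Lemma intg_eq0 f a b : continuous f -> (forall x, a <= x <= b -> 0 <= f x) ->
  intg f a b = 0 -> forall x, a < x < b -> f x = 0.
Proof.
move=> cf f0 I0 x /andP[ax xb]; apply/eqP/negPn/negP => fx0.
have fx : 0 < f x by rewrite lt_def fx0 f0 // !ltW.
have : \forall y \near x, f x / 2 < f y.
  apply: (cvgr_gt _ (cf x)); lra.
move=> /nbhs_ballP[e /= e0 he].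
pose d := Num.min (e / 2) (Num.min (x - a) (b - x)).
have d0 : 0 < d by rewrite !lt_min; apply/and3P; split; lra.
have de : d < e by apply: (@le_lt_trans _ _ (e / 2)); [rewrite ge_min lexx | lra].
have da : d <= x - a by rewrite !ge_min lexx orbT.
have db : d <= b - x by rewrite !ge_min lexx !orbT.
have : intg f (x - d) (x + d) <= intg f a b by apply: intg_le_sub => //; lra.
have : intg (fun=> f x / 2) (x - d) (x + d) <= intg f (x - d) (x + d).
  apply: intg_le => //; [lra | by ct | move=> y /andP[y1 y2]].
  apply/ltW/he; rewrite /ball /= ltr_norml; apply/andP; split; lra.
rewrite intg_cst I0 => h1 h2.
have : 0 < f x / 2 * (x + d - (x - d)) by apply: mulr_gt0; lra.
lra.
Qed.

Lemma intg_shift f c a b : continuous f ->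
  intg (fun x => f (c + x)) a b = intg f (c + a) (c + b).
Proof.
move=> cf; have h x := dv_shift (dv_prim (c + x) cf).
by rewrite (intgE _ _ h).
Qed.

Lemma intg_by_parts F G f g a b : (forall x, is_derive x (1 : R) F (f x)) ->
  (forall x, is_derive x (1 : R) G (g x)) -> continuous f -> continuous g ->
  intg (fun x => f x * G x) a b = F b * G b - F a * G a - intg (fun x => F x * g x) a b.
Proof.
move=> hF hG cf cg; have cF := dv_ct hF; have cG := dv_ct hG.
apply/eqP; rewrite eq_sym subr_eq eq_sym -intgD; try ct; apply/eqP.
by have h x := dvM (hF x) (hG x); rewrite (intgE _ _ h).
Qed.

(** Cauchy-Schwarz, read off from the nonnegative integral of [(f - k)^2], where [k] is the mean of
    [f] over the segment. *)
Lemma intg_sqr_le f a b : a <= b -> continuous f ->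
  intg f a b ^+ 2 <= (b - a) * intg (fun x => f x ^+ 2) a b.
Proof.
rewrite le_eqVlt => /predU1P[-> _|ab cf]; first by rewrite !intgxx expr0n mulr0.
set m := intg f a b; set k := m / (b - a).
have : 0 <= intg (fun x => (f x - k) ^+ 2) a b.
  by apply: intg_ge0; [exact: ltW | ct | move=> x _; exact: sqr_ge0].
rewrite (intg_ext (g := fun x => f x ^+ 2 + (- (2 * k) * f x + k ^+ 2))); last first.
  by move=> x; ring.
rewrite !intgD ?intg_cst ?intgZ; try ct; rewrite -/m.
have ba : 0 < b - a by lra.
have E : k * (b - a) = m by rewrite /k divfK // gt_eqF.
move=> h; have := mulr_ge0 (ltW ba) h.
have -> : (b - a) * (intg (fun x => f x ^+ 2) a b + (- (2 * k) * m + k ^+ 2 * (b - a))) =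
  (b - a) * intg (fun x => f x ^+ 2) a b - 2 * (k * (b - a)) * m + (k * (b - a)) ^+ 2 by ring.
rewrite E; nra.
Qed.

Lemma Rintegral_intg f a b : a < b -> continuous f ->
  \int[mu]_(x in `[a, b]) f x = intg f a b.
Proof.
move=> ab cf; rewrite /Rintegral (continuous_FTC2 (F := prim f) ab) //.
- exact: continuous_subspaceT.
- split=> [x _||].
  + by case: (dv_prim x cf).
  + apply: cvg_at_right_filter; apply: (dv_ct (df := f)) => y; exact: dv_prim.
  + apply: cvg_at_left_filter; apply: (dv_ct (df := f)) => y; exact: dv_prim.
- by move=> x _; rewrite derive1E; case: (dv_prim x cf).
Qed.

End Primitive.

Section Parametric.
Context {R : realType}.

Lemma dv_intro (f : R -> R) (x l : R) :
    (forall e : R, 0 < e -> \forall h \near 0, `|f (x + h) - f x - l * h| <= e * `|h|) ->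
  is_derive x (1 : R) f l.
Proof.
move=> H; have C : h^-1 *: (f (h *: (1 : R) + x) - f x) @[h --> 0^'] --> l.
  apply/cvgrPdist_le => e e0; have [r /= r0 Hr] := H e e0.
  exists r => //= h hr h0; have := Hr h hr.
  rewrite /GRing.scale /= mulr1 [h + x]addrC => hh.
  have -> : l - h^-1 * (f (x + h) - f x) = - (h^-1 * (f (x + h) - f x - l * h))
    by field.
  by rewrite normrN normrM normfV ler_pdivrMl ?normr_gt0 // [`|h| * e]mulrC.
by apply: DeriveDef; [apply/cvg_ex; exists l | exact/cvg_lim].
Qed.

(** Compactness of the segment makes joint continuity uniform in the second variable; continuity and
    differentiation of parametric integrals rest on this. *)
Lemma tube (T : topologicalType) (F : T -> R -> R) (a b : R) (z0 : T) (e : R) :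
    continuous (fun z : T * R => F z.1 z.2) -> 0 < e ->
  \forall z \near z0, forall x, a <= x <= b -> `|F z x - F z0 x| < e.
Proof.
move=> cF e0.
have := @segment_compact R a b => /compact_near_coveringP.
move=> /(_ T (nbhs z0) (fun z x => `|F z x - F z0 x| < e) _) H.
have {}H : \forall z \near z0, `[a, b] `<=` [set x | `|F z x - F z0 x| < e].
  apply: H => x _.
  have cG : continuous (fun w : R * T => F w.2 w.1 - F z0 w.1).
    by ct.
  have := cG (x, z0); rewrite /continuous_at /= subrr => /cvgr0_norm_lt /(_ e e0).
  by [].
by apply: filterS H => z H x xab; apply: H; rewrite /= in_itv.
Qed.

Lemma ct_intg (T : topologicalType) (F : T -> R -> R) (a b : R) :
  continuous (fun z : T * R => F z.1 z.2) -> continuous (fun z => intg (F z) a b).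
Proof.
move=> cF; have cz z : continuous (F z) by ct.
wlog ab : a b / a <= b.
  move=> H; case: (leP a b) => [|/ltW ba]; first exact: H.
  by under [fun z => _]funext do rewrite intg_swap; apply: ctN; exact: H.
move=> z0; apply/cvgrPdist_le => e e0.
have d0 : 0 < e / (b - a + 1) by apply: divr_gt0 => //; lra.
apply: filterS (tube a b z0 cF d0) => z H; rewrite -intgB //.
have /le_trans : `|intg (fun x => F z0 x - F z x) a b| <= e / (b - a + 1) * (b - a).
  apply: intg_abs_le_cst => //; first by ct.
  by move=> x xab; rewrite distrC ltW // H.
apply; rewrite mulrAC ler_pdivrMr; last lra.
by apply: ler_wpM2l; [exact: ltW | lra].
Qed.

(** Rescaling to [[0, 1]] moves variable endpoints into the integrand, which reduces [ct_intg_var]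
    to fixed endpoints. *)
Lemma intg_scale (f : R -> R) (a b : R) : continuous f ->
  intg f a b = (b - a) * intg (fun s => f (a + s * (b - a))) 0 1.
Proof.
move=> cf; rewrite -intgZ; last by ct.
have h (s : R) : is_derive s (1 : R) (fun s => prim f (a + s * (b - a)))
    ((b - a) * f (a + s * (b - a))).
  have h1 : is_derive s (1 : R) (fun s => a + s * (b - a)) (b - a) by dv; ring.
  by apply: dv_to (dv_comp h1 (dv_prim _ cf)) _; rewrite mulrC.
by rewrite (intgE _ _ h) mul0r addr0 (_ : a + 1 * (b - a) = b) //; ring.
Qed.

Lemma ct_intg_var (T : topologicalType) (F : T -> R -> R) (p q : T -> R) :
  continuous (fun z : T * R => F z.1 z.2) -> continuous p -> continuous q ->
  continuous (fun z => intg (F z) (p z) (q z)).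
Proof.
move=> cF cp cq; have cz z : continuous (F z) by ct.
under [fun z => _]funext do rewrite intg_scale //.
apply: ctM; first by ct.
apply: (@ct_intg _ (fun z s => F z (p z + s * (q z - p z)))).
by apply: (ct_comp2 cF); ct.
Qed.

(** The mean value theorem in time, applied to [F (t + s) x - dF t x * s], bounds the remainder by
    the oscillation of [dF], which is uniform in [x] by [tube]. *)
Lemma unif_diff (F dF : R -> R -> R) (a b t e : R) :
    (forall t x, is_derive t (1 : R) (F^~ x) (dF t x)) ->
    continuous (fun z : R * R => dF z.1 z.2) -> 0 < e ->
  \forall h \near 0, forall x, a <= x <= b ->
    `|F (t + h) x - F t x - dF t x * h| <= e * `|h|.
Proof.
move=> hF cF e0.
have [r /= r0 Hr] := tube a b t cF e0.
exists r => //= h; rewrite /ball_ /= sub0r normrN => hr x xab.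
have h1 s : is_derive s (1 : R) (fun s => F (t + s) x - dF t x * s)
    (dF (t + s) x - dF t x).
  by apply: dv_to (dvB (dv_shift (hF _ _)) (dvZ _ (dv_id s))) _; rewrite mulr1.
have -> : F (t + h) x - F t x - dF t x * h =
    (F (t + h) x - dF t x * h) - (F (t + 0) x - dF t x * 0) by rewrite addr0; ring.
have near_t s : `|s| <= `|h| -> `|dF (t + s) x - dF t x| <= e.
  move=> sh; apply/ltW/Hr => //; rewrite /ball /= opprD addrA subrr sub0r normrN.
  exact: le_lt_trans hr.
case: (leP 0 h) => h0.
  have [c /andP[c0 ch] ->] := dv_mvt h0 (fun s _ => h1 s).
  rewrite normrM subr0; apply: ler_wpM2r => //.
  by apply: near_t; rewrite !ger0_norm.
have [c /andP[c0 ch] E] := dv_mvt (ltW h0) (fun s _ => h1 s).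
rewrite -opprB normrN E normrM sub0r normrN; apply: ler_wpM2r => //.
by apply: near_t; rewrite !ler0_norm // ?lerN2 // ltW.
Qed.

Lemma dv_param (F dF : R -> R -> R) (a b t : R) :
    (forall t x, is_derive t (1 : R) (F^~ x) (dF t x)) ->
    (forall t, continuous (F t)) -> continuous (fun z : R * R => dF z.1 z.2) ->
  is_derive t (1 : R) (fun t => intg (F t) a b) (intg (dF t) a b).
Proof.
move=> hF cF cdF; have cdFt t' : continuous (dF t') by ct.
wlog ab : a b / a <= b.
  move=> H; case: (leP a b) => [|/ltW ba]; first exact: H.
  under [fun z => _]funext do rewrite intg_swap.
  by rewrite intg_swap; apply: dvN; exact: H.
apply: dv_intro => e e0.
have d0 : 0 < e / (b - a + 1) by apply: divr_gt0 => //; lra.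
apply: filterS (unif_diff a b t hF cdF d0) => h H; have cd : continuous (fun x => F (t + h) x - F t x - dF t x * h) by ct.
have -> : intg (F (t + h)) a b - intg (F t) a b - intg (dF t) a b * h =
    intg (fun x => F (t + h) x - F t x - dF t x * h) a b.
  rewrite !intgB //; try by ct.
  by rewrite [intg _ a b * h]mulrC -intgZ //; congr (_ - _); apply: intg_ext => x; exact: mulrC.
have /le_trans : `|intg (fun x => F (t + h) x - F t x - dF t x * h) a b| <=
    e / (b - a + 1) * `|h| * (b - a).
  by apply: intg_abs_le_cst => // x xab; exact: H.
apply; rewrite mulrAC; apply: ler_wpM2r => //.
rewrite mulrAC ler_pdivrMr; last lra.
by apply: ler_wpM2l; [exact: ltW | lra].
Qed.

(** As functions of the upper time [b], both sides have derivative [intg (F b) c d] and vanish at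
    [b = a]. *)
Lemma intg_fubini (F : R -> R -> R) (a b c d : R) :
  continuous (fun z : R * R => F z.1 z.2) ->
  intg (fun t => intg (F t) c d) a b = intg (fun x => intg (F^~ x) a b) c d.
Proof.
move=> cF.
have cFx x : continuous (F^~ x) by ct.
have h t : is_derive t (1 : R) (fun t => intg (fun x => intg (F^~ x) a t) c d) (intg (F t) c d).
  apply: (@dv_param (fun t x => intg (F^~ x) a t)) => //.
    by move=> s x; apply: dv_intg.
  move=> s; apply: (@ct_intg _ (fun x t => F t x)).
  by apply: (ct_comp2 cF); ct.
rewrite (intgE _ _ h) [X in _ - X](_ : _ = 0) ?subr0 //.
rewrite (intg_ext (g := fun=> 0)) ?intg_cst ?mul0r // => x; exact: intgxx.
Qed.

End Parametric.

(** * The resolvent kernels on the circle *)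

Section Resolvents.
Context {R : realType}.
Notation L := (pi *+ 2 : R).
Implicit Types (f g y q : R -> R).

Lemma period_gt0 : 0 < L. Proof. by rewrite mulr2n; have := @pi_gt0 R; lra. Qed.

Lemma period_ge0 : 0 <= L. Proof. exact/ltW/period_gt0. Qed.

Lemma intg_period y x : continuous y -> periodic y L -> intg y x (x + L) = intg y 0 L.
Proof.
move=> cy py.
have h t : is_derive t (1 : R) (fun t => intg y t (t + L)) 0.
  apply: (@dv_ext _ (fun t => prim y (L + t) - prim y t)).
    by move=> s; rewrite /intg [L + s]addrC.
  apply: dv_to (dvB (dv_shift (dv_prim (L + t) cy)) (dv_prim t cy)) _.
  by rewrite [L + t]addrC py subrr.
by rewrite (dv0_cst h x 0) add0r.
Qed.

(** The periodic solutions of [q + q' = y] and of [q - q' = y], that is (1 + dx)^-1 and (1 - dx)^-1.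
    The kernels are exponentials over one period and the prefactors normalise them to mass 1;
    positivity and mass 1 give the sup-norm bounds. *)
Definition opA y x : R := (expR L - 1)^-1 * intg (fun s => expR s * y (x + s)) 0 L.
Definition opB y x : R := (1 - expR (- L))^-1 * intg (fun s => expR (- s) * y (x + s)) 0 L.

Lemma opA_cst_gt0 : 0 < expR L - 1.
Proof. by rewrite subr_gt0 expR_gt1 period_gt0. Qed.

Lemma opB_cst_gt0 : 0 < 1 - expR (- L).
Proof. by rewrite subr_gt0 expR_lt1 oppr_lt0 period_gt0. Qed.

Lemma opAE y x : continuous y -> opA y x = (expR L - 1)^-1 * (expR (- x) *
  (prim (fun s => expR s * y s) (L + x) - prim (fun s => expR s * y s) x)).
Proof.
move=> cy; have cz : continuous (fun s => expR s * y s) by ct.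
rewrite /opA -[X in _ - prim _ X](addr0 x) [L + x]addrC.
rewrite -/(intg (fun s => expR s * y s) (x + 0) (x + L)) -intg_shift // -intgZ; last by ct.
congr (_ * _); apply: intg_ext => s; rewrite mulrA -expRD.
by congr (expR _ * _); ring.
Qed.

Lemma opBE y x : continuous y -> opB y x = (1 - expR (- L))^-1 * (expR x *
  (prim (fun s => expR (- s) * y s) (L + x) - prim (fun s => expR (- s) * y s) x)).
Proof.
move=> cy; have cz : continuous (fun s => expR (- s) * y s) by ct.
rewrite /opB -[X in _ - prim _ X](addr0 x) [L + x]addrC.
rewrite -/(intg (fun s => expR (- s) * y s) (x + 0) (x + L)) -intg_shift // -intgZ; last by ct.
congr (_ * _); apply: intg_ext => s; rewrite mulrA -expRD.
by congr (expR _ * _); ring.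
Qed.

Lemma dv_opA y x : continuous y -> periodic y L ->
  is_derive x (1 : R) (opA y) (y x - opA y x).
Proof.
move=> cy py; have cz : continuous (fun s => expR s * y s) by ct.
apply: (@dv_ext _ (fun x => (expR L - 1)^-1 * (expR (- x) *
  (prim (fun s => expR s * y s) (L + x) - prim (fun s => expR s * y s) x)))).
  by move=> s; rewrite opAE.
rewrite opAE //; set P := prim _.
have hP s : is_derive s (1 : R) P (expR s * y s) by exact: dv_prim.
have hPL := dv_shift (hP (L + x)); have hPx := hP x.
have hE : is_derive x (1 : R) (fun x => expR (- x)) (- expR (- x)) by dv; ring.
apply: dv_to (dvZ _ (dvM hE (dvB hPL hPx))) _ => /=.
have E : expR (- x) * expR x = 1 by rewrite -expRD addNr expR0.
have EK : (expR L - 1)^-1 * (expR L - 1) = 1 by rewrite mulVf // lt0r_neq0 // opA_cst_gt0.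
rewrite [L + x]addrC py (expRD x L).
set D := P _ - P _; set K := _^-1 in EK *.
transitivity (K * (expR L - 1) * (expR (- x) * expR x) * y x - K * (expR (- x) * D)).
  by ring.
by rewrite E EK !mul1r.
Qed.

Lemma dv_opB y x : continuous y -> periodic y L ->
  is_derive x (1 : R) (opB y) (opB y x - y x).
Proof.
move=> cy py; have cz : continuous (fun s => expR (- s) * y s) by ct.
apply: (@dv_ext _ (fun x => (1 - expR (- L))^-1 * (expR x *
  (prim (fun s => expR (- s) * y s) (L + x) - prim (fun s => expR (- s) * y s) x)))).
  by move=> s; rewrite opBE.
rewrite opBE //; set P := prim _.
have hP s : is_derive s (1 : R) P (expR (- s) * y s) by exact: dv_prim.
have hPL := dv_shift (hP (L + x)); have hPx := hP x.
have hE : is_derive x (1 : R) (fun x => expR x) (expR x) by dv; ring.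
apply: dv_to (dvZ _ (dvM hE (dvB hPL hPx))) _ => /=.
have E : expR (- x) * expR x = 1 by rewrite -expRD addNr expR0.
have EK : (1 - expR (- L))^-1 * (1 - expR (- L)) = 1.
  by rewrite mulVf // lt0r_neq0 // opB_cst_gt0.
rewrite [L + x]addrC py (opprD x L) (expRD (- x) (- L)).
set D := P _ - P _; set K := _^-1 in EK *.
transitivity (K * (expR x * D) - K * (1 - expR (- L)) * (expR (- x) * expR x) * y x).
  by ring.
by rewrite E EK !mul1r.
Qed.

Lemma per_opA y : periodic y L -> periodic (opA y) L.
Proof.
move=> py x; congr (_ * _); apply: intg_ext => s; congr (_ * _).
by rewrite addrAC py.
Qed.

Lemma per_opB y : periodic y L -> periodic (opB y) L.
Proof.
move=> py x; congr (_ * _); apply: intg_ext => s; congr (_ * _).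
by rewrite addrAC py.
Qed.

Lemma ct_opA (T : topologicalType) (F : T -> R -> R) :
  continuous (fun z : T * R => F z.1 z.2) -> continuous (fun z => opA (F z.1) z.2).
Proof.
move=> cF; apply: ctM; first exact: ct_cst.
by apply: (@ct_intg _ _ (fun (z : T * R) s => expR s * F z.1 (z.2 + s))); ct.
Qed.

Lemma ct_opB (T : topologicalType) (F : T -> R -> R) :
  continuous (fun z : T * R => F z.1 z.2) -> continuous (fun z => opB (F z.1) z.2).
Proof.
move=> cF; apply: ctM; first exact: ct_cst.
by apply: (@ct_intg _ _ (fun (z : T * R) s => expR (- s) * F z.1 (z.2 + s))); ct.
Qed.

Lemma opA_lin k y (z : R -> R) x : continuous y -> continuous z ->
  opA (fun x => k * y x + z x) x = k * opA y x + opA z x.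
Proof.
move=> cy cz; rewrite /opA mulrCA -mulrDr -(intgZ k); last by ct.
by rewrite -intgD; try ct; congr (_ * _); apply: intg_ext => s; ring.
Qed.

Lemma opB_lin k y (z : R -> R) x : continuous y -> continuous z ->
  opB (fun x => k * y x + z x) x = k * opB y x + opB z x.
Proof.
move=> cy cz; rewrite /opB mulrCA -mulrDr -(intgZ k); last by ct.
by rewrite -intgD; try ct; congr (_ * _); apply: intg_ext => s; ring.
Qed.

Lemma intg_expR : intg (fun s : R => expR s) 0 L = expR L - 1.
Proof.
have h s : is_derive s (1 : R) (fun s => expR s) (expR s) by dv; ring.
by rewrite (intgE _ _ h) expR0.
Qed.

Lemma intg_expRN : intg (fun s : R => expR (- s)) 0 L = 1 - expR (- L).
Proof.
have h s : is_derive s (1 : R) (fun s => - expR (- s)) (expR (- s)) by dv; ring.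
by rewrite (intgE _ _ h) oppr0 expR0; ring.
Qed.

Lemma opA_cst k x : opA (fun=> k) x = k.
Proof.
rewrite /opA (intg_ext (g := fun s => k * expR s)) => [|s]; last exact: mulrC.
rewrite intgZ; last by ct.
by rewrite intg_expR mulrCA mulVf ?mulr1 // lt0r_neq0 // opA_cst_gt0.
Qed.

Lemma opB_cst k x : opB (fun=> k) x = k.
Proof.
rewrite /opB (intg_ext (g := fun s => k * expR (- s))) => [|s]; last exact: mulrC.
rewrite intgZ; last by ct.
by rewrite intg_expRN mulrCA mulVf ?mulr1 // lt0r_neq0 // opB_cst_gt0.
Qed.

Lemma opA_le y (z : R -> R) x : continuous y -> continuous z -> (forall x, y x <= z x) ->
  opA y x <= opA z x.
Proof.
move=> cy cz yz; apply: ler_wpM2l; first by rewrite invr_ge0 ltW // opA_cst_gt0.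
apply: intg_le; [exact: period_ge0 | ct | ct | move=> s _].
by apply: ler_wpM2l => //; exact: expR_ge0.
Qed.

Lemma opB_le y (z : R -> R) x : continuous y -> continuous z -> (forall x, y x <= z x) ->
  opB y x <= opB z x.
Proof.
move=> cy cz yz; apply: ler_wpM2l; first by rewrite invr_ge0 ltW // opB_cst_gt0.
apply: intg_le; [exact: period_ge0 | ct | ct | move=> s _].
by apply: ler_wpM2l => //; exact: expR_ge0.
Qed.

Lemma opA_abs_le y M x : continuous y -> (forall x, `|y x| <= M) -> `|opA y x| <= M.
Proof.
move=> cy yM; rewrite ler_norml -{1}(opA_cst (- M) x) -{2}(opA_cst M x).
by apply/andP; split; apply: opA_le; try ct; move=> s; have := yM s; rewrite ler_norml => /andP[].
Qed.

Lemma opB_abs_le y M x : continuous y -> (forall x, `|y x| <= M) -> `|opB y x| <= M.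
Proof.
move=> cy yM; rewrite ler_norml -{1}(opB_cst (- M) x) -{2}(opB_cst M x).
by apply/andP; split; apply: opB_le; try ct; move=> s; have := yM s; rewrite ler_norml => /andP[].
Qed.

(** The kernel is strictly positive over a whole period, so one value of [opB y] sees all of [y].
    This settles the degenerate level [c = -1] in [rigidity]. *)
Lemma opB_eq0 y x : continuous y -> periodic y L -> (forall x, 0 <= y x) ->
  opB y x = 0 -> forall s, x < s < x + L -> y s = 0.
Proof.
move=> cy py y0 /eqP; rewrite mulf_eq0 invr_eq0 (negbTE (lt0r_neq0 opB_cst_gt0)) /=.
move=> /eqP I0 s /andP[xs sL].
have cz : continuous (fun s => expR (- s) * y (x + s)) by ct.
have h0 r : 0 <= r <= L -> 0 <= expR (- r) * y (x + r).
  by move=> _; rewrite mulr_ge0 ?expR_ge0.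
have sx : 0 < s - x < L by apply/andP; split; lra.
have := intg_eq0 cz h0 I0 sx; rewrite (_ : x + (s - x) = s); last by ring.
by move=> /eqP; rewrite mulf_eq0 gt_eqF ?expR_gt0 //= => /eqP.
Qed.

(** [expR x * (q x - opA y x)] is constant in [x], while [q] and [opA y] are periodic; as [expR L]
    differs from 1, the constant is 0. *)
Lemma opA_uniq y q : continuous y -> periodic y L -> periodic q L ->
  (forall x, is_derive x (1 : R) q (y x - q x)) -> forall x, q x = opA y x.
Proof.
move=> cy py pq hq x; have hA s := dv_opA s cy py.
have h s : is_derive s (1 : R) (fun s => expR s * (q s - opA y s)) 0.
  by have hqs := hq s; have hAs := hA s; dv; ring.
have := dv0_cst h (x + L) x; rewrite pq (per_opA py) (expRD x L).
set E := expR x; set D := q x - opA y x => E1.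
have : E * D * (expR L - 1) = 0.
  by transitivity (E * expR L * D - E * D); [ring | rewrite E1 subrr].
move=> /eqP; rewrite !mulf_eq0 (gt_eqF opA_cst_gt0) gt_eqF ?expR_gt0 //= orbF.
by rewrite subr_eq0 => /eqP.
Qed.

Lemma opB_uniq y q : continuous y -> periodic y L -> periodic q L ->
  (forall x, is_derive x (1 : R) q (q x - y x)) -> forall x, q x = opB y x.
Proof.
move=> cy py pq hq x; have hB s := dv_opB s cy py.
have h s : is_derive s (1 : R) (fun s => expR (- s) * (q s - opB y s)) 0.
  by have hqs := hq s; have hBs := hB s; dv; ring.
have := dv0_cst h (x + L) x; rewrite pq (per_opB py) (opprD x L) (expRD (- x) (- L)).
set E := expR (- x); set D := q x - opB y x => E1.
have : E * D * (1 - expR (- L)) = 0.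
  by transitivity (E * D - E * expR (- L) * D); [ring | rewrite E1 subrr].
move=> /eqP; rewrite !mulf_eq0 (gt_eqF opB_cst_gt0) gt_eqF ?expR_gt0 //= orbF.
by rewrite subr_eq0 => /eqP.
Qed.

Lemma opA_derive y dy x : continuous dy -> periodic dy L -> periodic y L ->
  (forall x, is_derive x (1 : R) y (dy x)) -> opA dy x = y x - opA y x.
Proof.
move=> cdy pdy py hy; have cy := dv_ct hy.
apply/esym/(opA_uniq cdy pdy (q := fun x => y x - opA y x)).
  by move=> s; rewrite py (per_opA py).
by move=> s; have h1 := hy s; have h2 := dv_opA s cy py; dv; ring.
Qed.

Lemma opB_derive y dy x : continuous dy -> periodic dy L -> periodic y L ->
  (forall x, is_derive x (1 : R) y (dy x)) -> opB dy x = opB y x - y x.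
Proof.
move=> cdy pdy py hy; have cy := dv_ct hy.
apply/esym/(opB_uniq cdy pdy (q := fun x => opB y x - y x)).
  by move=> s; rewrite py (per_opB py).
by move=> s; have h1 := hy s; have h2 := dv_opB s cy py; dv; ring.
Qed.

Lemma per_derive y dy : periodic y L -> (forall x, is_derive x (1 : R) y (dy x)) ->
  periodic dy L.
Proof.
move=> py hy x; apply: (@dv_unique _ (fun x => y (L + x)) x).
  by apply: dv_shift; rewrite addrC.
by apply: dv_ext (hy x) => s; rewrite addrC py.
Qed.

End Resolvents.

(** * Gronwall and Picard *)

Section FlowTools.
Context {R : realType}.
Notation L := (pi *+ 2 : R).

Lemma le_geo (a b c : R) : (forall n, a <= b + c / 2 ^+ n) -> a <= b.
Proof.
move=> h; rewrite leNgt; apply/negP => ba.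
have ba0 : 0 < a - b by lra.
pose n := Num.Def.archi_bound (c / (a - b)).
have := upper_nthrootP (leqnn n); have := h n.
have p0 : (0 : R) < 2 ^+ n by exact: exprn_gt0.
rewrite ltr_pdivrMr // -lerBlDl ler_pdivlMr //; lra.
Qed.

Lemma period_int (y : R -> R) x (k : int) : periodic y L -> y (x + k%:~R * L) = y x.
Proof.
move=> py.
have pn (n : nat) s : y (s + n%:R * L) = y s.
  elim: n s => [|n IHn] s; first by rewrite mul0r addr0.
  by rewrite -natr1 mulrDl mul1r addrA py IHn.
case: k => n; first by rewrite -pmulrn pn.
by rewrite NegzE mulrNz mulNr -pmulrn -[LHS](pn n.+1) subrK.
Qed.

Lemma period_reduce (x : R) : exists k : int, 0 <= x + k%:~R * L < L.
Proof.
have L0 := @period_gt0 R.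
exists (- Num.floor (x / L)); rewrite mulrNz mulNr.
have := Num.Theory.floor_itv (x / L); set n := (Num.floor _)%:~R.
rewrite intrD1 -/n => /andP[h1 h2].
rewrite subr_ge0 -ler_pdivlMr // h1 /= ltrBlDr -[X in _ < X + _]mul1r -mulrDl addrC.
by rewrite -ltr_pdivrMr.
Qed.

Lemma jointly_bounded (u : R -> R -> R) (a b : R) :
    continuous (fun z : R * R => u z.1 z.2) -> (forall t, periodic (u t) L) ->
  exists M, forall t x, a <= t <= b -> `|u t x| <= M.
Proof.
move=> cu pu; have [ab|ba] := leP a b; last first.
  by exists 0 => t x /andP[h1 h2]; have := le_trans h1 h2; rewrite leNgt ba.
have cA : compact ((`[a, b] : set R) `*` (`[0, L] : set R)).
  by apply: compact_setX; exact: segment_compact.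
have [||c _ hc] := @compact_EVT_max _ R (fun z => `|u z.1 z.2|) _ _ cA.
- by exists (a, 0); split; rewrite /= in_itv /= lexx ?ab ?period_ge0.
- by apply: continuous_subspaceT; ct.
exists `|u c.1 c.2| => t x tab; have [k /andP[k1 k2]] := period_reduce x.
rewrite -(period_int x k (pu t)); apply: (hc (t, x + k%:~R * L)).
by rewrite inE; split; rewrite /= in_itv //= k1 ltW.
Qed.

Lemma per_bounded (y : R -> R) : continuous y -> periodic y L ->
  exists M, forall x, `|y x| <= M.
Proof.
move=> cy py; have [||M hM] := @jointly_bounded (fun=> y) 0 0; [by ct | by [] |].
by exists M => x; apply: (hM 0); rewrite lexx.
Qed.

(** Differentiability is asked inside the interval only, because a trajectory coming from an
    arbitrary solution is known to be differentiable at positive times only. *)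
Lemma dv_le_in (f df g dg : R -> R) (a b : R) : a <= b ->
    {within `[a, b], continuous f} ->
    (forall x, a < x < b -> is_derive x (1 : R) f (df x)) ->
    (forall x, is_derive x (1 : R) g (dg x)) ->
    (forall x, a < x < b -> df x <= dg x) ->
  f b - f a <= g b - g a.
Proof.
move=> ab cf hf hg hle.
have h x : x \in `]a, b[ -> is_derive x (1 : R) (fun y => g y - f y) (dg x - df x).
  by rewrite in_itv => xab; exact: (dvB (hg x) (hf x xab)).
have cgf : {within `[a, b], continuous (fun y => g y - f y)}.
  move=> x; apply: cvgB; last exact: cf.
  exact: (continuous_subspaceT (dv_ct hg)).
have [c cab E] := MVT_segment ab h cgf.
have : 0 <= (g b - f b) - (g a - f a).
  move: ab; rewrite le_eqVlt => /predU1P[->|ab]; first by rewrite subrr.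
  have [c'] := MVT ab h cgf; rewrite in_itv => /= c'ab ->.
  by rewrite mulr_ge0 // subr_ge0 ?hle // ltW.
lra.
Qed.

Lemma dv_abs_le_in (f df g dg : R -> R) (a b : R) : a <= b ->
    {within `[a, b], continuous f} ->
    (forall x, a < x < b -> is_derive x (1 : R) f (df x)) ->
    (forall x, is_derive x (1 : R) g (dg x)) ->
    (forall x, a < x < b -> `|df x| <= dg x) ->
  `|f b - f a| <= g b - g a.
Proof.
move=> ab cf hf hg hle; rewrite ler_norml; apply/andP; split; last first.
  apply: dv_le_in ab cf hf hg _ => x /hle; rewrite ler_norml; by case/andP.
rewrite lerNl.
have -> : - (f b - f a) = (fun x => - f x) b - (fun x => - f x) a by ring.
apply: (@dv_le_in (fun x => - f x) (fun x => - df x)) ab _ _ hg _.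
- by move=> x; apply: cvgN; exact: cf.
- by move=> x xab; exact: (dvN (hf x xab)).
- by move=> x /hle; rewrite ler_norml => /andP[]; lra.
Qed.

(* Contraction by 1/2 in the norm weighted by [expR (2 * K * t)]. *)
Lemma sup_gronwall (w dw : R -> R -> R) (T K d M : R) : 0 < K -> 0 <= d ->
    (forall x, {within `[0, T], continuous (w^~ x)}) ->
    (forall t x, 0 < t < T -> is_derive t (1 : R) (w^~ x) (dw t x)) ->
    (forall t N, 0 < t < T -> (forall x, `|w t x| <= N) -> forall x, `|dw t x| <= K * N) ->
    (forall x, `|w 0 x| <= d) ->
    (forall t x, 0 <= t <= T -> `|w t x| <= M) ->
  forall t x, 0 <= t <= T -> `|w t x| <= 2 * d * expR (2 * K * t).
Proof.
move=> K0 d0 cw hw hdw w0 wM.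
have [T0|T0] := leP 0 T; last first.
  by move=> t x /andP[h1 h2]; have := le_lt_trans (le_trans h1 h2) T0; rewrite ltxx.
have M0 : 0 <= M by apply: le_trans (wM 0 0 _) => //; rewrite lexx.
have exp1 t : 0 <= t -> 1 <= expR (2 * K * t).
  by move=> t0; rewrite -expR0 ler_expR !mulr_ge0 // ltW.
have step n t x : 0 <= t <= T -> `|w t x| <= (2 * d + M / 2 ^+ n) * expR (2 * K * t).
  elim: n t x => [|n IHn] t x /andP[t0 tT].
    rewrite expr0 divr1; apply: le_trans (wM t x _) _; first by rewrite t0.
    apply: (@le_trans _ _ ((2 * d + M) * 1)); first by rewrite mulr1; lra.
    by apply: ler_wpM2l; [lra | exact: exp1].
  set N := 2 * d + M / 2 ^+ n in IHn *.
  have N0 : 0 <= N by rewrite /N addr_ge0 ?mulr_ge0 // invr_ge0 exprn_ge0.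
  have hg s : is_derive s (1 : R) (fun s => N / 2 * expR (2 * K * s))
      (K * (N * expR (2 * K * s))) by dv; field.
  have : `|w t x - w 0 x| <= N / 2 * expR (2 * K * t) - N / 2 * expR (2 * K * 0).
    apply: (dv_abs_le_in (f := w^~ x) (df := dw^~ x)) t0 _ _ hg _.
    - apply: continuous_subspaceW (cw x); apply: subset_itvl.
      by rewrite bnd_simp.
    - by move=> s /andP[s0 st]; apply: hw; rewrite s0 (lt_le_trans st).
    - move=> s /andP[s0 st]; have sT := lt_le_trans st tT.
      by apply: hdw => [|r]; [rewrite s0 | apply: IHn; rewrite !ltW].
  rewrite mulr0 expR0 mulr1 => h.
  (* Each pass replaces the bound [N] by [d + N / 2]; the fixed point [2 * d] of this map is the
     constant of the conclusion. *)
  have -> : 2 * d + M / 2 ^+ n.+1 = d + N / 2 by rewrite /N exprS; field; rewrite expf_neq0.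
  have := w0 x; have h3 : d <= d * expR (2 * K * t) by rewrite ler_peMr // exp1.
  have := ler_normD (w t x - w 0 x) (w 0 x); rewrite subrK mulrDl; lra.
move=> t x tT; apply: (@le_geo _ _ (M * expR (2 * K * t))) => n.
by have := step n t x tT; rewrite mulrDl; lra.
Qed.

End FlowTools.

Section Picard.
Context {R : realType}.
Notation L := (pi *+ 2 : R).

(** The segments with centre [s n] and radius [2 * c / 2 ^+ n] are nested; the supremum of their
    left ends lies in all of them, which yields the rate together with the limit. *)
Lemma geo_limit (s : nat -> R) (c : R) : (forall n, `|s n.+1 - s n| <= c / 2 ^+ n) ->
  exists l, forall n, `|s n - l| <= 2 * c / 2 ^+ n.
Proof.
move=> hs; pose d n := 2 * c / 2 ^+ n.
have dS n : d n - d n.+1 = c / 2 ^+ n.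
  by rewrite /d exprS; field; rewrite expf_neq0.
have lo : {homo (fun n => s n - d n) : m n / (m <= n)%N >-> m <= n}.
  apply: homo_leq => [x|x y z|n]; [exact: lexx | exact: le_trans |].
  by have := hs n; rewrite -dS ler_norml => /andP[]; lra.
have hi : {homo (fun n => s n + d n) : m n / (m <= n)%N >-> n <= m}.
  apply: (homo_leq (r := fun x y : R => y <= x)) => [x|x y z|n]; [exact: lexx | exact: ge_trans |].
  by have := hs n; rewrite -dS ler_norml => /andP[]; lra.
have d0 n : 0 <= d n.
  by rewrite /d -mulrA mulr_ge0 //; apply: le_trans (hs n).
have lohi m n : s m - d m <= s n + d n.
  have [mn|/ltnW nm] := leqP m n.
    by have := lo m n mn; have := d0 n; rewrite /=; lra.
  by have := hi n m nm; have := d0 m; rewrite /=; lra.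
pose A : set R := range (fun n => s n - d n).
have supA : has_sup A.
  by split; [exists (s 0 - d 0), 0 | exists (s 0 + d 0) => _ [n _ <-]; exact: lohi].
exists (sup A) => n; rewrite -/(d n) ler_norml; apply/andP; split.
  have : sup A <= s n + d n by apply: ge_sup; [case: supA | move=> _ [m _ <-]; exact: lohi].
  lra.
have : s n - d n <= sup A by apply: sup_upper_bound => //; exists n.
lra.
Qed.

Lemma ct_unif_lim (T : topologicalType) (F : nat -> T -> R) (f : T -> R) :
    (forall n, continuous (F n)) ->
    (forall (z0 : T) (e : R), 0 < e -> exists n, \forall z \near z0, `|F n z - f z| <= e) ->
  continuous f.
Proof.
move=> cF H z0; apply/cvgrPdist_le => e e0.
have e3 : 0 < e / 3 by rewrite divr_gt0.
have [n Hn] := H z0 _ e3.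
have h0 := nbhs_singleton Hn.
have /cvgrPdist_le /(_ _ e3) := cF n z0; apply: filterS2 Hn => z h1 h2.
have := ler_normD (f z0 - F n z0) (F n z0 - F n z + (F n z - f z)).
have := ler_normD (F n z0 - F n z) (F n z - f z).
have -> : f z0 - f z = f z0 - F n z0 + (F n z0 - F n z + (F n z - f z)) by ring.
rewrite [`|f z0 - F n z0|]distrC; lra.
Qed.

(** Integration gains [1 / r] in the norm weighted by [expR (r * |t|)], for both signs of time, so a
    large [r] makes the Picard map contract on the whole time line. *)
Lemma intg_expR_abs_le (g : R -> R) (N r t : R) : 0 < r -> continuous g ->
    (forall s, `|g s| <= N * expR (r * `|s|)) ->
  `|intg g 0 t| <= N / r * expR (r * `|t|).
Proof.
move=> r0 cg hg.
have N0 : 0 <= N by have := hg 0; rewrite normr0 mulr0 expR0 mulr1; apply: le_trans.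
have Nr : 0 <= N / r by rewrite divr_ge0 // ltW.
have rn0 : r != 0 by rewrite gt_eqF.
have [t0|t0] := leP 0 t.
  have h s : is_derive s (1 : R) (fun s => N / r * expR (r * s)) (N * expR (r * s)).
    by dv; field.
  have : `|intg g 0 t| <= intg (fun s => N * expR (r * s)) 0 t.
    apply: intg_abs_le => //; first by ct.
    by move=> s /andP[s0 _]; have := hg s; rewrite (ger0_norm s0).
  by rewrite (intgE _ _ h) mulr0 expR0 (ger0_norm t0); lra.
have h s : is_derive s (1 : R) (fun s => - (N / r) * expR (r * - s)) (N * expR (r * - s)).
  by dv; field.
rewrite intg_swap normrN.
have : `|intg g t 0| <= intg (fun s => N * expR (r * - s)) t 0.
  apply: intg_abs_le => //; [exact: ltW | by ct |].
  by move=> s /andP[_ s0]; have := hg s; rewrite (ler0_norm s0).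
by rewrite (intgE _ _ h) oppr0 mulr0 expR0 (ltr0_norm t0); lra.
Qed.

Section Solve.
Variables (Phi : (R -> R) -> R -> R) (K : R).
Hypothesis K0 : 0 < K.
Hypothesis ctPhi : forall u : R -> R -> R, continuous (fun z : R * R => u z.1 z.2) ->
  (forall t, periodic (u t) L) -> continuous (fun z : R * R => Phi (u z.1) z.2).
Hypothesis perPhi : forall y, continuous y -> periodic y L -> periodic (Phi y) L.
Hypothesis lipPhi : forall (y z : R -> R) (M : R), continuous y -> periodic y L -> continuous z ->
  periodic z L -> (forall x, `|y x - z x| <= M) -> forall x, `|Phi y x - Phi z x| <= K * M.

Fixpoint picard (u0 : R -> R) n : R -> R -> R :=
  if n is n'.+1 then fun t x => u0 x + intg (fun s => Phi (picard u0 n' s) x) 0 t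
  else fun=> u0.

Variable u0 : R -> R.
Hypothesis cu0 : continuous u0.
Hypothesis pu0 : periodic u0 L.

Let it := picard u0.

Let itS n t x : it n.+1 t x = u0 x + intg (fun s => Phi (it n s) x) 0 t.
Proof. by []. Qed.

Let it_regular n : continuous (fun z : R * R => it n z.1 z.2) /\ forall t, periodic (it n t) L.
Proof.
rewrite /it; elim: n => [|n [cn pn]]; first by split=> //; rewrite /=; ct.
rewrite -/it in cn pn *.
have cP := ctPhi cn pn; split=> [|t x] /=.
  apply: ctD; first by ct.
  apply: (@ct_intg_var _ _ (fun (z : R * R) s => Phi (it n s) z.2) (fun=> 0) (fun z => z.1)); try ct.
  by apply: (ct_comp2 (u := fun t x => Phi (it n t) x) cP); ct.
rewrite /it /= -/it pu0; congr (_ + _); apply: intg_ext => s.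
apply: perPhi => //; exact: (ct_comp2 cn (@ct_cst _ _ s) (@ct_id _)).
Qed.

Let ct_it n t : continuous (it n t).
Proof. exact: (ct_comp2 (it_regular n).1 (@ct_cst _ _ t) (@ct_id _)). Qed.

Let ct_Phi_it n x : continuous (fun t => Phi (it n t) x).
Proof.
have [cn pn] := it_regular n.
by apply: (ct_comp2 (u := fun t x => Phi (it n t) x) (ctPhi cn pn)); ct.
Qed.

Lemma picard_existence : exists u : R -> R -> R,
  [/\ continuous (fun z : R * R => u z.1 z.2), forall t, periodic (u t) L,
      u 0 = u0 & forall t x, is_derive t (1 : R) (u^~ x) (Phi (u t) x)].
Proof.
have [M hM] : exists M, forall x, `|Phi u0 x| <= M.
  apply: per_bounded; last exact: perPhi.
  by have := @ct_Phi_it 0 0; move=> _; apply: (ct_comp2 (u := fun t x => Phi (it 0 t) x)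
    (ctPhi (it_regular 0).1 (it_regular 0).2) (@ct_cst _ _ 0) (@ct_id _)).
have M0 : 0 <= M by apply: le_trans (hM 0).
(* At this rate one Picard step contracts by [K / r = 1 / 2] over all times at once, so the solution
   is global and nothing has to be glued. *)
pose r := 2 * K; have r0 : 0 < r by rewrite /r mulr_gt0.
pose C := M / r.
have C0 : 0 <= C by rewrite divr_ge0 // ltW.
have step n t x : `|it n.+1 t x - it n t x| <= C * expR (r * `|t|) / 2 ^+ n.
  elim: n t x => [|n IHn] t x.
    rewrite itS (_ : it 0 t x = u0 x) // addrC addKr expr0 divr1.
    apply: intg_expR_abs_le => //.
    move=> s; apply: le_trans (hM x) _; rewrite ler_peMr // -expR0 ler_expR.
    by rewrite mulr_ge0 // ltW.
  rewrite itS [X in _ - X]itS opprD addrACA subrr add0r -intgB //.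
  apply: le_trans (_ : C / 2 ^+ n * K / r * expR (r * `|t|) <= _).
    apply: intg_expR_abs_le => //.
      by apply: ctD; [|apply: ctN]; exact: ct_Phi_it.
    move=> s; rewrite mulrAC [_ * K]mulrC; apply: lipPhi => //.
    - exact: (it_regular n.+1).2.
    - exact: (it_regular n).2.
    - by move=> y; apply: le_trans (IHn s y) _; rewrite mulrAC.
  have -> : C / 2 ^+ n * K / r = C / 2 ^+ n.+1.
    by rewrite /r exprS; field; rewrite expf_neq0 //= gt_eqF.
  by rewrite mulrAC.
have [u hu] : exists u : R -> R -> R, forall t x n,
    `|it n t x - u t x| <= 2 * (C * expR (r * `|t|)) / 2 ^+ n.
  have h t x : exists l, forall n, `|it n t x - l| <= 2 * (C * expR (r * `|t|)) / 2 ^+ n.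
    by apply: geo_limit => n; exact: step.
  exists (fun t x => sval (cid (h t x))) => t x; exact: (svalP (cid (h t x))).
have cu : continuous (fun z : R * R => u z.1 z.2).
  apply: (@ct_unif_lim _ (fun n z => it n z.1 z.2)); first by move=> n; exact: (it_regular n).1.
  move=> z0 e e0; pose B := 2 * (C * expR (r * (`|z0.1| + 1))).
  exists (Num.Def.archi_bound (B / e)); set n := Num.Def.archi_bound _.
  have hB : B / 2 ^+ n <= e.
    rewrite ler_pdivrMr ?exprn_gt0 // mulrC -ler_pdivrMr // ltW //.
    exact: upper_nthrootP.
  have : \forall z \near z0, `|z0.1 - z.1| < 1.
    have cf : continuous (fun z : R * R => z.1) by ct.
    by have /cvgrPdist_lt /(_ 1 ltr01) := cf z0.
  apply: filterS => z hz; apply: le_trans (hu z.1 z.2 n) (le_trans _ hB).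
  rewrite ler_wpM2r ?invr_ge0 ?exprn_ge0 // ler_pM2l // ler_wpM2l // ler_expR ler_pM2l //.
  have := ler_normD (z.1 - z0.1) z0.1; rewrite subrK distrC; lra.
have pu t : periodic (u t) L.
  move=> x; apply/eqP; rewrite -subr_eq0 -normr_le0; apply: (@le_geo _ _ 0 (4 * (C * expR (r * `|t|)))) => n.
  have := hu t (x + L) n; have := hu t x n; rewrite (it_regular n).2 => h1 h2.
  have := ler_normB (it n t x - u t x) (it n t x - u t (x + L)).
  rewrite opprB addrC addrA subrK add0r => /le_trans; apply.
  by rewrite [4](_ : _ = 2 + 2) ?mulrDl; lra.
have cuP x : continuous (fun t => Phi (u t) x).
  by apply: (ct_comp2 (u := fun t x => Phi (u t) x) (ctPhi cu pu)); ct.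
have fix_u t x : u t x = u0 x + intg (fun s => Phi (u s) x) 0 t.
  apply/eqP; rewrite -subr_eq0 -normr_le0.
  apply: (@le_geo _ _ 0 (2 * (C * expR (r * `|t|)))) => n; rewrite add0r.
  have h1 := hu t x n.+1.
  have h2 : `|it n.+1 t x - (u0 x + intg (fun s => Phi (u s) x) 0 t)| <=
      2 * C / 2 ^+ n * K / r * expR (r * `|t|).
    rewrite itS opprD addrACA subrr add0r -intgB //.
    apply: intg_expR_abs_le => //.
      by apply: ctD; [|apply: ctN]; [exact: ct_Phi_it | exact: cuP].
    move=> s; rewrite mulrAC [_ * K]mulrC; apply: lipPhi => //.
    - exact: (it_regular n).2.
    - exact: (ct_comp2 cu (@ct_cst _ _ s) (@ct_id _)).
    - by move=> y; apply: le_trans (hu s y n) _; rewrite mulrA mulrAC.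
  have E : 2 * C / 2 ^+ n * K / r = 2 * C / 2 ^+ n.+1.
    by rewrite /r exprS; field; rewrite expf_neq0 //= gt_eqF.
  have E2 : 2 * (C * expR (r * `|t|)) / 2 ^+ n =
      2 * (C * expR (r * `|t|)) / 2 ^+ n.+1 + 2 * C / 2 ^+ n.+1 * expR (r * `|t|).
    by rewrite exprS; field; rewrite expf_neq0.
  rewrite E2 -E; have := ler_normB (it n.+1 t x - (u0 x + intg (fun s => Phi (u s) x) 0 t)) (it n.+1 t x - u t x).
  rewrite opprB addrC addrA subrK; lra.
exists u; split => //.
  by apply/funext => x; rewrite fix_u intgxx addr0.
move=> t x; apply: (@dv_ext _ (fun t => u0 x + intg (fun s => Phi (u s) x) 0 t)).
  by move=> s; rewrite -fix_u.
by apply: dv_to (dvD (dv_cst (u0 x) t) (dv_intg 0 t (cuP x))) _; rewrite add0r.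
Qed.

End Solve.
End Picard.

(** * The smoothing operators and the damped vector field *)

Section Flow.
Context {R : realType}.
Notation L := (pi *+ 2 : R).

Definition cper (y : R -> R) := continuous y /\ periodic y L.

(** Partial fractions: (1 - dx^2)^-1 is half the sum of (1 - dx)^-1 and (1 + dx)^-1, and its
    composition with dx is half their difference. *)
Definition opK (y : R -> R) (x : R) : R := 2^-1 * (opB y x + opA y x).
Definition opDK (y : R -> R) (x : R) : R := 2^-1 * (opB y x - opA y x).

Lemma dv_opK y x : cper y -> is_derive x (1 : R) (opK y) (opDK y x).
Proof.
move=> [cy py]; have hA := dv_opA x cy py; have hB := dv_opB x cy py.
rewrite /opDK; apply: dv_to (dvZ _ (dvD hB hA)) _; ring.
Qed.

Lemma dv_opDK y x : cper y -> is_derive x (1 : R) (opDK y) (opK y x - y x).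
Proof.
move=> [cy py]; have hA := dv_opA x cy py; have hB := dv_opB x cy py.
rewrite /opK; apply: dv_to (dvZ _ (dvB hB hA)) _; by field.
Qed.

Lemma cper_opK y : cper y -> cper (opK y).
Proof.
move=> hy; split; first exact: (dv_ct (fun x => dv_opK x hy)).
by case: hy => _ py x; rewrite /opK per_opA // per_opB.
Qed.

Lemma cper_opDK y : cper y -> cper (opDK y).
Proof.
move=> hy; split; first exact: (dv_ct (fun x => dv_opDK x hy)).
by case: hy => _ py x; rewrite /opDK per_opA // per_opB.
Qed.

Lemma opK_lin k (y z : R -> R) x : cper y -> cper z ->
  opK (fun x => k * y x + z x) x = k * opK y x + opK z x.
Proof. by move=> [cy _] [cz _]; rewrite /opK opA_lin // opB_lin //; ring. Qed.

Lemma opDK_lin k (y z : R -> R) x : cper y -> cper z ->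
  opDK (fun x => k * y x + z x) x = k * opDK y x + opDK z x.
Proof. by move=> [cy _] [cz _]; rewrite /opDK opA_lin // opB_lin //; ring. Qed.

Lemma opK_abs_le (y : R -> R) M x : cper y -> (forall x, `|y x| <= M) -> `|opK y x| <= M.
Proof.
move=> [cy _] yM; have := opA_abs_le x cy yM; have := opB_abs_le x cy yM.
by rewrite !ler_norml /opK => /andP[? ?] /andP[? ?]; apply/andP; split; lra.
Qed.

Lemma opDK_abs_le (y : R -> R) M x : cper y -> (forall x, `|y x| <= M) -> `|opDK y x| <= M.
Proof.
move=> [cy _] yM; have := opA_abs_le x cy yM; have := opB_abs_le x cy yM.
by rewrite !ler_norml /opDK => /andP[? ?] /andP[? ?]; apply/andP; split; lra.
Qed.

Lemma ct_opK (T : topologicalType) (F : T -> R -> R) :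
  continuous (fun z : T * R => F z.1 z.2) -> continuous (fun z => opK (F z.1) z.2).
Proof.
move=> cF; have cA := ct_opA cF; have cB := ct_opB cF.
by apply: ctM; [ct | apply: ctD].
Qed.

Lemma ct_opDK (T : topologicalType) (F : T -> R -> R) :
  continuous (fun z : T * R => F z.1 z.2) -> continuous (fun z => opDK (F z.1) z.2).
Proof.
move=> cF; have cA := ct_opA cF; have cB := ct_opB cF.
by apply: ctM; [ct | apply: ctD; [|apply: ctN]].
Qed.

Lemma opDK_derive (y dy : R -> R) x : cper dy -> periodic y L ->
  (forall x, is_derive x (1 : R) y (dy x)) -> opDK dy x = opK y x - y x.
Proof.
by move=> [cd pd] py hy; rewrite /opDK /opK (opA_derive x cd pd py hy) (opB_derive x cd pd py hy); field.
Qed.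

Lemma cperD (y z : R -> R) : cper y -> cper z -> cper (fun x => y x + z x).
Proof. by move=> [cy py] [cz pz]; split; [ct | move=> x; rewrite py pz]. Qed.

Lemma cperM (y z : R -> R) : cper y -> cper z -> cper (fun x => y x * z x).
Proof. by move=> [cy py] [cz pz]; split; [ct | move=> x; rewrite py pz]. Qed.

Lemma cperN (y : R -> R) : cper y -> cper (fun x => - y x).
Proof. by move=> [cy py]; split; [ct | move=> x; rewrite py]. Qed.

Lemma cper_comp (h y : R -> R) : continuous h -> cper y -> cper (fun x => h (y x)).
Proof. by move=> ch [cy py]; split; [ct | move=> x; rewrite py]. Qed.

Lemma cper_cst (k : R) : cper (fun=> k).
Proof. by split; [ct | move=> x]. Qed.

(* [dampK beta c0 c1 u] is the damping term [(1 - dx^2)^-1 D_j u], written without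
   derivatives of [u]: for [j = 1] it equals [b u - K (b u) + dx K (b' u)]. *)
Definition dampK (beta c0 c1 u : R -> R) (x : R) : R :=
  beta x * u x + opK (fun x => c0 x * u x) x + opDK (fun x => c1 x * u x) x.

Definition rhs (g beta c0 c1 u : R -> R) (x : R) : R :=
  - opDK (fun x => g (u x)) x - dampK beta c0 c1 u x.

Variables (g beta c0 c1 : R -> R) (Lg : R).
Hypothesis (cg : continuous g) (hbeta : cper beta) (hc0 : cper c0) (hc1 : cper c1).
Hypothesis Lg0 : 0 <= Lg.
Hypothesis lipg : forall x y, `|g x - g y| <= Lg * `|x - y|.

Let ctbeta := hbeta.1.
Let ctc0 := hc0.1.
Let ctc1 := hc1.1.

Lemma ct_dampK (u : R -> R -> R) : continuous (fun z : R * R => u z.1 z.2) ->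
  continuous (fun z : R * R => dampK beta c0 c1 (u z.1) z.2).
Proof.
move=> cu; have cb := ctbeta; have cc0 := ctc0; have cc1 := ctc1.
apply: ctD; first (apply: ctD; first by ct).
  by apply: (@ct_opK _ (fun t x => c0 x * u t x)); ct.
by apply: (@ct_opDK _ (fun t x => c1 x * u t x)); ct.
Qed.

Lemma ct_rhs (u : R -> R -> R) : continuous (fun z : R * R => u z.1 z.2) ->
  continuous (fun z : R * R => rhs g beta c0 c1 (u z.1) z.2).
Proof.
move=> cu; apply: ctD; last by apply: ctN; exact: ct_dampK.
by apply: ctN; apply: (@ct_opDK _ (fun t x => g (u t x))); ct.
Qed.

Lemma cper_dampK u : cper u -> cper (dampK beta c0 c1 u).
Proof.
move=> hu; apply: cperD; first apply: cperD.
- exact: cperM.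
- by apply: cper_opK; exact: cperM.
- by apply: cper_opDK; exact: cperM.
Qed.

Lemma cper_rhs u : cper u -> cper (rhs g beta c0 c1 u).
Proof.
move=> hu; apply: cperD; last by apply: cperN; exact: cper_dampK.
by apply: cperN; apply: cper_opDK; exact: cper_comp.
Qed.

Lemma dampK_lin k u v x : cper u -> cper v ->
  dampK beta c0 c1 (fun x => k * u x + v x) x = k * dampK beta c0 c1 u x + dampK beta c0 c1 v x.
Proof.
move=> hu hv; rewrite /dampK.
have -> : (fun x => c0 x * (k * u x + v x)) = (fun x => k * (c0 x * u x) + c0 x * v x).
  by apply/funext => s; ring.
have -> : (fun x => c1 x * (k * u x + v x)) = (fun x => k * (c1 x * u x) + c1 x * v x).
  by apply/funext => s; ring.
by rewrite opK_lin ?opDK_lin; try exact: cperM; ring.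
Qed.

(** [opK] and [opDK] have sup norm at most 1 and no term differentiates [u], so bounds for the
    coefficients and for [g] add up; the extra 1 makes the constant positive. *)
Lemma rhs_lipschitz : exists2 K, 0 < K & forall u v M, cper u -> cper v ->
  (forall x, `|u x - v x| <= M) ->
  (forall x, `|dampK beta c0 c1 u x - dampK beta c0 c1 v x| <= K * M) /\
  (forall x, `|rhs g beta c0 c1 u x - rhs g beta c0 c1 v x| <= K * M).
Proof.
have [Mb hMb] := per_bounded hbeta.1 hbeta.2.
have [M0 hM0] := per_bounded hc0.1 hc0.2.
have [M1 hM1] := per_bounded hc1.1 hc1.2.
have pos (c : R -> R) m : (forall x, `|c x| <= m) -> 0 <= m by move=> /(_ 0); apply: le_trans.
have Mb0 := pos _ _ hMb; have M00 := pos _ _ hM0; have M10 := pos _ _ hM1.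
exists (Mb + M0 + M1 + Lg + 1); first by rewrite ltr_wpDl // !addr_ge0.
move=> u v M hu hv uvM; have M_0 := pos _ _ uvM.
have bnd (c : R -> R) m x : (forall x, `|c x| <= m) -> `|c x * (u x - v x)| <= m * M.
  by move=> cm; rewrite normrM ler_pM.
have huv : cper (fun x => u x - v x) by apply: cperD => //; exact: cperN.
have dE x : dampK beta c0 c1 u x - dampK beta c0 c1 v x = dampK beta c0 c1 (fun x => u x - v x) x.
  have -> : (fun x => u x - v x) = (fun x => (-1) * v x + u x) by apply/funext => s; ring.
  by rewrite dampK_lin //; ring.
have dB x : `|dampK beta c0 c1 u x - dampK beta c0 c1 v x| <= (Mb + M0 + M1) * M.
  rewrite dE /dampK !mulrDl; apply: le_trans (ler_normD _ _) _.
  apply: lerD; first (apply: le_trans (ler_normD _ _) _; apply: lerD).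
  - exact: bnd.
  - by apply: opK_abs_le => [|y]; [exact: cperM | exact: bnd].
  - by apply: opDK_abs_le => [|y]; [exact: cperM | exact: bnd].
have LM : 0 <= Lg * M by exact: mulr_ge0.
split=> x; first by apply: le_trans (dB x) _; rewrite !mulrDl; lra.
have -> : rhs g beta c0 c1 u x - rhs g beta c0 c1 v x =
    - opDK (fun x => g (u x) - g (v x)) x - (dampK beta c0 c1 u x - dampK beta c0 c1 v x).
  have -> : (fun x => g (u x) - g (v x)) = (fun x => (-1) * g (v x) + g (u x)).
    by apply/funext => s; ring.
  by rewrite opDK_lin /rhs; try exact: cper_comp; ring.
apply: le_trans (ler_normB _ _) _; rewrite normrN.
have : `|opDK (fun x => g (u x) - g (v x)) x| <= Lg * M.
  apply: opDK_abs_le => [|y].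
    by apply: cperD; [|apply: cperN]; exact: cper_comp.
  by apply: le_trans (lipg _ _) _; apply: ler_wpM2l.
by have := dB x; rewrite !mulrDl; lra.
Qed.

(** Time is the whole line, so derivatives at 0 are two-sided and no endpoint needs special
    treatment, although the energy bounds will hold for nonnegative times only. *)
Definition is_flow (u0 : R -> R) (u : R -> R -> R) :=
  [/\ continuous (fun z : R * R => u z.1 z.2), forall t, periodic (u t) L,
      u 0 = u0 & forall t x, is_derive t (1 : R) (u^~ x) (rhs g beta c0 c1 (u t) x)].

Lemma flow_cper u0 u t : is_flow u0 u -> cper (u t).
Proof. by move=> [cu pu _ _]; split=> //; ct. Qed.

Lemma flow_existence u0 : cper u0 -> exists u, is_flow u0 u.
Proof.
move=> [cu0 pu0]; have [K K0 hK] := rhs_lipschitz.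
apply: (@picard_existence _ (rhs g beta c0 c1) K) => //.
- by move=> u cu pu; exact: ct_rhs.
- by move=> y cy py; apply: (cper_rhs (conj cy py)).2.
- by move=> y z M cy py cz pz yz; apply: (hK y z M _ _ yz).2.
Qed.

Lemma flow_dependence : exists2 K, 0 < K & forall u0 v0 u v d, is_flow u0 u -> is_flow v0 v ->
  0 <= d -> (forall x, `|u0 x - v0 x| <= d) ->
  forall t x, 0 <= t -> `|u t x - v t x| <= 2 * d * expR (2 * K * t).
Proof.
have [K K0 hK] := rhs_lipschitz; exists K => // u0 v0 u v d fu fv d0 h0 T x T0.
have [cu pu u0E hu] := fu; have [cv pv v0E hv] := fv.
have [Mu hMu] := jointly_bounded 0 T cu pu.
have [Mv hMv] := jointly_bounded 0 T cv pv.
have hw t y : is_derive t (1 : R) (fun t => u t y - v t y)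
    (rhs g beta c0 c1 (u t) y - rhs g beta c0 c1 (v t) y) by exact: (dvB (hu t y) (hv t y)).
apply: (@sup_gronwall _ (fun t x => u t x - v t x)
  (fun t y => rhs g beta c0 c1 (u t) y - rhs g beta c0 c1 (v t) y) T K d (Mu + Mv) K0 d0).
- by move=> y; apply: continuous_subspaceT; exact: (dv_ct (hw^~ y)).
- move=> t N _ hN; apply: (hK _ _ _ _ _ hN).2; [exact: flow_cper fu | exact: flow_cper fv].
- by move=> y; rewrite u0E v0E.
- move=> t y tT; apply: le_trans (ler_normB _ _) _.
  by apply: lerD; [exact: hMu | exact: hMv].
- by rewrite T0 lexx.
Qed.

End Flow.

(** * Regularity in x and the energy laws *)

Section Regularity.
Context {R : realType}.
Notation L := (pi *+ 2 : R).
Variables (g beta dbeta c0 c1 : R -> R).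
Hypothesis (cg : continuous g) (hbeta : cper beta) (hc0 : cper c0) (hc1 : cper c1).
Hypothesis (dv_beta : forall x, is_derive x (1 : R) beta (dbeta x)) (cdbeta : continuous dbeta).

(** The field without its multiplication term [- beta * u]. This part gains one derivative; the
    removed term gains none. *)
Definition smth (u : R -> R) (x : R) : R :=
  - opDK (fun x => g (u x)) x - opK (fun x => c0 x * u x) x - opDK (fun x => c1 x * u x) x.

Definition dsmth (u : R -> R) (x : R) : R :=
  - (opK (fun x => g (u x)) x - g (u x)) - opDK (fun x => c0 x * u x) x
  - (opK (fun x => c1 x * u x) x - c1 x * u x).

Let ctbeta := hbeta.1.
Let ctc0 := hc0.1.
Let ctc1 := hc1.1.

Lemma rhs_smth u x : rhs g beta c0 c1 u x = smth u x - beta x * u x.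
Proof. by rewrite /rhs /dampK /smth; ring. Qed.

Lemma dv_smth u x : cper u -> is_derive x (1 : R) (smth u) (dsmth u x).
Proof.
move=> hu; have h1 := dv_opDK x (cper_comp cg hu).
have h2 := dv_opK x (cperM hc0 hu); have h3 := dv_opDK x (cperM hc1 hu).
exact: (dvB (dvB (dvN h1) h2) h3).
Qed.

Lemma ct_smth (u : R -> R -> R) : continuous (fun z : R * R => u z.1 z.2) ->
  continuous (fun z : R * R => smth (u z.1) z.2).
Proof.
move=> cu; have cc0 := ctc0; have cc1 := ctc1.
have h1 := @ct_opDK _ _ (fun t x => g (u t x)).
have h2 := @ct_opK _ _ (fun t x => c0 x * u t x).
have h3 := @ct_opDK _ _ (fun t x => c1 x * u t x).
by apply: ctD; [apply: ctD; apply: ctN|apply: ctN]; [apply: h1 | apply: h2 | apply: h3]; ct.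
Qed.

Lemma ct_dsmth (u : R -> R -> R) : continuous (fun z : R * R => u z.1 z.2) ->
  continuous (fun z : R * R => dsmth (u z.1) z.2).
Proof.
move=> cu; have cc0 := ctc0; have cc1 := ctc1.
have h1 := @ct_opK _ _ (fun t x => g (u t x)).
have h2 := @ct_opDK _ _ (fun t x => c0 x * u t x).
have h3 := @ct_opK _ _ (fun t x => c1 x * u t x).
apply: ctD; [apply: ctD; apply: ctN|apply: ctN]; [| apply: h2; ct |].
  by apply: ctD; [apply: h1; ct | ct].
by apply: ctD; [apply: h3; ct | ct].
Qed.

Variables (u0 : R -> R) (u : R -> R -> R).
Hypothesis fu : is_flow g beta c0 c1 u0 u.

Let cu : continuous (fun z : R * R => u z.1 z.2). Proof. by case: fu. Qed.
Let hu t : cper (u t). Proof. exact: flow_cper fu. Qed.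

Definition duh t x : R := intg (fun s => expR (beta x * s) * smth (u s) x) 0 t.

Definition dduh t x : R :=
  intg (fun s => expR (beta x * s) * (dbeta x * s * smth (u s) x + dsmth (u s) x)) 0 t.

Let cS : continuous (fun z : R * R => smth (u z.1) z.2). Proof. exact: ct_smth. Qed.
Let cdS : continuous (fun z : R * R => dsmth (u z.1) z.2). Proof. exact: ct_dsmth. Qed.

Lemma dv_duh_t t x : is_derive t (1 : R) (duh^~ x) (expR (beta x * t) * smth (u t) x).
Proof.
apply: dv_intg; apply: ctM; first by ct.
exact: (ct_comp2 (u := fun t x => smth (u t) x) cS (@ct_id _) (@ct_cst _ _ x)).
Qed.

Lemma dv_dduh_t t x : is_derive t (1 : R) (dduh^~ x)
  (expR (beta x * t) * (dbeta x * t * smth (u t) x + dsmth (u t) x)).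
Proof.
have c1' := ct_comp2 (u := fun t x => smth (u t) x) cS (@ct_id _) (@ct_cst _ _ x).
have c2' := ct_comp2 (u := fun t x => dsmth (u t) x) cdS (@ct_id _) (@ct_cst _ _ x).
apply: dv_intg; apply: ctM; first by ct.
by apply: ctD; [apply: ctM; [ct|] |].
Qed.

Lemma ct_duh : continuous (fun z : R * R => duh z.1 z.2).
Proof.
have cb := ctbeta.
apply: (@ct_intg_var _ _ (fun (z : R * R) s => expR (beta z.2 * s) * smth (u s) z.2) (fun=> 0) fst); try ct.
by apply: (ct_comp2 (u := fun t x => smth (u t) x) cS); ct.
Qed.

Lemma ct_dduh : continuous (fun z : R * R => dduh z.1 z.2).
Proof.
have cb := ctbeta; have cdb := cdbeta.
apply: (@ct_intg_var _ _ (fun (z : R * R) s => expR (beta z.2 * s) *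
  (dbeta z.2 * s * smth (u s) z.2 + dsmth (u s) z.2)) (fun=> 0) fst); try ct.
  by apply: (ct_comp2 (u := fun t x => smth (u t) x) cS); ct.
by apply: (ct_comp2 (u := fun t x => dsmth (u t) x) cdS); ct.
Qed.

Lemma dv_duh_x t x : is_derive x (1 : R) (duh t) (dduh t x).
Proof.
have cb := ctbeta; have cdb := cdbeta.
notypeclasses refine (@dv_param _ (fun x s => expR (beta x * s) * smth (u s) x)
  (fun x s => expR (beta x * s) * (dbeta x * s * smth (u s) x + dsmth (u s) x)) 0 t x _ _ _).
- move=> y s; have h1 := dv_smth y (hu s); have h2 := dv_beta y; dv; ring.
- move=> y; apply: ctM; first by ct.
  exact: (ct_comp2 (u := fun t x => smth (u t) x) cS (@ct_id _) (@ct_cst _ _ y)).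
- apply: ctM; first by ct.
  apply: ctD; [apply: ctM; first by ct|].
    by apply: (ct_comp2 (u := fun t x => smth (u t) x) cS); ct.
  by apply: (ct_comp2 (u := fun t x => dsmth (u t) x) cdS); ct.
Qed.

(** At fixed [x] the flow satisfies [u_t + beta x * u = smth u], which an integrating factor solves.
    Only [u0] enters unsmoothed, so [u] is as regular in [x] as its datum. *)
Lemma duhamel t x : u t x = expR (- (beta x * t)) * (u0 x + duh t x).
Proof.
have [_ _ u0E hut] := fu.
have h s : is_derive s (1 : R) (fun s => expR (beta x * s) * u s x)
    (expR (beta x * s) * smth (u s) x).
  by have h1 := hut s x; dv; rewrite rhs_smth; ring.
rewrite /duh (intgE _ _ h) mulr0 expR0 mul1r u0E addrC subrK mulrA -expRD addNr expR0.
by rewrite mul1r.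
Qed.

Variable du0 : R -> R.
Hypothesis (dv_u0 : forall x, is_derive x (1 : R) u0 (du0 x)) (cdu0 : continuous du0).

Definition flow_dx t x : R := expR (- (beta x * t)) *
  (- (dbeta x * t) * (u0 x + duh t x) + (du0 x + dduh t x)).

Definition flow_dtx t x : R :=
  - beta x * flow_dx t x - dbeta x * u t x + dsmth (u t) x.

Lemma dv_flow_x t x : is_derive x (1 : R) (u t) (flow_dx t x).
Proof.
apply: (@dv_ext _ (fun x => expR (- (beta x * t)) * (u0 x + duh t x))).
  by move=> y; rewrite -duhamel.
have h1 := dv_duh_x t x; have h2 := dv_beta x; have h3 := dv_u0 x.
by rewrite /flow_dx; dv; ring.
Qed.

Lemma ct_flow_dx : continuous (fun z : R * R => flow_dx z.1 z.2).
Proof.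
have cb := ctbeta; have cdb := cdbeta; have cu0 := dv_ct dv_u0.
have c1' := ct_duh; have c2' := ct_dduh.
by rewrite /flow_dx; ct.
Qed.

Lemma dv_flow_dx_t t x : is_derive t (1 : R) (flow_dx^~ x) (flow_dtx t x).
Proof.
have h1 := dv_duh_t t x; have h2 := dv_dduh_t t x.
rewrite /flow_dtx duhamel /flow_dx; dv.
have E : expR (- (beta x * t)) * expR (beta x * t) = 1 by rewrite -expRD addNr expR0.
set e := expR (- _) in E *; set e1 := expR (beta x * t) in E *.
set A := (X in _ = X + _); transitivity (A + e * e1 * dsmth (u t) x).
  by rewrite /A; ring.
by rewrite E mul1r.
Qed.

Lemma ct_flow_dtx : continuous (fun z : R * R => flow_dtx z.1 z.2).
Proof.
have cb := ctbeta; have cdb := cdbeta; have c1' := ct_flow_dx.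
by rewrite /flow_dtx; ct.
Qed.

(** The derivative is the same [flow_dtx] as in [dv_flow_dx_t]: mixed derivatives agree.
    [energy_law1] uses this to recompute [flow_dtx] from another expression of the field. *)
Lemma dv_rhs_x t x : is_derive x (1 : R) (rhs g beta c0 c1 (u t)) (flow_dtx t x).
Proof.
apply: (@dv_ext _ (fun x => smth (u t) x - beta x * u t x)).
  by move=> y; rewrite rhs_smth.
have h1 := dv_smth x (hu t); have h2 := dv_beta x; have h3 := dv_flow_x t x.
by rewrite /flow_dtx; dv; ring.
Qed.

End Regularity.

(** * Sobolev inequalities on the circle *)

Section Sobolev.
Context {R : realType}.
Notation L := (pi *+ 2 : R).

Definition energy (y dy : R -> R) : R := intg (fun x => y x ^+ 2 + dy x ^+ 2) 0 L.

Lemma period_ge1 : 1 <= L.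
Proof. by rewrite mulr2n; have := @pi_ge2 R; lra. Qed.

Section C1.
Variables y dy : R -> R.
Hypothesis (py : periodic y L) (hy : forall x, is_derive x (1 : R) y (dy x)).
Hypothesis cdy : continuous dy.

Let cy : continuous y. Proof. exact: dv_ct hy. Qed.
Let pdy : periodic dy L. Proof. exact: per_derive py hy. Qed.

Lemma energy_shift x : intg (fun x => y x ^+ 2 + dy x ^+ 2) x (x + L) = energy y dy.
Proof. by apply: intg_period; [ct | move=> s; rewrite py pdy]. Qed.

Lemma energy_ge0 : 0 <= energy y dy.
Proof.
by apply: intg_ge0; [exact: period_ge0 | ct | move=> x _; rewrite addr_ge0 ?sqr_ge0].
Qed.

(** Within a period [y^2] varies by at most the integral of [y^2 + dy^2], since [2 * y * dy] is
    below it. Averaging over the period bounds [(y x ^+ 2 - energy y dy) * L] by the energy, and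
    [L >= 1] gives the factor 2. *)
Lemma energy_sup x : y x ^+ 2 <= 2 * energy y dy.
Proof.
have key s : x <= s <= x + L -> y (x + L) ^+ 2 - energy y dy <= y s ^+ 2.
  move=> /andP[xs sL].
  have h r : is_derive r (1 : R) (fun r => y r ^+ 2) (2 * y r * dy r) by dv; rewrite /= expr1; ring.
  have -> : y (x + L) ^+ 2 = y s ^+ 2 + intg (fun r => 2 * y r * dy r) s (x + L).
    by rewrite (intgE _ _ h); ring.
  have : intg (fun r => 2 * y r * dy r) s (x + L) <= intg (fun x => y x ^+ 2 + dy x ^+ 2) s (x + L).
    apply: intg_le => //; try ct.
    by move=> r _; have := sqr_ge0 (y r - dy r); rewrite sqrrB; lra.
  have : intg (fun x => y x ^+ 2 + dy x ^+ 2) s (x + L) <= energy y dy.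
    rewrite -(energy_shift x); apply: intg_le_sub => //; first by ct.
    by move=> r _; rewrite addr_ge0 ?sqr_ge0.
  lra.
have : intg (fun=> y (x + L) ^+ 2 - energy y dy) x (x + L) <= energy y dy.
  apply: le_trans (_ : intg (fun s => y s ^+ 2) x (x + L) <= _).
    by apply: intg_le; [rewrite lerDl period_ge0 | ct | ct | exact: key].
  rewrite -(energy_shift x); apply: intg_le; [by rewrite lerDl period_ge0 | ct | ct |].
  by move=> s _; rewrite lerDl sqr_ge0.
rewrite intg_cst py addrAC subrr add0r.
have L1 := period_ge1; have E0 := energy_ge0.
have [h _|h] := leP (y x ^+ 2 - energy y dy) 0; first lra.
move=> h2; have : (y x ^+ 2 - energy y dy) * 1 <= (y x ^+ 2 - energy y dy) * L.
  by apply: ler_wpM2l => //; exact: ltW.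
lra.
Qed.

Lemma intg_dy_sq_le x z : x <= z <= x + L -> intg (fun s => dy s ^+ 2) x z <= energy y dy.
Proof.
move=> /andP[xz zL]; rewrite -(energy_shift x).
apply: le_trans (_ : intg (fun s => dy s ^+ 2) x (x + L) <= _).
  by apply: intg_le_sub => //; [ct | move=> s _; exact: sqr_ge0].
apply: intg_le; [exact: le_trans zL | ct | ct |].
by move=> s _; rewrite lerDr sqr_ge0.
Qed.

Lemma intg_dy_sq x z : x <= z -> (y x - y z) ^+ 2 <= (z - x) * intg (fun s => dy s ^+ 2) x z.
Proof.
by move=> xz; have := intg_sqr_le xz cdy; rewrite (intgE _ _ hy) -sqrrN opprB.
Qed.

Lemma energy_holder x z : x <= z <= x + L -> (y x - y z) ^+ 2 <= (z - x) * energy y dy.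
Proof.
move=> /andP[xz zL]; apply: le_trans (intg_dy_sq xz) _.
by apply: ler_wpM2l; [rewrite subr_ge0 | apply: intg_dy_sq_le; rewrite xz].
Qed.

End C1.

(** The kernels are bounded, so a value is controlled by the L^1 norm and, by Cauchy-Schwarz, by the
    L^2 norm. This turns the dissipation, an L^2 quantity, into a bound for the damping at each
    point. *)
Lemma resolvent_L2 : exists2 C, 0 < C & forall (y : R -> R) x, cper y ->
  opK y x ^+ 2 <= C * intg (fun s => y s ^+ 2) 0 L /\
  opDK y x ^+ 2 <= C * intg (fun s => y s ^+ 2) 0 L.
Proof.
have L0 := @period_ge0 R; have Lp := @period_gt0 R.
pose kA := (expR L - 1)^-1 * expR L; pose kB := (1 - expR (- L))^-1.
have kA0 : 0 < kA by rewrite mulr_gt0 ?expR_gt0 // invr_gt0 opA_cst_gt0.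
have kB0 : 0 < kB by rewrite invr_gt0 opB_cst_gt0.
exists ((kA + kB) ^+ 2 * L); first by rewrite mulr_gt0 // exprn_gt0 // addr_gt0.
move=> y x [cy py]; pose I1 := intg (fun s => `|y s|) 0 L.
have I10 : 0 <= I1 by apply: intg_ge0 => //; ct.
have I1sq : I1 ^+ 2 <= L * intg (fun s => y s ^+ 2) 0 L.
  have ca : continuous (fun s => `|y s|) by ct.
  have := intg_sqr_le L0 ca; rewrite subr0.
  by rewrite (intg_ext _ _ (fun s => real_normK (num_real (y s)))).
have shiftE : intg (fun s => `|y (x + s)|) 0 L = I1.
  have ca : continuous (fun s => `|y s|) by ct.
  by rewrite (intg_shift x 0 L ca) addr0 intg_period // => s; rewrite py.
have hA : `|opA y x| <= kA * I1.
  rewrite normrM ger0_norm ?invr_ge0 ?(ltW opA_cst_gt0) // -mulrA ler_pM2l ?invr_gt0 ?opA_cst_gt0 //.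
  rewrite -shiftE -intgZ; last by ct.
  apply: intg_abs_le => //; try ct.
  move=> s /andP[s0 sL]; rewrite normrM ger0_norm ?expR_ge0 //.
  by rewrite ler_wpM2r // ler_expR.
have hB : `|opB y x| <= kB * I1.
  rewrite normrM ger0_norm ?invr_ge0 ?(ltW opB_cst_gt0) // ler_pM2l ?invr_gt0 ?opB_cst_gt0 //.
  rewrite -shiftE; apply: intg_abs_le => //; try ct.
  move=> s /andP[s0 sL]; rewrite normrM ger0_norm ?expR_ge0 //.
  by rewrite ler_piMl // -expR0 ler_expR lerNl oppr0.
have fin z : `|z| <= (kA + kB) * I1 -> z ^+ 2 <= (kA + kB) ^+ 2 * L * intg (fun s => y s ^+ 2) 0 L.
  move=> hz; rewrite -real_normK ?num_real // -mulrA.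
  apply: (@le_trans _ _ (((kA + kB) * I1) ^+ 2)).
    by rewrite ler_sqr ?nnegrE // mulr_ge0 // ltW // addr_gt0.
  by rewrite exprMn ler_wpM2l // sqr_ge0.
have A0 := normr_ge0 (opA y x); have B0 := normr_ge0 (opB y x).
by split; apply: fin; rewrite /opK /opDK normrM ger0_norm ?invr_ge0 // mulrDl;
  [have := ler_normD (opB y x) (opA y x) | have := ler_normB (opB y x) (opA y x)]; lra.
Qed.

End Sobolev.

(** * Energy identities and conservation of mass *)

Section EnergyLaw.
Context {R : realType}.
Notation L := (pi *+ 2 : R).

Lemma dv_comp_prim (g u : R -> R) (x du : R) : continuous g -> is_derive x (1 : R) u du ->
  is_derive x (1 : R) (fun x => prim g (u x)) (g (u x) * du).
Proof. by move=> cg hu; exact: (dv_comp hu (dv_prim (u x) cg)). Qed.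

Lemma opK0 (u : R -> R) x : opK (fun x => 0 * u x) x = 0.
Proof.
have -> : (fun x => 0 * u x) = fun=> 0 by apply/funext => s; rewrite mul0r.
by rewrite /opK opA_cst opB_cst; ring.
Qed.

Lemma opDK0 (u : R -> R) x : opDK (fun x => 0 * u x) x = 0.
Proof.
have -> : (fun x => 0 * u x) = fun=> 0 by apply/funext => s; rewrite mul0r.
by rewrite /opDK opA_cst opB_cst; ring.
Qed.

Lemma intg_derive_period (W w : R -> R) : (forall x, is_derive x (1 : R) W (w x)) ->
  periodic W L -> intg w 0 L = 0.
Proof. by move=> hW pW; rewrite (intgE _ _ hW) -[X in W X]add0r pW subrr. Qed.

(** [W] is the spatial flux of the energy: half the time derivative of the energy density is
    [W_x - D], and the periodicity of [W] removes the first term after integration. *)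
Lemma flow_energy (g beta dbeta c0 c1 u0 du0 : R -> R) (u W D : R -> R -> R) :
    continuous g -> cper beta -> cper c0 -> cper c1 ->
    (forall x, is_derive x (1 : R) beta (dbeta x)) -> continuous dbeta ->
    (forall x, is_derive x (1 : R) u0 (du0 x)) -> continuous du0 ->
    is_flow g beta c0 c1 u0 u ->
    let ux := flow_dx g beta dbeta c0 c1 u0 u du0 in
    let utx := flow_dtx g beta dbeta c0 c1 u0 u du0 in
    (forall t x, is_derive x (1 : R) (W t)
      (u t x * rhs g beta c0 c1 (u t) x + ux t x * utx t x + D t x)) ->
    (forall t, periodic (W t) L) ->
    continuous (fun z : R * R => D z.1 z.2) ->
  forall t, energy (u t) (ux t) + 2 * intg (fun s => intg (D s) 0 L) 0 t = energy u0 du0.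
Proof.
move=> cg hbeta hc0 hc1 dvb cdb dvu0 cdu0 fu ux utx hW pW cD t.
have [cu pu u0E hut] := fu.
have cux : continuous (fun z : R * R => ux z.1 z.2) by exact: ct_flow_dx.
have cutx : continuous (fun z : R * R => utx z.1 z.2) by exact: ct_flow_dtx.
have crhs := ct_rhs cg hbeta hc0 hc1 cu.
have huxt s x : is_derive s (1 : R) (ux^~ x) (utx s x) by exact: dv_flow_dx_t.
have E0 : energy (u 0) (ux 0) = energy u0 du0.
  apply: intg_ext => x; rewrite u0E; congr (_ + _ ^+ 2).
  apply: (@dv_unique _ (u 0) x); first by rewrite -[u 0]/(u 0); exact: dv_flow_x.
  by rewrite u0E.
have cD1 : continuous (fun s => intg (D s) 0 L) by exact: ct_intg.
pose r := fun t => rhs g beta c0 c1 (u t).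
have cr : continuous (fun z : R * R => r z.1 z.2) by [].
have h s : is_derive s (1 : R) (fun s => energy (u s) (ux s)) (- (2 * intg (D s) 0 L)).
  pose F s x := u s x ^+ 2 + ux s x ^+ 2.
  pose dF s x := 2 * (u s x * r s x) + 2 * (ux s x * utx s x).
  have hF s' x : is_derive s' (1 : R) (F^~ x) (dF s' x).
    have h1 := hut s' x; have h2 := huxt s' x.
    by rewrite /F /dF /r; dv; rewrite /= !expr1; ring.
  have cdF : continuous (fun z : R * R => dF z.1 z.2) by rewrite /dF; ct.
  have cFs s' : continuous (F s') by rewrite /F; ct.
  have := @dv_param _ F dF 0 L s hF cFs cdF.
  have cw : continuous (fun x => u s x * r s x + ux s x * utx s x) by ct.
  have cDs : continuous (D s) by ct.
  have := intg_derive_period (hW s) (pW s); rewrite intgD // => I0.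
  have -> : intg (dF s) 0 L = 2 * intg (fun x => u s x * r s x + ux s x * utx s x) 0 L.
    by rewrite -intgZ //; apply: intg_ext => x; rewrite /dF; ring.
  by rewrite (_ : 2 * intg _ 0 L = - (2 * intg (D s) 0 L)) //; move: I0; rewrite /r; lra.
have h2 s : is_derive s (1 : R)
    (fun s => energy (u s) (ux s) + 2 * intg (fun s => intg (D s) 0 L) 0 s) 0.
  by apply: dv_to (dvD (h s) (dvZ 2 (dv_intg 0 s cD1))) _; rewrite addNr.
by have := dv0_cst h2 t 0; rewrite intgxx mulr0 addr0 E0.
Qed.

Section Laws.
Variables (g b db u0 du0 : R -> R) (u : R -> R -> R).
Hypothesis (cg : continuous g) (hb : cper b) (cdb : continuous db).
Hypothesis dvb : forall x, is_derive x (1 : R) b (db x).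
Hypothesis dvu0 : forall x, is_derive x (1 : R) u0 (du0 x).
Hypothesis cdu0 : continuous du0.

Let zero : R -> R := fun=> 0.

Let hdb : cper db.
Proof. by split=> //; case: hb => _ pb; exact: per_derive pb dvb. Qed.

(** The nonlinear term contributes the exact derivative of [prim g (u)] for every continuous [g], so
    truncating the flux does not disturb the identity. The products in [W] are the boundary terms of
    integrating by parts against [u]. *)
Lemma energy_law0 : is_flow g zero b zero u0 u ->
  forall t, energy (u t) (flow_dx g zero zero b zero u0 u du0 t) +
    2 * intg (fun s => intg (fun x => b x * u s x ^+ 2) 0 L) 0 t = energy u0 du0.
Proof.
move=> fu; have hu t := flow_cper t fu; have [cu pu _ _] := fu; have cb := hb.1.
have hz : cper zero by exact: cper_cst.
have cz : continuous zero := hz.1.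
have dvz x : is_derive x (1 : R) zero (zero x) by exact: dv_cst.
pose ux := flow_dx g zero zero b zero u0 u du0.
have hux t x : is_derive x (1 : R) (u t) (ux t x) by exact: dv_flow_x.
pose phi t := opK (fun x => g (u t x)); pose kap t := opDK (fun x => b x * u t x).
have hg t := cper_comp cg (hu t); have hbu t := cperM hb (hu t).
apply: (@flow_energy g zero zero b zero u0 du0 u
  (fun t x => prim g (u t x) - u t x * phi t x - u t x * kap t x)) => //.
- move=> t x; have h1 := hux t x; have h2 := dv_opK x (hg t); have h3 := dv_opDK x (hbu t).
  have h4 := dv_comp_prim cg h1.
  apply: dv_to (dvB (dvB h4 (dvM h1 h2)) (dvM h1 h3)) _.
  by rewrite /rhs /flow_dtx -/(ux t x) /dampK /dsmth !opK0 !opDK0 /zero /phi /kap; ring.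
- by move=> t x; rewrite /phi /kap !(pu t) (cper_opK (hg t)).2 (cper_opDK (hbu t)).2.
- by ct.
Qed.

(** For differentiable data the derivative-free damping collapses to [- opDK (b * ux)], by expanding
    [opDK] of the derivative of [b * u]. In this form the dissipation [b * ux^2] becomes visible. *)
Lemma energy_law1 : is_flow g b (fun x => - b x) db u0 u ->
  let ux := flow_dx g b db (fun x => - b x) db u0 u du0 in
  (forall t x, dampK b (fun x => - b x) db (u t) x = - opDK (fun x => b x * ux t x) x) /\
  forall t, energy (u t) (ux t) +
    2 * intg (fun s => intg (fun x => b x * ux s x ^+ 2) 0 L) 0 t = energy u0 du0.
Proof.
move=> fu ux; have hu t := flow_cper t fu; have [cu pu _ _] := fu; have cb := hb.1.
have hnb : cper (fun x => - b x) by exact: cperN.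
have hux t x : is_derive x (1 : R) (u t) (ux t x) by exact: dv_flow_x.
have cux : continuous (fun z : R * R => ux z.1 z.2) by exact: ct_flow_dx.
have hcux t : cper (ux t).
  by split; [ct | exact: per_derive (pu t) (hux t)].
pose phi t := opK (fun x => g (u t x)); pose th t := opK (fun x => b x * ux t x).
have hg t := cper_comp cg (hu t); have hbux t := cperM hb (hcux t).
have hbu t := cperM hb (hu t); have hdbu t := cperM hdb (hu t).
have dampE t x : dampK b (fun x => - b x) db (u t) x = - opDK (fun x => b x * ux t x) x.
  have hd y : is_derive y (1 : R) (fun y => b y * u t y) (1 * (db y * u t y) + b y * ux t y).
    by have h1 := dvb y; have h2 := hux t y; dv; ring.
  have hcd : cper (fun y => 1 * (db y * u t y) + b y * ux t y).
    by apply: cperD => //; apply: cperM => //; exact: cper_cst.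
  have := opDK_derive x hcd (hbu t).2 hd; rewrite opDK_lin // /dampK.
  have -> : (fun x => - b x * u t x) = (fun x => (-1) * (b x * u t x) + 0 * u t x).
    by apply/funext => s; ring.
  rewrite opK_lin ?opK0 //; last by apply: cperM => //; exact: cper_cst.
  lra.
split=> //.
apply: (@flow_energy g b db (fun x => - b x) db u0 du0 u
  (fun t x => prim g (u t x) + u t x * (th t x - phi t x))) => //.
- move=> t x; have h1 := hux t x; have h2 := dv_opK x (hg t); have h3 := dv_opK x (hbux t).
  have h4 := dv_comp_prim cg h1.
  apply: dv_to (dvD h4 (dvM h1 (dvB h3 h2))) _.
  have rE y : rhs g b (fun x => - b x) db (u t) y = opDK (fun x => b x * ux t x) y - opDK (fun x => g (u t x)) y.
    by rewrite /rhs dampE; ring.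
  have -> : flow_dtx g b db (fun x => - b x) db u0 u du0 t x =
      (th t x - b x * ux t x) - (phi t x - g (u t x)).
    have hA := dv_rhs_x cg hb hnb hdb dvb cdb fu dvu0 t x.
    have hB := dvB (dv_opDK x (hbux t)) (dv_opDK x (hg t)).
    exact: (dv_unique hA (dv_ext (fun y => esym (rE y)) hB)).
  by rewrite rE -/(ux t x) /th /phi; ring.
- by move=> t x; rewrite /phi /th (pu t) (cper_opK (hg t)).2 (cper_opK (hbux t)).2.
- by ct.
Qed.

End Laws.

Lemma intg_opK (y : R -> R) : cper y -> intg (opK y) 0 L = intg y 0 L.
Proof.
move=> hy; have hK := cper_opK hy; have hDK := cper_opDK hy.
have := intg_derive_period (fun x => dv_opDK x hy) hDK.2.
by rewrite intgB; [lra | exact: hK.1 | exact: hy.1].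
Qed.

Lemma intg_opDK (y : R -> R) : cper y -> intg (opDK y) 0 L = 0.
Proof.
by move=> hy; apply: (intg_derive_period (fun x => dv_opK x hy) (cper_opK hy).2).
Qed.

(** [opDK] produces mean zero and [opK] preserves means, so after integration [b * u] cancels
    against [opK (- b * u)] and the other terms vanish. *)
Lemma flow_mass (g b db u0 : R -> R) (u : R -> R -> R) :
    continuous g -> cper b -> cper db -> is_flow g b (fun x => - b x) db u0 u ->
  forall t, intg (u t) 0 L = intg u0 0 L.
Proof.
move=> cg hb hdb fu t; have hu s := flow_cper s fu; have [cu pu u0E hut] := fu.
have hnb := cperN hb.
have crhs := ct_rhs cg hb hnb hdb cu.
have cus s : continuous (u s) by ct.
have h s : is_derive s (1 : R) (fun s => intg (u s) 0 L) 0.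
  apply: dv_to (@dv_param _ u (fun s => rhs g b (fun x => - b x) db (u s)) 0 L s hut cus crhs) _.
  have h1 := cper_comp cg (hu s); have h2 := cperM hb (hu s).
  have h3 := cperM hnb (hu s); have h4 := cperM hdb (hu s).
  have c1 := (cper_opDK h1).1; have c2 := (cper_opK h3).1; have c3 := (cper_opDK h4).1.
  have c0 := h2.1.
  rewrite /rhs /dampK intgB; [|by ct|by ct].
  rewrite intgN // !intgD; try by ct.
  rewrite intg_opDK // intg_opK // intg_opDK //.
  rewrite (intg_ext _ _ (fun x => mulNr (b x) (u s x))) intgN //; lra.
by rewrite (dv0_cst h t 0) u0E.
Qed.

End EnergyLaw.

(** * Flows with data in H^1 *)

Section Estimates.
Context {R : realType}.
Notation L := (pi *+ 2 : R).

(* [y] is a uniform limit of C^1 functions whose H^1 norm squared is at most [E]. *)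
Definition H1le (E : R) (y : R -> R) := forall e : R, 0 < e -> exists z dz : R -> R,
  [/\ periodic z L, forall x, is_derive x (1 : R) z (dz x), continuous dz,
      energy z dz <= E & forall x, `|z x - y x| <= e].

Lemma H1le_cper E y : H1le E y -> cper y.
Proof.
move=> H; split.
  have H' n : exists z : R -> R, continuous z /\ forall x, `|z x - y x| <= 1 / 2 ^+ n.
    have [|z [dz [_ hz _ _ hn]]] := H (1 / 2 ^+ n); first by rewrite divr_gt0 ?exprn_gt0.
    by exists z; split=> //; exact: dv_ct hz.
  apply: (@ct_unif_lim _ _ (fun n => sval (cid (H' n)))).
    by move=> n; case: (svalP (cid (H' n))).
  move=> x e e0; pose n := Num.Def.archi_bound (1 / e); exists n.
  exists 1 => /= [|s _]; first exact: ltr01.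
  apply: le_trans ((svalP (cid (H' n))).2 s) _.
  rewrite ler_pdivrMr ?exprn_gt0 // mulrC -ler_pdivrMr // ltW //.
  exact: upper_nthrootP.
move=> x; apply/eqP; rewrite -subr_eq0 -normr_le0; apply/ler_addgt0Pr => e e0.
have [|z [dz [pz _ _ _ hn]]] := H (e / 2); first by rewrite divr_gt0.
have := hn x; have := hn (x + L); rewrite pz => h1 h2.
have := ler_normB (z x - y x) (z x - y (x + L)).
by rewrite (_ : z x - y x - (z x - y (x + L)) = y (x + L) - y x); [lra | ring].
Qed.

Lemma H1le_sup E y x : H1le E y -> y x ^+ 2 <= 2 * E.
Proof.
move=> H; have E0 : 0 <= E.
  have [|z [dz [pz hz cdz hE _]]] := H 1; first by [].
  by apply: le_trans hE; apply: energy_ge0 hz cdz.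
rewrite -real_normK ?num_real // -(@sqr_sqrtr _ (2 * E)) ?mulr_ge0 //.
rewrite ler_sqr ?nnegrE ?sqrtr_ge0 //; apply/ler_addgt0Pr => e e0.
have [|z [dz [pz hz cdz hE hn]]] := H e; first by [].
have : `|z x| <= Num.sqrt (2 * E).
  rewrite -ler_sqr ?nnegrE ?sqrtr_ge0 // sqr_sqrtr ?mulr_ge0 // real_normK ?num_real //.
  by apply: le_trans (energy_sup pz hz cdz x) _; rewrite ler_pM2l.
have := ler_normB (z x) (z x - y x); have := hn x.
rewrite (_ : z x - (z x - y x) = y x); [lra | ring].
Qed.

Lemma H1le_holder E y x z : H1le E y -> x <= z <= x + L ->
  (y x - y z) ^+ 2 <= (z - x) * E.
Proof.
move=> H xz; have E0 : 0 <= E.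
  have [|w [dw [pw hw cdw hE _]]] := H 1; first by [].
  by apply: le_trans hE; apply: energy_ge0 hw cdw.
have zx0 : 0 <= z - x by case/andP: xz => xz _; rewrite subr_ge0.
rewrite -real_normK ?num_real // -(@sqr_sqrtr _ ((z - x) * E)) ?mulr_ge0 //.
rewrite ler_sqr ?nnegrE ?sqrtr_ge0 //; apply/ler_addgt0Pr => e e0.
have [|w [dw [pw hw cdw hE hn]]] := H (e / 2); first by rewrite divr_gt0.
have : `|w x - w z| <= Num.sqrt ((z - x) * E).
  rewrite -ler_sqr ?nnegrE ?sqrtr_ge0 // sqr_sqrtr ?mulr_ge0 // real_normK ?num_real //.
  by apply: le_trans (energy_holder pw hw cdw xz) _; rewrite ler_wpM2l.
have := ler_normB (w x - w z) ((w x - y x) - (w z - y z)).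
have := ler_normB (w x - y x) (w z - y z); have := hn x; have := hn z.
rewrite (_ : w x - w z - (w x - y x - (w z - y z)) = y x - y z); [lra | ring].
Qed.

(** The bound passes to the uniform limit because [A^2 - B^2 = (A - B) * (2 * A - (A - B))] and [A]
    is bounded on the segment. *)
Lemma intg_sq_limit (A : R -> R) t c : 0 <= t -> continuous A ->
    (forall d, 0 < d -> exists B : R -> R, [/\ continuous B,
      forall s, 0 <= s <= t -> `|A s - B s| <= d & intg (fun s => B s ^+ 2) 0 t <= c]) ->
  intg (fun s => A s ^+ 2) 0 t <= c.
Proof.
move=> t0 cA H; have [N hN] : exists N, forall s (x : R), 0 <= s <= t -> `|A s| <= N.
  by apply: (@jointly_bounded _ (fun s _ => A s) 0 t); [ct | by []].
have N0 : 0 <= N by apply: le_trans (hN 0 0 _); rewrite ?lexx.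
apply/ler_addgt0Pr => e e0.
pose d := Num.min 1 (e / (t * (2 * N + 1) + 1)).
have q0 : 0 <= t * (2 * N + 1) by rewrite mulr_ge0 // addr_ge0 // mulr_ge0.
have d0 : 0 < d by rewrite lt_min ltr01 divr_gt0 //; lra.
have d1 : d <= 1 by rewrite ge_min lexx.
have de : d * (t * (2 * N + 1)) <= e.
  apply: (@le_trans _ _ (e / (t * (2 * N + 1) + 1) * (t * (2 * N + 1)))).
    by apply: ler_wpM2r => //; rewrite ge_min lexx orbT.
  rewrite mulrAC ler_pdivrMr; last lra.
  by apply: ler_wpM2l; [exact: ltW | lra].
have [B [cB hB hc]] := H d d0.
have : intg (fun s => A s ^+ 2) 0 t <= intg (fun s => B s ^+ 2 + d * (2 * N + 1)) 0 t.
  apply: intg_le => //; try ct.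
  move=> s st; have := hB s st; have := hN s 0 st => hA hAB.
  have hAN := ler_norm (A s); have hAN' := ler_norm (- A s); rewrite normrN in hAN'.
  have h1 : A s ^+ 2 - B s ^+ 2 = (A s - B s) * (2 * A s - (A s - B s)) by ring.
  have : A s ^+ 2 - B s ^+ 2 <= d * (2 * N + 1).
    rewrite h1; apply: le_trans (ler_norm _) _; rewrite normrM ler_pM //.
    apply: le_trans (ler_normB _ _) _; apply: lerD; last exact: le_trans d1.
    by rewrite normrM ger0_norm // ler_pM2l.
  lra.
rewrite intgD; try ct; rewrite intg_cst; lra.
Qed.

Variables (b db : R -> R).
Hypothesis (hb : cper b) (cdb : continuous db).
Hypothesis dvb : forall x, is_derive x (1 : R) b (db x).
Hypothesis b0 : forall x, 0 <= b x.

Let hdb : cper db.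
Proof. by split=> //; case: hb => _ pb; exact: per_derive pb dvb. Qed.

(* The coefficients of [dampK] for the dampings [D_0] ([jb = true]) and [D_1]. *)
Definition beta_ (jb : bool) := if jb then (fun=> 0) else b.
Definition dbeta_ (jb : bool) := if jb then (fun=> 0) else db.
Definition c0_ (jb : bool) := if jb then b else (fun x => - b x).
Definition c1_ (jb : bool) := if jb then (fun=> 0) else db.

Lemma cper_beta jb : cper (beta_ jb).
Proof. by case: jb => //; exact: cper_cst. Qed.
Lemma cper_c0 jb : cper (c0_ jb).
Proof. by case: jb => //; exact: cperN. Qed.
Lemma cper_c1 jb : cper (c1_ jb).
Proof. by case: jb => //; exact: cper_cst. Qed.
Lemma dv_beta_ jb x : is_derive x (1 : R) (beta_ jb) (dbeta_ jb x).
Proof. by case: jb => //; exact: dv_cst. Qed.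
Lemma ct_dbeta jb : continuous (dbeta_ jb).
Proof. by case: jb => //; exact: ct_cst. Qed.

Definition flow jb g := is_flow g (beta_ jb) (c0_ jb) (c1_ jb).
Definition damp jb := dampK (beta_ jb) (c0_ jb) (c1_ jb).

(** What the dissipation controls on an arc: a weighted integral for D_0, an increment for D_1. Both
    are linear and free of derivatives of [y], so they pass to uniform limits. *)
Definition obs (jb : bool) (y : R -> R) (x z : R) : R :=
  if jb then intg (fun s => b s * y s) x z else y x - y z.

(** The dissipation [Q] dominates everything: its time integral is at most the initial energy,
    [resolvent_L2] gives [damp ^+ 2 <= Cr * Mb * Q], and on an arc where [b >= m] one has
    [obs ^+ 2 <= (L * Mb + L / m) * Q]. *)
Lemma damped_C1 jb : exists2 C, 0 < C & forall g u0 du0 u, continuous g ->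
    (forall x, is_derive x (1 : R) u0 (du0 x)) -> continuous du0 -> flow jb g u0 u ->
  [/\ forall t, 0 <= t -> H1le (energy u0 du0) (u t),
      forall t x, 0 <= t -> intg (fun s => damp jb (u s) x ^+ 2) 0 t <= C * energy u0 du0 &
      forall t x z m, 0 <= t -> x <= z <= x + L -> 0 < m -> (forall s, x <= s <= z -> m <= b s) ->
        intg (fun s => obs jb (u s) x z ^+ 2) 0 t <= (C + L / m) * energy u0 du0].
Proof.
have [Cr Cr0 hCr] := @resolvent_L2 R.
have [Mb hMb] := per_bounded hb.1 hb.2.
have Mb0 : 0 <= Mb by apply: le_trans (hMb 0).
have bM x : b x <= Mb by apply: le_trans (hMb x); exact: ler_norm.
have L0 := @period_ge0 R; have cb := hb.1.
exists ((Cr + L) * Mb + 1); first by rewrite ltr_wpDl // mulr_ge0 // addr_ge0 // ltW.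
move=> g u0 du0 u cg dvu0 cdu0 fu.
have hu t := flow_cper t fu; have [cu pu u0E hut] := fu.
pose ux := flow_dx g (beta_ jb) (dbeta_ jb) (c0_ jb) (c1_ jb) u0 u du0.
have hbe := cper_beta jb; have hc0 := cper_c0 jb; have hc1 := cper_c1 jb.
have hux t x : is_derive x (1 : R) (u t) (ux t x).
  by exact: (dv_flow_x cg hbe hc0 hc1 (dv_beta_ jb) (@ct_dbeta jb) fu dvu0).
have cux : continuous (fun z : R * R => ux z.1 z.2).
  exact: (ct_flow_dx cg hbe hc0 hc1 (@ct_dbeta jb) fu dvu0 cdu0).
have cuxt t : continuous (ux t) by ct.
have hcux t : cper (ux t) by split=> //; exact: per_derive (pu t) (hux t).
pose q t x := b x * (if jb then u t x else ux t x) ^+ 2.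
have cq : continuous (fun z : R * R => q z.1 z.2) by rewrite /q; case: (jb); ct.
have cqt t : continuous (q t) by ct.
have q0 t x : 0 <= q t x by rewrite mulr_ge0 // sqr_ge0.
pose Q t := intg (q t) 0 L.
have cQ : continuous Q by exact: ct_intg.
have Q0 t : 0 <= Q t by apply: intg_ge0.
have dampE t x : damp jb (u t) x ^+ 2 <= Cr * Mb * Q t /\
    energy (u t) (ux t) + 2 * intg Q 0 t = energy u0 du0.
  have sq (w : R -> R) : continuous w ->
      intg (fun s => (b s * w s) ^+ 2) 0 L <= Mb * intg (fun s => b s * w s ^+ 2) 0 L.
    move=> cw; rewrite -intgZ; last by ct.
    apply: intg_le => //; try ct.
    move=> s _; rewrite exprMn expr2 mulrA ler_wpM2r ?sqr_ge0 //.
    by rewrite ler_wpM2r.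
  clear hbe hc0 hc1 cq cqt q0 cQ Q0.
  move: fu hut @ux hux cux cuxt hcux @q @Q; rewrite /flow /damp /beta_ /dbeta_ /c0_ /c1_.
  case: jb => fu hut hux cux cuxt hcux; split.
  - rewrite /dampK mul0r add0r opDK0 addr0 -mulrA.
    apply: le_trans (hCr (fun x => b x * u t x) x (cperM hb (hu t))).1 _.
    by rewrite ler_pM2l //; apply: sq; ct.
  - exact: (energy_law0 cg hb dvu0 cdu0 fu).
  - rewrite (energy_law1 cg hb cdb dvb dvu0 cdu0 fu).1 sqrrN -mulrA.
    apply: le_trans (hCr _ x (cperM hb (hcux t))).2 _.
    by rewrite ler_pM2l //; apply: sq.
  - exact: (energy_law1 cg hb cdb dvb dvu0 cdu0 fu).2.
have IQ0 t : 0 <= t -> 0 <= intg Q 0 t by move=> t0; exact: intg_ge0.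
have et t : 0 <= energy (u t) (ux t) by apply: energy_ge0 (hux t) (cuxt t).
have e0 : 0 <= energy u0 du0 by apply: energy_ge0 dvu0 cdu0.
have IQ t : intg Q 0 t <= energy u0 du0.
  by have := (dampE t 0).2; have := et t; lra.
have cd : continuous (fun z : R * R => damp jb (u z.1) z.2) by exact: ct_dampK.
split.
- move=> t t0 e e_0; exists (u t), (ux t); split=> //.
    by have := (dampE t 0).2; have := IQ0 t t0; lra.
  by move=> x; rewrite subrr normr0 ltW.
- move=> t x t0; apply: le_trans (_ : intg (fun s => Cr * Mb * Q s) 0 t <= _).
    apply: intg_le => //; last by move=> s _; exact: (dampE s x).1.
      apply: ctX; exact: (ct_comp2 (u := fun t x => damp jb (u t) x) cd (@ct_id _) (@ct_cst _ _ x)).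
    by ct.
  rewrite intgZ //; apply: le_trans (_ : Cr * Mb * energy u0 du0 <= _).
    by rewrite ler_wpM2l // mulr_ge0 // ltW.
  by rewrite ler_wpM2r // mulrDl -addrA lerDl addr_ge0 // mulr_ge0.
move=> t x z m t0 /andP[xz zL] m0 hm.
have cobs : continuous (fun s => obs jb (u s) x z).
  rewrite /obs; case: (jb); last by ct.
  by apply: (@ct_intg _ _ (fun t s => b s * u t s)); ct.
(* Cauchy-Schwarz on an arc of length at most [L], then [(b * u)^2 <= Mb * b * u^2] for D_0 and
   [ux^2 <= b * ux^2 / m] for D_1. *)
have obsE s : obs jb (u s) x z ^+ 2 <= (L * Mb + L / m) * Q s.
  have Lm : 0 <= L / m by rewrite divr_ge0 // ltW.
  have LMb : 0 <= L * Mb by rewrite mulr_ge0.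
  have QE : Q s = intg (q s) x (x + L).
    rewrite intg_period // => y; rewrite /q hb.2 (pu s) (hcux s).2.
    by case: (jb).
  have cus : continuous (u s) by ct.
  have cuxs := cuxt s.
  move: (cqt s) (q0 s) QE (Q0 s) (hux s); rewrite /q /obs.
  move: (Q s) => Qs; case: (jb) => cqs qs0 QE Qs0 huxs.
    have ci : continuous (fun r => b r * u s r) by ct.
    apply: le_trans (intg_sqr_le xz ci) _.
    apply: (@le_trans _ _ (L * (Mb * Qs))); last first.
      by rewrite [leRHS]mulrDl mulrA lerDl mulr_ge0.
    apply: ler_pM; [lra | by apply: intg_ge0 => //; [ct | move=> r _; exact: sqr_ge0] | lra |].
    apply: le_trans (_ : intg (fun r => Mb * (b r * u s r ^+ 2)) x z <= _).
      apply: intg_le => //; try ct.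
      by move=> r _; rewrite exprMn expr2 -mulrA ler_wpM2r // mulr_ge0 // sqr_ge0.
    rewrite intgZ //.
    by apply: ler_wpM2l => //; rewrite QE; apply: intg_le_sub.
  apply: le_trans (intg_dy_sq huxs cuxs xz) _.
  apply: (@le_trans _ _ (L * (m^-1 * Qs))); last first.
    by rewrite [leRHS]mulrDl mulrA lerDr mulr_ge0.
  apply: ler_pM; [lra | by apply: intg_ge0 => //; [ct | move=> r _; exact: sqr_ge0] | lra |].
  apply: le_trans (_ : intg (fun r => m^-1 * (b r * ux s r ^+ 2)) x z <= _).
    apply: intg_le => //; try ct.
    move=> r rxz; rewrite mulrA ler_peMl ?sqr_ge0 // ler_pdivlMl // mulr1; exact: hm.
  rewrite intgZ //.
  apply: ler_wpM2l; first by rewrite invr_ge0 ltW.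
  by rewrite QE; apply: intg_le_sub.
apply: le_trans (_ : intg (fun s => (L * Mb + L / m) * Q s) 0 t <= _).
  by apply: intg_le => //; ct.
have Lm : 0 <= L / m by rewrite divr_ge0 // ltW.
have LMb : 0 <= L * Mb by rewrite mulr_ge0.
have CMb : 0 <= Cr * Mb by rewrite mulr_ge0 // ltW.
rewrite intgZ //; apply: le_trans (_ : (L * Mb + L / m) * energy u0 du0 <= _).
  by rewrite ler_wpM2l // addr_ge0.
by rewrite ler_wpM2r //; rewrite mulrDl; lra.
Qed.

End Estimates.

Section DampedH1.
Context {R : realType}.
Notation L := (pi *+ 2 : R).
Variables (b db : R -> R).
Hypothesis (hb : cper b) (cdb : continuous db).
Hypothesis dvb : forall x, is_derive x (1 : R) b (db x).
Hypothesis b0 : forall x, 0 <= b x.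

Lemma obs_lipschitz jb : exists2 K, 0 < K & forall (y w : R -> R) d x z, continuous y ->
  continuous w -> x <= z <= x + L -> (forall s, `|y s - w s| <= d) ->
  `|obs b jb y x z - obs b jb w x z| <= K * d.
Proof.
have cb := hb.1; have [Mb hMb] := per_bounded hb.1 hb.2.
have Mb0 : 0 <= Mb by apply: le_trans (hMb 0).
have LMb0 : 0 <= L * Mb by rewrite mulr_ge0 // period_ge0.
exists (L * Mb + 2); first lra.
move=> y w d x z cy cw /andP[xz zL] hd; have d0 : 0 <= d by apply: le_trans (hd 0).
rewrite mulrDl /obs; case: jb; last first.
  have := ler_normB (y x - w x) (y z - w z); have := hd x; have := hd z.
  have -> : y x - w x - (y z - w z) = y x - y z - (w x - w z) by ring.
  have : 0 <= L * Mb * d by rewrite mulr_ge0.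
  lra.
rewrite -intgB; try ct.
have : `|intg (fun s => b s * y s - b s * w s) x z| <= Mb * d * (z - x).
  apply: intg_abs_le_cst => //; first by ct.
  by move=> s _; rewrite -mulrBr normrM ler_pM.
move=> /le_trans; apply.
have : Mb * d * (z - x) <= Mb * d * L by rewrite ler_wpM2l ?mulr_ge0 //; lra.
by rewrite [_ * L]mulrC [L * Mb * d]mulrAC -[L * d * Mb]mulrA [d * Mb]mulrC; lra.
Qed.

(** On bounded time intervals the flow depends continuously on its datum in the sup norm, and the
    bounds for C^1 data involve only their energy, which [H1le] keeps below [E]; so they pass to the
    limit. *)
Lemma damped_H1 jb : exists2 C, 0 < C & forall g Lg u0 u E, continuous g -> 0 <= Lg ->
    (forall x y, `|g x - g y| <= Lg * `|x - y|) -> H1le E u0 -> flow b db jb g u0 u ->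
  [/\ forall t, 0 <= t -> H1le E (u t),
      forall t x, 0 <= t -> intg (fun s => damp b db jb (u s) x ^+ 2) 0 t <= C * E &
      forall t x z m, 0 <= t -> x <= z <= x + L -> 0 < m -> (forall s, x <= s <= z -> m <= b s) ->
        intg (fun s => obs b jb (u s) x z ^+ 2) 0 t <= (C + L / m) * E].
Proof.
have [C C0 hC] := damped_C1 hb cdb dvb b0 jb; exists C => // g Lg u0 u E cg Lg0 lipg hu0 fu.
have hbe := cper_beta hb jb; have hc0 := cper_c0 hb jb; have hc1 := cper_c1 hb cdb dvb jb.
have hu t := flow_cper t fu; have [cu pu u0E hut] := fu.
have cb := hb.1.
have [K K0 hK] := flow_dependence cg hbe hc0 hc1 Lg0 lipg.
have [K' K'0 hK'] := rhs_lipschitz cg hbe hc0 hc1 Lg0 lipg.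
have [Ko Ko0 hKo] := obs_lipschitz jb.
have approx t d : 0 <= t -> 0 < d -> exists z dz v, [/\ forall x, is_derive x (1 : R) z (dz x),
    continuous dz, energy z dz <= E, flow b db jb g z v &
    forall s x, 0 <= s <= t -> `|u s x - v s x| <= d].
  (* This precision of the datum beats the growth factor of [flow_dependence] up to time [t]. *)
  move=> t0 d0; pose e := d / (2 * expR (2 * K * t)).
  have e0 : 0 < e by rewrite divr_gt0 // mulr_gt0 // expR_gt0.
  have [z [dz [pz hz cdz hE hn]]] := hu0 e e0.
  have [v fv] := flow_existence cg hbe hc0 hc1 Lg0 lipg (conj (dv_ct hz) pz).
  exists z, dz, v; split=> // s x /andP[s0 st].
  have h0 y : `|u0 y - z y| <= e by rewrite distrC.
  apply: le_trans (hK _ _ _ _ e fu fv (ltW e0) h0 s x s0) _.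
  apply: (@le_trans _ _ (2 * e * expR (2 * K * t))).
    apply: ler_wpM2l; first by rewrite mulr_ge0 // ltW.
    by rewrite ler_expR; apply: ler_wpM2l => //; rewrite mulr_ge0 // ltW.
  by rewrite /e le_eqVlt; apply/orP; left; apply/eqP; field; rewrite gt_eqF // expR_gt0.
have E0 : 0 <= E.
  have [z [dz [_ hz cdz hE _]]] := hu0 1 ltr01.
  by apply: le_trans hE; apply: energy_ge0 hz cdz.
split.
- move=> t t0 e e0; have e20 : 0 < e / 2 by rewrite divr_gt0.
  have [z [dz [v [hz cdz hE fv hn]]]] := approx t (e / 2) t0 e20.
  have [h1 _ _] := hC g z dz v cg hz cdz fv.
  have [w [dw [pw hw cdw hEw hnw]]] := h1 t t0 (e / 2) e20.
  exists w, dw; split=> //; first exact: le_trans hE.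
  move=> x; have h2 := hn t x; rewrite t0 lexx in h2.
  have := ler_normB (w x - v t x) (u t x - v t x); have := hnw x; have := h2 isT.
  by rewrite (_ : w x - v t x - (u t x - v t x) = w x - u t x); [lra | ring].
- move=> t x t0.
  have cd (v : R -> R -> R) : continuous (fun z : R * R => v z.1 z.2) ->
      continuous (fun s => damp b db jb (v s) x).
    move=> cv; have cdv : continuous (fun z : R * R => damp b db jb (v z.1) z.2) by exact: ct_dampK.
    exact: (ct_comp2 (u := fun t x => damp b db jb (v t) x) cdv (@ct_id _) (@ct_cst _ _ x)).
  apply: intg_sq_limit => //; first exact: cd.
  move=> d d0; have [z [dz [v [hz cdz hE fv hn]]]] := approx t (d / K') t0 (divr_gt0 d0 K'0).
  exists (fun s => damp b db jb (v s) x); split.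
  + by apply: cd; case: fv.
  + move=> s st; have := (hK' _ _ _ (hu s) (flow_cper s fv) (fun y => hn s y st)).1 x.
    by rewrite [K' * _]mulrC divfK // gt_eqF.
  + have [_ h2 _] := hC g z dz v cg hz cdz fv.
    by apply: le_trans (h2 t x t0) _; rewrite ler_pM2l.
move=> t x z m t0 xz m0 hm.
have co (v : R -> R -> R) : continuous (fun z : R * R => v z.1 z.2) ->
    continuous (fun s => obs b jb (v s) x z).
  move=> cv; rewrite /obs; case: jb {hC hbe hc0 hc1 fu hut hK hK' hKo approx}; last by ct.
  by apply: (@ct_intg _ _ (fun t s => b s * v t s)); ct.
apply: intg_sq_limit => //; first exact: co.
move=> d d0; have [z' [dz [v [hz cdz hE fv hn]]]] := approx t (d / Ko) t0 (divr_gt0 d0 Ko0).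
exists (fun s => obs b jb (v s) x z); split.
- by apply: co; case: fv.
- move=> s st; have := hKo _ _ _ x z (hu s).1 (flow_cper s fv).1 xz (fun y => hn s y st).
  by rewrite [Ko * _]mulrC divfK // gt_eqF.
- have [_ _ h3] := hC g z' dz v cg hz cdz fv.
  apply: le_trans (h3 t x z m t0 xz m0 hm) _; rewrite ler_wpM2l // addr_ge0 ?divr_ge0 //.
  + exact: ltW.
  + exact: period_ge0.
  + exact: ltW.
Qed.

End DampedH1.

(** * Limits along an ultrafilter and rigidity *)

Section UltraLimit.
Context {R : realType}.
Notation L := (pi *+ 2 : R).

Lemma ultra_bounded_cvg (I : Type) (U : set_system I) (UF : UltraFilter U) (h : I -> R) B :
  (\forall i \near U, `|h i| <= B) -> exists l : R, h i @[i --> U] --> l.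
Proof.
move=> hB; have cB : compact (`[- B, B] : set R) by exact: segment_compact.
have [|p [_ hp]] := cB (h @ U) _ _.
  by rewrite /nbhs /=; apply: filterS hB => i; rewrite /= in_itv /= -ler_norml.
exists p => V pV; have [//|hV] := in_ultra_setVsetC (h @^-1` V) UF.
have [r [hr Vr]] := hp (~` V) V hV pV.
by [].
Qed.

Lemma cvg_norm_le (I : Type) (U : set_system I) (UF : ProperFilter U) (h : I -> R) (l c : R) :
  h i @[i --> U] --> l -> (\forall i \near U, `|h i| <= c) -> `|l| <= c.
Proof. by move=> hl hc; exact: (cvgr_to_le (cvg_norm hl) hc). Qed.

Variables (u : R -> R -> R) (B M : R).
Hypothesis pu : forall t, periodic (u t) L.
Hypothesis uB : forall t x, 0 <= t -> `|u t x| <= B.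
Hypothesis u_mod : forall e : R, 0 < e -> exists2 d : R, 0 < d &
  forall t x y, 0 <= t -> `|x - y| < d -> `|u t x - u t y| <= e.
Hypothesis u_lip : forall t s x, 0 <= t -> 0 <= s -> `|u t x - u s x| <= M * `|t - s|.

Variables (U : set_system R) (UF : UltraFilter U).

(** The bounds on [u] hold for nonnegative times only. Along an ultrafilter at infinity every shift
    is admissible; along the one in [v_near], whose times may stay bounded, nonnegative shifts still
    are. *)
Definition adm s := \forall t \near U, 0 <= t + s.

Lemma adm_le s r : s <= r -> adm s -> adm r.
Proof. by move=> sr; apply: filterS => t h; lra. Qed.

Definition ulim s x : R := lim (u (t + s) x @[t --> U]).

Lemma ulim_cvg s x : adm s -> u (t + s) x @[t --> U] --> ulim s x.
Proof.
move=> hs; have [l hl] : exists l : R, u (t + s) x @[t --> U] --> l.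
  by apply: (@ultra_bounded_cvg _ U UF _ B); apply: filterS hs => t; exact: uB.
by apply/cvg_ex; exists l.
Qed.

Lemma ulim_per s : periodic (ulim s) L.
Proof. by move=> x; rewrite /ulim; under eq_fun do rewrite pu. Qed.

Lemma ulim_bounded s x : adm s -> `|ulim s x| <= B.
Proof.
move=> hs; apply: (cvg_norm_le _ (@ulim_cvg s x hs)).
by apply: filterS hs => t; exact: uB.
Qed.

Lemma ulim_modulus (e : R) : 0 < e -> exists2 d : R, 0 < d &
  forall s x y, adm s -> `|x - y| < d -> `|ulim s x - ulim s y| <= e.
Proof.
move=> /u_mod[d d0 hd]; exists d => // s x y hs xy.
apply: (cvg_norm_le _ (cvgB (@ulim_cvg s x hs) (@ulim_cvg s y hs))).
by apply: filterS hs => t ht; exact: hd.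
Qed.

Lemma ulim_lip s r x : adm s -> adm r -> `|ulim s x - ulim r x| <= M * `|s - r|.
Proof.
move=> hs hr; apply: (cvg_norm_le _ (cvgB (@ulim_cvg s x hs) (@ulim_cvg r x hr))).
apply: filterS2 hs hr => t ts tr; apply: le_trans (u_lip x ts tr) _.
by rewrite (_ : t + s - (t + r) = s - r) //; ring.
Qed.

(** An Arzela-Ascoli argument on the compact set of times in [[s1, s2]] and points of one period.
    Five errors of size [e / 5] add up: the moduli in time and in space of [u], those of its limit,
    and the convergence at a nearby point. *)
Lemma ulim_unif s1 s2 (e : R) : adm s1 -> 0 < e ->
  \forall t \near U, forall s x, s1 <= s <= s2 -> `|u (t + s) x - ulim s x| <= e.
Proof.
move=> h1 e0; have M0 : 0 <= M.
  have := u_lip 0 ler01 (ler0n _ 2); rewrite (_ : 1 - 2 = -1 :> R); last by ring.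
  by rewrite normrN1 mulr1; apply: le_trans.
have e5 : 0 < e / 5 by rewrite divr_gt0.
have cK : compact ((`[s1, s2] : set R) `*` (`[0, L] : set R)).
  by apply: compact_setX; exact: segment_compact.
move/compact_near_coveringP: cK.
move=> /(_ R U (fun t z => s1 <= z.1 -> `|u (t + z.1) z.2 - ulim z.1 z.2| <= e) _) H.
have {}H : \forall t \near U, forall z, ((`[s1, s2] : set R) `*` (`[0, L] : set R)) z ->
    s1 <= z.1 -> `|u (t + z.1) z.2 - ulim z.1 z.2| <= e.
  apply: H => -[r x0] [/= + _]; rewrite in_itv /= => /andP[s1r _].
  have [d d0 hd] := u_mod e5; have [d' d'0 hd'] := ulim_modulus e5.
  have hr := adm_le s1r h1; have /cvgrPdist_le /(_ _ e5) hcv := @ulim_cvg r x0 hr.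
  pose dt := e / 5 / (M + 1); have dt0 : 0 < dt by rewrite divr_gt0 // ltr_wpDl.
  have Mdt (a : R) : `|a| < dt -> M * `|a| <= e / 5.
    move=> ha; apply: (@le_trans _ _ (M * dt)); first by rewrite ler_wpM2l // ltW.
    by rewrite /dt mulrC mulrAC ler_pdivrMr ?ltr_wpDl // ler_wpM2l // ?(ltW e5) // lerDl.
  exists ([set z : R * R | `|z.1 - r| < dt /\ `|z.2 - x0| < Num.min d d'],
    [set t | 0 <= t + s1 /\ `|ulim r x0 - u (t + r) x0| <= e / 5]) => /=.
    split; last by apply: filterS2 h1 hcv.
    have c1 : continuous (fun z : R * R => z.1) by ct.
    have c2 : continuous (fun z : R * R => z.2) by ct.
    have m0 : 0 < Num.min d d' by rewrite lt_min d0.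
    have /cvgrPdist_lt /(_ _ dt0) n1 := c1 (r, x0).
    have /cvgrPdist_lt /(_ _ m0) n2 := c2 (r, x0).
    by apply: filterS2 n1 n2 => z /= z1 z2; split; rewrite distrC.
  move=> [[s y] t] [/= [h3 +] [ts1 h4]] s1s; rewrite lt_min => /andP[h5 h6].
  have ts : 0 <= t + s by lra.
  have tr : 0 <= t + r by lra.
  have a1 := hd (t + s) y x0 ts h5.
  have a2 := u_lip x0 ts tr; rewrite (_ : t + s - (t + r) = s - r) in a2; last by ring.
  have a3 := hd' s y x0 (adm_le s1s h1) h6.
  have a4 := ulim_lip x0 (adm_le s1s h1) hr; have a5 := Mdt _ h3.
  move: h4 a1 a2 a3 a4; rewrite !ler_norml.
  move=> /andP[? ?] /andP[? ?] /andP[? ?] /andP[? ?] /andP[? ?].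
  by apply/andP; split; lra.
apply: filterS H => t H s x /andP[s1s ss2].
have [k /andP[k1 k2]] := period_reduce x.
rewrite -(period_int x k (pu _)) -(period_int x k (ulim_per _)).
apply: (H (s, x + k%:~R * L)) => //; split; rewrite /= in_itv /= ?s1s ?ss2 //.
by rewrite k1 ltW.
Qed.

Lemma ulim_jc : (forall s, adm s) -> continuous (fun z : R * R => ulim z.1 z.2).
Proof.
move=> ha z0; apply/cvgrPdist_le => e e0; have e2 : 0 < e / 2 by rewrite divr_gt0.
have M0 : 0 <= M.
  have := u_lip 0 ler01 (ler0n _ 2); rewrite (_ : 1 - 2 = -1 :> R); last by ring.
  by rewrite normrN1 mulr1; apply: le_trans.
have [d d0 hd] := ulim_modulus e2.
pose dt := e / 2 / (M + 1); have dt0 : 0 < dt by rewrite divr_gt0 // ltr_wpDl.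
have c1 : continuous (fun z : R * R => z.1) by ct.
have c2 : continuous (fun z : R * R => z.2) by ct.
have /cvgrPdist_lt /(_ _ dt0) n1 := c1 z0.
have /cvgrPdist_lt /(_ _ d0) n2 := c2 z0.
apply: filterS2 n1 n2 => z /= z1 z2.
have h1 := hd z0.1 z0.2 z.2 (ha _) z2.
have h2 := ulim_lip z.2 (ha z0.1) (ha z.1).
have h3 : M * `|z0.1 - z.1| <= e / 2.
  apply: (@le_trans _ _ (M * dt)); first by rewrite ler_wpM2l // ltW.
  by rewrite /dt mulrC mulrAC ler_pdivrMr ?ltr_wpDl // ler_wpM2l // ?(ltW e2) // lerDl.
have := ler_normD (ulim z0.1 z0.2 - ulim z0.1 z.2) (ulim z0.1 z.2 - ulim z.1 z.2).
by rewrite addrA subrK; lra.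
Qed.

Lemma ulim_ctx s : adm s -> continuous (ulim s).
Proof.
move=> hs x; apply/cvgrPdist_le => e e0; have [d d0 hd] := ulim_modulus e0.
have /cvgrPdist_lt /(_ _ d0) n1 := @ct_id R x.
by apply: filterS n1 => y /= xy; exact: hd.
Qed.

End UltraLimit.

(** * Rigidity of undamped solutions that are flat on an arc *)

Section Rigidity.
Context {R : realType}.
Notation L := (pi *+ 2 : R).

Definition flux (z : R) : R := z + z ^+ 2 / 2.

Lemma ct_flux : continuous flux.
Proof. by rewrite /flux; ct. Qed.

Lemma flux_lip B y z : `|y| <= B -> `|z| <= B -> `|flux y - flux z| <= (1 + B) * `|y - z|.
Proof.
move=> yB zB; have -> : flux y - flux z = (1 + (y + z) / 2) * (y - z) by rewrite /flux; field.
rewrite normrM; apply: ler_wpM2r => //; move: yB zB; rewrite !ler_norml.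
by move=> /andP[? ?] /andP[? ?]; apply/andP; split; lra.
Qed.

Variables (v : R -> R -> R) (B M x1 x2 : R).
Hypothesis cv : continuous (fun z : R * R => v z.1 z.2).
Hypothesis pv : forall s, periodic (v s) L.
Hypothesis vB : forall s x, `|v s x| <= B.
Hypothesis v_mod : forall e : R, 0 < e -> exists2 d : R, 0 < d &
  forall s x y, 0 <= s -> `|x - y| < d -> `|v s x - v s y| <= e.
Hypothesis v_lip : forall s r x, 0 <= s -> 0 <= r -> `|v s x - v r x| <= M * `|s - r|.
Hypothesis hv : forall s x, is_derive s (1 : R) (v^~ x) (- opDK (fun x => flux (v s x)) x).
Hypothesis x12 : x1 < x2.
Let x0 := (x1 + x2) / 2.
Hypothesis v_flat : forall s x, x1 < x < x2 -> v s x = v s x0.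

Let F s x := flux (v s x).
Let phi s := opK (F s).
Let dphi s := opDK (F s).
Let c := v 0 x0.
Let k := flux c.

Let cF : continuous (fun z : R * R => F z.1 z.2).
Proof. by rewrite /F /flux; ct. Qed.
Let hF s : cper (F s).
Proof. by split; [ct | move=> x; rewrite /F pv]. Qed.
Let cphi : continuous (fun z : R * R => phi z.1 z.2). Proof. exact: ct_opK. Qed.
Let cdphi : continuous (fun z : R * R => dphi z.1 z.2). Proof. exact: ct_opDK. Qed.
Let dv_phi s x : is_derive x (1 : R) (phi s) (dphi s x). Proof. exact: dv_opK. Qed.
Let dv_dphi s x : is_derive x (1 : R) (dphi s) (phi s x - F s x). Proof. exact: dv_opDK. Qed.
Let x0_in : x1 < x0 < x2. Proof. by have h := x12; rewrite /x0; apply/andP; split; lra. Qed.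

Lemma dv_locally_cst (h : R -> R) (l x : R) : x1 < x < x2 ->
  (forall y, x1 < y < x2 -> h y = h x0) -> is_derive x (1 : R) h l -> l = 0.
Proof.
move=> /andP[xl xr] hcst hl; apply: (dv_unique hl).
apply: (near_eq_is_derive _ (dv_cst (h x0) x)).
have n1 : \forall y \near x, x1 < y by exact: lt_nbhsr.
have n2 : \forall y \near x, y < x2 by exact: lt_nbhsl.
by apply: filterS2 n1 n2 => y y1 y2; rewrite hcst // y1.
Qed.

(** Points of the arc share one trajectory, hence one time derivative and one value of [dphi]. From
    this, [phi_xx = phi - F = 0] on the arc; as [F] is flat there, so is [phi]; thus [dphi] vanishes
    there and the value [c] does not depend on time. *)
Let dphi_flat s x : x1 < x < x2 -> dphi s x = dphi s x0.
Proof.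
move=> xin; have E : v^~ x = v^~ x0 by apply/funext => r; exact: v_flat.
have h := hv s x; rewrite E in h.
by have := dv_unique h (hv s x0); rewrite -/(F s) -/(dphi s) => /oppr_inj.
Qed.

Let phi_in s x : x1 < x < x2 -> phi s x = F s x.
Proof.
by move=> xin; apply/eqP; rewrite -subr_eq0; apply/eqP;
  apply: (dv_locally_cst xin (fun y => @dphi_flat s y) (dv_dphi s x)).
Qed.

Let dphi_x0 s : dphi s x0 = 0.
Proof.
apply: (dv_locally_cst x0_in _ (dv_phi s x0)) => y yin.
by rewrite !phi_in // /F v_flat.
Qed.

Let v_x0 s : v s x0 = c.
Proof.
have h r : is_derive r (1 : R) (v^~ x0) 0.
  by have := hv r x0; rewrite -/(F r) -/(dphi r) dphi_x0 oppr0.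
exact: (dv0_cst h s 0).
Qed.

Let phi_x0 s : phi s x0 = k.
Proof. by rewrite phi_in // /F v_x0. Qed.

Let G z : R := z ^+ 2 / 2 + z ^+ 3 / 6 - k * z.

Let dv_G s x : is_derive s (1 : R) (fun s => G (v s x)) (- ((F s x - k) * dphi s x)).
Proof.
by rewrite /G /F /flux; dv; rewrite /= -[opDK _ x]/(dphi s x); field.
Qed.

Let GB : exists2 CG, 0 <= CG & forall s x, `|G (v s x)| <= CG.
Proof.
have B0 : 0 <= B by apply: le_trans (vB 0 0).
exists (B ^+ 2 / 2 + B ^+ 3 / 6 + `|k| * B).
  by rewrite !addr_ge0 ?mulr_ge0 ?exprn_ge0.
move=> s x; have vb := vB s x; rewrite /G.
apply: le_trans (ler_normB _ _) _; apply: lerD; last by rewrite normrM ler_pM.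
apply: le_trans (ler_normD _ _) _; apply: lerD; rewrite normrM normrX [`|_^-1|]ger0_norm ?invr_ge0 //.
  by rewrite ler_pM2r ?invr_gt0 // lerXn2r ?nnegrE.
by rewrite ler_pM2r ?invr_gt0 // lerXn2r ?nnegrE.
Qed.

(* [(phi - k)^2 - phi_x^2] is the flux of the conservation law for [G (v)]. *)
Let PQ s x := (phi s x - k) ^+ 2 - dphi s x ^+ 2.

Let dv_PQ s x : is_derive x (1 : R) (PQ s) (2 * ((F s x - k) * dphi s x)).
Proof.
have h1 := dv_phi s x; have h2 := dv_dphi s x.
by rewrite /PQ; dv; rewrite /= !expr1; ring.
Qed.

Let J s := intg (fun x => (phi s x - k) ^+ 2 + dphi s x ^+ 2) x0 (x0 + L).

Let cJ : continuous J.
Proof.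
by apply: (@ct_intg _ _ (fun s x => (phi s x - k) ^+ 2 + dphi s x ^+ 2)); ct.
Qed.

Let J_integrable : exists C, forall T, 0 <= T -> intg J 0 T <= C.
Proof.
have [CG CG0 hG] := GB; have L0 := @period_ge0 R.
pose C1 := 4 * CG * L; have C10 : 0 <= C1 by rewrite !mulr_ge0.
exists ((C1 * expR (2 * L) + C1) * L) => T T0.
pose A x := intg (PQ^~ x) 0 T; pose N x := intg (fun s => (phi s x - k) ^+ 2) 0 T.
have cPQ : continuous (fun z : R * R => PQ z.1 z.2) by rewrite /PQ; ct.
have cFx x : continuous (F^~ x) by ct.
have cdpx x : continuous (dphi^~ x) by ct.
have cpx x : continuous (phi^~ x) by ct.
have hA x : is_derive x (1 : R) A (intg (fun s => 2 * ((F s x - k) * dphi s x)) 0 T).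
  apply: (@dv_param _ (fun x s => PQ s x) (fun x s => 2 * ((F s x - k) * dphi s x)) 0 T x
    (fun x s => dv_PQ s x)); last by ct.
  by move=> y; exact: (ct_comp2 cPQ (@ct_id _) (@ct_cst _ _ y)).
(* The integrand is the time derivative of [- 2 * G (v)], so the integral is an increment of a
   bounded quantity and its bound is free of [T]. *)
have dA x : `|intg (fun s => 2 * ((F s x - k) * dphi s x)) 0 T| <= 4 * CG.
  have -> : intg (fun s => 2 * ((F s x - k) * dphi s x)) 0 T = - 2 * (G (v T x) - G (v 0 x)).
    have h s : is_derive s (1 : R) (fun s => - 2 * G (v s x)) (2 * ((F s x - k) * dphi s x)).
      by apply: dv_to (dvZ (- 2) (dv_G s x)) _; ring.
    by rewrite (intgE _ _ h); ring.
  rewrite normrM normrN [`|2|]ger0_norm //.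
  by have := ler_normB (G (v T x)) (G (v 0 x)); have := hG T x; have := hG 0 x; lra.
have A0 : A x0 = 0.
  rewrite /A (intg_ext (g := fun=> 0)) ?intg_cst ?mul0r // => s.
  by rewrite /PQ phi_x0 dphi_x0; ring.
have Ab x : x0 <= x <= x0 + L -> - C1 <= A x.
  move=> /andP[x0x xL]; have [y _] := dv_mvt x0x (fun y _ => hA y).
  rewrite A0 subr0 => ->; have := dA y; set D := intg _ 0 T => hD.
  have : `|D * (x - x0)| <= C1 by rewrite normrM ler_pM // ger0_norm; lra.
  by rewrite ler_norml => /andP[].
have hN x : is_derive x (1 : R) N (intg (fun s => 2 * ((phi s x - k) * dphi s x)) 0 T).
  apply: (@dv_param _ (fun x s => (phi s x - k) ^+ 2)
    (fun x s => 2 * ((phi s x - k) * dphi s x)) 0 T x); last by ct.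
    by move=> y s; have h := dv_phi s y; dv; rewrite /= !expr1; ring.
  by move=> y; ct.
have NA x : intg (fun s => (phi s x - k) ^+ 2 + dphi s x ^+ 2) 0 T = 2 * N x - A x.
  rewrite /N /A -intgZ; last by ct.
  rewrite -intgB; [|by ct|by rewrite /PQ; ct].
  by apply: intg_ext => s; rewrite /PQ; ring.
(* The differential inequality in [x] for Gronwall: the left side is at most the time integral of
   [(phi - k)^2 + dphi^2], which equals [2 * N x - A x], and [A x >= - C1]. *)
have dN x : x0 <= x <= x0 + L ->
    intg (fun s => 2 * ((phi s x - k) * dphi s x)) 0 T <= 2 * N x + C1.
  move=> xin; apply: le_trans (_ : 2 * N x - A x <= _); last by have := Ab x xin; lra.
  rewrite -NA; apply: intg_le => //; try ct.
  by move=> s _; have := sqr_ge0 (phi s x - k - dphi s x); rewrite sqrrB; lra.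
have N0 : N x0 = 0.
  rewrite /N (intg_ext (g := fun=> 0)) ?intg_cst ?mul0r // => s.
  by rewrite phi_x0 subrr expr0n.
have Nb x : x0 <= x <= x0 + L -> 2 * N x <= C1 * expR (2 * L).
  move=> /andP[x0x xL].
  have h y : is_derive y (1 : R) (fun y => expR (- (2 * y)) * (2 * N y + C1))
     (2 * expR (- (2 * y)) * (intg (fun s => 2 * ((phi s y - k) * dphi s y)) 0 T - (2 * N y + C1))).
    by have h1 := hN y; dv; ring.
  have := dv_le x0x (fun y _ => h y) (fun y _ => dv_cst 0 y) _.
  rewrite subrr N0 => H.
  have {H} : expR (- (2 * x)) * (2 * N x + C1) <= expR (- (2 * x0)) * C1.
    have : expR (- (2 * x)) * (2 * N x + C1) - expR (- (2 * x0)) * (2 * 0 + C1) <= 0.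
      apply: H => y /andP[y1 y2]; rewrite mulr_ge0_le0 ?mulr_ge0 ?expR_ge0 //.
      by rewrite subr_le0; apply: dN; rewrite y1 (le_trans y2).
    by rewrite mulr0 add0r; lra.
  rewrite -(ler_pM2l (expR_gt0 (2 * x))) mulrA -expRD subrr expR0 mul1r mulrA -expRD.
  have : expR (2 * x - 2 * x0) * C1 <= expR (2 * L) * C1.
    by rewrite ler_wpM2r // ler_expR; lra.
  lra.
have cNA : continuous (fun x => 2 * N x - A x).
  by have cN := dv_ct hN; have cA := dv_ct hA; ct.
rewrite /J intg_fubini; last by ct.
rewrite (intg_ext _ _ NA).
apply: le_trans (_ : intg (fun=> C1 * expR (2 * L) + C1) x0 (x0 + L) <= _).
  apply: intg_le => //; [by rewrite lerDl | by ct |].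
  by move=> x xin; have := Nb x xin; have := Ab x xin; lra.
by rewrite intg_cst addrAC subrr add0r.
Qed.

Let J_small (e : R) : 0 < e -> exists2 s, 0 <= s & J s <= e.
Proof.
move=> e0; have [C hC] := J_integrable.
have C0 : 0 <= C by have := hC 0 (lexx _); rewrite intgxx.
have [//|H] := pselect (exists2 s, 0 <= s & J s <= e).
pose T := C / e + 1; have T0 : 0 <= T by rewrite addr_ge0 // divr_ge0 // ltW.
have : intg (fun=> e) 0 T <= C.
  apply: le_trans (hC T T0); apply: intg_le => //; first by ct.
  move=> s /andP[s0 _]; rewrite leNgt; apply/negP => /ltW Js.
  by apply: H; exists s.
rewrite intg_cst subr0 /T mulrDr mulr1 mulrC divfK ?gt_eqF //; lra.
Qed.

(** The quadratic [flux] takes the value [k] at [c] and [- 2 - c] only. A continuous [w] leaving [c]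
    for the other root would pass through their midpoint, where the flux is not [k]. *)
Lemma flux_level (w : R -> R) : continuous w -> w x0 = c ->
  (forall x, x0 < x < x0 + L -> flux (w x) = k) -> forall x, x0 <= x < x0 + L -> w x = c.
Proof.
move=> cw w0 hw x /andP[]; rewrite le_eqVlt => /predU1P[<- //|x0x xL].
have key y : x0 < y < x0 + L -> (w y - c) * (1 + c + (w y - c) / 2) = 0.
  by move=> /hw; rewrite /k /flux => h; transitivity (w y + w y ^+ 2 / 2 - (c + c ^+ 2 / 2));
    [field | rewrite h subrr].
have [//|/eqP wxc] := eqVneq (w x) c.
have wx := key x; rewrite x0x xL in wx; move: (wx isT) => /eqP; rewrite mulf_eq0 subr_eq0.
move: wxc => /eqP/negbTE -> /= /eqP wxE.
have [y yin hy] : exists2 y, y \in `[x0, x] & w y = (w x + c) / 2.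
  apply: IVT; [exact: ltW | exact: continuous_subspaceT |].
  rewrite w0 ge_min le_max; have [h|h] := leP (w x) c.
    by apply/andP; split; apply/orP; [right | left]; lra.
  by apply/andP; split; apply/orP; [left | right]; lra.
move: yin; rewrite in_itv /= => /andP[y0 yx].
have [yx0|yx0] := eqVneq y x0.
  by rewrite yx0 w0 in hy; lra.
have yin : x0 < y < x0 + L by rewrite [x0 < y]lt_def yx0 y0 (le_lt_trans yx).
by have := key y yin; rewrite hy; nra.
Qed.

(** Times with small [J] form a filter base. Along a finer ultrafilter the profiles converge
    uniformly to some [w] whose [J] vanishes; then [opK (flux w)] is [k] over a period, its second
    derivative gives [flux w = k], and [flux_level] gives [w = c]. *)
Let v_near (e : R) : 0 < e -> exists2 s, 0 <= s & forall x, `|v s x - c| <= e.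
Proof.
move=> e0; have B0 : 0 <= B by apply: le_trans (vB 0 0).
have L0 := @period_gt0 R.
pose D (e : R) := [set s : R | 0 <= s /\ J s <= e].
pose FF := filter_from [set e : R | 0 < e] D.
have PF : ProperFilter FF.
  apply: filter_from_proper; last first.
    by move=> d /= d0; have [s s0 Js] := J_small d0; exists s.
  apply: filter_from_filter; first by exists 1 => /=.
  move=> a b /= a0 b0; exists (Num.min a b); first by rewrite /= lt_min a0.
  by move=> s [s0]; rewrite le_min => /andP[h1 h2]; split; split.
have [U [UF FU]] := ultraFilterLemma PF.
have U_D d : 0 < d -> \forall s \near U, 0 <= s /\ J s <= d.
  by move=> d0; apply: FU; exists d.
have h0 : adm U 0.
  by apply: filterS (U_D 1 ltr01) => s [s0 _]; rewrite addr0.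
have vB' t x : 0 <= t -> `|v t x| <= B by [].
pose w := ulim v U 0.
have cw : continuous w by exact: (ulim_ctx vB' v_mod UF h0).
have pw : periodic w L by exact: ulim_per.
have wB x : `|w x| <= B by exact: (ulim_bounded vB' UF x h0).
have hw (d : R) : 0 < d -> exists s, [/\ 0 <= s, J s <= d & forall x, `|v s x - w x| <= d].
  move=> d0; have n1 := ulim_unif pv vB' v_mod v_lip UF 0 h0 d0.
  have [s [[s0 Js] hs]] := filter_ex (filterI (U_D d d0) n1).
  exists s; split=> // x; have := hs 0 x; rewrite addr0; apply.
  by rewrite lexx.
have wx0 : w x0 = c.
  apply/eqP; rewrite -subr_eq0 -normr_le0; apply/ler_addgt0Pr => d d0.
  by have [s [_ _ /(_ x0)]] := hw d d0; rewrite v_x0 distrC add0r.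
have hfw : cper (fun x => flux (w x)) by exact: cper_comp ct_flux (conj cw pw).
pose Kw := opK (fun x => flux (w x)); pose Dw := opDK (fun x => flux (w x)).
have cKw : continuous Kw by exact: (cper_opK hfw).1.
have cDw : continuous Dw by exact: (cper_opDK hfw).1.
pose Jw := intg (fun x => (Kw x - k) ^+ 2 + Dw x ^+ 2) x0 (x0 + L).
have Jw0 : Jw = 0.
  apply/eqP; rewrite eq_le; apply/andP; split; last first.
    apply: intg_ge0; [by rewrite lerDl ltW | by ct |].
    by move=> x _; rewrite addr_ge0 ?sqr_ge0.
  (* From [a^2 <= 2 * b^2 + 2 * r^2] for both squares in [Jw]: the 2 multiplies [J s], and twice
     [2 * ((1 + B) * d')^2] is integrated over a period. *)
  pose C := 2 + 4 * (1 + B) ^+ 2 * L.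
  have C0 : 0 < C.
    have : 0 <= 4 * (1 + B) ^+ 2 * L 
      by apply: mulr_ge0; [apply: mulr_ge0 => //; exact: sqr_ge0 | exact: ltW].
    by rewrite /C; lra.
  apply/ler_addgt0Pr => d d0; rewrite add0r.
  pose d' := Num.min 1 (d / C).
  have d'0 : 0 < d' by rewrite lt_min ltr01 divr_gt0.
  have d'1 : d' <= 1 by rewrite ge_min lexx.
  have d'C : C * d' <= d.
    by rewrite mulrC -ler_pdivlMr // ge_min lexx orbT.
  have [s [s0 Js hs]] := hw d' d'0.
  have fd x : `|flux (w x) - F s x| <= (1 + B) * d'.
    apply: le_trans (flux_lip (wB x) (vB s x)) _.
    by rewrite distrC ler_wpM2l // addr_ge0.
  have hdiff : cper (fun x => flux (w x) - F s x).
    by apply: cperD => //; apply: cperN.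
  have dE x : flux (w x) - F s x = (-1) * F s x + flux (w x) by ring.
  have Kd x : `|Kw x - phi s x| <= (1 + B) * d'.
    have -> : Kw x - phi s x = opK (fun x => flux (w x) - F s x) x.
      by rewrite (funext dE) opK_lin // /Kw /phi; ring.
    exact: opK_abs_le.
  have Dd x : `|Dw x - dphi s x| <= (1 + B) * d'.
    have -> : Dw x - dphi s x = opDK (fun x => flux (w x) - F s x) x.
      by rewrite (funext dE) opDK_lin // /Dw /dphi; ring.
    exact: opDK_abs_le.
  have sqd (a b r : R) : `|a - b| <= r -> a ^+ 2 <= 2 * b ^+ 2 + 2 * r ^+ 2.
    move=> abr; have r0 : 0 <= r by apply: le_trans abr.
    have : (a - b) ^+ 2 <= r ^+ 2 by rewrite -real_normK ?num_real // ler_sqr ?nnegrE.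
    by have := sqr_ge0 (a - 2 * b); rewrite !sqrrB; lra.
  apply: le_trans d'C.
  apply: le_trans (_ : intg (fun x => 2 * ((phi s x - k) ^+ 2 + dphi s x ^+ 2) +
      4 * ((1 + B) * d') ^+ 2) x0 (x0 + L) <= _).
    apply: intg_le; [by rewrite lerDl ltW | by ct | by ct |] => x _.
    have h1 : (Kw x - k) ^+ 2 <= 2 * (phi s x - k) ^+ 2 + 2 * ((1 + B) * d') ^+ 2.
      by apply: sqd; rewrite (_ : _ - _ - _ = Kw x - phi s x) //; ring.
    have h2 := sqd _ _ _ (Dd x); lra.
  rewrite intgD; [|by ct|by ct]; rewrite intg_cst intgZ; last by ct.
  rewrite -/(J s) /C [leRHS]mulrDl; apply: lerD; first by rewrite ler_pM2l.
  rewrite exprMn (_ : x0 + L - x0 = L); last by ring.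
  have -> : 4 * ((1 + B) ^+ 2 * d' ^+ 2) * L = 4 * (1 + B) ^+ 2 * L * d' ^+ 2 by ring.
  apply: ler_wpM2l; last by rewrite expr2 ler_piMl // ltW.
  by apply: mulr_ge0; [apply: mulr_ge0 => //; exact: sqr_ge0 | exact: ltW].
have Jz : forall x, x0 < x < x0 + L -> Kw x = k /\ Dw x = 0.
  move=> x xin; have cI : continuous (fun x => (Kw x - k) ^+ 2 + Dw x ^+ 2) by ct.
  have := intg_eq0 cI _ Jw0 xin => /(_ _) /eqP.
  rewrite paddr_eq0 ?sqr_ge0 // !sqrf_eq0 subr_eq0 => H.
  have /andP[/eqP -> /eqP ->] := H (fun y _ => addr_ge0 (sqr_ge0 _) (sqr_ge0 _)).
  by [].
have fw x : x0 < x < x0 + L -> flux (w x) = k.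
  move=> xin; have := dv_opDK x hfw; rewrite -/(Kw x) -/Dw (Jz x xin).1 => hD.
  have /eqP : k - flux (w x) = 0.
    apply: (dv_unique hD); apply: (near_eq_is_derive _ (dv_cst 0 x)).
    move: xin => /andP[xl xr].
    have n1 : \forall y \near x, x0 < y by exact: lt_nbhsr.
    have n2 : \forall y \near x, y < x0 + L by exact: lt_nbhsl.
    by apply: filterS2 n1 n2 => y y1 y2; rewrite (Jz y _).2 // y1.
  by rewrite subr_eq0 => /eqP.
have wc x : w x = c.
  have [n /andP[n1 n2]] := period_reduce (x - x0).
  rewrite -(period_int x n pw); apply: (flux_level cw wx0 fw).
  by apply/andP; split; lra.
by have [s [s0 _ hs]] := hw e e0; exists s => // x; rewrite -(wc x).
Qed.

Let G_cons s : intg (fun x => G (v s x)) 0 L = intg (fun x => G (v 0 x)) 0 L.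
Proof.
have cGv : continuous (fun z : R * R => G (v z.1 z.2)) by rewrite /G; ct.
have h r : is_derive r (1 : R) (fun r => intg (fun x => G (v r x)) 0 L) 0.
  have cd : continuous (fun z : R * R => - ((F z.1 z.2 - k) * dphi z.1 z.2)) by ct.
  have cG' r' : continuous (fun x => G (v r' x)).
    by apply: (ct_comp2 (u := fun r x => G (v r x)) cGv); ct.
  apply: dv_to (@dv_param _ (fun r x => G (v r x)) _ 0 L r dv_G cG' cd) _.
  rewrite (intg_ext (g := fun x => - 2^-1 * (2 * ((F r x - k) * dphi r x)))); last first.
    by move=> x; field.
  rewrite intgZ; last by ct.
  rewrite (intg_derive_period (dv_PQ r)) ?mulr0 // => x.
  by rewrite /PQ /phi /dphi (cper_opK (hF r)).2 (cper_opDK (hF r)).2.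
exact: (dv0_cst h s 0).
Qed.

(** Taylor's formula at [c], which is critical for [G] because [k = flux c]. The second derivative
    [1 + c] decides whether [G - G c] has a sign near [c]. *)
Let Gdiff z : G z - G c = (z - c) ^+ 2 * ((1 + c) / 2 + (z - c) / 6).
Proof. by rewrite /G /k /flux; field. Qed.

(** The integral of [G (v)] is the same at all times, and at the times provided by [v_near] it is
    arbitrarily close to that of the constant [G c]. *)
Let G_int s : intg (fun x => G (v s x) - G c) 0 L = 0.
Proof.
have cG r : continuous (fun x => G (v r x)) by rewrite /G; ct.
rewrite intgB //; last by ct.
rewrite G_cons; have L0 := @period_gt0 R.
apply/eqP; rewrite -normr_le0; apply/ler_addgt0Pr => e e0; rewrite add0r.
pose C := ((1 + `|c|) / 2 + 1) * L.
have c1 : 0 <= (1 + `|c|) / 2 + 1 by rewrite addr_ge0 // divr_ge0 // addr_ge0.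
have C0 : 0 < C + 1 by rewrite ltr_wpDl // mulr_ge0 // ltW.
pose d := Num.min 1 (e / (C + 1)).
have d0 : 0 < d by rewrite lt_min ltr01 divr_gt0.
have d1 : d <= 1 by rewrite ge_min lexx.
have dC : d * C <= e.
  apply: (@le_trans _ _ (d * (C + 1))); first by rewrite ler_pM2l // lerDl.
  by rewrite -ler_pdivlMr // ge_min lexx orbT.
have [r r0 hr] := v_near d0.
rewrite -(G_cons r) -intgB //; last by ct.
apply: le_trans dC; rewrite /C mulrA -[L in leRHS](subr0 L).
apply: intg_abs_le_cst; [exact: ltW | by ct |] => x _.
rewrite Gdiff normrM; apply: ler_pM => //.
  rewrite normrX; apply: (@le_trans _ _ (d ^+ 2)); first by rewrite lerXn2r ?nnegrE // ltW.
  by rewrite expr2 ler_piMl // ltW.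
have := hr x; have := ler_norm c; have := ler_norm (- c); rewrite normrN.
by rewrite !ler_norml => ? ? /andP[? ?]; apply/andP; split; lra.
Qed.

Lemma rigidity x : v 0 x = v 0 x0.
Proof.
have L0 := @period_gt0 R; have B0 : 0 <= B by apply: le_trans (vB 0 0).
(* At [c = -1] the difference [G - G c] is cubic and has no sign. There [F - k = (v + 1)^2 / 2] is
   nonnegative, and [opB (F - k)] at [x0] equals [phi + dphi - k = 0]; positivity of the kernel
   gives [v = -1]. *)
rewrite -/c; have [c1|c1] := eqVneq (1 + c) 0.
  have [n /andP[n1 n2]] := period_reduce (x - x0).
  rewrite -(period_int x n (pv 0)); set y := x + _.
  have yin : x0 <= y < x0 + L by rewrite /y; apply/andP; split; lra.
  have gE z : F 0 z - k = (v 0 z + 1) ^+ 2 / 2.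
    by rewrite /F /k /flux (_ : c = -1); [field | lra].
  have hg : cper (fun z => F 0 z - k) by apply: cperD => //; exact: cper_cst.
  have p0 : opB (fun z => F 0 z - k) x0 = 0.
    have -> : (fun z => F 0 z - k) = (fun z => (-1) * k + F 0 z) by apply/funext => z; ring.
    rewrite opB_lin ?opB_cst //; [|by ct|exact: (hF 0).1].
    have -> : opB (F 0) x0 = phi 0 x0 + dphi 0 x0 by rewrite /phi /dphi /opK /opDK; field.
    by rewrite phi_x0 dphi_x0; ring.
  have g0 z : 0 <= F 0 z - k by rewrite gE divr_ge0 // sqr_ge0.
  have [-> //|yx0] := eqVneq y x0.
  have yin' : x0 < y < x0 + L.
    by move: yin => /andP[h1 h2]; rewrite [x0 < y]lt_def yx0 h1.
  have /eqP := opB_eq0 hg.1 hg.2 g0 p0 yin'.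
  by rewrite gE mulf_eq0 invr_eq0 pnatr_eq0 orbF sqrf_eq0 addr_eq0 => /eqP ->; lra.
have c10 : 0 < `|1 + c| by rewrite normr_gt0.
(* Within distance [|1 + c|] of [c] the second factor in [Gdiff], times the sign of [1 + c], is at
   least [|1 + c| / 2 - |1 + c| / 6 = |1 + c| / 3]. *)
have [s s0 hs] := v_near c10.
have vs y : v s y = c.
  pose sg : R := if 0 <= 1 + c then 1 else -1.
  have sgE : sg * (1 + c) = `|1 + c|.
    by rewrite /sg; case: leP => h; [rewrite mul1r ger0_norm | rewrite mulN1r ltr0_norm].
  have sgA : `|sg| = 1 by rewrite /sg; case: ifP => _; rewrite ?normrN normr1.
  pose q z := (v s z - c) ^+ 2 * (`|1 + c| / 2 + sg * (v s z - c) / 6).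
  have qE z : q z = sg * (G (v s z) - G c) by rewrite /q Gdiff -sgE; field.
  have cq : continuous q by rewrite /q; ct.
  have pos z : `|1 + c| / 3 <= `|1 + c| / 2 + sg * (v s z - c) / 6.
    have : `|sg * (v s z - c)| <= `|1 + c| by rewrite normrM sgA mul1r.
    by rewrite ler_norml => /andP[? ?]; lra.
  have q0 z : 0 <= q z.
    rewrite mulr_ge0 ?sqr_ge0 //; apply: le_trans (pos z); rewrite divr_ge0 //.
  (* The period starts at [y - 1] so that [y] is an interior point, as [intg_eq0] requires. *)
  have I0 : intg q (y - 1) (y - 1 + L) = 0.
    rewrite intg_period //; last by move=> z; rewrite /q pv.
    rewrite (intg_ext _ _ qE) intgZ ?G_int ?mulr0 //.
    by rewrite /G; ct.
  have yin : y - 1 < y < y - 1 + L.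
    by have := @period_ge1 R; rewrite mulr2n; have := @pi_ge2 R => ? ?; apply/andP; split; lra.
  have /eqP := intg_eq0 cq (fun z _ => q0 z) I0 yin.
  rewrite mulf_eq0 sqrf_eq0 subr_eq0 => /orP[/eqP //|/eqP h].
  by have := pos y; rewrite h; lra.
(* Backward uniqueness: run in reverse from time [s], the equation is Lipschitz with constant
   [1 + B] on functions bounded by [B], so the deviation, zero at time [s], is zero at time 0. *)
pose w t x := v (s - t) x - c.
pose dw t x := dphi (s - t) x.
have hw t y : is_derive t (1 : R) (w^~ y) (dw t y).
  have h1 : is_derive t (1 : R) (fun t => s - t) (-1) by dv; ring.
  by apply: dv_to (dvB (dv_comp h1 (hv (s - t) y)) (dv_cst c t)) _; rewrite /dw /dphi /F; ring.
have cB : `|c| <= B by exact: vB.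
have K0 : 0 < 1 + B by lra.
have dk z : opDK (fun=> k) z = 0 by rewrite /opDK opA_cst opB_cst; ring.
have H : forall t y, 0 <= t <= s -> `|w t y| <= 2 * 0 * expR (2 * (1 + B) * t).
  apply: (@sup_gronwall _ w dw s (1 + B) 0 (B + B) K0 (lexx _)).
  - by move=> y; apply: continuous_subspaceT; exact: (dv_ct (hw^~ y)).
  - move=> t N _ hN y; rewrite /dw.
    have -> : dphi (s - t) y = opDK (fun z => (-1) * k + F (s - t) z) y.
      by rewrite opDK_lin ?dk; [rewrite mulr0 add0r | exact: cper_cst | exact: hF].
    apply: opDK_abs_le; first by apply: cperD; [exact: cper_cst | exact: hF].
    move=> z; rewrite (_ : -1 * k + F (s - t) z = flux (v (s - t) z) - flux c); last first.
      by rewrite /k /F; ring.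
    apply: le_trans (flux_lip (vB _ _) cB) _; apply: ler_wpM2l; first exact: ltW.
    exact: hN.
  - by move=> y; rewrite /w subr0 vs subrr normr0.
  - move=> t y _; apply: le_trans (ler_normB _ _) _.
    by apply: lerD.
have := H s x; rewrite /w subrr mulr0 mul0r normr_le0 subr_eq0 => /(_ _)/eqP; apply.
by rewrite s0 lexx.
Qed.

End Rigidity.

(** * Pointwise convergence of the damped flow *)

Section Asymptotics.
Context {R : realType}.
Notation L := (pi *+ 2 : R).

Lemma intg_tail (h : R -> R) (C a e : R) : continuous h -> (forall s, 0 <= h s) ->
    (forall T, 0 <= T -> intg h 0 T <= C) -> 0 < e ->
  \forall t \near +oo, intg h t (t + a) <= e.
Proof.
move=> ch h0 hC e0; pose A : set R := [set intg h 0 T | T in [set T | 0 <= T]].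
have supA : has_sup A.
  by split; [exists (intg h 0 0), 0 => //=; exact: lexx | exists C => _ [T /= T0 <-]; exact: hC].
have [_ [T0 /= T00 <-] hT0] := sup_adherent e0 supA.
exists (Num.max T0 `|a|); split; first exact: num_real.
move=> t; rewrite gt_max => /andP[T0t at0].
have ta : 0 <= t + a by have := ler_norm (- a); rewrite normrN; lra.
have : intg h 0 (t + a) <= sup A by apply: sup_upper_bound => //; exists (t + a).
have : intg h 0 T0 <= intg h 0 t.
  by apply: intg_le_sub => //; [exact: ltW].
by rewrite -(intg_cat h 0 t (t + a)); lra.
Qed.

Variables (b db : R -> R) (jb : bool) (g : R -> R) (u0 : R -> R) (u : R -> R -> R).
Variables (Lg B E C y1 y2 m : R).
Hypothesis (hb : cper b) (cdb : continuous db).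
Hypothesis dvb : forall x, is_derive x (1 : R) b (db x).
Hypothesis (cg : continuous g) (Lg0 : 0 <= Lg).
Hypothesis lipg : forall x y, `|g x - g y| <= Lg * `|x - y|.
Hypothesis g_flux : forall z, `|z| <= B -> g z = flux z.
Hypothesis fu : flow b db jb g u0 u.
Hypothesis uB : forall t x, 0 <= t -> `|u t x| <= B.
Hypothesis uE : forall t, 0 <= t -> H1le E (u t).
Hypothesis dampC : forall t x, 0 <= t -> intg (fun s => damp b db jb (u s) x ^+ 2) 0 t <= C.
Hypothesis obsC : forall t x z, 0 <= t -> y1 <= x -> x <= z -> z <= y2 ->
  intg (fun s => obs b jb (u s) x z ^+ 2) 0 t <= C.
Hypothesis (y12 : y1 < y2) (y2L : y2 <= y1 + L) (m0 : 0 < m).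
Hypothesis bm : forall s, y1 <= s <= y2 -> m <= b s.

Let cu : continuous (fun z : R * R => u z.1 z.2). Proof. by case: fu. Qed.
Let pu t : periodic (u t) L. Proof. by case: fu. Qed.
Let hu t : cper (u t). Proof. exact: flow_cper fu. Qed.
Let hbe := cper_beta hb jb.
Let hc0 := cper_c0 hb jb.
Let hdb : cper db.
Proof. by split; [exact: cdb | exact: per_derive hb.2 dvb]. Qed.
Let hc1 : cper (c1_ db jb).
Proof. by rewrite /c1_; case: jb => //; exact: cper_cst. Qed.
Let B0 : 0 <= B. Proof. exact: le_trans (uB 0 (lexx 0)). Qed.

Let cdamp : continuous (fun z : R * R => damp b db jb (u z.1) z.2).
Proof. exact: (ct_dampK hbe hc0 hc1 cu). Qed.

Let cdampx x : continuous (fun t => damp b db jb (u t) x).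
Proof.
exact: (ct_comp2 (u := fun t x => damp b db jb (u t) x) cdamp (@ct_id _) (@ct_cst _ _ x)).
Qed.

Let u_mod (e : R) : 0 < e -> exists2 d : R, 0 < d &
  forall t x y, 0 <= t -> `|x - y| < d -> `|u t x - u t y| <= e.
Proof.
move=> e0; have E0 : 0 <= E.
  by have := le_trans (sqr_ge0 _) (H1le_sup 0 (uE (lexx 0))); lra.
have L0 := @period_gt0 R.
exists (Num.min L (e ^+ 2 / (E + 1))).
  by rewrite lt_min L0 divr_gt0 ?exprn_gt0 // ltr_wpDl.
have key t x y : 0 <= t -> 0 <= y - x -> y - x < Num.min L (e ^+ 2 / (E + 1)) -> `|u t x - u t y| <= e.
  move=> t0 yx; rewrite lt_min => /andP[yxL yxe].
  have xyL : x <= y <= x + L by apply/andP; split; lra.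
  have := H1le_holder (uE t0) xyL.
  move: yxe; rewrite ltr_pdivlMr ?ltr_wpDl // => yxe h.
  rewrite -ler_sqr ?nnegrE ?(ltW e0) // real_normK ?num_real //.
  by apply: le_trans h _; move: yxe; rewrite mulrDr mulr1; lra.
move=> t x y t0 xy; have [h|h] := leP x y.
  by apply: key => //; [lra | rewrite distrC ger0_norm ?subr_ge0 // in xy].
by rewrite distrC; apply: key => //; [lra | rewrite gtr0_norm ?subr_gt0 // in xy].
Qed.

Let hut (t x : R) : 0 <= t ->
  is_derive t (1 : R) (u^~ x) (- opDK (fun x => flux (u t x)) x - damp b db jb (u t) x).
Proof.
move=> t0; have [_ _ _ h] := fu; have := h t x; rewrite /rhs.
by rewrite (_ : (fun x => g (u t x)) = (fun x => flux (u t x))) //; apply/funext => y; rewrite g_flux ?uB.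
Qed.

Let u_lip : exists2 M, 0 <= M & forall t s x : R, 0 <= t -> 0 <= s -> `|u t x - u s x| <= M * `|t - s|.
Proof.
have [K K0 hK] := rhs_lipschitz cg hbe hc0 hc1 Lg0 lipg.
have hz : cper (fun _ : R => 0 : R) by exact: cper_cst.
have [D hD] := per_bounded (cper_dampK hbe hc0 hc1 hz).1 (cper_dampK hbe hc0 hc1 hz).2.
have D0 : 0 <= D by apply: le_trans (hD 0).
pose M := (1 + B) * B + (K * B + D).
have M0 : 0 <= M by rewrite !addr_ge0 // mulr_ge0 ?addr_ge0 // ltW.
have dM (t x : R) : 0 <= t -> `|- opDK (fun x => flux (u t x)) x - damp b db jb (u t) x| <= M.
  move=> t0; apply: le_trans (ler_normB _ _) _; rewrite normrN; apply: lerD.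
    apply: opDK_abs_le; first exact: cper_comp ct_flux (hu t).
    move=> y; have := @flux_lip _ B (u t y) 0 (uB _ t0).
    rewrite normr0 {2}/flux expr0n /= mul0r addr0 !subr0 => /(_ B0) /le_trans; apply.
    by rewrite ler_wpM2l ?uB // addr_ge0.
  have uB' y : `|u t y - 0| <= B by rewrite subr0 uB.
  have := (hK _ _ _ (hu t) hz uB').1 x; have := hD x; rewrite -/(damp b db jb (u t) x).
  set a := dampK _ _ _ _ x => h1 h2.
  have := ler_normD (damp b db jb (u t) x - a) a; rewrite subrK.
  by move=> /le_trans; apply; apply: lerD.
exists M => // .
have key (t s x : R) : 0 <= s -> s <= t -> `|u t x - u s x| <= M * (t - s).
  move=> s0 st; have [r /andP[sr _] ->] := dv_mvt st (fun r (h : s <= r <= t) => @hut r x (le_trans s0 (andP h).1)).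
  by rewrite normrM [`|t - s|]ger0_norm ?subr_ge0 // ler_wpM2r ?subr_ge0 // dM // (le_trans s0).
move=> t s x t0 s0; have [ts|/ltW st] := leP t s.
  by rewrite distrC [`|t - s|]distrC [`|s - t|]ger0_norm ?subr_ge0 //; exact: key.
by rewrite [`|t - s|]ger0_norm ?subr_ge0 //; exact: key.
Qed.

Section Limit.
Variables (U : set_system R) (UF : UltraFilter U).
Hypothesis Uoo : (+oo)%R `<=` U.

Let ad s : adm U s.
Proof.
apply: Uoo; exists (- s); split; first exact: num_real.
by move=> t /= h; lra.
Qed.

Let v := ulim u U.

Let cv : continuous (fun z : R * R => v z.1 z.2).
Proof. by have [M _ hM] := u_lip; exact: (ulim_jc uB u_mod hM UF ad). Qed.

Let pv s : periodic (v s) L. Proof. exact: ulim_per. Qed.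
Let vB s x : `|v s x| <= B. Proof. exact: (ulim_bounded uB UF x (ad s)). Qed.
Let hvc s : cper (v s). Proof. by split; [ct | exact: pv]. Qed.

Let shiftU (h : R -> R) (c a : R) : continuous h -> (forall s, 0 <= h s) ->
    (forall T, 0 <= T -> intg h 0 T <= c) -> forall s (e : R), 0 < e ->
  \forall t \near U, intg (fun r => h (t + r)) s (s + a) <= e.
Proof.
move=> ch h0 hc s e e0; apply: Uoo; have := intg_tail a ch h0 hc e0.
move=> [T [Tr hT]]; exists (T - s); split; first exact: num_real.
by move=> t ht; rewrite intg_shift // addrA; apply: hT; lra.
Qed.

Let v_unif s1 s2 (e : R) : 0 < e ->
  \forall t \near U, forall s x, s1 <= s <= s2 -> `|u (t + s) x - v s x| <= e.
Proof. by move=> e0; have [M _ hM] := u_lip; exact: (ulim_unif pu uB u_mod hM UF s2 (ad s1) e0). Qed.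

(** The equation is passed to the limit in integrated form: the flux term converges uniformly on the
    window, and the integral of the damping tends to 0 by Cauchy-Schwarz, since its square has an
    integrable tail. No derivative of [u] in time has to converge. *)
Let v_int (s1 s2 x : R) : s1 <= s2 ->
  v s2 x - v s1 x = - intg (fun r => opDK (fun x => flux (v r x)) x) s1 s2.
Proof.
move=> s12; pose Fv r := opDK (fun x => flux (v r x)) x.
have cF (w : R -> R -> R) : continuous (fun z : R * R => w z.1 z.2) ->
    continuous (fun r => opDK (fun x => flux (w r x)) x).
  move=> cw; have cDw : continuous (fun z : R * R => opDK (fun x => flux (w z.1 x)) z.2).
    by apply: (@ct_opDK _ _ (fun t x => flux (w t x))); rewrite /flux; ct.
  exact: (ct_comp2 (u := fun t x => opDK (fun x => flux (w t x)) x) cDw (@ct_id _) (@ct_cst _ _ x)).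
apply/eqP; rewrite -subr_eq0 -normr_le0 opprK; apply/ler_addgt0Pr => e e0; rewrite add0r.
pose a := s2 - s1; have a0 : 0 <= a by rewrite /a; lra.
(* The errors are [d] at each endpoint, [d] for the damping and [(1 + B) * d * a] for the flux.
   Below, [d2] is chosen so that [a * d2 <= d ^+ 2]. *)
pose d := e / (3 + (1 + B) * a).
have q0 : 0 < 3 + (1 + B) * a by rewrite ltr_pwDl // mulr_ge0 // addr_ge0.
have d0 : 0 < d by rewrite divr_gt0.
pose d2 := d ^+ 2 / (a + 1).
have d20 : 0 < d2 by rewrite divr_gt0 ?exprn_gt0 // ltr_wpDl.
have n1 := v_unif s1 s2 d0.
have cd2 : continuous (fun t => damp b db jb (u t) x ^+ 2) by exact/ctX/cdampx.
have n2 := @shiftU _ C a cd2 (fun t => sqr_ge0 _) (fun T T0 => @dampC T x T0) s1 d2 d20.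
have [t [[h1 h2] h3]] := filter_ex (filterI (filterI n1 n2) (ad s1)).
have Ea : s1 + a = s2 by rewrite /a; ring.
rewrite Ea in h2.
have cdt : continuous (fun r => damp b db jb (u (t + r)) x).
  have cs : continuous (fun r => t + r) by ct.
  exact: (ct_comp (h := fun r => damp b db jb (u r) x) (@cdampx x) cs).
have cut : continuous (fun z : R * R => u (t + z.1) z.2) by ct.
have cFt := cF (fun r => u (t + r)) cut.
have I1 : `|intg (fun r => damp b db jb (u (t + r)) x) s1 s2| <= d.
  rewrite -ler_sqr ?nnegrE ?(ltW d0) // real_normK ?num_real //.
  apply: le_trans (intg_sqr_le s12 cdt) _; rewrite -/a.
  apply: (@le_trans _ _ (a * d2)); first by rewrite ler_wpM2l.
  by rewrite /d2 mulrC mulrAC ler_pdivrMr ?ltr_wpDl // ler_wpM2l ?sqr_ge0 // lerDl.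
have I2 : `|intg (fun r => Fv r - opDK (fun x => flux (u (t + r) x)) x) s1 s2| <= (1 + B) * d * a.
  apply: intg_abs_le_cst => //; first by apply: ctD; [exact: cF cv | exact: ctN].
  move=> r /andP[r1 r2]; have tr : 0 <= t + r by move: h3; lra.
  have hF1 := cper_comp ct_flux (hvc r); have hF2 := cper_comp ct_flux (hu (t + r)).
  have -> : Fv r - opDK (fun x => flux (u (t + r) x)) x =
      opDK (fun x => (-1) * flux (u (t + r) x) + flux (v r x)) x.
    by rewrite opDK_lin // /Fv; ring.
  apply: opDK_abs_le; first by apply: cperD => //; apply: cperM => //; exact: cper_cst.
  move=> y; rewrite mulN1r addrC; apply: le_trans (flux_lip (vB r y) (uB _ tr)) _.
  by rewrite distrC ler_wpM2l ?addr_ge0 // h1 // r1.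
have I3 : u (t + s2) x - u (t + s1) x =
    - intg (fun r => opDK (fun x => flux (u (t + r) x)) x) s1 s2 -
    intg (fun r => damp b db jb (u (t + r)) x) s1 s2.
  pose Z r := u (t + r) x - (- intg (fun r => opDK (fun x => flux (u (t + r) x)) x) s1 r -
    intg (fun r => damp b db jb (u (t + r)) x) s1 r).
  have hZ r : s1 <= r <= s2 -> is_derive r (1 : R) Z 0.
    move=> /andP[r1 r2]; have tr : 0 <= t + r by move: h3; lra.
    apply: dv_to (dvB (dv_shift (hut x tr)) (dvB (dvN (dv_intg s1 r cFt)) (dv_intg s1 r cdt))) _.
    by ring.
  have [c _] := dv_mvt s12 hZ; rewrite /Z.
  by rewrite mul0r !intgxx; lra.
have -> : v s2 x - v s1 x + intg Fv s1 s2 =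
    - (u (t + s2) x - v s2 x) + (u (t + s1) x - v s1 x) +
    (intg (fun r => Fv r - opDK (fun x => flux (u (t + r) x)) x) s1 s2 -
    intg (fun r => damp b db jb (u (t + r)) x) s1 s2).
  by rewrite intgB //; [lra | exact: cF cv].
apply: (@le_trans _ _ (d + d + ((1 + B) * d * a + d))); last first.
  rewrite (_ : d + d + _ = d * (3 + (1 + B) * a)); last by ring.
  by rewrite /d divfK // gt_eqF.
apply: le_trans (ler_normD _ _) _; apply: lerD.
  apply: le_trans (ler_normD _ _) _; rewrite normrN; apply: lerD; apply: h1; rewrite ?lexx ?s12 //.
by apply: le_trans (ler_normB _ _) _; exact: lerD.
Qed.

Let hv (s x : R) : is_derive s (1 : R) (v^~ x) (- opDK (fun x => flux (v s x)) x).
Proof.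
have cD : continuous (fun z : R * R => opDK (fun x => flux (v z.1 x)) z.2).
  by apply: (@ct_opDK _ _ (fun t x => flux (v t x))); have c := cv; rewrite /flux; ct.
have cF : continuous (fun r => opDK (fun x => flux (v r x)) x).
  exact: (ct_comp2 (u := fun t x => opDK (fun x => flux (v t x)) x) cD (@ct_id _) (@ct_cst _ _ x)).
apply: (@dv_ext _ (fun s => v 0 x - intg (fun r => opDK (fun x => flux (v r x)) x) 0 s)).
  move=> r; have [r0|/ltW r0] := leP 0 r; have := v_int x r0; first by lra.
  by rewrite [intg _ 0 r]intg_swap; lra.
by apply: dv_to (dvB (dv_cst (v 0 x) s) (dv_intg 0 s cF)) _; rewrite sub0r.
Qed.

(** The squared observation of [u] has an integrable tail, so its integral over a window pushed to
    infinity tends to 0. The window is centred at [s] because [intg_eq0] speaks of interior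
    points. *)
Let obs_v (s x z : R) : y1 <= x -> x <= z -> z <= y2 -> obs b jb (v s) x z = 0.
Proof.
move=> y1x xz zy2; have [K K0 hK] := obs_lipschitz hb jb.
have xzL : x <= z <= x + L by have h := y2L; rewrite xz /=; lra.
have co (w : R -> R -> R) : continuous (fun z : R * R => w z.1 z.2) ->
    continuous (fun s => obs b jb (w s) x z).
  move=> cw; rewrite /obs; case: (jb); last by ct.
  by apply: (@ct_intg _ _ (fun t s => b s * w t s)); have cb := hb.1; ct.
have cov := co v cv; have cou := co u cu.
have I0 : intg (fun r => obs b jb (v r) x z ^+ 2) (s - 1) (s - 1 + 2) = 0.
  apply/eqP; rewrite eq_le; apply/andP; split; last first.
    by apply: intg_ge0; [lra | by ct | move=> r _; exact: sqr_ge0].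
  apply/ler_addgt0Pr => e e0; rewrite add0r.
  pose d := Num.min 1 (e / (2 + 4 * K ^+ 2)).
  have q0 : 0 < 2 + 4 * K ^+ 2 by rewrite ltr_pwDl // mulr_ge0 // sqr_ge0.
  have d0 : 0 < d by rewrite lt_min ltr01 divr_gt0.
  have d1 : d <= 1 by rewrite ge_min lexx.
  have de : d * (2 + 4 * K ^+ 2) <= e by rewrite -ler_pdivlMr // ge_min lexx orbT.
  have co2 : continuous (fun t => obs b jb (u t) x z ^+ 2) by exact: ctX.
  have n1 := v_unif (s - 1) (s - 1 + 2) d0.
  have n2 := @shiftU _ C 2 co2 (fun t => sqr_ge0 _) (fun T T0 => obsC T0 y1x xz zy2) (s - 1) d d0.
  have [t [h1 h2]] := filter_ex (filterI n1 n2).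
  have cout : continuous (fun r => obs b jb (u (t + r)) x z).
    have cs : continuous (fun r => t + r) by ct.
    exact: (ct_comp (h := fun r => obs b jb (u r) x z) cou cs).
  apply: le_trans de.
  apply: le_trans (_ : intg (fun r => 2 * obs b jb (u (t + r)) x z ^+ 2 + 2 * (K * d) ^+ 2)
      (s - 1) (s - 1 + 2) <= _).
    apply: intg_le; [lra | by ct | by ct |] => r rin.
    have : `|obs b jb (v r) x z - obs b jb (u (t + r)) x z| <= K * d.
      by apply: hK xzL _ => [||y]; [exact: (hvc r).1 | exact: (hu (t + r)).1 | rewrite distrC h1].
    set p := obs _ _ (v r) _ _; set q := obs _ _ _ _ _ => hpq.
    have : (p - q) ^+ 2 <= (K * d) ^+ 2.
      by rewrite -real_normK ?num_real // ler_sqr ?nnegrE // mulr_ge0 // ltW.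
    by have := sqr_ge0 (p - 2 * q); rewrite !sqrrB; lra.
  rewrite intgD; [|by ct|by ct]; rewrite intg_cst intgZ; last by ct.
  rewrite [leRHS]mulrDr; apply: lerD; first by rewrite mulrC ler_pM2r.
  have -> : 2 * (K * d) ^+ 2 * (s - 1 + 2 - (s - 1)) = d ^+ 2 * (4 * K ^+ 2) by ring.
  by apply: ler_wpM2r; [rewrite mulr_ge0 // sqr_ge0 | rewrite expr2 ler_piMl // ltW].
have sin : s - 1 < s < s - 1 + 2 by apply/andP; split; lra.
have cov2 : continuous (fun r => obs b jb (v r) x z ^+ 2) by exact: ctX.
by have := intg_eq0 cov2 (fun r _ => sqr_ge0 _) I0 sin => /eqP; rewrite sqrf_eq0 => /eqP.
Qed.

Let y0 := (y1 + y2) / 2.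

(** For D_1 increments vanish. For D_0 all integrals of [b * v] from [y1] vanish; differentiating in
    the endpoint gives [b * v = 0], and [b] is at least [m > 0] on the arc. *)
Let v_flat (s x : R) : y1 < x < y2 -> v s x = v s y0 /\ (jb -> v s x = 0).
Proof.
have y012 : y1 < y0 < y2 by have h := y12; rewrite /y0; apply/andP; split; lra.
have [jt|jf] := boolP jb; last first.
  move=> /andP[yx xy]; split=> //.
  have o p q : y1 < p -> p <= q -> q < y2 -> v s p = v s q.
    move=> p1 pq q2; have := @obs_v s p q (ltW p1) pq (ltW q2).
    by rewrite /obs (negbTE jf) => /eqP; rewrite subr_eq0 => /eqP.
  case/andP: y012 => ? ?; have [h|/ltW h] := leP x y0; first exact: o.
  by apply/esym; exact: o.
have z x' : y1 < x' < y2 -> v s x' = 0.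
  move=> xin; have cbv : continuous (fun r => b r * v s r).
    by have cb := hb.1; have cvs := (hvc s).1; ct.
  have hI := dv_intg y1 x' cbv.
  have /eqP : b x' * v s x' = 0.
    apply: (dv_unique hI); apply: (near_eq_is_derive _ (dv_cst 0 x')).
    move: xin => /andP[xl xr].
    have n1 : \forall y \near x', y1 < y by exact: lt_nbhsr.
    have n2 : \forall y \near x', y < y2 by exact: lt_nbhsl.
    apply: filterS2 n1 n2 => y yl yr.
    by have := @obs_v s y1 y (lexx _) (ltW yl) (ltW yr); rewrite /obs jt.
  rewrite mulf_eq0 gt_eqF; first by move/eqP.
  by apply: lt_le_trans (bm _) => //; case/andP: xin => ? ?; rewrite !ltW.
by move=> xin; rewrite !z.
Qed.

Let v_mod (e : R) : 0 < e -> exists2 d : R, 0 < d &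
  forall s x y, 0 <= s -> `|x - y| < d -> `|v s x - v s y| <= e.
Proof.
move=> e0; have [d d0 hd] := ulim_modulus uB u_mod UF e0.
by exists d => // s x y _; apply: hd; exact: ad.
Qed.

Let v_cst x : v 0 x = v 0 y0.
Proof.
have [M _ hM] := u_lip.
have v_lip s r y : 0 <= s -> 0 <= r -> `|v s y - v r y| <= M * `|s - r|.
  by move=> _ _; exact: (ulim_lip uB hM UF y (ad s) (ad r)).
exact: (rigidity cv pv vB v_mod v_lip hv y12 (fun s x h => (@v_flat s x h).1)).
Qed.

(** For D_0 the constant is 0 by [v_flat]. For D_1 it is identified by the conserved mass, which
    passes to the uniform limit. *)
Lemma ultra_limit x : v 0 x = if jb then 0 else L^-1 * intg u0 0 L.
Proof.
have L0 := @period_gt0 R.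
have y012 : y1 < y0 < y2 by have h := y12; rewrite /y0; apply/andP; split; lra.
rewrite v_cst; have [jt|jf] := boolP jb; first exact: (@v_flat 0 y0 y012).2.
have fu' : is_flow g b (fun x => - b x) db u0 u.
  by move: fu; rewrite /flow /beta_ /c0_ /c1_ (negbTE jf).
have mass := flow_mass cg hb hdb fu'.
suff : intg (v 0) 0 L = intg u0 0 L.
  rewrite (intg_ext _ _ v_cst) intg_cst subr0 => <-.
  by rewrite mulrC mulfK // gt_eqF.
apply/eqP; rewrite -subr_eq0 -normr_le0; apply/ler_addgt0Pr => e e0; rewrite add0r.
have d0 : 0 < e / L by rewrite divr_gt0.
have [t ht] := filter_ex (v_unif 0 0 d0).
rewrite -(mass t) -intgB //; [|exact: (hvc 0).1|exact: (hu t).1].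
have cvu : continuous (fun x => v 0 x - u t x).
  by have c1 := (hvc 0).1; have c2 := (hu t).1; ct.
have : `|intg (fun x => v 0 x - u t x) 0 L| <= e / L * (L - 0).
  apply: intg_abs_le_cst => //; first exact: ltW.
  by move=> y _; rewrite distrC -[t]addr0; apply: ht; rewrite lexx.
by rewrite subr0 divfK // gt_eqF.
Qed.

End Limit.

(** Otherwise the times at which [u t x] is at distance at least [e] from the limit meet every
    neighbourhood of infinity; an ultrafilter refining their trace contradicts [ultra_limit]. *)
Lemma flow_cvg x : u t x @[t --> +oo] --> (if jb then 0 else L^-1 * intg u0 0 L).
Proof.
set mm : R := if jb then _ else _.
apply/cvgrPdist_lt => e e0; apply: contrapT => H.
pose S := [set t : R | e <= `|mm - u t x|].
have PF : ProperFilter (within S (+oo)%R).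
  apply: Build_ProperFilter_ex => A HA.
  apply: contrapT => nA; apply: H.
  have {}HA : \forall t \near (+oo)%R, S t -> A t by [].
  apply: filterS HA => t At.
  rewrite ltNge; apply/negP => St; apply: nA; exists t; exact: At.
have [U [UF FU]] := ultraFilterLemma PF.
have Uoo : (+oo)%R `<=` U by move=> A HA; apply: FU; exact: cvg_within HA.
have ad0 : adm U 0.
  by apply: Uoo; exists 0; split; [exact: num_real | move=> t /= t0; lra].
have := @ulim_cvg _ u B uB U UF 0 x ad0; rewrite (ultra_limit UF Uoo) -/mm => /cvgrPdist_lt /(_ e e0) h1.
have h2 : \forall t \near U, e <= `|mm - u t x| by apply: FU; exact: withinT.
have [t [h3 h4]] := filter_ex (filterI h1 h2).
by move: h3; rewrite addr0 ltNge h4.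
Qed.

End Asymptotics.

(** * Fourier series *)

Section Fourier.
Context {R : realType}.
Notation L := (pi *+ 2 : R).

Definition cx (k : int) (x : R) : R := cos (k%:~R * x).
Definition sx (k : int) (x : R) : R := sin (k%:~R * x).

Lemma ct_cx k : continuous (cx k). Proof. by rewrite /cx; ct. Qed.
Lemma ct_sx k : continuous (sx k). Proof. by rewrite /sx; ct. Qed.

Lemma dv_cx k x : is_derive x (1 : R) (cx k) (- k%:~R * sx k x).
Proof. by rewrite /cx /sx; dv; ring. Qed.

Lemma dv_sx k x : is_derive x (1 : R) (sx k) (k%:~R * cx k x).
Proof. by rewrite /cx /sx; dv; ring. Qed.

Lemma cxN k x : cx (- k) x = cx k x.
Proof. by rewrite /cx mulrNz mulNr cosN. Qed.

Lemma sxN k x : sx (- k) x = - sx k x.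
Proof. by rewrite /sx mulrNz mulNr sinN. Qed.

Lemma per_cx k : periodic (cx k) L.
Proof. by move=> x; rewrite /cx mulrDr (period_int _ _ (@cosD2pi R)). Qed.

Lemma per_sx k : periodic (sx k) L.
Proof. by move=> x; rewrite /sx mulrDr (period_int _ _ (@sinD2pi R)). Qed.

Lemma cper_cx k : cper (cx k). Proof. by split; [exact: ct_cx | exact: per_cx]. Qed.
Lemma cper_sx k : cper (sx k). Proof. by split; [exact: ct_sx | exact: per_sx]. Qed.

Definition ca (f : R -> R) (k : int) : R := intg (fun x => f x * cx k x) 0 L / L.
Definition sa (f : R -> R) (k : int) : R := intg (fun x => f x * sx k x) 0 L / L.

Lemma period_neq0 : L != 0. Proof. by rewrite gt_eqF // period_gt0. Qed.

Lemma intg_cx k : intg (cx k) 0 L / L = (k == 0)%:R.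
Proof.
have [->|k0] := eqVneq k 0.
  rewrite (intg_ext (g := fun=> 1)) => [|x]; last by rewrite /cx mul0r cos0.
  by rewrite intg_cst mul1r subr0 divff // period_neq0.
have kR : k%:~R != 0 :> R by rewrite intr_eq0.
have h x : is_derive x (1 : R) (fun x => k%:~R^-1 * sx k x) (cx k x).
  by apply: dv_to (dvZ _ (dv_sx k x)) _; rewrite mulKf.
by rewrite (intg_derive_period h) ?mul0r // => x; rewrite per_sx.
Qed.

Lemma intg_sx k : intg (sx k) 0 L = 0.
Proof.
have [->|k0] := eqVneq k 0.
  rewrite (intg_ext (g := fun=> 0)) => [|x]; last by rewrite /sx mul0r sin0.
  by rewrite intg_cst mul0r.
have kR : k%:~R != 0 :> R by rewrite intr_eq0.
have h x : is_derive x (1 : R) (fun x => - k%:~R^-1 * cx k x) (sx k x).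
  by apply: dv_to (dvZ _ (dv_cx k x)) _; field.
by apply: (intg_derive_period h) => x; rewrite per_cx.
Qed.

Lemma cxcx k l x : cx k x * cx l x = 2^-1 * (cx (k - l) x + cx (k + l) x).
Proof. by rewrite /cx intrB intrD mulrBl mulrDl cosB cosD; field. Qed.

Lemma sxsx k l x : sx k x * sx l x = 2^-1 * (cx (k - l) x - cx (k + l) x).
Proof. by rewrite /cx /sx intrB intrD mulrBl mulrDl cosB cosD; field. Qed.

Lemma sxcx k l x : sx k x * cx l x = 2^-1 * (sx (k - l) x + sx (k + l) x).
Proof. by rewrite /cx /sx intrB intrD mulrBl mulrDl sinB sinD; field. Qed.

Lemma ca_cx l k : ca (cx l) k = 2^-1 * ((k == l)%:R + (k == - l)%:R).
Proof.
rewrite /ca (intg_ext _ _ (cxcx l k)); have c1 := @ct_cx (l - k); have c2 := @ct_cx (l + k).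
rewrite intgZ; last by ct.
rewrite intgD // -mulrA mulrDl !intg_cx subr_eq0 [l == k]eq_sym.
by rewrite [l + k]addrC addr_eq0.
Qed.

Lemma sa_sx l k : sa (sx l) k = 2^-1 * ((k == l)%:R - (k == - l)%:R).
Proof.
rewrite /sa (intg_ext _ _ (sxsx l k)); have c1 := @ct_cx (l - k); have c2 := @ct_cx (l + k).
rewrite intgZ; last by ct.
rewrite intgB // -mulrA mulrBl !intg_cx subr_eq0 [l == k]eq_sym.
by rewrite [l + k]addrC addr_eq0.
Qed.

Lemma ca_sx l k : ca (sx l) k = 0.
Proof.
rewrite /ca (intg_ext _ _ (sxcx l k)); have c1 := @ct_sx (l - k); have c2 := @ct_sx (l + k).
by rewrite intgZ; [rewrite intgD // !intg_sx addr0 mulr0 mul0r | ct].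
Qed.

Lemma sa_cx l k : sa (cx l) k = 0.
Proof.
rewrite /sa (intg_ext (g := fun x => sx k x * cx l x)) => [|x]; last exact: mulrC.
exact: ca_sx.
Qed.

Definition zr (N : nat) : seq int := [seq i%:Z - N%:Z | i <- iota 0 (N + N).+1].

Lemma mem_zr N k : (k \in zr N) = (`|k| <= N)%N.
Proof.
apply/mapP/idP => [ [j] | kN].
  by rewrite mem_iota add0n ltnS /= => jN ->; lia.
exists (absz (k + N%:Z)); first by rewrite mem_iota; lia.
by lia.
Qed.

Lemma zr_uniq N : uniq (zr N).
Proof. by rewrite map_inj_uniq ?iota_uniq // => i j /= /addIr [ij]. Qed.

Lemma sum_delta (F : int -> R) (s : seq int) k : uniq s ->
  \sum_(l <- s) F l * (k == l)%:R = if k \in s then F k else 0.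
Proof.
elim: s => [|a s IHs] /=; first by rewrite big_nil.
move=> /andP[as_ us].
rewrite big_cons IHs // in_cons; have [->|ka] := eqVneq k a.
  by rewrite (negbTE as_) mulr1 addr0.
by rewrite mulr0 add0r.
Qed.

Lemma intg_sum (s : seq int) (F : int -> R -> R) a c : (forall k, continuous (F k)) ->
  continuous (fun x => \sum_(k <- s) F k x) /\
  intg (fun x => \sum_(k <- s) F k x) a c = \sum_(k <- s) intg (F k) a c.
Proof.
move=> cF; elim: s => [|k s [IH1 IH2]].
  have E : (fun x => \sum_(k <- [::]) F k x) = fun=> 0 by apply/funext => x; rewrite big_nil.
  by rewrite E big_nil; split; [ct | rewrite intg_cst mul0r].
have E : (fun x => \sum_(k <- k :: s) F k x) = (fun x => F k x + \sum_(k <- s) F k x).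
  by apply/funext => x; rewrite big_cons.
have ck := cF k; rewrite E big_cons; split; first by ct.
by rewrite intgD // IH2.
Qed.

(** Indices run over both signs, so under [sym] the modes [k] and [- k] contribute equally. This
    matches the normalisation of [fcoef] and keeps factors 2 out of Parseval's identity. *)
Definition tp (N : nat) (al be : int -> R) (x : R) : R :=
  \sum_(k <- zr N) (al k * cx k x + be k * sx k x).

Definition sym (al be : int -> R) := forall k, al (- k) = al k /\ be (- k) = - be k.

Lemma dv_tp N al be x :
  is_derive x (1 : R) (tp N al be) (tp N (fun k => k%:~R * be k) (fun k => - k%:~R * al k) x).
Proof.
rewrite /tp; elim: (zr N) => [|k s IHs].
  apply: (@dv_ext _ (fun=> 0)); first by move=> y; rewrite big_nil.
  by apply: dv_to (dv_cst 0 x) _; rewrite big_nil.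
apply: (@dv_ext _ (fun y => al k * cx k y + be k * sx k y +
   \sum_(k <- s) (al k * cx k y + be k * sx k y))); first by move=> y; rewrite big_cons.
apply: dv_to (dvD (dvD (dvZ (al k) (dv_cx k x)) (dvZ (be k) (dv_sx k x))) IHs) _.
by rewrite big_cons; ring.
Qed.

Lemma cper_tp N al be : cper (tp N al be).
Proof.
split; first exact: (dv_ct (dv_tp N al be)).
by move=> x; apply: eq_bigr => k _; rewrite per_cx per_sx.
Qed.

Lemma intg_mul_tp N al be (y : R -> R) : continuous y ->
  intg (fun x => y x * tp N al be x) 0 L / L = \sum_(k <- zr N) (al k * ca y k + be k * sa y k).
Proof.
move=> cy; have cF k : continuous (fun x => y x * (al k * cx k x + be k * sx k x)).
  by have c1 := @ct_cx k; have c2 := @ct_sx k; ct.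
rewrite (intg_ext (g := fun x => \sum_(k <- zr N) y x * (al k * cx k x + be k * sx k x))).
  rewrite (intg_sum _ _ _ cF).2 mulr_suml; apply: eq_bigr => k _.
  have c1 : continuous (fun x => y x * cx k x) by have := @ct_cx k; move=> ?; ct.
  have c2 : continuous (fun x => y x * sx k x) by have := @ct_sx k; move=> ?; ct.
  rewrite (intg_ext (g := fun x => al k * (y x * cx k x) + be k * (y x * sx k x))).
    by rewrite intgD ?intgZ //; try ct; rewrite /ca /sa mulrDl !mulrA.
  by move=> x; ring.
by move=> x; rewrite mulr_sumr.
Qed.

Lemma ca_tp N al be k : sym al be -> ca (tp N al be) k = if k \in zr N then al k else 0.
Proof.
move=> hs; rewrite /ca.
rewrite (intg_ext (g := fun x => cx k x * tp N al be x)) => [|x]; last exact: mulrC.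
rewrite intg_mul_tp; last exact: ct_cx.
transitivity (2^-1 * \sum_(l <- zr N) al l * (k == l)%:R + 2^-1 * \sum_(l <- zr N) al l * (- k == l)%:R).
  rewrite !mulr_sumr -big_split; apply: eq_bigr => l _ /=.
  rewrite ca_cx sa_cx [l == - k]eq_sym [l == k]eq_sym; ring.
rewrite !sum_delta ?zr_uniq // !mem_zr abszN; case: ifP => _; last by ring.
by rewrite (hs k).1; field.
Qed.

Lemma sa_tp N al be k : sym al be -> sa (tp N al be) k = if k \in zr N then be k else 0.
Proof.
move=> hs; rewrite /sa.
rewrite (intg_ext (g := fun x => sx k x * tp N al be x)) => [|x]; last exact: mulrC.
rewrite intg_mul_tp; last exact: ct_sx.
transitivity (2^-1 * \sum_(l <- zr N) be l * (k == l)%:R - 2^-1 * \sum_(l <- zr N) be l * (- k == l)%:R).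
  rewrite !mulr_sumr -sumrB; apply: eq_bigr => l _ /=.
  rewrite ca_sx sa_sx [l == - k]eq_sym [l == k]eq_sym; ring.
rewrite !sum_delta ?zr_uniq // !mem_zr abszN; case: ifP => _; last by ring.
by rewrite (hs k).2; field.
Qed.

Lemma sym_coef (y : R -> R) : continuous y -> sym (ca y) (sa y).
Proof.
move=> cy k; split; rewrite /ca /sa.
  by congr (_ / _); apply: intg_ext => x; rewrite cxN.
rewrite -mulNr -intgN; last by have c := @ct_sx k; ct.
by congr (_ / _); apply: intg_ext => x; rewrite sxN mulrN.
Qed.

Lemma parseval_tp N al be : sym al be ->
  intg (fun x => tp N al be x ^+ 2) 0 L / L = \sum_(k <- zr N) (al k ^+ 2 + be k ^+ 2).
Proof.
move=> hs; rewrite (intg_ext (g := fun x => tp N al be x * tp N al be x)) => [|x]; last exact: expr2.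
rewrite intg_mul_tp; last exact: (cper_tp N al be).1.
rewrite big_seq [RHS]big_seq; apply: eq_bigr => k kN.
by rewrite ca_tp // sa_tp // kN !expr2.
Qed.

Lemma bessel N (y : R -> R) : continuous y ->
  \sum_(k <- zr N) (ca y k ^+ 2 + sa y k ^+ 2) <= intg (fun x => y x ^+ 2) 0 L / L.
Proof.
move=> cy; pose T := tp N (ca y) (sa y); have cT : continuous T by exact: (cper_tp _ _ _).1.
have L0 := @period_gt0 R.
have h0 : 0 <= intg (fun x => (y x - T x) ^+ 2) 0 L / L.
  apply: divr_ge0; last exact: ltW.
  by apply: intg_ge0; [exact: ltW | ct | move=> x _; exact: sqr_ge0].
move: h0; rewrite (intg_ext (g := fun x => y x ^+ 2 + (- 2 * (y x * T x) + T x ^+ 2))); last first.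
  by move=> x; ring.
rewrite !intgD ?intgZ; try ct.
have -> (a c d : R) : (a + (- 2 * c + d)) / L = a / L + (- 2 * (c / L) + d / L).
  by rewrite !mulrDl !mulrA.
rewrite intg_mul_tp // parseval_tp; last exact: sym_coef.
under [X in - 2 * X]eq_bigr do rewrite -!expr2.
lra.
Qed.

Lemma coef_derive (y dy : R -> R) k : (forall x, is_derive x (1 : R) y (dy x)) ->
  continuous dy -> periodic y L ->
  ca dy k = k%:~R * sa y k /\ sa dy k = - k%:~R * ca y k.
Proof.
move=> hy cdy py; have cy := dv_ct hy; have c1 := @ct_cx k; have c2 := @ct_sx k.
have E : y L = y 0 by rewrite -[in LHS](add0r L) py.
have Ec : cx k L = cx k 0 by rewrite -[in LHS](add0r L) per_cx.
have Es : sx k L = sx k 0 by rewrite -[in LHS](add0r L) per_sx.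
split; rewrite /ca /sa mulrA; congr (_ / _).
  rewrite (intg_by_parts _ _ hy (dv_cx k) cdy) ?E ?Ec; last by ct.
  rewrite subrr sub0r -intgN; last by ct.
  by rewrite -intgZ; [apply: intg_ext => x; ring | ct].
rewrite (intg_by_parts _ _ hy (dv_sx k) cdy) ?E ?Es; last by ct.
rewrite subrr sub0r -intgN; last by ct.
by rewrite -intgZ; [apply: intg_ext => x; ring | ct].
Qed.

(* The kernels [(1 + cos)^n] concentrate at 0: their integrals satisfy
   [(n + 1) I_(n+1) = (2 n + 1) I_n]. *)
Lemma wallis n : n.+1%:R * intg (fun x : R => (1 + cos x) ^+ n.+1) 0 L =
  (2 * n%:R + 1) * intg (fun x => (1 + cos x) ^+ n) 0 L.
Proof.
have h x : is_derive x (1 : R) (fun x => sin x * (1 + cos x) ^+ n)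
    (n.+1%:R * (1 + cos x) ^+ n.+1 - (2 * n%:R + 1) * (1 + cos x) ^+ n).
  have h1 : is_derive x (1 : R) (fun x => 1 + cos x) (- sin x) by dv; ring.
  have h2 : is_derive x (1 : R) (fun x => sin x) (cos x) by dv; ring.
  apply: dv_to (dvM h2 (dvX n h1)) _.
  case: n => [|n] /=; first by rewrite expr0 expr1; ring.
  rewrite [(1 + cos x) ^+ n.+2]exprS [(1 + cos x) ^+ n.+1]exprS.
  have := cos2Dsin2 x => E; rewrite -[n.+2]addn1 natrD.
  set e := (1 + cos x) ^+ n; set N := n.+1%:R.
  transitivity (cos x * ((1 + cos x) * e) - N * e * (sin x ^+ 2)); first by ring.
  have -> : sin x ^+ 2 = 1 - cos x ^+ 2 by rewrite -E; ring.
  by ring.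
have p : periodic (fun x : R => sin x * (1 + cos x) ^+ n) L.
  by move=> x; rewrite (@sinD2pi R) (@cosD2pi R).
have := intg_derive_period h p.
rewrite intgB; [|by ct|by ct]; rewrite !intgZ; try ct.
lra.
Qed.

(** Multiplication by [1 + cos] mixes a cosine mode with its two neighbours only, so the vanishing
    of all cosine moments persists. *)
Lemma intg_kernel_eq0 (y : R -> R) n k : continuous y -> (forall k, ca y k = 0) ->
  intg (fun x => y x * (1 + cos x) ^+ n * cx k x) 0 L = 0.
Proof.
move=> cy y0; elim: n k => [|n IHn] k.
  rewrite (intg_ext (g := fun x => y x * cx k x)) => [|x]; last by rewrite expr0 mulr1.
  have /eqP := y0 k; rewrite /ca mulf_eq0 invr_eq0 (negbTE period_neq0) orbF => /eqP //.
have c k' : continuous (fun x => y x * (1 + cos x) ^+ n * cx k' x).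
  by have c1 := @ct_cx k'; ct.
have E x : y x * (1 + cos x) ^+ n.+1 * cx k x = y x * (1 + cos x) ^+ n * cx k x +
    2^-1 * (y x * (1 + cos x) ^+ n * cx (k - 1) x + y x * (1 + cos x) ^+ n * cx (k + 1) x).
  have := cxcx k 1 x; rewrite {2}/cx mul1r => h.
  transitivity (y x * (1 + cos x) ^+ n * cx k x + y x * (1 + cos x) ^+ n * (cx k x * cos x)).
    by rewrite exprS; ring.
  by rewrite h; ring.
have ck := c k; have ck1 := c (k - 1); have ck2 := c (k + 1).
rewrite (intg_ext _ _ E) intgD; [|by ct|by ct].
by rewrite intgZ; [rewrite intgD // !IHn; ring | ct].
Qed.

(** A Fejer-type argument: from [|y 0 - y x| <= e + D * (1 - cos x)] one gets [|y 0| * I n <= e * I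
    n + D * (2 * I n - I n.+1)], and [wallis] turns the last bracket into [I n / n.+1]. *)
Lemma ca_eq0_at0 (y : R -> R) : cper y -> (forall k, ca y k = 0) -> y 0 = 0.
Proof.
move=> [cy py] y0; apply/eqP; rewrite -normr_le0; apply/ler_addgt0Pr => e e0; rewrite add0r.
have L0 := @period_gt0 R; have [M hM] := per_bounded cy py.
have M0 : 0 <= M by apply: le_trans (hM 0).
have /cvgrPdist_le /(_ _ e0) [d /= d0 hd] := cy 0.
pose d' := Num.min (d / 2) (pi / 2).
have d'0 : 0 < d' by rewrite lt_min !divr_gt0 // pi_gt0.
have d'd : d' < d by rewrite gt_min; apply/orP; left; lra.
have d'p : d' <= pi / 2 by rewrite ge_min lexx orbT.
pose rho := 1 - cos d'.
have rho0 : 0 < rho.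
  have p0 := @pi_gt0 R.
  by rewrite subr_gt0 -(@cos0 R) ltr_cos // in_itv /=; apply/andP; split; lra.
pose D := 2 * M / rho; have D0 : 0 <= D by rewrite divr_ge0 ?mulr_ge0 // ltW.
(* Near 0 continuity gives [e]; elsewhere [1 - cos x >= rho], and [D * rho] is the trivial bound
   [2 * M]. *)
have bnd x : `|y 0 - y x| <= e + D * (1 - cos x).
  have [k] := period_reduce (x + pi); set x' := x + k%:~R * L => /andP[x1 x2].
  have E1 : y x = y x' by rewrite period_int.
  have E2 : cos x = cos x' by rewrite /x' (period_int _ _ (@cosD2pi R)).
  have p0 := @pi_gt0 R; rewrite mulr2n in x2.
  have x'l : - pi <= x' by rewrite /x'; lra.
  have x'u : x' <= pi by rewrite /x' ltW //; lra.
  rewrite E1 E2; have [h|h] := leP `|x'| d'.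
    apply: (@le_trans _ _ e); last by rewrite lerDl mulr_ge0 // subr_ge0 cos_le1.
    by apply: hd; rewrite /ball_ /= sub0r normrN; exact: le_lt_trans d'd.
  have rc : rho <= 1 - cos x'.
    have x'p : `|x'| <= pi by rewrite ler_norml x'l.
    have x'0 := normr_ge0 x'.
    rewrite /rho lerD2l lerN2 -(cos_norm x') ltW // ltr_cos // in_itv /=;
      by apply/andP; split; lra.
  apply: (@le_trans _ _ (D * rho)); last first.
    by apply: (@le_trans _ _ (D * (1 - cos x'))); [rewrite ler_wpM2l | rewrite lerDr ltW].
  rewrite /D divfK ?gt_eqF //; apply: le_trans (ler_normB _ _) _.
  by have := hM 0; have := hM x'; lra.
pose I n := intg (fun x : R => (1 + cos x) ^+ n) 0 L.
have cI n : continuous (fun x : R => (1 + cos x) ^+ n) by ct.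
have p0 x : 0 <= 1 + cos x :> R by have := cos_geN1 x; lra.
have I0 n : 0 < I n.
  rewrite lt_def; apply/andP; split; last first.
    by apply: intg_ge0; [exact: ltW | exact: cI | move=> x _; exact: exprn_ge0].
  apply/eqP => In; have hp : 0 < (pi : R) / 2 < L.
    have p1 := @pi_gt0 R; have L2 : L = pi + pi by rewrite mulr2n.
    by apply/andP; split; rewrite ?L2; lra.
  have /eqP := intg_eq0 (cI n) (fun x _ => exprn_ge0 n (p0 x)) In hp.
  by rewrite cos_pihalf addr0 expr1n oner_eq0.
have key n : `|y 0| * I n <= e * I n + D * (2 * I n - I n.+1).
  have K0 : intg (fun x => y x * (1 + cos x) ^+ n) 0 L = 0.
    rewrite -[RHS](intg_kernel_eq0 n 0 cy y0); apply: intg_ext => x.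
    by rewrite /cx mul0r cos0 mulr1.
  have E1 : y 0 * I n = intg (fun x => (y 0 - y x) * (1 + cos x) ^+ n) 0 L.
    rewrite -intgZ // -[LHS]subr0 -[X in _ - X]K0 -intgB; [|by ct|by ct].
    by apply: intg_ext => x; ring.
  rewrite -[I n in X in X <= _]gtr0_norm // -normrM E1.
  have E2 : e * I n + D * (2 * I n - I n.+1) =
      intg (fun x => (e + D * (1 - cos x)) * (1 + cos x) ^+ n) 0 L.
    rewrite -!intgZ // -intgB; [|by ct|by ct]; rewrite -intgZ; last by ct.
    by rewrite -intgD; [|by ct|by ct]; apply: intg_ext => x; rewrite exprS; ring.
  rewrite E2; apply: intg_abs_le; [exact: ltW | by ct | by ct |] => x _.
  by rewrite normrM [`|_ ^+ n|]ger0_norm ?exprn_ge0 // ler_wpM2r ?exprn_ge0.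
have key2 n : `|y 0| <= e + D / n.+1%:R.
  have E : I n.+1 = (2 * n%:R + 1) / n.+1%:R * I n.
    have := wallis n; rewrite -/(I n) -/(I n.+1) => h.
    by rewrite mulrAC -h mulrC mulKf // pnatr_eq0.
  have := key n; rewrite E.
  have -> : e * I n + D * (2 * I n - (2 * n%:R + 1) / n.+1%:R * I n) = (e + D / n.+1%:R) * I n.
    have n0 : n.+1%:R != 0 :> R by rewrite pnatr_eq0.
    by rewrite -[n.+1]addn1 natrD in n0 *; field.
  by rewrite ler_pM2r.
apply/ler_addgt0Pr => e' e'0; apply: le_trans (key2 (Num.Def.archi_bound (D / e'))) _.
rewrite lerD2l ler_pdivrMr ?ltr0n // mulrC -ler_pdivrMr // ltW //.
by apply: lt_trans (archi_boundP _) _; [rewrite divr_ge0 // ltW | rewrite ltr_nat].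
Qed.

(** Translating the point to 0 suffices: the cosine moments of a translate are combinations of both
    families of coefficients of [y]. *)
Lemma coef_eq0 (y : R -> R) : cper y -> (forall k, ca y k = 0) -> (forall k, sa y k = 0) ->
  forall x, y x = 0.
Proof.
move=> [cy py] hc hs x; rewrite -[x]addr0.
have cs : continuous (fun s => y (x + s)) by ct.
apply: (@ca_eq0_at0 (fun s => y (x + s))); first by split=> // s; rewrite addrA py.
move=> k; rewrite /ca.
have cz : continuous (fun s => y s * cx k (s - x)) by have c := @ct_cx k; ct.
rewrite (intg_ext (g := fun s => (fun r => y r * cx k (r - x)) (x + s))); last first.
  by move=> s; rewrite /= addrC addrK.
rewrite (intg_shift x 0 L cz) addr0 intg_period //; last first.
  by move=> s; rewrite py addrAC per_cx.
have c1 := @ct_cx k; have c2 := @ct_sx k.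
rewrite (intg_ext (g := fun s => cx k x * (y s * cx k s) + sx k x * (y s * sx k s))); last first.
  by move=> s; rewrite /cx /sx mulrBr cosB; ring.
rewrite intgD; [|by ct|by ct]; rewrite !intgZ; try ct.
by rewrite mulrDl -!mulrA -/(ca y k) -/(sa y k) hc hs !mulr0 addr0.
Qed.

End Fourier.

(** * Fourier series of finite weighted energy *)

Section FourierSeries.
Context {R : realType}.
Notation L := (pi *+ 2 : R).

Lemma zr0 : zr 0 = [:: 0]. Proof. by []. Qed.

Lemma big_zrS N (F : int -> R) :
  \sum_(k <- zr N.+1) F k = \sum_(k <- zr N) F k + (F N.+1%:Z + F (- N.+1%:Z)).
Proof.
rewrite (perm_big (N.+1%:Z :: - N.+1%:Z :: zr N)) /=.
  by rewrite !big_cons addrA addrC.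
apply: uniq_perm; first exact: zr_uniq.
  by rewrite cons_uniq cons_uniq in_cons !mem_zr zr_uniq andbT; apply/andP; split; lia.
by move=> k; rewrite mem_zr in_cons in_cons mem_zr; lia.
Qed.

Lemma coef_abs_le (y : R -> R) M k : continuous y -> (forall x, `|y x| <= M) ->
  `|ca y k| <= M /\ `|sa y k| <= M.
Proof.
move=> cy yM; have L0 := @period_gt0 R; have c1 := @ct_cx R k; have c2 := @ct_sx R k.
have key (f : R -> R) : continuous f -> (forall x, `|f x| <= 1) ->
    `|intg (fun x => y x * f x) 0 L / L| <= M.
  move=> cf f1; rewrite normrM normfV [`|L|]gtr0_norm // ler_pdivrMr // -[L in leRHS]subr0.
  apply: intg_abs_le_cst; [exact: ltW | by ct | move=> x _].
  rewrite normrM -[leRHS]mulr1; apply: ler_pM => //.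
by split; apply: key => // x; [exact: cos_max | exact: sin_max].
Qed.

Lemma coef_sub (y z : R -> R) k : continuous y -> continuous z ->
  ca (fun x => y x - z x) k = ca y k - ca z k /\ sa (fun x => y x - z x) k = sa y k - sa z k.
Proof.
move=> cy cz; have c1 := @ct_cx R k; have c2 := @ct_sx R k.
split; rewrite /ca /sa -mulrBl -intgB; try ct; congr (_ / _); apply: intg_ext => x; ring.
Qed.

Lemma coef_eq (y z : R -> R) : cper y -> cper z ->
  (forall k, ca y k = ca z k) -> (forall k, sa y k = sa z k) -> y = z.
Proof.
move=> hy hz hc hs; apply/funext => x; apply/eqP; rewrite -subr_eq0; apply/eqP.
apply: (@coef_eq0 _ (fun x => y x - z x)); first by apply: cperD => //; exact: cperN.
  by move=> k; rewrite (coef_sub k hy.1 hz.1).1 hc subrr.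
by move=> k; rewrite (coef_sub k hy.1 hz.1).2 hs subrr.
Qed.

Section Series.
Variables (al be : int -> R) (M2 : R).
Hypothesis hsym : sym al be.
Let w (k : int) : R := (1 + k%:~R ^+ 2) * (al k ^+ 2 + be k ^+ 2).
Hypothesis hM2 : forall N, \sum_(k <- zr N) w k <= M2.

Let w0 k : 0 <= w k.
Proof. by rewrite mulr_ge0 ?addr_ge0 ?sqr_ge0. Qed.

Let M20 : 0 <= M2.
Proof. by apply: le_trans (hM2 0); rewrite zr0 big_seq1. Qed.

(** Young's inequality with weight [r] splits each coefficient into a share of the energy [w] and
    [1 / (4 r q)]. As [q >= n * (n + 1)], the second part telescopes, so tails are at most
    [r * M2 + 1 / (r n)]. *)
Let term (r : R) (n : nat) x : 0 < r -> (0 < n)%N ->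
  `|al n.+1%:Z * cx n.+1%:Z x + be n.+1%:Z * sx n.+1%:Z x +
    (al (- n.+1%:Z) * cx (- n.+1%:Z) x + be (- n.+1%:Z) * sx (- n.+1%:Z) x)| <=
  r * (w n.+1%:Z + w (- n.+1%:Z)) + r^-1 * (n%:R^-1 - n.+1%:R^-1).
Proof.
move=> r0 n0; set m := n.+1%:Z; set q : R := 1 + m%:~R ^+ 2.
have q0 : 0 < q by rewrite ltr_pwDl // sqr_ge0.
have amgm (a : R) : `|a| <= r * (q * a ^+ 2) + (4 * r * q)^-1.
  have rq0 : 0 < 4 * r * q by rewrite !mulr_gt0.
  rewrite -(ler_pM2r rq0) [leRHS]mulrDl mulVf ?gt_eqF //.
  have := sqr_ge0 (2 * r * q * `|a| - 1); rewrite -[a ^+ 2]real_normK ?num_real //.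
  by rewrite sqrrB; lra.
have tk k : `|al k * cx k x + be k * sx k x| <= `|al k| + `|be k|.
  apply: le_trans (ler_normD _ _) _; rewrite !normrM; apply: lerD.
    by rewrite ler_piMr // cos_max.
  by rewrite ler_piMr // sin_max.
have wE : w m + w (- m) = 2 * (q * al m ^+ 2 + q * be m ^+ 2).
  by rewrite /w (hsym m).1 (hsym m).2 mulrNz !sqrrN -/q; ring.
have inv : q^-1 <= n%:R^-1 - n.+1%:R^-1.
  have nR : 0 < n%:R :> R by rewrite ltr0n.
  have nR1 : 0 < n.+1%:R :> R by rewrite ltr0n.
  have -> : n%:R^-1 - n.+1%:R^-1 = (n%:R * n.+1%:R)^-1 :> R.
    by rewrite -[n.+1]addn1 natrD in nR1 *; field; rewrite !gt_eqF.
  rewrite lef_pV2 ?posrE ?mulr_gt0 // /q /m -pmulrn -[n.+1]addn1 natrD; nra.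
apply: le_trans (ler_normD _ _) _; apply: le_trans (lerD (tk _) (tk _)) _.
rewrite (hsym m).1 (hsym m).2 normrN wE.
have h1 := amgm (al m); have h2 := amgm (be m).
have : r^-1 * q^-1 <= r^-1 * (n%:R^-1 - n.+1%:R^-1) by rewrite ler_pM2l ?invr_gt0.
have -> : r^-1 * q^-1 = 4 * (4 * r * q)^-1 by field; rewrite !gt_eqF.
move: h1 h2; set i := (4 * r * q)^-1; set s := r^-1 * _; move: i s (q * al m ^+ 2) (q * be m ^+ 2).
by move: `|al m| `|be m| => A1 A2 i s A3 A4; lra.
Qed.

Let tp_diff (r : R) (n d : nat) x : 0 < r -> (0 < n)%N ->
  `|tp (n + d) al be x - tp n al be x| <= r * M2 + r^-1 / n%:R.
Proof.
move=> r0 n0; have nR : 0 < n%:R :> R by rewrite ltr0n.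
have lin (A1 A2 B C D E F1 F2 F3 : R) : A1 <= r * (B - C) + E * (F1 - F2) ->
    A2 <= r * D + E * (F2 - F3) -> A1 + A2 <= r * (B + D - C) + E * (F1 - F3) by nra.
have key : `|tp (n + d) al be x - tp n al be x| <=
    r * (\sum_(k <- zr (n + d)) w k - \sum_(k <- zr n) w k) + r^-1 * (n%:R^-1 - (n + d)%:R^-1).
  elim: d => [|d IHd]; first by rewrite addn0 !subrr normr0 !mulr0 addr0.
  rewrite addnS /tp !big_zrS -!/(tp _ _ _ _) addrAC.
  apply: le_trans (ler_normD _ _) _.
  by apply: lin (@term r (n + d) x r0 (ltn_addr _ n0)); exact: IHd.
apply: le_trans key _; apply: lerD.
  have s0 : 0 <= \sum_(k <- zr n) w k by apply: sumr_ge0.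
  by rewrite ler_pM2l // lerBlDr; apply: le_trans (hM2 _) _; rewrite lerDl.
by rewrite ler_pM2l ?invr_gt0 // lerBlDr lerDl invr_ge0.
Qed.

Let tp_cauchy (e : R) : 0 < e -> exists N, forall n m x, (N <= n)%N -> (N <= m)%N ->
  `|tp n al be x - tp m al be x| <= e.
Proof.
move=> e0; pose r := e / (4 * (M2 + 1)).
have r0 : 0 < r by rewrite divr_gt0 // mulr_gt0 // ltr_wpDl.
pose A := 4 / (r * e); have A0 : 0 <= A by rewrite divr_ge0 // mulr_ge0 // ltW.
pose N := (Num.Def.archi_bound A).+1.
have key n d x : (N <= n)%N -> `|tp (n + d) al be x - tp n al be x| <= e / 2.
  move=> Nn; have n0 : (0 < n)%N by apply: leq_trans Nn.
  have nR : 0 < n%:R :> R by rewrite ltr0n.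
  apply: le_trans (@tp_diff r n d x r0 n0) _.
  have An : A <= n%:R.
    apply: ltW; apply: lt_le_trans (archi_boundP A0) _; rewrite ler_nat.
    by apply: leq_trans Nn.
  have h1 : r * M2 <= e / 4.
    rewrite /r mulrAC ler_pdivrMr ?mulr_gt0 ?ltr_wpDl //.
    by rewrite (_ : e / 4 * (4 * (M2 + 1)) = e * (M2 + 1)); [rewrite ler_pM2l // lerDl | field].
  have h2 : r^-1 / n%:R <= e / 4.
    rewrite ler_pdivrMr // -ler_pdivrMl ?divr_gt0 //; apply: le_trans An.
    rewrite /A le_eqVlt; apply/orP; left; apply/eqP; field.
    by rewrite !gt_eqF.
  lra.
exists N => n m x Nn Nm; have [nm|/ltnW mn] := leqP n m.
  rewrite distrC -(subnKC nm); apply: le_trans (key n (m - n)%N x Nn) _; lra.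
by rewrite -(subnKC mn); apply: le_trans (key m (n - m)%N x Nm) _; lra.
Qed.

Lemma energy_tp N : energy (tp N al be) (tp N (fun k => k%:~R * be k) (fun k => - k%:~R * al k)) =
  L * \sum_(k <- zr N) w k.
Proof.
have hs2 : sym (fun k => k%:~R * be k) (fun k => - k%:~R * al k).
  by move=> k; rewrite mulrNz (hsym k).1 (hsym k).2; split; ring.
have L0 := @period_neq0 R.
have c1 := (cper_tp N al be).1; have c2 := (cper_tp N (fun k => k%:~R * be k) (fun k => - k%:~R * al k)).1.
rewrite /energy intgD; [|by ct|by ct].
have := parseval_tp N hsym; have := parseval_tp N hs2.
move=> /(canRL (divfK L0)) -> /(canRL (divfK L0)) ->.
rewrite -mulrDl mulrC -big_split; congr (_ * _); apply: eq_bigr => k _.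
by rewrite /= /w; ring.
Qed.

(** The Sobolev embedding on the Fourier side: the partial sums are uniformly Cauchy and, having
    energy at most [L * M2], they themselves witness [H1le] for the limit. *)
Lemma trig_series : exists S : R -> R,
  [/\ H1le (L * M2) S, forall k, ca S k = al k, forall k, sa S k = be k &
   forall e : R, 0 < e -> exists N, forall n x, (N <= n)%N -> `|tp n al be x - S x| <= e].
Proof.
have hS x : exists l : R, tp n al be x @[n --> \oo] --> l.
  have : cvg (tp n al be x @[n --> \oo]).
    apply/cauchy_cvgP; apply/cauchy_exP => e e0.
    have e2 : 0 < e / 2 by rewrite divr_gt0.
    have [N hN] := tp_cauchy e2; exists (tp N al be x); exists N => // n /= Nn.
    by apply: le_lt_trans (hN N n x (leqnn N) Nn) _; lra.
  by move=> /cvg_ex.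
pose S x := sval (cid (hS x)); have SP x := svalP (cid (hS x)).
have conv (e : R) : 0 < e -> exists N, forall n x, (N <= n)%N -> `|tp n al be x - S x| <= e.
  move=> e0; have [N hN] := tp_cauchy e0; exists N => n x Nn.
  have hc : (tp n al be x - tp m al be x) @[m --> \oo] --> tp n al be x - S x.
    by apply: cvgB; [exact: cvg_cst | exact: SP].
  apply: (cvgr_to_le (cvg_norm hc)); exists N => // m /= Nm; exact: hN.
have HS : H1le (L * M2) S.
  move=> e e0; have [N hN] := conv e e0.
  exists (tp N al be), (tp N (fun k => k%:~R * be k) (fun k => - k%:~R * al k)); split.
  - exact: (cper_tp _ _ _).2.
  - by move=> x; exact: dv_tp.
  - exact: (cper_tp _ _ _).1.
  - by rewrite energy_tp ler_pM2l ?period_gt0.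
  - by move=> x; exact: hN.
have cS := (H1le_cper HS).1.
have coefS k (e : R) : 0 < e -> `|al k - ca S k| <= e /\ `|be k - sa S k| <= e.
  move=> e0; have [N hN] := conv e e0; pose n := maxn N `|k|%N.
  have cT := (cper_tp n al be).1.
  have cD : continuous (fun x => tp n al be x - S x) by ct.
  have := coef_abs_le k cD (fun x => hN n x (leq_maxl _ _)).
  rewrite (coef_sub k cT cS).1 (coef_sub k cT cS).2 ca_tp // sa_tp // mem_zr.
  by rewrite leq_maxr.
exists S; split=> // k; apply/eqP; rewrite -subr_eq0 -normr_le0 distrC; apply/ler_addgt0Pr => e e0;
  by rewrite add0r; have [] := coefS k e e0.
Qed.

End Series.

(** Bessel's inequality for an approximant and for its derivative supplies the weights 1 and [k^2].
    A finite sum of squared coefficients is continuous in the sup norm, so the approximant can be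
    replaced by [y]. *)
Lemma H1le_coef E (y : R -> R) N : H1le E y ->
  \sum_(k <- zr N) (1 + k%:~R ^+ 2) * (ca y k ^+ 2 + sa y k ^+ 2) <= E / L.
Proof.
move=> H; have L0 := @period_gt0 R; have [cy py] := H1le_cper H.
have [B hB] := per_bounded cy py; have B0 : 0 <= B by apply: le_trans (hB 0).
pose W : R := \sum_(k <- zr N) (1 + k%:~R ^+ 2).
have q0 (k : int) : 0 <= 1 + k%:~R ^+ 2 :> R by rewrite addr_ge0 // sqr_ge0.
have W0 : 0 <= W by exact: sumr_ge0.
apply/ler_addgt0Pr => e e0.
pose A := 2 * (2 * B + 1) * W; have A0 : 0 <= A by rewrite !mulr_ge0 // addr_ge0 // mulr_ge0.
pose d := Num.min 1 (e / (A + 1)).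
have d0 : 0 < d by rewrite lt_min ltr01 divr_gt0 // ltr_wpDl.
have d1 : d <= 1 by rewrite ge_min lexx.
have dA : d * A <= e.
  apply: (@le_trans _ _ (d * (A + 1))); first by rewrite ler_pM2l // lerDl.
  by rewrite -ler_pdivlMr ?ltr_wpDl // ge_min lexx orbT.
have [z [dz [pz hz cdz hE hzy]]] := H d d0; have cz := dv_ct hz.
have hD x : `|y x - z x| <= d by rewrite distrC.
have cD : continuous (fun x => y x - z x) by ct.
have sq (a c : R) : `|a| <= B -> `|a - c| <= d -> a ^+ 2 <= c ^+ 2 + d * (2 * B + 1).
  move=> aB acd; have -> : a ^+ 2 = c ^+ 2 + (a - c) * (2 * a - (a - c)) by ring.
  rewrite lerD2l; apply: le_trans (ler_norm _) _; rewrite normrM; apply: ler_pM => //.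
  apply: le_trans (ler_normB _ _) _; rewrite normrM ger0_norm //; lra.
apply: (@le_trans _ _ (\sum_(k <- zr N) ((1 + k%:~R ^+ 2) * (ca z k ^+ 2 + sa z k ^+ 2) +
    (1 + k%:~R ^+ 2) * (d * (2 * (2 * B + 1)))))).
  apply: ler_sum => k _; rewrite -mulrDr ler_wpM2l //.
  have [h1 h2] := coef_abs_le k cy hB; have := coef_abs_le k cD hD.
  rewrite (coef_sub k cy cz).1 (coef_sub k cy cz).2 => -[h3 h4].
  by have := sq _ _ h1 h3; have := sq _ _ h2 h4; lra.
rewrite big_split /= -mulr_suml -/W; apply: lerD; last first.
  by apply: le_trans dA; rewrite /A le_eqVlt; apply/orP; left; apply/eqP; ring.
have b1 := bessel N cz; have b2 := bessel N cdz.
apply: (@le_trans _ _ (energy z dz / L)); last by rewrite ler_pM2r ?invr_gt0.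
rewrite /energy intgD; [|by ct|by ct]; rewrite mulrDl.
apply: le_trans (lerD b1 b2); rewrite -big_split; apply: ler_sum => k _ /=.
by have [-> ->] := coef_derive k hz cdz pz; rewrite le_eqVlt; apply/orP; left; apply/eqP; ring.
Qed.

Lemma H1le_series E (y : R -> R) (e : R) : H1le E y -> 0 < e ->
  exists N, forall n x, (N <= n)%N -> `|tp n (ca y) (sa y) x - y x| <= e.
Proof.
move=> H e0; have hy := H1le_cper H.
have [S [HS hc hs /(_ e e0)]] := trig_series (sym_coef hy.1) (fun N => H1le_coef N H).
by rewrite (coef_eq (H1le_cper HS) hy hc hs).
Qed.

Lemma C1_H1le (y dy : R -> R) : periodic y L -> (forall x, is_derive x (1 : R) y (dy x)) ->
  continuous dy -> H1le (energy y dy) y.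
Proof.
by move=> py hy cdy e e0; exists y, dy; split=> // x; rewrite subrr normr0 ltW.
Qed.

End FourierSeries.

(** * Fourier coefficients of measurable functions *)

Section TorusMeasure.
Context {R : realType}.
Notation L := (pi *+ 2 : R).
Notation mu := (@lebesgue_measure R).
Notation tor := (`[0, (pi *+ 2 : R)]%classic).

Definition int1 (f : R -> R) := measurable_fun [set: R] f /\ mu.-integrable tor (EFin \o f).

Lemma mtor : measurable (tor : set (measurableTypeR R)). Proof. exact: measurable_itv. Qed.

Lemma ae_neq (c : R) : {ae mu, forall x : R, x != c}.
Proof.
exists [set c]; split; [exact: measurable_set1 | exact: lebesgue_measure_set1 |].
by move=> x /= /negP; rewrite negbK => /eqP.
Qed.

Lemma aeS (P Q : R -> Prop) : (forall x, P x -> Q x) -> {ae mu, forall x, P x} -> {ae mu, forall x, Q x}.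
Proof.
move=> PQ [N [mN N0 hN]]; exists N; split=> // x /= nQ; apply: hN => /= Px.
by apply: nQ; exact: PQ.
Qed.

Lemma aeI (P Q : R -> Prop) : {ae mu, forall x, P x} -> {ae mu, forall x, Q x} ->
  {ae mu, forall x, P x /\ Q x}.
Proof.
move=> [N [mN N0 hN]] [M [mM M0 hM]]; exists (N `|` M); split; first exact: measurableU.
  have h : (mu (N `|` M) <= mu N + mu M)%E by exact: measureU2.
  move: h; rewrite [X in (_ <= X + _)%E]N0 [X in (_ <= _ + X)%E]M0 adde0 => h.
  by apply/eqP; rewrite eq_le h measure_ge0.
move=> x /= nPQ; have [Px|nP] := pselect (P x); last by left; exact: hN.
by right; apply: hM => /= Qx; exact: nPQ.
Qed.

Lemma int1_cont (f : R -> R) : continuous f -> int1 f.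
Proof. by move=> cf; split; [exact: continuous_measurable_fun | exact: ct_integrable]. Qed.

Lemma ti_cont (f : R -> R) : continuous f -> torus_int f = intg f 0 L.
Proof. by move=> cf; rewrite /torus_int Rintegral_intg // period_gt0. Qed.

Lemma int1D (f g : R -> R) : int1 f -> int1 g -> int1 (fun x => f x + g x).
Proof.
move=> [mf hf] [mg hg]; split; first exact: measurable_funD.
exact: (integrableD mtor hf hg).
Qed.

Lemma int1Z (c : R) (f : R -> R) : int1 f -> int1 (fun x => c * f x).
Proof.
move=> [mf hf]; split; first by apply: measurable_funM => //; exact: measurable_cst.
exact: (integrableZl mtor c hf).
Qed.

Lemma int1B (f g : R -> R) : int1 f -> int1 g -> int1 (fun x => f x - g x).
Proof.
move=> [mf hf] [mg hg]; split; first exact: measurable_funB.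
exact: (integrableB mtor hf hg).
Qed.

Lemma int1M (f h : R -> R) (M : R) : int1 f -> measurable_fun [set: R] h -> (forall x, `|h x| <= M) ->
  int1 (fun x => f x * h x).
Proof.
move=> [mf hf] mh hM; split; first exact: measurable_funM.
apply: (integrableMl mtor hf (measurable_funS measurableT (@subsetT _ _) mh)).
by exists M; split; [exact: num_real | move=> r Mr x _ /=; apply: le_trans (hM x) (ltW Mr)].
Qed.

Lemma int1_cper (f h : R -> R) : int1 f -> cper h -> int1 (fun x => f x * h x).
Proof.
move=> hf [ch ph]; have [M hM] := per_bounded ch ph.
exact: (int1M hf (continuous_measurable_fun ch) hM).
Qed.

Lemma int1_abs (f : R -> R) : int1 f -> int1 (fun x => `|f x|).
Proof.
move=> [mf hf]; split; first by apply: measurableT_comp mf; exact: normr_measurable.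
exact: (integrable_abse hf).
Qed.

Lemma tiD (f g : R -> R) : int1 f -> int1 g ->
  torus_int (fun x => f x + g x) = torus_int f + torus_int g.
Proof. by move=> [_ hf] [_ hg]; rewrite /torus_int (RintegralD mtor hf hg). Qed.

Lemma tiB (f g : R -> R) : int1 f -> int1 g ->
  torus_int (fun x => f x - g x) = torus_int f - torus_int g.
Proof. by move=> [_ hf] [_ hg]; rewrite /torus_int (RintegralB mtor hf hg). Qed.

Lemma tiZ (c : R) (f : R -> R) : int1 f -> torus_int (fun x => c * f x) = c * torus_int f.
Proof. by move=> [_ hf]; rewrite /torus_int (RintegralZl c mtor hf). Qed.

Lemma ti_mul_le (f h : R -> R) (M : R) : int1 f -> continuous h -> (forall x, `|h x| <= M) ->
  `|torus_int (fun x => f x * h x)| <= M * torus_int (fun x => `|f x|).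
Proof.
move=> hf ch hM; have hp := int1M hf (continuous_measurable_fun ch) hM.
apply: le_trans (le_normr_Rintegral mtor hp.2) _.
rewrite -(tiZ M (int1_abs hf)); apply: le_Rintegral; first exact: mtor.
- exact: (int1_abs hp).2.
- exact: (int1Z M (int1_abs hf)).2.
- by move=> x _; rewrite normrM mulrC ler_wpM2r.
Qed.

(* If [h] is a uniform limit of test functions annihilated by [f], then [f] annihilates [h]. *)
Lemma ti_approx (f h : R -> R) : int1 f -> cper h ->
  (forall e : R, 0 < e -> exists k, [/\ cper k, torus_int (fun x => f x * k x) = 0 &
     forall x, `|h x - k x| <= e]) ->
  torus_int (fun x => f x * h x) = 0.
Proof.
move=> hf hh happ; set A := torus_int (fun x => `|f x|).
have A0 : 0 <= A by apply: Rintegral_ge0.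
apply/eqP; rewrite -normr_le0; apply/ler_addgt0Pr => e e0; rewrite add0r.
have e1 : 0 < e / (A + 1) by rewrite divr_gt0 // ltr_wpDl.
have [k [hk k0 hkh]] := happ _ e1.
have cD : continuous (fun x => h x - k x) by have ch := hh.1; have ck := hk.1; ct.
have := ti_mul_le hf cD hkh.
rewrite (_ : (fun x => f x * (h x - k x)) = (fun x => f x * h x - f x * k x)); last first.
  by apply/funext => x; rewrite mulrBr.
rewrite (tiB (int1_cper hf hh) (int1_cper hf hk)) k0 subr0 -/A => /le_trans; apply.
by rewrite mulrAC ler_pdivrMr ?ltr_wpDl // ler_pM2l // lerDl.
Qed.

Definition mca (f : R -> R) (k : int) : R := torus_int (fun x => f x * cx k x) / L.
Definition msa (f : R -> R) (k : int) : R := torus_int (fun x => f x * sx k x) / L.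

Lemma fcoefE (f : R -> R) k : fcoef f k = Complex (mca f k) (- msa f k).
Proof. by []. Qed.

Lemma mca_cont (f : R -> R) k : continuous f -> mca f k = ca f k.
Proof. by move=> cf; have c := @ct_cx R k; rewrite /mca ti_cont //; ct. Qed.

Lemma msa_cont (f : R -> R) k : continuous f -> msa f k = sa f k.
Proof. by move=> cf; have c := @ct_sx R k; rewrite /msa ti_cont //; ct. Qed.

Lemma ti_mul_tp (f : R -> R) N al be : int1 f ->
  torus_int (fun x => f x * tp N al be x) / L = \sum_(k <- zr N) (al k * mca f k + be k * msa f k).
Proof.
move=> hf; rewrite /tp.
suff H (s : seq int) : int1 (fun x => f x * \sum_(k <- s) (al k * cx k x + be k * sx k x)) /\
    torus_int (fun x => f x * \sum_(k <- s) (al k * cx k x + be k * sx k x)) / L =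
    \sum_(k <- s) (al k * mca f k + be k * msa f k) by have [] := H (zr N).
elim: s => [|k s [IH1 IH2]].
  have -> : (fun x => f x * \sum_(k <- [::]) (al k * cx k x + be k * sx k x)) = fun=> 0.
    by apply/funext => x; rewrite big_nil mulr0.
  have h0 : continuous (fun _ : R => 0 : R) by exact: ct_cst.
  by split; [exact: int1_cont | rewrite ti_cont // intg_cst !mul0r big_nil].
have -> : (fun x => f x * \sum_(j <- k :: s) (al j * cx j x + be j * sx j x)) =
   (fun x => (al k * (f x * cx k x) + be k * (f x * sx k x)) +
      f x * \sum_(j <- s) (al j * cx j x + be j * sx j x)).
  by apply/funext => x; rewrite big_cons; ring.
have h1 := int1_cper hf (@cper_cx R k); have h2 := int1_cper hf (@cper_sx R k).
have h1' := int1Z (al k) h1; have h2' := int1Z (be k) h2.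
split; first by apply: int1D => //; exact: int1D.
rewrite (tiD (int1D h1' h2') IH1) (tiD h1' h2') (tiZ _ h1) (tiZ _ h2) big_cons -IH2 /mca /msa.
by ring.
Qed.

Lemma ti_C1_eq0 (f : R -> R) (y dy : R -> R) : int1 f ->
  (forall k, mca f k = 0) -> (forall k, msa f k = 0) ->
  periodic y L -> (forall x, is_derive x (1 : R) y (dy x)) -> continuous dy ->
  torus_int (fun x => f x * y x) = 0.
Proof.
move=> hf hc hs py hy cdy; apply: ti_approx => //; first by split=> //; exact: dv_ct hy.
move=> e e0; have [N hN] := H1le_series (C1_H1le py hy cdy) e0.
exists (tp N (ca y) (sa y)); split; first exact: cper_tp.
  apply: (mulIf (invr_neq0 (@period_neq0 R))); rewrite ti_mul_tp // mul0r.
  by rewrite big1 // => k _; rewrite hc hs !mulr0 addr0.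
by move=> x; rewrite distrC hN.
Qed.

Section Uniqueness.
Variable w : R -> R.
Hypothesis hw : int1 w.
Hypothesis hc : forall k, mca w k = 0.
Hypothesis hs : forall k, msa w k = 0.

(** For [0 < a < L] this is positive on (0, a) and negative on (a, L), as the product formula [thE]
    shows; being periodic and smooth, it is a good argument for approximate indicators. *)
Let th (a x : R) := cos (x - a / 2) - cos (a / 2).

Let thE a x : th a x = 2 * (sin (x / 2) * sin ((a - x) / 2)).
Proof.
have e1 : x - a / 2 = x / 2 - (a - x) / 2 by field.
have e2 : a / 2 = x / 2 + (a - x) / 2 by field.
rewrite /th e1 [in X in _ - X]e2 cosB cosD; ring.
Qed.

(* Smooth approximations of the indicator function of the arc (0, a). *)
Let psi a (n : nat) x := (1 + expR (- (n%:R * th a x)))^-1.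

Let cpsi a n : continuous (psi a n).
Proof.
have h : continuous (fun x => 1 + expR (- (n%:R * th a x))) by rewrite /th; ct.
move=> x; apply: cvgV; last exact: h.
by rewrite gt_eqF // ltr_pwDl // expR_ge0.
Qed.

Let psi_int a n : torus_int (fun x => w x * psi a n x) = 0.
Proof.
have p0 x : 1 + expR (- (n%:R * th a x)) != 0 by rewrite gt_eqF // ltr_pwDl // expR_ge0.
pose q x := - (n%:R * sin (x - a / 2) * expR (- (n%:R * th a x))) * psi a n x ^+ 2.
apply: (@ti_C1_eq0 w (psi a n) q) => //.
- by move=> x; rewrite /psi /th addrAC cosD2pi.
- move=> x; rewrite /psi /q /th; have h := p0 x; rewrite /th in h.
  have h2 : is_derive x (1 : R) (fun x => 1 + expR (- (n%:R * (cos (x - a / 2) - cos (a / 2)))))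
      (n%:R * sin (x - a / 2) * expR (- (n%:R * (cos (x - a / 2) - cos (a / 2))))) by dv; ring.
  notypeclasses refine (dv_to (@is_deriveV R (fun x => 1 + expR (- (n%:R * (cos (x - a / 2) - cos (a / 2))))) x _ 1 h h2) _).
  rewrite /psi /th /GRing.scale /=; field => //.
- by have c : continuous (psi a n) := @cpsi a n; rewrite /q /th; ct.
Qed.

Let psi01 a n x : 0 <= psi a n x <= 1.
Proof.
by rewrite invr_ge0 addr_ge0 ?expR_ge0 //= invf_le1 ?lerDl ?expR_ge0 // ltr_pwDl // expR_ge0.
Qed.

Let exp_small (d : R) : 0 < d -> expR (- (n%:R * d)) @[n --> \oo] --> (0 : R).
Proof.
move=> d0; have e1 : expR (- d) < 1 by rewrite -expR0 ltr_expR oppr_lt0.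
have := @cvg_expr R (expR (- d)); rewrite ger0_norm ?expR_ge0 // => /(_ e1).
rewrite (_ : (fun n => expR (- (n%:R * d))) = (fun n => expR (- d) ^+ n)) //.
by apply/funext => n; rewrite -expRM_natl mulrN.
Qed.

Let psi_lim a x : 0 < a < L -> 0 < x < L -> x != a ->
  psi a n x @[n --> \oo] --> (if x < a then 1 else 0 : R).
Proof.
move=> /andP[a0 aL] /andP[x0 xL] xa.
have s1 : 0 < sin (x / 2).
  by apply: sin_gt0_pi; move: xL; rewrite mulr2n; lra.
have := xa; case: ltgtP => // [lt|gt] _.
  have t0 : 0 < th a x.
    rewrite thE !mulr_gt0 //; apply: sin_gt0_pi; move: aL; rewrite mulr2n; lra.
  rewrite -[X in _ --> X](@invr1 R) -[X in X^-1](addr0 1).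
  apply: cvgV; first by rewrite addr0 oner_neq0.
  by apply: cvgD; [exact: cvg_cst | exact: exp_small].
have t0 : 0 < - th a x.
  rewrite thE -mulrN !mulr_gt0 // -mulrN -sinN mulr_gt0 //; apply: sin_gt0_pi.
  by move: xL; rewrite mulr2n; lra.
apply: (squeeze_cvgr _ (cvg_cst 0) (exp_small t0)); near=> n.
rewrite (andP (psi01 a n x)).1 /=.
rewrite mulrN opprK /psi -[leRHS]invrK -expRN lef_pV2 ?posrE ?expR_gt0 // ?lerDr // ltr_pwDl // expR_ge0.
Unshelve. all: by end_near. Qed.

(** Off three points [psi a n] tends to the indicator of the arc, with values in [[0, 1]]; dominated
    convergence transfers orthogonality from these smooth functions to the indicator. *)
Let int_itv (a : R) : 0 < a < L -> \int[mu]_(x in `[0, a]) w x = 0.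
Proof.
move=> aL; have /andP[a0 aL'] := aL.
pose A : set R := `[0, a]%classic.
have hg : int1 (fun x => w x * \1_A x).
  apply: (@int1M _ _ 1) => //; first by apply: measurable_indic; exact: measurable_itv.
  by move=> x; rewrite indicE normr_nat lern1; case: (_ \in _).
have hp n : int1 (fun x => w x * psi a n x).
  apply: (@int1M _ _ 1) => //; last first.
    by move=> x; rewrite ger0_norm; have /andP[] := psi01 a n x.
  exact: continuous_measurable_fun.
have key : (\int[mu]_(x in tor) (w x * \1_A x)%:E = 0)%E.
  have h1 n : (\int[mu]_(x in tor) (w x * psi a n x)%:E = 0)%E.
    have := psi_int a n; rewrite /torus_int /Rintegral => h.
    by rewrite -(fineK (integrable_fin_num mtor (hp n).2)) /= h.
  have mf n : measurable_fun tor (fun x => (w x * psi a n x)%:E) by exact: measurable_int (hp n).2.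
  have mg : measurable_fun tor (fun x => (w x * \1_A x)%:E) by exact: measurable_int hg.2.
  have [|||_ _] := @dominated_convergence _ _ _ mu tor mtor
     (fun n x => (w x * psi a n x)%:E) (fun x => (w x * \1_A x)%:E) (fun x => `|w x|%:E) mf mg.
  - apply: aeS (aeI (aeI (ae_neq 0) (ae_neq a)) (ae_neq L)) => x [[x0 xa] xL].
    rewrite /= in_itv /= => /andP[x0' xL'].
    have {}x0 : 0 < x by rewrite lt_neqAle eq_sym x0.
    have {}xL : x < L by rewrite lt_neqAle xL.
    apply/fine_cvgP; split; first exact: nearW.
    apply: cvgM; first exact: cvg_cst.
    have := @psi_lim a x aL; rewrite x0 xL => /(_ isT xa).
    by rewrite indicE mem_setE in_itv /= (ltW x0) le_eqVlt (negbTE xa) /=; case: ifP.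
  - exact: (int1_abs hw).2.
  - apply: nearW => x n _ /=; rewrite lee_fin normrM ler_piMr //.
    by rewrite ger0_norm; have /andP[] := psi01 a n x.
  - under eq_fun do rewrite h1.
    have H2 : (fun _ : nat => 0%E : \bar R) @ \oo --> (0%E : \bar R) by exact: cvg_cst.
    by move=> H; rewrite -(cvg_lim (@ereal_hausdorff R) H) (cvg_lim (@ereal_hausdorff R) H2).
rewrite /Rintegral (_ : `[0, a]%classic = tor `&` A); last first.
  apply/seteqP; split=> x /=; rewrite /A /= !in_itv /=; last by case.
  by move=> /andP[h1 h2]; rewrite h1 h2 (le_trans h2 (ltW aL')).
suff -> : (\int[mu]_(x in tor `&` A) (w x)%:E = \int[mu]_(x in tor) (w x * \1_A x)%:E)%E by rewrite key.
rewrite integral_mkcondr; apply: eq_integral => x _.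
by rewrite patchE indicE; case: ifP => _; rewrite ?mulr1 ?mulr0.
Qed.

(** By [int_itv] the indefinite integral of [w] is identically 0, while at Lebesgue points its
    derivative is [w]. The restriction to one period provides the local integrability on the line
    that the differentiation theorem asks for. *)
Lemma ae_eq0_coef : {ae mu, forall x : R, 0 < x < L -> w x = 0}.
Proof.
have hw2 : mu.-integrable tor (EFin \o (w \_ tor)).
  have h : {in tor, EFin \o w =1 EFin \o (w \_ tor)} by move=> x xt /=; rewrite patchE xt.
  exact: (eq_integrable mtor _ _ h hw.2).
have := lebesgue_differentiation (integrable_locally mtor hw.2).
apply: aeS => x lx /andP[x0 xL].
have [|dF F'] := @FTC1_lebesgue_pt R (w \_ tor) (BLeft 0) x L xL hw2 _ lx.
  by rewrite /= lte_fin.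
have <- : (w \_ tor) x = w x by rewrite patchE mem_setE in_itv /= !ltW.
rewrite -F' derive1E; apply: (@derive_val _ _ _ _ _ _ _).
have F0 y : 0 < y < L -> \int[mu]_(t in `[0, y]) (w \_ tor) t = 0.
  move=> yL; rewrite -[RHS](int_itv yL); apply: eq_Rintegral => z; rewrite mem_setE !in_itv /= => /andP[z0 zy].
  by rewrite patchE mem_setE in_itv /= z0 (le_trans zy) // ltW //; case/andP: yL.
apply: dv_intro => e e0; apply/nbhs_ballP; exists (Num.min x (L - x)).
  by rewrite /= lt_min x0 subr_gt0.
move=> h; rewrite /ball /= sub0r normrN lt_min => /andP[]; rewrite !ltr_norml => h1 h2.
by rewrite !F0 ?x0 // ?subr0 ?mul0r ?subrr ?normr0 ?mulr_ge0 ?(ltW e0) //; lra.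
Qed.

End Uniqueness.

(** Translation invariance of Lebesgue measure, from its uniqueness: the pushforward by a
    translation agrees with it on half-open intervals. *)
Lemma ae_shift (P : R -> Prop) c : {ae mu, forall x, P x} -> {ae mu, forall x, P (x + c)}.
Proof.
move=> [N [mN N0 hN]].
pose sh : measurableTypeR R -> measurableTypeR R := fun x => x + c.
have msh : measurable_fun [set: measurableTypeR R] sh.
  by apply: continuous_measurable_fun => x; apply: cvgD; [exact: cvg_id | exact: cvg_cst].
exists (sh @^-1` N); split.
- by rewrite -[_ @^-1` _]setTI; exact: msh.
- pose nu := measure_function_pushforward__canonical__measure_function_Measure mu msh.
  have H X : ocitv X -> lebesgue_measure X = nu X.
    move=> [[x y] /= xy <-].
    rewrite /nu /= /pushforward (_ : sh @^-1` `]x, y] = `](x - c), (y - c)]%classic); last first.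
      by apply/seteqP; split=> z; rewrite /sh /= !in_itv /= ltrBlDr lerBrDr.
    by rewrite !lebesgue_measure_itv /= !lte_fin ltrD2r -!EFinB opprD addrACA subrr addr0.
  by have := lebesgue_measure_unique H mN; rewrite [X in X = _ -> _]N0 => ->.
- by move=> x /= h; exact: hN.
Qed.

(** Countably many translates of the open period cover the line except the multiples of [L], which
    [P] excludes one by one as null points. *)
Lemma ae_periodic (w : R -> R) : periodic w L -> {ae mu, forall x : R, 0 < x < L -> w x = 0} ->
  {ae mu, forall x : R, w x = 0}.
Proof.
move=> pw hw.
pose P (n : nat) (x : R) := (0 < x + n%:R * L < L -> w x = 0) /\
  (0 < x + - (n%:R * L) < L -> w x = 0) /\ x != n%:R * L /\ x != - (n%:R * L).
have : {ae mu, forall x : R, forall n, P n x}.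
  apply: ae_foralln => n.
  have h1 := ae_shift (n%:R * L) hw; have h2 := ae_shift (- (n%:R * L)) hw.
  have h3 := ae_neq (n%:R * L); have h4 := ae_neq (- (n%:R * L)).
  apply: aeS (aeI (aeI h1 h2) (aeI h3 h4)) => x [[{}h1 {}h2] [{}h3 {}h4]].
  split; last split=> //.
    by move=> /h1; rewrite [n%:R]pmulrn (period_int _ _ pw).
  by move=> /h2; rewrite -mulNr pmulrn -mulrNz (period_int _ _ pw).
apply: aeS => x hP; have [k /andP[k0 kL]] := @period_reduce R x.
move: k0; rewrite le_eqVlt => /orP[/eqP k0|k0].
  have := hP `|k|%N; case: (intP k) k0 => [|n|n] k0 [_ [_ [/eqP h1 /eqP h2]]].
  - by exfalso; apply: h1; rewrite absz0; move: k0; rewrite mulr0z; lra.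
  - by exfalso; apply: h2; rewrite absz_nat; move: k0; rewrite -pmulrn; lra.
  - by exfalso; apply: h1; rewrite abszN absz_nat; move: k0; rewrite mulrNz -pmulrn; lra.
have := hP `|k|%N; case: (intP k) k0 kL => [|n|n] k0 kL [h1 [h2 _]].
- by apply: h1; rewrite absz0; move: k0 kL; rewrite mulr0z => -> ->.
- by apply: h1; rewrite absz_nat; move: k0 kL; rewrite -pmulrn => -> ->.
- by apply: h2; rewrite abszN absz_nat; move: k0 kL; rewrite mulrNz -pmulrn mulNr => -> ->.
Qed.

Lemma coef_aeq (f g : R -> R) : int1 f -> int1 g -> periodic f L -> periodic g L ->
  fcoef f = fcoef g -> aeq f g.
Proof.
move=> hf hg pf pg E; have hw := int1B hf hg.
have hc k : mca (fun x => f x - g x) k = 0.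
  rewrite /mca (_ : (fun x => _) = (fun x => f x * cx k x - g x * cx k x)); last first.
    by apply/funext => x; rewrite mulrBl.
  rewrite (tiB (int1_cper hf (@cper_cx R k)) (int1_cper hg (@cper_cx R k))) mulrBl.
  by have := congr1 (fun c => complex.Re (c k)) E; rewrite /= -/(mca f k) -/(mca g k) => ->; rewrite subrr.
have hs k : msa (fun x => f x - g x) k = 0.
  rewrite /msa (_ : (fun x => _) = (fun x => f x * sx k x - g x * sx k x)); last first.
    by apply/funext => x; rewrite mulrBl.
  rewrite (tiB (int1_cper hf (@cper_sx R k)) (int1_cper hg (@cper_sx R k))) mulrBl.
  have := congr1 (fun c => complex.Im (c k)) E; rewrite /= -/(msa f k) -/(msa g k) => /oppr_inj ->.
  by rewrite subrr.
have pw : periodic (fun x => f x - g x) L by move=> x; rewrite pf pg.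
have := ae_periodic pw (ae_eq0_coef hw hc hs).
by apply: aeS => x /eqP; rewrite subr_eq0 => /eqP.
Qed.

End TorusMeasure.

(** * The Riesz-Fischer theorem and weak derivatives *)

Section RieszFischer.
Context {R : realType}.
Notation L := (pi *+ 2 : R).
Notation mu := (@lebesgue_measure R).
Notation tor := (`[0, (pi *+ 2 : R)]%classic).

Lemma L2T_int1 (f : R -> R) : L2T f -> int1 f.
Proof.
move=> [pf mf hf]; split=> //.
have h1 : int1 (fun x => f x ^+ 2) by split; [exact: measurable_funX | exact: hf].
have h2 : int1 (fun _ : R => 1 : R) by apply: int1_cont; exact: ct_cst.
apply: (le_integrable (@mtor R) _ _ (int1D h1 h2).2).
  by apply: measurableT_comp => //; apply: measurable_funS mf.
move=> x _ /=; rewrite lee_fin [leRHS]ger0_norm ?addr_ge0 ?sqr_ge0 //.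
by have := sqr_ge0 (`|f x| - 1); rewrite -[f x ^+ 2]real_normK ?num_real // sqrrB; nra.
Qed.

Lemma cper_L2T (f : R -> R) : cper f -> L2T f.
Proof.
move=> [cf pf]; split=> //; first exact: continuous_measurable_fun.
by apply: (@ct_integrable R (fun x => f x ^+ 2)); ct.
Qed.

Lemma ei_cont (f : R -> R) : continuous f -> (\int[mu]_(x in tor) (f x)%:E = (intg f 0 L)%:E)%E.
Proof.
move=> cf; rewrite -ti_cont // /torus_int /Rintegral fineK //.
exact: (integrable_fin_num (@mtor R) (int1_cont cf).2).
Qed.

Lemma tp_diff_sq (al be : int -> R) N M : sym al be -> (N <= M)%N ->
  intg (fun x => (tp M al be x - tp N al be x) ^+ 2) 0 L / L =
  \sum_(k <- zr M) (al k ^+ 2 + be k ^+ 2) - \sum_(k <- zr N) (al k ^+ 2 + be k ^+ 2).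
Proof.
move=> hs NM; have c1 := (cper_tp N al be).1; have c2 := (cper_tp M al be).1.
have e1 := parseval_tp N hs; have e2 := parseval_tp M hs.
have e3 : intg (fun x => tp M al be x * tp N al be x) 0 L / L =
    \sum_(k <- zr N) (al k ^+ 2 + be k ^+ 2).
  rewrite intg_mul_tp //; apply: eq_big_seq => k; rewrite mem_zr => kN.
  by rewrite ca_tp // sa_tp // mem_zr (leq_trans kN NM) !expr2.
rewrite (intg_ext (g := fun x => tp M al be x ^+ 2 +
   (- 2 * (tp M al be x * tp N al be x) + tp N al be x ^+ 2))) => [|x]; last by ring.
rewrite !intgD; try ct; rewrite intgZ; last by ct.
have e : intg (fun x => tp M al be x * tp N al be x) 0 L = intg (fun x => tp N al be x ^+ 2) 0 L.
  by apply: (mulIf (invr_neq0 (@period_neq0 R))); rewrite e3 e1.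
by rewrite -e1 -e2 e; move: L^-1 => Li; ring.
Qed.

Section Construction.
Variables (al be : int -> R) (M : R).
Hypothesis hsym : sym al be.
Let sg N := \sum_(k <- zr N) (al k ^+ 2 + be k ^+ 2).
Hypothesis hM : forall N, sg N <= M.

Let sg_nd : nondecreasing_seq sg.
Proof.
apply/nondecreasing_seqP => n; rewrite /sg big_zrS lerDl.
by rewrite !addr_ge0 ?sqr_ge0.
Qed.

Let sg_cauchy (e : R) : 0 < e -> exists K, forall m, (K <= m)%N -> sg m - sg K <= e.
Proof.
move=> e0; have cv : cvgn sg.
  by apply: nondecreasing_is_cvgn => //; exists M => _ [n _ <-].
have /cvgrPdist_le/(_ e e0) [K _ /(_ K (leqnn K)) /= hK] := cv.
exists K => m _; have := nondecreasing_cvgn_le sg_nd cv m.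
by have := le_trans (ler_norm _) hK; lra.
Qed.

Let e4 n : (0 : R) < 4^-1 ^+ n. Proof. by rewrite exprn_gt0. Qed.
Let Kf n := sval (cid (sg_cauchy (e4 n))).
Let KfP n : forall m, (Kf n <= m)%N -> sg m - sg (Kf n) <= 4^-1 ^+ n.
Proof. exact: (svalP (cid (sg_cauchy (e4 n)))). Qed.
(** A subsequence whose consecutive partial sums differ by at most [4^-n] in normalised squared L^2
    norm, hence by [L * 2^-n] in L^1. Summing the [(Kf i).+1] makes it monotone and keeps it above
    both [Kf n] and [n]. *)
Let Nn n := (\sum_(i < n.+1) (Kf i).+1)%N.

Let NnS n : (Nn n <= Nn n.+1)%N.
Proof. by rewrite /Nn [in leqRHS]big_ord_recr /= leq_addr. Qed.

Let NnK n : (Kf n <= Nn n)%N.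
Proof. by rewrite /Nn big_ord_recr /=; apply: leq_trans (leq_addl _ _); exact: leqnSn. Qed.

Let Nn_ge n : (n <= Nn n)%N.
Proof.
elim: n => // n IHn; rewrite /Nn big_ord_recr /= -/(Nn n) -addn1.
by apply: leq_add.
Qed.

Let T n := tp (Nn n) al be.
Let cT n : continuous (T n). Proof. exact: (cper_tp _ _ _).1. Qed.
Let dT n x := T n.+1 x - T n x.
Let cdT n : continuous (fun x => `|dT n x|).
Proof. by have c1 : continuous (T n) := @cT n; have c2 : continuous (T n.+1) := @cT n.+1; rewrite /dT; ct. Qed.

Let intg_dT n : intg (fun x => `|dT n x|) 0 L <= L * 2^-1 ^+ n.
Proof.
have L0 := @period_gt0 R.
have h1 := intg_sqr_le (ltW L0) (@cdT n).
have h2 := tp_diff_sq hsym (NnS n); rewrite -/(sg _) -/(sg _) in h2.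
have h3 : intg (fun x => `|dT n x| ^+ 2) 0 L / L <= 4^-1 ^+ n.
  rewrite (intg_ext (g := fun x => (T n.+1 x - T n x) ^+ 2)) => [|x]; last first.
    by rewrite real_normK ?num_real.
  rewrite h2; apply: le_trans (KfP (leq_trans (NnK n) (NnS n))).
  by rewrite lerD2l lerN2; apply: sg_nd.
have a0 : 0 <= intg (fun x => `|dT n x|) 0 L by apply: intg_ge0 => //; rewrite ltW.
have b0 : 0 <= L * 2^-1 ^+ n :> R by rewrite mulr_ge0 ?exprn_ge0 // ltW.
rewrite -ler_sqr ?nnegrE //.
apply: le_trans h1 _; rewrite subr0 exprMn -exprM mulnC exprM.
have -> : (2^-1 : R) ^+ 2 = 4^-1 by field.
by move: h3; rewrite ler_pdivrMr // => h3; rewrite expr2 -mulrA ler_pM2l // mulrC.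
Qed.

Let G x : \bar R := (\sum_(0 <= n <oo) (`|dT n x|)%:E)%E.

Let mG : measurable_fun [set: measurableTypeR R] G.
Proof.
apply: (@ge0_emeasurable_sum _ (measurableTypeR R) R setT (fun n x => (`|dT n x|)%:E) xpredT) => n.
  by move=> x _ _; rewrite lee_fin.
move=> _; apply: measurableT_comp => //.
exact: (continuous_measurable_fun (@cdT n)).
Qed.

Let G0 x : (0 <= G x)%E.
Proof. by apply: nneseries_ge0 => n _ _; rewrite lee_fin. Qed.

Let iG : mu.-integrable tor G.
Proof.
apply/integrableP; split; first exact: measurable_funS mG.
have -> : (\int[mu]_(x in tor) `|G x| = \int[mu]_(x in tor) G x)%E.
  by apply: eq_integral => x _; rewrite gee0_abs.
rewrite (integral_nneseries mu (@mtor R)) => [|n|n x _]; last by rewrite lee_fin.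
  apply: (@le_lt_trans _ _ ((2 * L)%:E)); last exact: ltry.
  apply: lime_le.
    apply: is_cvg_nneseries => n _ _; apply: integral_ge0 => x _; by rewrite lee_fin.
  apply: nearW => n; apply: (@le_trans _ _ ((L * (2 - 2 * 2^-1 ^+ n))%:E)); last first.
    have L0 := @period_gt0 R.
    by rewrite lee_fin mulrC ler_pM2r // gerBl mulr_ge0 // exprn_ge0.
  elim: n => [|n IHn]; first by rewrite big_geq // expr0 mulr1 subrr mulr0.
  have hn : (\int[mu]_(x in tor) (`|dT n x|)%:E <= (L * 2^-1 ^+ n)%:E)%E.
    by rewrite ei_cont ?lee_fin //; exact: cdT.
  rewrite big_nat_recr //=; apply: le_trans (leeD IHn hn) _.
  by rewrite -EFinD lee_fin exprS le_eqVlt; apply/orP; left; apply/eqP; field.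
apply: measurableT_comp => //; apply: measurable_funS (continuous_measurable_fun (@cdT n)) => //.
Qed.

Let E : set R := [set x | (G x < +oo)%E].
Let mE : measurable (E : set (measurableTypeR R)).
Proof. by have := emeasurable_fun_infty_o measurableT mG +oo%E; rewrite setTI. Qed.

(** Cutting off outside [E] makes the sequence converge at every point, so the limit is measurable
    and exactly periodic; [E] is periodic because [G] is. *)
Let T' n x := T n x * \1_E x.

Let T'_bound n x : (`|T' n x|%:E <= `|T 0 x|%:E + G x)%E.
Proof.
rewrite /T' indicE; case: (boolP (x \in E)) => _; last first.
  by rewrite mulr0 normr0 adde_ge0 // lee_fin.
rewrite mulr1; apply: (@le_trans _ _ (`|T 0 x|%:E + \sum_(0 <= i < n) (`|dT i x|)%:E)%E).
  rewrite sumEFin -EFinD lee_fin.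
  have -> : T n x = T 0 x + \sum_(0 <= i < n) dT i x by rewrite telescope_sumr // addrC subrK.
  by apply: le_trans (ler_normD _ _) _; rewrite lerD2l; exact: ler_norm_sum.
by apply: leeD => //; apply: nneseries_lim_ge => i _ _; rewrite lee_fin.
Qed.

Let T'_cvg x : cvgn (T' ^~ x).
Proof.
rewrite /T' indicE; case: (boolP (x \in E)) => [|_]; last first.
  by under eq_fun do rewrite mulr0; exact: is_cvg_cst.
rewrite inE => xE; under eq_fun do rewrite mulr1.
have -> : T ^~ x = (fun n => T 0 x + series (dT ^~ x) n).
  by apply/funext => n; rewrite /series /= telescope_sumr // addrC subrK.
apply: is_cvgD; first exact: is_cvg_cst.
apply: normed_cvg.
rewrite (_ : [normed series _] = (fun n => \sum_(0 <= i < n) `|dT i x|)) //; apply: nondecreasing_is_cvgn.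
  by apply/nondecreasing_seqP => n; rewrite big_nat_recr //= lerDl.
exists (fine (G x)) => _ [n _ <-].
rewrite -lee_fin fineK ?ge0_fin_numE // /series /= -sumEFin.
by apply: nneseries_lim_ge => i _ _; rewrite lee_fin.
Qed.

Let g x := limn (T' ^~ x).
Let T'g x : T' n x @[n --> \oo] --> g x. Proof. exact: T'_cvg. Qed.

Let mT' n : measurable_fun [set: R] (T' n).
Proof.
apply: measurable_funM; first exact: continuous_measurable_fun.
exact: measurable_indic.
Qed.

Let mg : measurable_fun [set: R] g.
Proof. by apply: (@measurable_fun_cvg _ _ _ _ T') => // x _; exact: T'g. Qed.

Let pT' n : periodic (T' n) L.
Proof.
have pT m x : T m (x + L) = T m x by exact: (cper_tp _ _ _).2.
move=> x; rewrite /T' pT; congr (_ * _); rewrite !indicE; congr (nat_of_bool _)%:R.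
have GE : G (x + L) = G x by apply: eq_eseriesr => m _; rewrite /dT !pT.
by apply/idP/idP; rewrite !inE /E /= GE.
Qed.

Let pg : periodic g L.
Proof. by move=> x; rewrite /g; congr (limn _); apply/funext => n; exact: pT'. Qed.

(** Fatou's lemma, with the integrals of [T' n ^+ 2] bounded by [L * M] through Parseval. *)
Let g_L2 : L2T g.
Proof.
split=> //; have mg2 := measurable_funX 2 mg.
have mT2 n : measurable_fun tor (fun x => (T' n x ^+ 2)%:E).
  by apply: measurableT_comp => //; apply: measurable_funS (measurable_funX 2 (@mT' n)).
apply/integrableP; split.
  by apply: measurableT_comp => //; exact: measurable_funS mg2.
have -> : (\int[mu]_(x in tor) `|(g x ^+ 2)%:E| = \int[mu]_(x in tor) limn_einf (fun n => (T' n x ^+ 2)%:E))%E.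
  apply: eq_integral => x _.
  have h : (T' n x ^+ 2)%:E @[n --> \oo] --> (g x ^+ 2)%:E.
    have h0 : T' n x * T' n x @[n --> \oo] --> g x * g x by apply: cvgM; exact: T'g.
    by apply/fine_cvgP; split; [exact: nearW | rewrite /comp /=; exact: h0].
  rewrite is_cvg_limn_einfE; last by apply/cvg_ex; eexists; exact: h.
  by rewrite (cvg_lim (@ereal_hausdorff R) h) gee0_abs // lee_fin sqr_ge0.
apply: le_lt_trans (fatou mu (@mtor R) mT2 _) _; first by move=> n x _; rewrite lee_fin sqr_ge0.
apply: (@le_lt_trans _ _ ((L * M)%:E)); last exact: ltry.
rewrite limn_einf_lim; apply: lime_le; first exact: is_cvg_einfs.
apply: nearW => n; apply: (@le_trans _ _ (\int[mu]_(x in tor) (T' n x ^+ 2)%:E)%E).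
  by apply: ereal_inf_lbound; exists n => //=.
have cT2 : continuous (fun x => T n x ^+ 2) by have c : continuous (T n) := @cT n; ct.
apply: (@le_trans _ _ (\int[mu]_(x in tor) (T n x ^+ 2)%:E)%E).
  have mT : measurable_fun tor (fun x => (T n x ^+ 2)%:E).
    by apply: measurableT_comp => //; apply: measurable_funS (continuous_measurable_fun cT2).
  apply: ge0_le_integral; try exact: mtor; try exact: mT2; try exact: mT;
    try (by move=> x _; rewrite lee_fin sqr_ge0).
  move=> x _; rewrite lee_fin /T' exprMn ler_piMr ?sqr_ge0 // indicE.
rewrite ei_cont // lee_fin; have L0 := @period_gt0 R.
by have := parseval_tp (Nn n) hsym => /(canRL (divfK (@period_neq0 R))) ->; rewrite mulrC ler_pM2l //; exact: hM.
Qed.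

(** Dominated convergence with the integrable majorant [|T 0| + G], which bounds every [T n] on the
    full-measure set [E]. *)
Let g_coef (h : R -> R) l : continuous h -> (forall x, `|h x| <= 1) ->
  (exists N, forall n, (N <= n)%N -> intg (fun x => T n x * h x) 0 L = l) ->
  torus_int (fun x => g x * h x) = l.
Proof.
move=> ch h1 [N hN]; have mh := continuous_measurable_fun ch.
have mTh n : measurable_fun tor (fun x => (T n x * h x)%:E).
  apply: measurableT_comp => //; apply: measurable_funS (continuous_measurable_fun _) => //.
  by have c : continuous (T n) := @cT n; ct.
have mgh : measurable_fun tor (fun x => (g x * h x)%:E).
  by apply: measurableT_comp => //; apply: measurable_funS (measurable_funM mg mh).
have c0 : continuous (fun x => `|T 0 x|) by have c : continuous (T 0) := @cT 0; ct.
have iD := integrableD (@mtor R) (int1_cont c0).2 iG.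
have aeE : {ae mu, forall x, tor x -> E x}.
  have := integrable_ae (@mtor R) iG; apply: aeS => x hx /hx.
  by rewrite /E /= ge0_fin_numE.
have T'E n x : E x -> T' n x = T n x by move=> xE; rewrite /T' indicE mem_set ?mulr1.
have [|||_ _] := @dominated_convergence _ _ _ mu tor (@mtor R)
   (fun n x => (T n x * h x)%:E) (fun x => (g x * h x)%:E) (fun x => `|T 0 x|%:E + G x)%E mTh mgh.
- apply: aeS aeE => x hx /hx xE; apply/fine_cvgP; split; first exact: nearW.
  apply: cvgM; last exact: cvg_cst.
  by have := @T'g x; under eq_fun do rewrite T'E //.
- exact: iD.
- apply: aeS aeE => x hx n /hx xE; rewrite -(T'E n x xE); apply: le_trans (@T'_bound n x).
  by rewrite lee_fin normrM ler_piMr.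
move=> H; rewrite /torus_int /Rintegral.
have H2 : (\int[mu]_(x in tor) (T n x * h x)%:E)%E @[n --> \oo] --> l%:E.
  apply: cvg_near_cst; exists N => // n /= Nn'; rewrite ei_cont ?hN //.
  by have c : continuous (T n) := @cT n; ct.
by rewrite -(cvg_lim (@ereal_hausdorff R) H) (cvg_lim (@ereal_hausdorff R) H2).
Qed.

Lemma riesz_fischer : exists2 g : R -> R, L2T g &
  (forall k, mca g k = al k) /\ (forall k, msa g k = be k).
Proof.
exists g; first exact: g_L2.
split=> k.
  rewrite /mca (@g_coef (cx k) (al k * L)) ?mulfK ?period_neq0 //; first exact: ct_cx.
    by move=> x; exact: cos_max.
  exists `|k|%N => n kn; apply: (mulIf (invr_neq0 (@period_neq0 R))).
  rewrite mulfK ?period_neq0 // -/(ca (T n) k) ca_tp // mem_zr.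
  by rewrite (leq_trans kn (Nn_ge n)).
rewrite /msa (@g_coef (sx k) (be k * L)) ?mulfK ?period_neq0 //; first exact: ct_sx.
  by move=> x; exact: sin_max.
exists `|k|%N => n kn; apply: (mulIf (invr_neq0 (@period_neq0 R))).
rewrite mulfK ?period_neq0 // -/(sa (T n) k) sa_tp // mem_zr.
by rewrite (leq_trans kn (Nn_ge n)).
Qed.

End Construction.

Lemma dxE (c : int -> R[i]) k :
  dx c k = Complex (- k%:~R * complex.Im (c k)) (k%:~R * complex.Re (c k)).
Proof.
rewrite /dx -complexiE; have -> : (k%:~R : R[i]) = (k%:~R : R)%:C%C by rewrite rmorph_int.
by case: (c k) => x y /=; apply/eqP; rewrite eq_complex /=; apply/andP; split; apply/eqP; ring.
Qed.

(** [wderiv] is a choice, so only its coefficients are known. Riesz-Fischer ensures that there is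
    something to choose, since [H1le_coef] makes [k * ca y k] and [k * sa y k] square summable. *)
Lemma wderiv_spec E (y : R -> R) : H1le E y ->
  [/\ int1 (wderiv y), forall k, mca (wderiv y) k = k%:~R * sa y k &
   forall k, msa (wderiv y) k = - k%:~R * ca y k].
Proof.
move=> H; have cy := (H1le_cper H).1; have hs := sym_coef cy.
have hs2 : sym (fun k => k%:~R * sa y k) (fun k => - k%:~R * ca y k).
  by move=> k; rewrite mulrNz (hs k).1 (hs k).2; split; ring.
have [|g hg [h1 h2]] := @riesz_fischer _ _ (E / L) hs2.
  move=> N; apply: le_trans (H1le_coef N H); apply: ler_sum => k _.
  have := sqr_ge0 (ca y k); have := sqr_ge0 (sa y k).
  by rewrite !exprMn sqrrN; nra.
have : [set g : R -> R | L2T g /\ fcoef g = dx (fcoef y)] (wderiv y).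
  apply: xgetPex; exists g; split=> //; apply/funext => k.
  by rewrite dxE !fcoefE /= (mca_cont k cy) (msa_cont k cy) h1 h2 mulrNN mulNr opprK.
move=> [/L2T_int1 hi hc]; split=> // k.
  have := congr1 (fun c => complex.Re (c k)) hc.
  by rewrite dxE !fcoefE /= (msa_cont k cy) mulrNN.
have := congr1 (fun c => complex.Im (c k)) hc.
by rewrite dxE !fcoefE /= (mca_cont k cy) => /eqP; rewrite eqr_oppLR mulNr => /eqP.
Qed.

(** Against trigonometric polynomials the formula is an identity between coefficients. For [psi] of
    class C^2 the Fourier sums of both [psi] and [dpsi] converge uniformly, and [g] and [y] are
    integrable. *)
Lemma weak_by_parts (y g psi dpsi ddpsi : R -> R) : cper y -> int1 g ->
  (forall k, mca g k = k%:~R * sa y k) -> (forall k, msa g k = - k%:~R * ca y k) ->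
  periodic psi L -> (forall x, is_derive x (1 : R) psi (dpsi x)) ->
  (forall x, is_derive x (1 : R) dpsi (ddpsi x)) -> continuous ddpsi ->
  torus_int (fun x => g x * psi x) = - intg (fun x => y x * dpsi x) 0 L.
Proof.
move=> hy ig hc hs pp d1 d2 cdd; have cp := dv_ct d1; have cdp := dv_ct d2.
have pdp := per_derive pp d1; have iy := int1_cont hy.1.
have L0 := @period_gt0 R.
have cydp : continuous (fun x => y x * dpsi x) by have := hy.1 => cy; ct.
rewrite -ti_cont //; apply/eqP; rewrite -addr_eq0 -normr_le0; apply/ler_addgt0Pr => e e0; rewrite add0r.
set A := torus_int (fun x => `|g x|); set B := torus_int (fun x => `|y x|).
have A0 : 0 <= A by apply: Rintegral_ge0.
have B0 : 0 <= B by apply: Rintegral_ge0.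
pose r := e / (A + B + 1); have AB : 0 < A + B + 1 by rewrite ltr_wpDl ?addr_ge0.
have r0 : 0 < r by rewrite divr_gt0.
have [N1 h1] := H1le_series (C1_H1le pp d1 cdp) r0.
have [N2 h2] := H1le_series (C1_H1le pdp d2 cdd) r0.
pose N := maxn N1 N2; pose k := tp N (ca psi) (sa psi); pose dk := tp N (ca dpsi) (sa dpsi).
have hk : cper k by exact: cper_tp. have hdk : cper dk by exact: cper_tp.
have hp : cper psi by []. have hdp : cper dpsi by [].
have z : torus_int (fun x => g x * k x) + torus_int (fun x => y x * dk x) = 0.
  apply: (mulIf (invr_neq0 (@period_neq0 R))); rewrite mul0r mulrDl !ti_mul_tp //.
  rewrite -big_split big1 // => j _ /=; rewrite hc hs mca_cont ?msa_cont ?hy.1 //.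
  + by have [-> ->] := coef_derive j d1 cdp pp; ring.
  + exact: hy.1.
  + exact: hy.1.
have e1 : torus_int (fun x => g x * psi x) = torus_int (fun x => g x * (psi x - k x)) +
    torus_int (fun x => g x * k x).
  rewrite -tiD; [|by apply: int1_cper => //; apply: cperD => //; exact: cperN|exact: int1_cper].
  by congr torus_int; apply/funext => x; rewrite -mulrDr subrK.
have e2 : torus_int (fun x => y x * dpsi x) = torus_int (fun x => y x * (dpsi x - dk x)) +
    torus_int (fun x => y x * dk x).
  rewrite -tiD; [|by apply: int1_cper => //; apply: cperD => //; exact: cperN|exact: int1_cper].
  by congr torus_int; apply/funext => x; rewrite -mulrDr subrK.
have b1 : `|torus_int (fun x => g x * (psi x - k x))| <= r * A.
  apply: ti_mul_le => //; first by have c1 := hk.1; ct.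
  by move=> x; rewrite distrC; apply: h1; rewrite leq_maxl.
have b2 : `|torus_int (fun x => y x * (dpsi x - dk x))| <= r * B.
  apply: ti_mul_le => //; first by have c1 := hdk.1; ct.
  by move=> x; rewrite distrC; apply: h2; rewrite leq_maxr.
rewrite e1 e2 addrACA z addr0; apply: le_trans (ler_normD _ _) _; apply: le_trans (lerD b1 b2) _.
rewrite -mulrDr /r mulrAC ler_pdivrMr // ler_pM2l //; lra.
Qed.

End RieszFischer.

(** * Sobolev norms and the flow *)

Section SobolevNorm.
Context {R : realType}.
Notation L := (pi *+ 2 : R).

Definition hw (s : R) (f : R -> R) (k : int) : R :=
  (1 + k%:~R ^+ 2) `^ s * (mca f k ^+ 2 + msa f k ^+ 2).

Lemma hw_ge0 s f k : 0 <= hw s f k.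
Proof. by rewrite mulr_ge0 ?powR_ge0 ?addr_ge0 ?sqr_ge0. Qed.

Lemma hw1 f k : hw 1 f k = (1 + k%:~R ^+ 2) * (mca f k ^+ 2 + msa f k ^+ 2).
Proof. by rewrite /hw powRr1 // addr_ge0 ?sqr_ge0. Qed.

Lemma HnormE s (f : R -> R) : Hnorm s f = sqrte (\esum_(k in [set: int]) (hw s f k)%:E).
Proof. by rewrite /Hnorm; congr sqrte; apply: eq_esum => k _; rewrite fcoefE /= sqrrN. Qed.

Lemma sum_le_zr (F : int -> R) (s : seq int) N : (forall k, 0 <= F k) -> uniq s ->
  (forall k, k \in s -> (`|k| <= N)%N) -> \sum_(k <- s) F k <= \sum_(k <- zr N) F k.
Proof.
move=> F0 us sN; rewrite [leRHS](bigID (fun k => k \in s)) /=.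
have -> : \sum_(k <- zr N | k \in s) F k = \sum_(k <- s) F k.
  rewrite -big_filter; apply: perm_big; apply: uniq_perm => //; first by rewrite filter_uniq // zr_uniq.
  by move=> k; rewrite mem_filter mem_zr /=; case: (boolP (k \in s)) => // /sN ->.
by rewrite lerDl; apply: sumr_ge0.
Qed.

Lemma Hnorm_ge0 s (f : R -> R) : (0 <= Hnorm s f)%E.
Proof. exact: sqrte_ge0. Qed.

(** The sum over all integers is a supremum over finite sets, each contained in a symmetric
    window. *)
Lemma Hnorm_le s (f : R -> R) (M : R) : 0 <= M ->
  (forall N, \sum_(k <- zr N) hw s f k <= M ^+ 2) -> (Hnorm s f <= M%:E)%E.
Proof.
move=> M0 hM; have -> : M%:E = sqrte (M ^+ 2)%:E.
  by rewrite EFin_expe sqrte_sqr gee0_abs // lee_fin.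
rewrite HnormE lee_sqrt ?lee_fin ?sqr_ge0 //; apply: ge_ereal_sup => _ [A [fA _] <-].
rewrite fsbig_finite //= sumEFin lee_fin.
pose N := (\max_(k <- finmap.enum_fset (fset_set A)) `|k|)%N.
apply: (@le_trans _ _ (\sum_(k <- zr N) hw s f k)); last exact: hM.
apply: sum_le_zr; [exact: hw_ge0 | exact: finmap.fset_uniq |].
by move=> k kA; rewrite /N; apply: leq_bigmax_seq.
Qed.

Lemma Hnorm_ge s (f : R -> R) (M : R) N : (Hnorm s f <= M%:E)%E ->
  \sum_(k <- zr N) hw s f k <= M ^+ 2.
Proof.
move=> hM; have M0 : 0 <= M by rewrite -lee_fin; apply: le_trans hM; exact: Hnorm_ge0.
rewrite -lee_fin; apply: (@le_trans _ _ (\esum_(k in [set: int]) (hw s f k)%:E)%E).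
  apply: esum_ge; exists [set` zr N]; first by split; [exact: finite_seq | by []].
  by rewrite -fsbig_seq ?zr_uniq // sumEFin.
have e0 : (0 <= \esum_(k in [set: int]) (hw s f k)%:E)%E.
  by apply: esum_ge0 => k _; rewrite lee_fin hw_ge0.
rewrite HnormE in hM; rewrite -(sqr_sqrte e0) EFin_expe !expe2.
by apply: lee_pmul => //; exact: sqrte_ge0.
Qed.

Lemma H1le_Hnorm E (y : R -> R) : H1le E y -> (Hnorm 1 y <= (Num.sqrt (E / L))%:E)%E.
Proof.
move=> H; have cy := (H1le_cper H).1; apply: Hnorm_le; first exact: sqrtr_ge0.
have hN N : \sum_(k <- zr N) hw 1 y k <= E / L.
  apply: le_trans (H1le_coef N H); apply: ler_sum => k _.
  by rewrite hw1 mca_cont // msa_cont.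
move=> N; rewrite sqr_sqrtr //; apply: le_trans (hN 0%N); apply: sumr_ge0 => k _; exact: hw_ge0.
Qed.

Lemma H1le_H1T E (y : R -> R) : H1le E y -> H1T y.
Proof.
move=> H; split; first exact: (cper_L2T (H1le_cper H)).
by apply: le_lt_trans (H1le_Hnorm H) _; exact: ltry.
Qed.

Lemma fcoef_eq (f h : R -> R) : (forall k, mca f k = mca h k) -> (forall k, msa f k = msa h k) ->
  fcoef f = fcoef h.
Proof. by move=> h1 h2; apply/funext => k; rewrite !fcoefE h1 h2. Qed.

(** The Fourier series of [f] converges uniformly by [trig_series]; its sum has the coefficients of
    [f], hence equals [f] almost everywhere by [coef_aeq]. *)
Lemma H1T_rep (f : R -> R) (M : R) : L2T f -> (Hnorm 1 f <= M%:E)%E ->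
  exists S, [/\ H1le (L * M ^+ 2) S, aeq f S, forall k, mca f k = ca S k & forall k, msa f k = sa S k].
Proof.
move=> hf hM; have i1 := L2T_int1 hf.
have hs : sym (mca f) (msa f).
  move=> k; rewrite /mca /msa; split.
    by congr (torus_int _ / _); apply/funext => x; rewrite cxN.
  rewrite -mulNr -mulN1r -tiZ; last by apply: int1_cper => //; exact: cper_sx.
  by congr (torus_int _ / _); apply/funext => x; rewrite sxN; ring.
have [|S [HS hc hs' _]] := @trig_series R _ _ (M ^+ 2) hs.
  by move=> N; apply: le_trans (Hnorm_ge N hM); apply: ler_sum => k _; rewrite hw1.
have hS := H1le_cper HS; exists S; split=> //.
apply: coef_aeq => //; [exact: int1_cont hS.1 | by case: hf | exact: hS.2 |].
by apply: fcoef_eq => k; [rewrite (mca_cont k hS.1) hc | rewrite (msa_cont k hS.1) hs'].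
Qed.

Lemma H1T_Hnorm_fin (f : R -> R) : H1T f -> exists2 M : R, 0 <= M & (Hnorm 1 f <= M%:E)%E.
Proof.
move=> [_ fin]; exists (fine (Hnorm 1 f)); first by apply: fine_ge0; exact: Hnorm_ge0.
by rewrite fineK // ge0_fin_numE // Hnorm_ge0.
Qed.

Lemma H1le_mul (c dc y : R -> R) (m E : R) : 0 <= m -> periodic c L ->
  (forall x, is_derive x (1 : R) c (dc x)) -> continuous dc ->
  (forall x, `|c x| <= m) -> (forall x, `|dc x| <= m) -> H1le E y ->
  H1le (3 * m ^+ 2 * E) (fun x => c x * y x).
Proof.
move=> m0 pc hc cdc cm dcm H e e0; have cc := dv_ct hc.
have e1 : 0 < e / (m + 1) by rewrite divr_gt0 // ltr_wpDl.
have [z [dz [pz hz cdz hE hzy]]] := H _ e1; have cz := dv_ct hz.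
exists (fun x => c x * z x), (fun x => dc x * z x + c x * dz x); split.
- by move=> x; rewrite pc pz.
- by move=> x; have h1 := hc x; have h2 := hz x; dv; ring.
- by ct.
(* The factor 3: [(dc * z + c * dz)^2] is at most twice the sum of the two squares, and [(c * z)^2]
   adds a third copy of [m^2 * z^2]. *)
- rewrite (le_trans _ (ler_wpM2l _ hE)) //; last by rewrite mulr_ge0 ?sqr_ge0.
  rewrite /energy -intgZ; last by ct.
  apply: intg_le; [exact: period_ge0 | by ct | by ct | move=> x _].
  have q1 : c x ^+ 2 <= m ^+ 2 by rewrite -[c x ^+ 2]real_normK ?num_real // lerXn2r ?nnegrE.
  have q2 : dc x ^+ 2 <= m ^+ 2 by rewrite -[dc x ^+ 2]real_normK ?num_real // lerXn2r ?nnegrE.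
  have z2 := sqr_ge0 (z x); have dz2 := sqr_ge0 (dz x).
  have p1 := ler_wpM2r z2 q1; have p2 := ler_wpM2r z2 q2; have p3 := ler_wpM2r dz2 q1.
  have := sqr_ge0 (dc x * z x - c x * dz x); rewrite !exprMn in p1 p2 p3 *.
  by have -> : (dc x * z x - c x * dz x) ^+ 2 = 2 * (dc x ^+ 2 * z x ^+ 2) + 2 * (c x ^+ 2 * dz x ^+ 2)
     - (dc x * z x + c x * dz x) ^+ 2 by [ring]; nra.
- move=> x; rewrite -mulrBr normrM; apply: (@le_trans _ _ (m * (e / (m + 1)))).
    by apply: ler_pM.
  by rewrite mulrCA ler_piMr ?(ltW e0) // ler_pdivrMr ?ltr_wpDl // mul1r lerDl.
Qed.

Lemma H1le_add (y1 y2 : R -> R) (E1 E2 : R) : H1le E1 y1 -> H1le E2 y2 ->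
  H1le (2 * E1 + 2 * E2) (fun x => y1 x + y2 x).
Proof.
move=> H1 H2 e e0; have e1 : 0 < e / 2 by rewrite divr_gt0.
have [z1 [d1 [p1 h1 c1 E1' a1]]] := H1 _ e1; have [z2 [d2 [p2 h2 c2 E2' a2]]] := H2 _ e1.
have cz1 := dv_ct h1; have cz2 := dv_ct h2.
exists (fun x => z1 x + z2 x), (fun x => d1 x + d2 x); split.
- by move=> x; rewrite p1 p2.
- by move=> x; have q1 := h1 x; have q2 := h2 x; dv.
- by ct.
- apply: le_trans (lerD (ler_wpM2l _ E1') (ler_wpM2l _ E2')) => //.
  rewrite /energy -!intgZ -?intgD; try ct.
  apply: intg_le; [exact: period_ge0 | by ct | by ct | move=> x _].
  by have := sqr_ge0 (z1 x - z2 x); have := sqr_ge0 (d1 x - d2 x); rewrite !expr2; nra.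
- by move=> x; rewrite opprD addrACA; apply: le_trans (ler_normD _ _) _; have := a1 x; have := a2 x; lra.
Qed.

Lemma H1le_mono E E' (y : R -> R) : E <= E' -> H1le E y -> H1le E' y.
Proof.
move=> EE H e e0; have [z [dz [h1 h2 h3 h4 h5]]] := H e e0.
by exists z, dz; split=> //; exact: le_trans h4 EE.
Qed.

Lemma H1le_small (y dy : R -> R) (m : R) : 0 <= m -> periodic y L ->
  (forall x, is_derive x (1 : R) y (dy x)) -> continuous dy ->
  (forall x, `|y x| <= m) -> (forall x, `|dy x| <= m) -> H1le (2 * L * m ^+ 2) y.
Proof.
move=> m0 py hy cdy ym dym; have cy := dv_ct hy; apply: H1le_mono (C1_H1le py hy cdy).
have -> : 2 * L * m ^+ 2 = intg (fun=> 2 * m ^+ 2) 0 L by rewrite intg_cst subr0; ring.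
apply: intg_le; [exact: period_ge0 | by ct | by ct | move=> x _].
have q1 : y x ^+ 2 <= m ^+ 2 by rewrite -[y x ^+ 2]real_normK ?num_real // lerXn2r ?nnegrE.
have q2 : dy x ^+ 2 <= m ^+ 2 by rewrite -[dy x ^+ 2]real_normK ?num_real // lerXn2r ?nnegrE.
lra.
Qed.

(** [6 * E] and [4 * L] arise when [H1le_add] doubles the bounds of [H1le_mul] and [H1le_small];
    dividing by [L] passes from the energy to the squared [Hnorm]. *)
Definition small_cst (E : R) := Num.sqrt ((6 * E + 4 * L) / L).

(** The bound is linear in the C^1 size [m] of the factors while [y] is kept. Applied to increments
    of the factors, it gives convergence in H^1 without further regularity of [y]. *)
Lemma H1le_combo (c dc y B dB : R -> R) (m E : R) : 0 <= m -> 0 <= E -> periodic c L -> periodic B L ->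
  (forall x, is_derive x (1 : R) c (dc x)) -> continuous dc ->
  (forall x, is_derive x (1 : R) B (dB x)) -> continuous dB ->
  (forall x, `|c x| <= m /\ `|dc x| <= m) -> (forall x, `|B x| <= m /\ `|dB x| <= m) -> H1le E y ->
  H1le (m ^+ 2 * (6 * E + 4 * L)) (fun x => c x * y x + B x) /\
  (Hnorm 1 (fun x => c x * y x + B x)%R <= (m * small_cst E)%:E)%E.
Proof.
move=> m0 E0 pc pB hc cdc hB cdB cm Bm H.
have h1 := H1le_mul m0 pc hc cdc (fun x => (cm x).1) (fun x => (cm x).2) H.
have h2 := H1le_small m0 pB hB cdB (fun x => (Bm x).1) (fun x => (Bm x).2).
have h3 : H1le (m ^+ 2 * (6 * E + 4 * L)) (fun x => c x * y x + B x).
  by apply: H1le_mono (H1le_add h1 h2); rewrite le_eqVlt; apply/orP; left; apply/eqP; ring.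
split=> //; apply: le_trans (H1le_Hnorm h3) _; rewrite lee_fin -mulrA sqrtrM ?sqr_ge0 //.
by rewrite sqrtr_sqr ger0_norm.
Qed.

Lemma unif_diff_per (F dF : R -> R -> R) (t e : R) :
    (forall t x, is_derive t (1 : R) (F^~ x) (dF t x)) ->
    continuous (fun z : R * R => dF z.1 z.2) ->
    (forall t, periodic (F t) L) -> (forall t, periodic (dF t) L) -> 0 < e ->
  \forall h \near 0, forall x, `|F (t + h) x - F t x - dF t x * h| <= e * `|h|.
Proof.
move=> hF cdF pF pdF e0; apply: filterS (unif_diff 0 L t hF cdF e0) => h H x.
have [k /andP[k0 kL]] := @period_reduce R x.
rewrite -(period_int x k (pF _)) -(period_int x k (pF t)) -(period_int x k (pdF t)).
by apply: H; rewrite k0 ltW.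
Qed.

Lemma tube_per (F : R -> R -> R) (t e : R) :
    continuous (fun z : R * R => F z.1 z.2) -> (forall t, periodic (F t) L) -> 0 < e ->
  \forall h \near 0, forall x, `|F (t + h) x - F t x| <= e.
Proof.
move=> cF pF e0.
have h0 : (t + h) @[h --> (0 : R)] --> t.
  by rewrite -[X in _ --> X]addr0; apply: cvgD; [exact: cvg_cst | exact: cvg_id].
have H0 : \forall h \near (0 : R), forall x, 0 <= x <= L -> `|F (t + h) x - F t x| < e.
  exact: (h0 _ (tube 0 L t cF e0)).
apply: filterS H0 => h H x.
have [k /andP[k0 kL]] := @period_reduce R x.
by rewrite -(period_int x k (pF _)) -(period_int x k (pF t)) ltW // H // k0 ltW.
Qed.

Lemma dvM2 (f g : R -> R) (x df dg l : R) : is_derive x (1 : R) f df -> is_derive x (1 : R) g dg ->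
  df * g x + f x * dg = l -> is_derive x (1 : R) (fun y => f y * g y) l.
Proof. by move=> h1 h2 <-; dv; ring. Qed.

Lemma dvMM2 (f g k j : R -> R) (x df dg dk dj l : R) : is_derive x (1 : R) f df ->
  is_derive x (1 : R) g dg -> is_derive x (1 : R) k dk -> is_derive x (1 : R) j dj ->
  (df * g x + f x * dg) + (dk * j x + k x * dj) = l ->
  is_derive x (1 : R) (fun y => f y * g y + k y * j y) l.
Proof. by move=> h1 h2 h3 h4 <-; dv; ring. Qed.

Lemma dvNM2 (f g k : R -> R) (x df dg dk : R) : is_derive x (1 : R) f df ->
  is_derive x (1 : R) g dg -> is_derive x (1 : R) k dk ->
  is_derive x (1 : R) (fun y => - f y * g y + k y) (- df * g x - f x * dg + dk).
Proof. by move=> h1 h2 h3; dv; ring. Qed.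

Lemma dv_quot (c : R) (f g k : R -> R) (x df dg dk : R) : is_derive x (1 : R) f df ->
  is_derive x (1 : R) g dg -> is_derive x (1 : R) k dk ->
  is_derive x (1 : R) (fun y => c * (f y - g y) - k y) (c * (df - dg) - dk).
Proof. by move=> h1 h2 h3; dv; ring. Qed.

End SobolevNorm.

(** * The flow as a continuously differentiable curve in H^1 *)

Section FlowH1.
Context {R : realType}.
Notation L := (pi *+ 2 : R).
Variables (g beta dbeta c0 c1 S : R -> R) (u : R -> R -> R) (E : R).
Hypothesis (cg : continuous g) (hbeta : cper beta) (hc0 : cper c0) (hc1 : cper c1).
Hypothesis (dv_beta : forall x, is_derive x (1 : R) beta (dbeta x)) (cdbeta : continuous dbeta).
Hypothesis (fu : is_flow g beta c0 c1 S u) (E0 : 0 <= E) (HS : H1le E S).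

Let cbeta := hbeta.1.
Let cu : continuous (fun z : R * R => u z.1 z.2). Proof. by case: fu. Qed.
Let hu t : cper (u t). Proof. exact: flow_cper fu. Qed.
Let sm t := smth g c0 c1 (u t).
Let dsm t := dsmth g c0 c1 (u t).
Let csm : continuous (fun z : R * R => sm z.1 z.2). Proof. exact: ct_smth. Qed.
Let cdsm : continuous (fun z : R * R => dsm z.1 z.2). Proof. exact: ct_dsmth. Qed.
Let dsm_dv t x : is_derive x (1 : R) (sm t) (dsm t x). Proof. exact: dv_smth. Qed.
Let D t x := duh g beta c0 c1 u t x.
Let dD t x := dduh g beta dbeta c0 c1 u t x.
Let cD : continuous (fun z : R * R => D z.1 z.2). Proof. exact: (ct_duh cg hbeta hc0 hc1 fu). Qed.
Let cdD : continuous (fun z : R * R => dD z.1 z.2).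
Proof. exact: (ct_dduh cg hbeta hc0 hc1 cdbeta fu). Qed.

(** Duhamel's formula reads [u = rho * S + Y], where the rough datum [S] does not move in time. The
    suffixes name the derivatives of [rho] and [Y] in [t] and [x], all of them continuous. *)
Let rho t x := expR (- (beta x * t)).
Let rhox t x := - (dbeta x * t) * rho t x.
Let rhot t x := - beta x * rho t x.
Let rhotx t x := - dbeta x * rho t x + beta x * (dbeta x * t) * rho t x.
Let Y t x := rho t x * D t x.
Let Yx t x := rhox t x * D t x + rho t x * dD t x.
Let Yt t x := - beta x * Y t x + sm t x.
Let Ytx t x := - dbeta x * Y t x - beta x * Yx t x + dsm t x.

Let crho : continuous (fun z : R * R => rho z.1 z.2). Proof. by rewrite /rho; ct. Qed.
Let crhox : continuous (fun z : R * R => rhox z.1 z.2). Proof. by rewrite /rhox; ct. Qed.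
Let crhot : continuous (fun z : R * R => rhot z.1 z.2). Proof. by rewrite /rhot; ct. Qed.
Let crhotx : continuous (fun z : R * R => rhotx z.1 z.2). Proof. by rewrite /rhotx; ct. Qed.
Let cY : continuous (fun z : R * R => Y z.1 z.2). Proof. by rewrite /Y; ct. Qed.
Let cYx : continuous (fun z : R * R => Yx z.1 z.2). Proof. by rewrite /Yx; ct. Qed.
Let cYt : continuous (fun z : R * R => Yt z.1 z.2). Proof. by rewrite /Yt; ct. Qed.
Let cYtx : continuous (fun z : R * R => Ytx z.1 z.2). Proof. by rewrite /Ytx; ct. Qed.

Let slice (F : R -> R -> R) t : continuous (fun z : R * R => F z.1 z.2) -> continuous (F t).
Proof. by move=> cF; apply: (ct_comp2 (u := F)) => //; [exact: ct_cst | exact: ct_id]. Qed.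

Let rho_x t x : is_derive x (1 : R) (rho t) (rhox t x).
Proof. by have h := dv_beta x; rewrite /rhox /rho; dv; ring. Qed.
Let rhot_x t x : is_derive x (1 : R) (rhot t) (rhotx t x).
Proof. by have h := dv_beta x; have h2 := rho_x t x; rewrite /rhot /rhotx /rhox; dv; rewrite /rhox; ring. Qed.
Let rho_t t x : is_derive t (1 : R) (rho^~ x) (rhot t x).
Proof. by rewrite /rhot /rho; dv; ring. Qed.
Let rhox_t t x : is_derive t (1 : R) (rhox^~ x) (rhotx t x).
Proof. by have h := rho_t t x; rewrite /rhox /rhotx; dv; rewrite /rhot; ring. Qed.

Let D_t t x : is_derive t (1 : R) (D^~ x) (expR (beta x * t) * sm t x).
Proof. exact: (dv_duh_t cg hc0 hc1 fu t x). Qed.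
Let dD_t t x : is_derive t (1 : R) (dD^~ x) (expR (beta x * t) * (dbeta x * t * sm t x + dsm t x)).
Proof. exact: (dv_dduh_t dbeta cg hc0 hc1 fu t x). Qed.
Let D_x t x : is_derive x (1 : R) (D t) (dD t x).
Proof. exact: (dv_duh_x cg hbeta hc0 hc1 dv_beta cdbeta fu). Qed.

Let rhoK t x : rho t x * expR (beta x * t) = 1.
Proof. by rewrite /rho -expRD addNr expR0. Qed.

Let Y_x t x : is_derive x (1 : R) (Y t) (Yx t x).
Proof. exact: (dvM2 (rho_x t x) (D_x t x) (erefl _)). Qed.
Let Yt_x t x : is_derive x (1 : R) (Yt t) (Ytx t x).
Proof. exact: (dvNM2 (dv_beta x) (Y_x t x) (dsm_dv t x)). Qed.
Let Y_t t x : is_derive t (1 : R) (Y^~ x) (Yt t x).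
Proof.
notypeclasses refine (dvM2 (rho_t t x) (D_t t x) _); rewrite /Yt /Y /rhot.
have := rhoK t x; move: (expR _) (rho t x) => a r ra.
by rewrite mulrA [r * a]ra; ring.
Qed.
Let Yx_t t x : is_derive t (1 : R) (Yx^~ x) (Ytx t x).
Proof.
notypeclasses refine (dvMM2 (rhox_t t x) (D_t t x) (rho_t t x) (dD_t t x) _).
rewrite /Ytx /Y /Yx /rhot /rhotx /rhox.
have := rhoK t x; move: (expR _) (rho t x) => a r ra.
apply/eqP; rewrite -subr_eq0; apply/eqP; transitivity ((r * a - 1) * dsm t x); first by ring.
by rewrite ra subrr mul0r.
Qed.

Lemma flow_split t x : u t x = rho t x * S x + Y t x.
Proof. by rewrite (duhamel fu) mulrDr. Qed.

Let ut t := rhs g beta c0 c1 (u t).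

Lemma rhs_split t x : ut t x = rhot t x * S x + Yt t x.
Proof. by rewrite /ut rhs_smth flow_split /rhot /Yt /sm; ring. Qed.

Let prho t : periodic (rho t) L. Proof. by move=> x; rewrite /rho hbeta.2. Qed.
Let prhot t : periodic (rhot t) L. Proof. by move=> x; rewrite /rhot prho hbeta.2. Qed.
Let prhox t : periodic (rhox t) L. Proof. exact: per_derive (prho t) (rho_x t). Qed.
Let prhotx t : periodic (rhotx t) L. Proof. exact: per_derive (prhot t) (rhot_x t). Qed.
Let pY t : periodic (Y t) L.
Proof.
have e y : Y t y = u t y - rho t y * S y by rewrite flow_split; ring.
by move=> x; rewrite !e (hu t).2 prho (H1le_cper HS).2.
Qed.
Let put t : periodic (ut t) L. Proof. exact: (cper_rhs cg hbeta hc0 hc1 (hu t)).2. Qed.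
Let pYt t : periodic (Yt t) L.
Proof.
have e y : Yt t y = ut t y - rhot t y * S y by rewrite rhs_split; ring.
by move=> x; rewrite !e put prhot (H1le_cper HS).2.
Qed.
Let pYx t : periodic (Yx t) L. Proof. exact: per_derive (pY t) (Y_x t). Qed.
Let pYtx t : periodic (Ytx t) L. Proof. exact: per_derive (pYt t) (Yt_x t). Qed.

Let split_H1 (r rx B Bx : R -> R) : periodic r L -> periodic B L ->
  (forall x, is_derive x (1 : R) r (rx x)) -> continuous rx ->
  (forall x, is_derive x (1 : R) B (Bx x)) -> continuous Bx ->
  exists E', H1le E' (fun x => r x * S x + B x).
Proof.
move=> pr pB hr crx hB cBx.
have [m1 h1] := per_bounded (dv_ct hr) pr; have [m2 h2] := per_bounded crx (per_derive pr hr).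
have [m3 h3] := per_bounded (dv_ct hB) pB; have [m4 h4] := per_bounded cBx (per_derive pB hB).
have m1' := le_trans (normr_ge0 _) (h1 0); have m2' := le_trans (normr_ge0 _) (h2 0).
have m3' := le_trans (normr_ge0 _) (h3 0); have m4' := le_trans (normr_ge0 _) (h4 0).
pose m := m1 + m2 + (m3 + m4).
have m0 : 0 <= m by rewrite !addr_ge0.
have [||h _] := @H1le_combo R r rx S B Bx m E m0 E0 pr pB hr crx hB cBx _ _ HS; last by eexists; exact: h.
  by move=> x; have := h1 x; have := h2 x; rewrite /m; lra.
by move=> x; have := h3 x; have := h4 x; rewrite /m; lra.
Qed.

Lemma flow_H1 t : exists E', H1le E' (u t).
Proof.
have [E' h] := @split_H1 (rho t) (rhox t) (Y t) (Yx t) (prho t) (pY t) (rho_x t)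
  (slice (t := t) crhox) (Y_x t) (slice (t := t) cYx).
by exists E'; rewrite (_ : u t = (fun x => rho t x * S x + Y t x)) //; apply/funext => x; exact: flow_split.
Qed.

Lemma rhs_H1 t : exists E', H1le E' (ut t).
Proof.
have [E' h] := @split_H1 (rhot t) (rhotx t) (Yt t) (Ytx t) (prhot t) (pYt t) (rhot_x t)
  (slice (t := t) crhotx) (Yt_x t) (slice (t := t) cYtx).
by exists E'; rewrite (_ : ut t = (fun x => rhot t x * S x + Yt t x)) //; apply/funext => x; exact: rhs_split.
Qed.

Lemma rhs_cvg_H1 t (e : R) : 0 < e ->
  \forall h \near 0, (Hnorm 1 (fun x => ut (t + h) x - ut t x)%R <= (e * small_cst E)%:E)%E.
Proof.
move=> e0; have f1 := tube_per t crhot prhot e0; have f2 := tube_per t crhotx prhotx e0.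
have f3 := tube_per t cYt pYt e0; have f4 := tube_per t cYtx pYtx e0.
apply: filterS (filterI (filterI f1 f2) (filterI f3 f4)) => h [[g1 g2] [g3 g4]].
rewrite (_ : (fun x => _) = (fun x => (rhot (t + h) x - rhot t x) * S x + (Yt (t + h) x - Yt t x))); last first.
  by apply/funext => x; rewrite !rhs_split; ring.
have d1 := slice (t := t) crhotx; have d2 := slice (t := t + h) crhotx.
have d3 := slice (t := t) cYtx; have d4 := slice (t := t + h) cYtx.
apply: (@H1le_combo R _ (fun x => rhotx (t + h) x - rhotx t x) S _ (fun x => Ytx (t + h) x - Ytx t x) e E
  (ltW e0) E0 _ _ _ _ _ _ _ _ HS).2.
- by move=> x; rewrite !prhot.
- by move=> x; rewrite !pYt.
- by move=> x; exact: (dvB (rhot_x (t + h) x) (rhot_x t x)).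
- by ct.
- by move=> x; exact: (dvB (Yt_x (t + h) x) (Yt_x t x)).
- by ct.
- by move=> x; split; [exact: g1 | exact: g2].
- by move=> x; split; [exact: g3 | exact: g4].
Qed.

(** The error of the difference quotient splits into the error for [rho], times [S], plus the error
    for [Y]. These errors and their [x]-derivatives are uniformly small, which is all that
    [H1le_combo] asks. *)
Lemma flow_diff_H1 t (e : R) : 0 < e ->
  \forall h \near 0, h != 0 ->
    (Hnorm 1 (fun x => h^-1 * (u (t + h) x - u t x) - ut t x)%R <= (e * small_cst E)%:E)%E.
Proof.
move=> e0; have f1 := unif_diff_per t rho_t crhot prho prhot e0.
have f2 := unif_diff_per t rhox_t crhotx prhox prhotx e0.
have f3 := unif_diff_per t Y_t cYt pY pYt e0; have f4 := unif_diff_per t Yx_t cYtx pYx pYtx e0.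
apply: filterS (filterI (filterI f1 f2) (filterI f3 f4)) => h [[g1 g2] [g3 g4]] h0.
pose q (F dF : R -> R -> R) x := h^-1 * (F (t + h) x - F t x) - dF t x.
have qle (F dF : R -> R -> R) x : `|F (t + h) x - F t x - dF t x * h| <= e * `|h| -> `|q F dF x| <= e.
  move=> H; have -> : q F dF x = (F (t + h) x - F t x - dF t x * h) * h^-1 by rewrite /q; field.
  by rewrite normrM normfV ler_pdivrMr // normr_gt0.
rewrite (_ : (fun x => _) = (fun x => q rho rhot x * S x + q Y Yt x)); last first.
  by apply/funext => x; rewrite /q !flow_split rhs_split; ring.
have d1 := slice (t := t) crhox; have d2 := slice (t := t + h) crhox; have d3 := slice (t := t) crhotx.
have d4 := slice (t := t) cYx; have d5 := slice (t := t + h) cYx; have d6 := slice (t := t) cYtx.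
apply: (@H1le_combo R _ (q rhox rhotx) S _ (q Yx Ytx) e E (ltW e0) E0 _ _ _ _ _ _ _ _ HS).2.
- by move=> x; rewrite /q !prho prhot.
- by move=> x; rewrite /q !pY pYt.
- by move=> x; exact: (dv_quot h^-1 (rho_x (t + h) x) (rho_x t x) (rhot_x t x)).
- by rewrite /q; ct.
- by move=> x; exact: (dv_quot h^-1 (Y_x (t + h) x) (Y_x t x) (Yt_x t x)).
- by rewrite /q; ct.
- by move=> x; split; apply: qle; [exact: g1 | exact: g2].
- by move=> x; split; apply: qle; [exact: g3 | exact: g4].
Qed.

End FlowH1.

(** * The equation in Fourier coefficients *)

Section Equation.
Context {R : realType}.
Notation L := (pi *+ 2 : R).

Lemma q_gt0 (k : int) : 0 < 1 + k%:~R ^+ 2 :> R.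
Proof. by rewrite ltr_pwDl // sqr_ge0. Qed.

Lemma coef_opK (y : R -> R) k : cper y ->
  ((1 + k%:~R ^+ 2) * ca (opK y) k = ca y k /\ (1 + k%:~R ^+ 2) * sa (opK y) k = sa y k) /\
  ((1 + k%:~R ^+ 2) * ca (opDK y) k = k%:~R * sa y k /\
   (1 + k%:~R ^+ 2) * sa (opDK y) k = - k%:~R * ca y k).
Proof.
move=> hy; have hK := cper_opK hy; have hD := cper_opDK hy.
have cKy : continuous (fun x => opK y x - y x) by have h1 := hK.1; have h2 := hy.1; ct.
have [e1 e2] := coef_derive k (fun x => dv_opK x hy) hD.1 hK.2.
have [e3 e4] := coef_derive k (fun x => dv_opDK x hy) cKy hD.2.
have [f1 f2] := coef_sub k hK.1 hy.1.
have g1 : (1 + k%:~R ^+ 2) * ca (opK y) k = ca y k.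
  by move: e3; rewrite f1 e2; move: (ca _ _) (ca _ _) (k%:~R : R) => p q r e3; nra.
have g2 : (1 + k%:~R ^+ 2) * sa (opK y) k = sa y k.
  by move: e4; rewrite f2 e1; move: (sa _ _) (sa _ _) (k%:~R : R) => p q r e4; nra.
by split=> //; rewrite e1 e2 -g1 -g2; split; ring.
Qed.

Lemma coef_add (y z : R -> R) k : continuous y -> continuous z ->
  ca (fun x => y x + z x) k = ca y k + ca z k /\ sa (fun x => y x + z x) k = sa y k + sa z k.
Proof.
move=> cy cz; have c1 := @ct_cx R k; have c2 := @ct_sx R k.
split; rewrite /ca /sa -mulrDl -intgD; try ct; congr (_ / _); apply: intg_ext => x; ring.
Qed.

Lemma coef_opp (y : R -> R) k : continuous y ->
  ca (fun x => - y x) k = - ca y k /\ sa (fun x => - y x) k = - sa y k.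
Proof.
move=> cy; have c1 := @ct_cx R k; have c2 := @ct_sx R k.
split; rewrite /ca /sa -mulNr -intgN; try ct; congr (_ / _); apply: intg_ext => x; ring.
Qed.

Lemma smoothT_sqr (a : R -> R) : smoothT a -> exists db ddb : R -> R,
  [/\ cper (fun x => a x ^+ 2), forall x, is_derive x (1 : R) (fun x => a x ^+ 2) (db x),
   forall x, is_derive x (1 : R) db (ddb x) & continuous ddb].
Proof.
move=> [pa sa_]; pose d n := derive1n n a.
have hd n x : is_derive x (1 : R) (d n) (d n.+1 x).
  by rewrite /d derive1nS derive1E; exact: (DeriveDef (sa_ n x) erefl).
have d0 x : is_derive x (1 : R) a (d 1%N x) := hd 0%N x.
have d1 x : is_derive x (1 : R) (d 1%N) (d 2%N x) := hd 1%N x.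
have c0 := dv_ct d0; have c1 := dv_ct d1; have c2 := dv_ct (hd 2%N).
exists (fun x => 2 * (a x * d 1%N x)), (fun x => 2 * (d 1%N x * d 1%N x + a x * d 2%N x)); split.
- by split; [ct | move=> x; rewrite pa].
- by move=> x; have h := d0 x; dv; ring.
- by move=> x; have h := d0 x; have h2 := d1 x; dv; ring.
- by ct.
Qed.

Section Damping.
Variables (a db ddb : R -> R) (j : 'I_2).
Let b (x : R) : R := a x ^+ 2.
Let jb := j == 0 :> nat.
Hypothesis (hb : cper b) (dvb : forall x, is_derive x (1 : R) b (db x)).
Hypothesis (dvdb : forall x, is_derive x (1 : R) db (ddb x)) (cddb : continuous ddb).

Let cdb := dv_ct dvdb.
Let cb := hb.1.
Let hdb : cper db. Proof. by split=> //; exact: per_derive hb.2 dvb. Qed.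

Lemma damping_aeq (f S : R -> R) : int1 f -> cper S -> aeq f S ->
  (forall k, mca f k = ca S k) -> (forall k, msa f k = sa S k) ->
  damping j a f = damping j a S.
Proof.
move=> hf hS fS hc hs; have iS := int1_cont hS.1.
have E : fcoef f = fcoef S.
  by apply: fcoef_eq => k; [rewrite (mca_cont k hS.1) hc | rewrite (msa_cont k hS.1) hs].
have W : wderiv f = wderiv S := congr1 (fun c => xget (0 : R -> R) [set g : R -> R | L2T g /\ fcoef g = dx c]) E.
have D (h : R -> R) : damping j a h = if jb then fcoef (fun x => a x ^+ 2 * h x)
  else - dx (fcoef (fun x => a x ^+ 2 * wderiv h x)) by [].
rewrite (D f) (D S) W; case: (jb); last by [].
have key (h : R -> R) : cper h -> torus_int (fun x => a x ^+ 2 * f x * h x) = torus_int (fun x => a x ^+ 2 * S x * h x).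
  move=> hh; have i1 : int1 (fun x => f x * (b x * h x)) by apply: int1_cper => //; exact: cperM.
  have i2 : int1 (fun x => S x * (b x * h x)) by apply: int1_cper => //; exact: cperM.
  rewrite (_ : (fun x => a x ^+ 2 * f x * h x) = (fun x => f x * (b x * h x))); last first.
    by apply/funext => x; rewrite /b; ring.
  rewrite (_ : (fun x => a x ^+ 2 * S x * h x) = (fun x => S x * (b x * h x))); last first.
    by apply/funext => x; rewrite /b; ring.
  rewrite /torus_int /Rintegral; congr fine.
  apply: ae_eq_integral; [exact: mtor | exact: measurable_int i1.2 | exact: measurable_int i2.2 |].
  by apply: aeS fS => x e _ /=; rewrite e.
by apply: fcoef_eq => k; rewrite /mca /msa key //; [exact: cper_cx | exact: cper_sx].
Qed.

Lemma aeq_coef (f h : R -> R) : int1 f -> int1 h -> aeq f h ->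
  (forall k, mca f k = mca h k) /\ (forall k, msa f k = msa h k).
Proof.
move=> hf hh fh.
have key (p : R -> R) : cper p -> torus_int (fun x => f x * p x) = torus_int (fun x => h x * p x).
  move=> hp; have i1 := int1_cper hf hp; have i2 := int1_cper hh hp.
  rewrite /torus_int /Rintegral; congr fine.
  apply: ae_eq_integral; [exact: mtor | exact: measurable_int i1.2 | exact: measurable_int i2.2 |].
  by apply: aeS fh => x e _ /=; rewrite e.
by split=> k; rewrite /mca /msa key //; [exact: cper_cx | exact: cper_sx].
Qed.

Let dm (y : R -> R) := damp b db jb y.

(** The factor [1 + k^2] undoes K. For D_1 the coefficients of [b * wderiv y] come from
    [weak_by_parts] with the test functions [b * cx k] and [b * sx k], which is where the second
    derivative of [b] enters. *)
Lemma damping_coef E (y : R -> R) k : H1le E y ->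
  damping j a y k = Complex ((1 + k%:~R ^+ 2) * ca (dm y) k) (- ((1 + k%:~R ^+ 2) * sa (dm y) k)).
Proof.
move=> H; have hy := H1le_cper H; have cy := hy.1; have hby : cper (fun x => b x * y x) by exact: cperM.
have hdby : cper (fun x => db x * y x) by exact: cperM.
rewrite /damping /dm /damp /jb; case: ifP => _ /=.
  rewrite fcoefE mca_cont; last exact: hby.1.
  rewrite msa_cont; last exact: hby.1.
  have -> : dampK (fun=> 0) b (fun=> 0) y = opK (fun x => b x * y x).
    by apply/funext => x; rewrite /dampK opDK0 mul0r add0r addr0.
  by have [[-> ->] _] := coef_opK k hby.
rewrite -[LHS]/(- (dx (fcoef (fun x => a x ^+ 2 * wderiv y x)) k)) dxE fcoefE /=.
have [iw wc ws] := wderiv_spec H.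
have c1 := @ct_cx R k; have c2 := @ct_sx R k.
have e1 : mca (fun x => a x ^+ 2 * wderiv y x) k = - ca (fun x => db x * y x) k + k%:~R * sa (fun x => b x * y x) k.
  rewrite /mca (_ : (fun x => _) = (fun x => wderiv y x * (b x * cx k x))); last first.
    by apply/funext => x; rewrite /b; ring.
  have P : periodic (fun x => b x * cx k x) L by move=> x; rewrite hb.2 per_cx.
  have D1 x : is_derive x (1 : R) (fun x => b x * cx k x) (db x * cx k x - k%:~R * (b x * sx k x)).
    by have h1 := dvb x; have h2 := dv_cx k x; dv; ring.
  have D2 x : is_derive x (1 : R) (fun x => db x * cx k x - k%:~R * (b x * sx k x)) (ddb x * cx k x - k%:~R * (db x * sx k x) - k%:~R * (db x * sx k x + b x * (k%:~R * cx k x))).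
    by have h1 := dvb x; have h3 := dvdb x; have h2 := dv_cx k x; have h4 := dv_sx k x; dv; ring.
  have C2 : continuous (fun x => ddb x * cx k x - k%:~R * (db x * sx k x) - k%:~R * (db x * sx k x + b x * (k%:~R * cx k x))) by ct.
  rewrite (weak_by_parts hy iw wc ws P D1 D2 C2).
  rewrite /ca /sa (intg_ext (g := fun x => db x * y x * cx k x - k%:~R * (b x * y x * sx k x))) => [|x]; last by ring.
  by rewrite intgB ?intgZ; try ct; move: L^-1 => Li; ring.
have e2 : msa (fun x => a x ^+ 2 * wderiv y x) k = - sa (fun x => db x * y x) k - k%:~R * ca (fun x => b x * y x) k.
  rewrite /msa (_ : (fun x => _) = (fun x => wderiv y x * (b x * sx k x))); last first.
    by apply/funext => x; rewrite /b; ring.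
  have P : periodic (fun x => b x * sx k x) L by move=> x; rewrite hb.2 per_sx.
  have D1 x : is_derive x (1 : R) (fun x => b x * sx k x) (db x * sx k x + k%:~R * (b x * cx k x)).
    by have h1 := dvb x; have h2 := dv_sx k x; dv; ring.
  have D2 x : is_derive x (1 : R) (fun x => db x * sx k x + k%:~R * (b x * cx k x)) (ddb x * sx k x + k%:~R * (db x * cx k x) + k%:~R * (db x * cx k x - b x * (k%:~R * sx k x))).
    by have h1 := dvb x; have h3 := dvdb x; have h2 := dv_cx k x; have h4 := dv_sx k x; dv; ring.
  have C2 : continuous (fun x => ddb x * sx k x + k%:~R * (db x * cx k x) + k%:~R * (db x * cx k x - b x * (k%:~R * sx k x))) by ct.
  rewrite (weak_by_parts hy iw wc ws P D1 D2 C2).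
  rewrite /ca /sa (intg_ext (g := fun x => db x * y x * sx k x + k%:~R * (b x * y x * cx k x))) => [|x]; last by ring.
  by rewrite intgD ?intgZ; try ct; move: L^-1 => Li; ring.
have hnby : cper (fun x => - b x * y x) by apply: cperM => //; exact: cperN.
have [[p1 p2] _] := coef_opK k hnby; have [_ [p3 p4]] := coef_opK k hdby.
have nE : (fun x => - b x * y x) = (fun x => - (b x * y x)) by apply/funext => x; rewrite mulNr.
have [n1 n2] := coef_opp k hby.1.
have cK := (cper_opK hnby).1; have cDK := (cper_opDK hdby).1; have cby := hby.1.
have cs : continuous (fun x => b x * y x + opK (fun x => - b x * y x) x) by ct.
have [q1 q2] := coef_add k cs cDK; have [q3 q4] := coef_add k cby cK.
rewrite e1 e2 /dampK q1 q2 q3 q4 !mulrDr p1 p2 p3 p4 nE n1 n2.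
by apply/eqP; rewrite eq_complex /=; apply/andP; split; apply/eqP; ring.
Qed.

(** Coefficient by coefficient, the equation is [1 + k^2] times the difference between [w] and the
    field. This factor never vanishes, and coefficients determine a continuous periodic function. *)
Lemma equation_iff E (w y : R -> R) : cper w -> H1le E y ->
  ((fcoef w - dx (dx (fcoef w))) + dx (fcoef (fun x => y x + y x ^+ 2 / 2)) + damping j a y = 0) <->
  w = rhs flux (beta_ b jb) (c0_ b jb) (c1_ db jb) y.
Proof.
move=> hw H; have hy := H1le_cper H; set r := rhs _ _ _ _ _.
have hfl : cper (fun x => flux (y x)) by apply: cper_comp => //; exact: ct_flux.
have hdm : cper (dm y) by apply: cper_dampK => //; [exact: cper_beta | exact: cper_c0 | exact: cper_c1].
have hr : cper r.
  apply: cper_rhs => //; [exact: ct_flux | exact: cper_beta | exact: cper_c0 | exact: cper_c1].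
have hD := cper_opDK hfl; have cD := hD.1; have cdm := hdm.1.
have cND : continuous (fun x => - opDK (fun x => flux (y x)) x) by ct.
have key k : ((fcoef w - dx (dx (fcoef w))) + dx (fcoef (fun x => y x + y x ^+ 2 / 2)) + damping j a y) k =
    Complex ((1 + k%:~R ^+ 2) * (ca w k - ca r k)) (- ((1 + k%:~R ^+ 2) * (sa w k - sa r k))).
  have [r1 r2] : ca r k = - ca (opDK (fun x => flux (y x))) k - ca (dm y) k /\
      sa r k = - sa (opDK (fun x => flux (y x))) k - sa (dm y) k.
    have [q1 q2] := coef_sub k cND cdm; have [q3 q4] := coef_opp k cD.
    by split; [rewrite -q3 -q1 | rewrite -q4 -q2].
  have [_ [p1 p2]] := coef_opK k hfl.
  rewrite -[LHS]/((fcoef w k - dx (dx (fcoef w)) k) + dx (fcoef (fun x => y x + y x ^+ 2 / 2)) k + damping j a y k).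
  rewrite (damping_coef k H) !dxE !fcoefE /= (mca_cont k hw.1) (msa_cont k hw.1).
  rewrite -/(flux _) (@mca_cont R (fun x => y x + y x ^+ 2 / 2) k hfl.1) (@msa_cont R (fun x => y x + y x ^+ 2 / 2) k hfl.1).
  rewrite -[ca (fun x => y x + y x ^+ 2 / 2) k]/(ca (fun x => flux (y x)) k).
  rewrite -[sa (fun x => y x + y x ^+ 2 / 2) k]/(sa (fun x => flux (y x)) k).
  rewrite r1 r2 !mulrBr !mulrN p1 p2.
  by apply/eqP; rewrite eq_complex /=; apply/andP; split; apply/eqP; ring.
split=> [h|e].
  apply: coef_eq => // k; have := congr1 (fun c => c k) h; rewrite key => /eqP;
    rewrite eq_complex /= => /andP[/eqP h1 /eqP h2]; apply/eqP; rewrite -subr_eq0.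
    by move/eqP: h1; rewrite mulf_eq0 gt_eqF ?q_gt0.
  by move/eqP: h2; rewrite oppr_eq0 mulf_eq0 gt_eqF ?q_gt0.
by apply/funext => k; rewrite key e !subrr !mulr0 oppr0.
Qed.

End Damping.

(** Precomposing with the clamp onto [[- N, N]], a 1-Lipschitz map, makes the quadratic flux
    globally Lipschitz with constant [1 + N]. *)
Lemma trunc_flux (N : R) : 0 <= N -> exists g Lg, [/\ continuous g, 0 <= Lg,
  forall x y : R, `|g x - g y| <= Lg * `|x - y| & forall z : R, `|z| <= N -> g z = flux z].
Proof.
move=> N0; pose cl (z : R) := Num.min N (Num.max (- N) z).
have clE z : [\/ z <= - N /\ cl z = - N, N <= z /\ cl z = N | (- N <= z /\ z <= N) /\ cl z = z].
  rewrite /cl minEle maxEle; case: (leP (- N) z) => h1.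
    by case: (leP N z) => h2; [apply: Or32 | apply: Or33; split=> //; split=> //; exact: ltW].
  case: (leP N (- N)) => h2; apply: Or31; split; lra.
have clN z : `|cl z| <= N.
  by rewrite ler_norml; apply/andP; case: (clE z) => -[h ->]; split; lra.
have cl1 x y : `|cl x - cl y| <= `|x - y|.
  have h1 := ler_norm (x - y); have h2 := ler_norm (y - x); rewrite distrC in h2.
  by rewrite ler_norml; apply/andP; case: (clE x) => -[hx ->]; case: (clE y) => -[hy ->]; split; lra.
have lip x y : `|flux (cl x) - flux (cl y)| <= (1 + N) * `|x - y|.
  have -> : flux (cl x) - flux (cl y) = (cl x - cl y) * (1 + (cl x + cl y) / 2) by rewrite /flux; field.
  rewrite normrM mulrC; apply: ler_pM => //; apply: le_trans (ler_normD _ _) _.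
  have h1 := clN x; have h2 := clN y; have h3 := ler_normD (cl x) (cl y).
  by rewrite normr1 lerD2l normrM [`|2^-1|]ger0_norm //; lra.
exists (fun z => flux (cl z)), (1 + N); split=> //; [|by rewrite addr_ge0 | ].
- move=> x; apply/cvgrPdist_le => e e0.
  have d0 : 0 < e / (1 + N) by rewrite divr_gt0 // ltr_pwDl.
  apply/nbhs_ballP; exists (e / (1 + N)) => // z; rewrite /ball /= => zx.
  apply: le_trans (lip _ _) _; rewrite mulrC -ler_pdivlMr ?ltr_pwDl //; exact: ltW.
- move=> z; rewrite ler_norml => /andP[h1 h2].
  by rewrite /cl maxEle h1 minEle; case: leP => // h3; congr flux; lra.
Qed.

Lemma cvge0_le (T : Type) (F : set_system T) (FF : Filter F) (h : T -> \bar R) :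
  (forall x, 0 <= h x)%E -> (forall e : R, 0 < e -> \forall x \near F, (h x <= e%:E)%E) ->
  h x @[x --> F] --> 0%E.
Proof.
move=> h0 H; have fin x (e : R) : (h x <= e%:E)%E -> h x \is a fin_num.
  by move=> hx; rewrite ge0_fin_numE // (le_lt_trans hx) ?ltry.
apply/fine_cvgP; split; first by apply: filterS (H 1 ltr01) => x; exact: fin.
apply/cvgrPdist_le => e e0; apply: filterS (H e e0) => x hx /=.
by rewrite sub0r normrN ger0_norm ?fine_ge0 // -lee_fin fineK // (fin _ _ hx).
Qed.

Lemma near0_shift (P : R -> Prop) (t : R) : (\forall h \near 0, P h) -> \forall r \near t, P (r - t).
Proof.
move=> /nbhs_ballP[d d0 hd]; apply/nbhs_ballP; exists d => // r; rewrite /ball /= => rt.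
by apply: hd; rewrite /ball /= sub0r normrN distrC.
Qed.

Section FlowSolution.
Variables (a db ddb : R -> R) (j : 'I_2).
Let b (x : R) : R := a x ^+ 2.
Let jb := j == 0 :> nat.
Hypothesis (hb : cper b) (dvb : forall x, is_derive x (1 : R) b (db x)).
Hypothesis (dvdb : forall x, is_derive x (1 : R) db (ddb x)) (cddb : continuous ddb).

Let cdb := dv_ct dvdb.

(** The trajectory stays in the range where [g] is [flux], so the flow of the truncated equation
    solves the original one. *)
Lemma flow_solution g S u u0 E B : continuous g -> (forall z, `|z| <= B -> g z = flux z) ->
  flow b db jb g S u -> 0 <= E -> H1le E S -> (forall t x, 0 <= t -> `|u t x| <= B) ->
  aeq S u0 -> solution j a u0 u.
Proof.
move=> cg gf fu E0 HS uB Su0.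
have hbe := cper_beta hb jb; have hc0 := cper_c0 hb jb; have hc1 := cper_c1 hb cdb dvb jb.
have dbe := dv_beta_ dvb jb; have cdbe := @ct_dbeta R db cdb jb.
exists (fun t => rhs g (beta_ b jb) (c0_ b jb) (c1_ db jb) (u t)); split.
- pose K := small_cst E + 1; have K0 : 0 < K by rewrite ltr_wpDl // sqrtr_ge0.
  have small (e : R) : 0 < e -> 0 < e / K /\ (e / K * small_cst E <= e).
    move=> e0; split; first by rewrite divr_gt0.
    by rewrite mulrAC ler_pdivrMr // ler_pM2l // lerDl.
  split=> t t0.
  + have [E1 h1] := flow_H1 cg hbe hc0 hc1 dbe cdbe fu E0 HS t.
    have [E2 h2] := rhs_H1 cg hbe hc0 hc1 dbe cdbe fu E0 HS t.
    by split; [exact: H1le_H1T h1 | exact: H1le_H1T h2].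
  + apply: cvge0_le => [r|e e0]; first exact: Hnorm_ge0.
    have [e1 e2] := small e e0.
    have H := near0_shift t (flow_diff_H1 cg hbe hc0 hc1 dbe cdbe fu E0 HS t e1).
    suff : nbhs t (fun r => r != t -> (`[0, +oo[%classic : set R) r ->
       (Hnorm 1 ((r - t)^-1 *: (u r - u t) - rhs g (beta_ b jb) (c0_ b jb) (c1_ db jb) (u t))%R <= e%:E)%E) by [].
    apply: filterS H => r; rewrite subr_eq0 => H rt _; have {}H := H rt.
    rewrite (_ : t + (r - t) = r) in H; last by rewrite addrC subrK.
    apply: le_trans H _; rewrite lee_fin //.
  + apply: cvge0_le => [r|e e0]; first exact: Hnorm_ge0.
    have [e1 e2] := small e e0.
    have H := near0_shift t (rhs_cvg_H1 cg hbe hc0 hc1 dbe cdbe fu E0 HS t e1).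
    suff : nbhs t (fun r => (`[0, +oo[%classic : set R) r ->
       (Hnorm 1 (rhs g (beta_ b jb) (c0_ b jb) (c1_ db jb) (u r) - rhs g (beta_ b jb) (c0_ b jb) (c1_ db jb) (u t))%R <= e%:E)%E) by [].
    apply: filterS H => r H _; rewrite (_ : t + (r - t) = r) in H; last by rewrite addrC subrK.
    apply: le_trans H _; rewrite lee_fin //.
- move=> t t0; have [E1 h1] := flow_H1 cg hbe hc0 hc1 dbe cdbe fu E0 HS t.
  have hw : cper (rhs g (beta_ b jb) (c0_ b jb) (c1_ db jb) (u t)).
    by apply: cper_rhs => //; exact: flow_cper fu.
  apply: (equation_iff j hb dvb dvdb cddb hw h1).2; apply/funext => x; rewrite /rhs.
  by congr (- opDK _ x - _); apply/funext => z; rewrite gf // uB.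
- by case: fu => _ _ -> _.
Qed.

End FlowSolution.
End Equation.

(** * Uniqueness *)

Section SolutionUniqueness.
Context {R : realType}.
Notation L := (pi *+ 2 : R).

Lemma L2T_lin (c : R) (f h : R -> R) : L2T f -> L2T h -> L2T (fun x => c * f x + h x).
Proof.
move=> [pf mf hf] [ph mh hh].
have mc : measurable_fun [set: R] (fun x => c * f x + h x).
  by apply: measurable_funD => //; apply: measurable_funM => //; exact: measurable_cst.
split=> //; first by move=> x; rewrite pf ph.
have i1 : int1 (fun x => f x ^+ 2) by split; [exact: measurable_funX | exact: hf].
have i2 : int1 (fun x => h x ^+ 2) by split; [exact: measurable_funX | exact: hh].
have i3 := int1D (int1Z (2 * c ^+ 2) i1) (int1Z 2 i2).
apply: (le_integrable (@mtor R) _ _ i3.2).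
  by apply: measurableT_comp => //; apply: measurable_funS (measurable_funX 2 mc).
have c0 : 0 <= 2 * c ^+ 2 by apply: mulr_ge0; rewrite ?sqr_ge0.
move=> x _ /=; rewrite lee_fin ger0_norm ?sqr_ge0 // ger0_norm; last first.
  by apply: addr_ge0; apply: mulr_ge0 => //; exact: sqr_ge0.
by have := sqr_ge0 (c * f x - h x); rewrite !expr2; nra.
Qed.

(* The continuous representative: [Hnorm 1] controls the supremum norm. *)
Definition rep (f : R -> R) : R -> R :=
  xget (fun=> 0) [set S : R -> R | cper S /\ (forall k, ca S k = mca f k) /\ (forall k, sa S k = msa f k)].

Lemma rep_spec (f : R -> R) : H1T f ->
  [/\ cper (rep f), aeq f (rep f), forall k, mca f k = ca (rep f) k &
      forall k, msa f k = sa (rep f) k] /\ exists E, H1le E (rep f).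
Proof.
move=> hf; have [M M0 hM] := H1T_Hnorm_fin hf; have [S [HS fS hc hs]] := H1T_rep hf.1 hM.
have hS := H1le_cper HS.
have : [set S : R -> R | cper S /\ (forall k, ca S k = mca f k) /\ (forall k, sa S k = msa f k)] (rep f).
  by apply: xgetPex; exists S; split=> //; split=> k; rewrite ?hc ?hs.
move=> [h1 [h2 h3]].
have e : rep f = S by apply: coef_eq => // k; rewrite ?h2 ?h3 ?hc ?hs.
by rewrite e; split; [split | exists (L * M ^+ 2)].
Qed.

Lemma rep_le (f S : R -> R) (M : R) : L2T f -> (Hnorm 1 f <= M%:E)%E -> cper S ->
  (forall k, ca S k = mca f k) -> (forall k, sa S k = msa f k) -> forall x, S x ^+ 2 <= 2 * (L * M ^+ 2).
Proof.
move=> hf hM hS hc hs x; have [S' [HS' _ hc' hs']] := H1T_rep hf hM.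
have -> : S = S' by apply: coef_eq => // [|k|k]; [exact: H1le_cper HS' | rewrite hc hc' | rewrite hs hs'].
exact: H1le_sup.
Qed.

Lemma mca_quot (c : R) (f h p : R -> R) k : int1 f -> int1 h -> int1 p ->
  mca (fun x => c * (f x - h x) - p x) k = c * (mca f k - mca h k) - mca p k /\
  msa (fun x => c * (f x - h x) - p x) k = c * (msa f k - msa h k) - msa p k.
Proof.
move=> i1 i2 i3.
have key (e : R -> R) : cper e -> torus_int (fun x => (c * (f x - h x) - p x) * e x) / L =
    c * (torus_int (fun x => f x * e x) / L - torus_int (fun x => h x * e x) / L) - torus_int (fun x => p x * e x) / L.
  move=> he; have j1 := int1_cper i1 he; have j2 := int1_cper i2 he; have j3 := int1_cper i3 he.
  rewrite (_ : (fun x => (c * (f x - h x) - p x) * e x) = (fun x => c * (f x * e x - h x * e x) - p x * e x)); last first.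
    by apply/funext => x; ring.
  rewrite tiB ?tiZ ?tiB //; [|exact: int1B|exact: int1Z (int1B j1 j2)].
  by move: L^-1 => Li; ring.
by split; apply: key; [exact: cper_cx | exact: cper_sx].
Qed.

Lemma rhs_ext (g g' beta c0 c1 y : R -> R) : (forall x, g (y x) = g' (y x)) ->
  rhs g beta c0 c1 y = rhs g' beta c0 c1 y.
Proof. by move=> h; apply/funext => x; rewrite /rhs; congr (- opDK _ x - _); apply/funext => z. Qed.

Section Uniqueness.
Variables (a db ddb : R -> R) (j : 'I_2).
Let b (x : R) : R := a x ^+ 2.
Let jb := j == 0 :> nat.
Hypothesis (hb : cper b) (dvb : forall x, is_derive x (1 : R) b (db x)).
Hypothesis (dvdb : forall x, is_derive x (1 : R) db (ddb x)) (cddb : continuous ddb).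
Let cdb := dv_ct dvdb.

Variables (g S u0 : R -> R) (u v vt : R -> R -> R) (E B : R).
Hypothesis (gf : forall z, `|z| <= B -> g z = flux z) (fu : flow b db jb g S u).
Hypothesis (HS : H1le E S) (hu0 : H1T u0) (Su0 : aeq S u0).
Hypothesis (uB : forall t x, 0 <= t -> `|u t x| <= B).
Hypothesis vC1 : C1_H1 v vt.
Hypothesis veq : forall t, 0 <= t ->
  (fcoef (vt t) - dx (dx (fcoef (vt t)))) + dx (fcoef (fun x => v t x + v t x ^+ 2 / 2)) +
  damping j a (v t) = 0.
Hypothesis v0 : aeq (v 0) u0.

Let hv t : 0 <= t -> H1T (v t). Proof. by case: vC1 => h _ _ /h []. Qed.
Let hvt t : 0 <= t -> H1T (vt t). Proof. by case: vC1 => h _ _ /h []. Qed.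
(** Freezing time at 0 for negative arguments gives a function on the whole line, so joint
    continuity and compactness apply without one-sided versions. *)
Let V (t : R) : R -> R := rep (v (Num.max 0 t)).
Let W (t : R) : R -> R := rep (vt (Num.max 0 t)).
Let max0 (t : R) : 0 <= Num.max 0 t. Proof. by rewrite le_max lexx. Qed.
Let maxE (t : R) : 0 <= t -> Num.max 0 t = t. Proof. by move=> t0; rewrite max_r. Qed.
Let Vs t := rep_spec (hv (max0 t)).
Let Ws t := rep_spec (hvt (max0 t)).
Let hV t : cper (V t). Proof. by have [[]] := Vs t. Qed.
Let hW t : cper (W t). Proof. by have [[]] := Ws t. Qed.

(** Passing to continuous representatives changes no Fourier coefficient in the equation, so
    [equation_iff] applies and the solution obeys the same ODE as the flow. *)
Let W_rhs (t : R) : 0 <= t -> W t = rhs flux (beta_ b jb) (c0_ b jb) (c1_ db jb) (V t).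
Proof.
move=> t0; have [[_ a1 c1 s1] [E1 H1]] := Vs t; have [[_ a2 c2 s2] _] := Ws t.
have e := veq t0; rewrite -{1 2 3 4}(maxE t0) in e.
apply: (equation_iff j hb dvb dvdb cddb (hW t) H1).1.
have cV := (hV t).1; have l2 := (hv (max0 t)).1.
have iv := L2T_int1 l2.
have iv2 : int1 (fun x => v (Num.max 0 t) x ^+ 2) by case: l2 => _ m i; split; [exact: measurable_funX | exact: i].
have i1 : int1 (fun x => v (Num.max 0 t) x + v (Num.max 0 t) x ^+ 2 / 2).
  rewrite (_ : (fun x => _) = (fun x => v (Num.max 0 t) x + 2^-1 * v (Num.max 0 t) x ^+ 2)); last first.
    by apply/funext => x; rewrite [_ / 2]mulrC.
  by apply: int1D => //; exact: int1Z.
have i2 : int1 (fun x => V t x + V t x ^+ 2 / 2) by apply: int1_cont; ct.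
have ae : aeq (fun x => v (Num.max 0 t) x + v (Num.max 0 t) x ^+ 2 / 2) (fun x => V t x + V t x ^+ 2 / 2).
  by apply: aeS a1 => x ->.
have [f1 f2] := aeq_coef i1 i2 ae.
have e1 : fcoef (vt (Num.max 0 t)) = fcoef (W t).
  by apply: fcoef_eq => k; [rewrite (mca_cont k (hW t).1) c2 | rewrite (msa_cont k (hW t).1) s2].
have e2 : damping j a (v (Num.max 0 t)) = damping j a (V t).
  exact: (damping_aeq _ hb iv (hV t) a1 c1 s1).
move: e; rewrite (fcoef_eq f1 f2) e1 => e; rewrite (maxE t0) in e2; rewrite e2 in e.
exact: e.
Qed.

Let V_diff (t e : R) : 0 <= t -> 0 < e -> \forall r \near t, 0 <= r -> r != t ->
  forall x : R, `|V r x - V t x - W t x * (r - t)| <= e * `|r - t|.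
Proof.
move=> t0 e0; case: vC1 => _ /(_ t t0) /fine_cvgP[fin /cvgrPdist_le hd] _.
have L0 := @period_gt0 R; have L1 := @period_ge1 R.
(* [rep_le] bounds the square of the representative by [2 * (L * e1^2) = e^2 / (2 * L)], which is at
   most [e^2]. *)
pose e1 := e / (2 * L); have e10 : 0 < e1 by rewrite divr_gt0 // mulr_gt0.
pose N1 (r : R) := Hnorm 1 ((r - t)^-1 *: (v r - v t) - vt t)%R.
have H1 : nbhs t (fun r => r != t -> (`[0, +oo[%classic : set R) r -> N1 r \is a fin_num) := fin.
have H2 : nbhs t (fun r => r != t -> (`[0, +oo[%classic : set R) r -> `|0 - fine (N1 r)| <= e1) := hd e1 e10.
suff H' : \forall r \near t, r != t -> (`[0, +oo[%classic : set R) r ->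
    (Hnorm 1 ((r - t)^-1 *: (v r - v t) - vt t)%R <= e1%:E)%E.
  apply: filterS H' => r hr r0 rt x.
  have {}hr := hr rt; have {hr}hN : (Hnorm 1 ((r - t)^-1 *: (v r - v t) - vt t)%R <= e1%:E)%E.
    by apply: hr; rewrite /= in_itv /= r0.
  have [[_ _ cr sr] _] := Vs r; have [[_ _ ct_ st] _] := Vs t; have [[_ _ cw sw] _] := Ws t.
  have lr := (hv r0).1; have lt_ := (hv t0).1; have lw := (hvt t0).1.
  have rt0 : r - t != 0 by rewrite subr_eq0.
  rewrite (maxE r0) in cr sr; rewrite (maxE t0) in ct_ st cw sw.
  pose f x := (r - t)^-1 * (v r x - v t x) - vt t x.
  have lf : L2T f.
    have -> : f = (fun x => (r - t)^-1 * (-1 * v t x + v r x) + (-1 * vt t x + 0)).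
      by apply/funext => z; rewrite /f; ring.
    apply: L2T_lin; first exact: L2T_lin.
    by apply: L2T_lin => //; apply: cper_L2T; exact: cper_cst.
  have hN' : (Hnorm 1 f <= e1%:E)%E by exact: hN.
  pose s x := (r - t)^-1 * (V r x - V t x) - W t x.
  have cVr := (hV r).1; have cVt := (hV t).1; have cWt := (hW t).1.
  have hs : cper s.
    split; first by rewrite /s; ct.
    by move=> z; rewrite /s (hV r).2 (hV t).2 (hW t).2.
  have sc k : ca s k = mca f k /\ sa s k = msa f k.
    have [q1 q2] := mca_quot (r - t)^-1 k (L2T_int1 lr) (L2T_int1 lt_) (L2T_int1 lw).
    have [q3 q4] := mca_quot (r - t)^-1 k (int1_cont cVr) (int1_cont cVt) (int1_cont cWt).
    rewrite -(mca_cont k hs.1) -(msa_cont k hs.1) /f q1 q2 /s q3 q4.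
    rewrite !(mca_cont k cVr) !(msa_cont k cVr) !(mca_cont k cVt) !(msa_cont k cVt).
    rewrite !(mca_cont k cWt) !(msa_cont k cWt) cr ct_ cw sr st sw.
    by rewrite /V /W (maxE r0) (maxE t0).
  have := rep_le lf hN' hs (fun k => (sc k).1) (fun k => (sc k).2) x.
  have -> : V r x - V t x - W t x * (r - t) = s x * (r - t) by rewrite /s; field.
  rewrite normrM => hle; apply: ler_wpM2r => //.
  rewrite -ler_sqr ?nnegrE ?(ltW e0) // real_normK ?num_real //; apply: le_trans hle _.
  have fe (z : R) : z != 0 -> 2 * (z * (e / (2 * z)) ^+ 2) = e ^+ 2 / (2 * z) by move=> z0; field.
  rewrite /e1 fe ?gt_eqF //.
  by rewrite ler_pdivrMr ?mulr_gt0 // ler_peMr ?sqr_ge0 //; lra.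
apply: filterS (filterI H1 H2) => r [h1 h2] rt r0; have {}h1 := h1 rt r0; have {}h2 := h2 rt r0.
move: h2; rewrite sub0r normrN => h2.
by rewrite -/(N1 r) -(fineK h1) lee_fin; apply: le_trans h2; exact: ler_norm.
Qed.

Let V_lip t : exists2 M, 0 <= M & \forall s \near t, forall x, `|V s x - V t x| <= M * `|s - t|.
Proof.
have [M hM] := per_bounded (hW t).1 (hW t).2; have M0 := le_trans (normr_ge0 _) (hM 0).
have /nbhs_ballP[d d0 hd] := @V_diff _ 1 (max0 t) ltr01.
exists (M + 1); first by rewrite addr_ge0.
apply/nbhs_ballP; exists d => // s; rewrite /ball /= => st x.
have le_max s' t' : Num.max 0 s' - Num.max 0 t' <= `|s' - t'| :> R.
  have h1 := ler_norm (s' - t'); have h0 := normr_ge0 (s' - t').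
  by rewrite !maxEle; case: (leP 0 s') => ?; case: (leP 0 t') => ?; lra.
have st' : `|Num.max 0 s - Num.max 0 t| <= `|s - t| :> R.
  by rewrite ler_norml le_max andbT lerNl opprB distrC le_max.
have VE r : V (Num.max 0 r) = V r by rewrite /V (maxE (max0 r)).
have WE r : W (Num.max 0 r) = W r by rewrite /W (maxE (max0 r)).
have [e|ne] := eqVneq (Num.max 0 s) (Num.max 0 t).
  by rewrite /V e subrr normr0 mulr_ge0 // addr_ge0.
have hb' : ball (Num.max 0 t) d (Num.max 0 s).
  by rewrite /ball /= distrC; apply: le_lt_trans st' _; rewrite distrC.
have := hd _ hb' (max0 s) ne x; rewrite !VE WE mul1r => h.
have -> : V s x - V t x = V s x - V t x - W t x * (Num.max 0 s - Num.max 0 t) + W t x * (Num.max 0 s - Num.max 0 t) by ring.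
apply: le_trans (ler_normD _ _) _; rewrite normrM.
have := ler_pM (normr_ge0 _) (normr_ge0 _) (hM x) st'.
by rewrite mulrDl mul1r; lra.
Qed.

Let cV : continuous (fun z : R * R => V z.1 z.2).
Proof.
move=> [t x]; apply/cvgrPdist_le => e e0 /=.
have e2 : 0 < e / 2 by rewrite divr_gt0.
have [M M0 hM] := V_lip t.
have H2 : \forall y \near x, `|V t x - V t y| <= e / 2.
  by have /cvgrPdist_le := (hV t).1 x; apply.
have d0 : 0 < e / 2 / (M + 1) by rewrite divr_gt0 // ltr_wpDl.
have H1 : \forall s \near t, forall y, `|V s y - V t y| <= e / 2.
  have Hb : \forall s \near t, `|t - s| < e / 2 / (M + 1).
    by apply/nbhs_ballP; exists (e / 2 / (M + 1)).
  apply: filterS (filterI hM Hb) => s [h1 h2] y; apply: le_trans (h1 y) _.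
  apply: (@le_trans _ _ ((M + 1) * (e / 2 / (M + 1)))).
    apply: ler_pM => //; first by rewrite lerDl.
    by rewrite distrC ltW.
  by rewrite mulrC divfK // gt_eqF // ltr_wpDl.
exists ([set s | forall y, `|V s y - V t y| <= e / 2], [set y | `|V t x - V t y| <= e / 2]) => //.
move=> [s y] /= [h1 h2].
have -> : V t x - V s y = (V t x - V t y) - (V s y - V t y) by ring.
by apply: le_trans (ler_normB _ _) _; have := h1 y; lra.
Qed.

Let V_t (t x : R) : 0 < t -> is_derive t (1 : R) (V^~ x) (W t x).
Proof.
move=> t0; apply: dv_intro => e e0.
have h0 : (t + h) @[h --> (0 : R)] --> t.
  by rewrite -[X in _ --> X]addr0; apply: cvgD; [exact: cvg_cst | exact: cvg_id].
have H1 : \forall h \near (0 : R), 0 <= t + h -> t + h != t ->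
    forall x, `|V (t + h) x - V t x - W t x * (t + h - t)| <= e * `|t + h - t|.
  exact: (h0 _ (V_diff (ltW t0) e0)).
have H2 : \forall h \near (0 : R), 0 <= t + h.
  apply/nbhs_ballP; exists t => // h; rewrite /ball /= sub0r normrN => /ltW.
  by rewrite ler_norml => /andP[]; lra.
apply: filterS (filterI H1 H2) => h [h1 h2].
have [->|hn] := eqVneq h 0; first by rewrite addr0 subrr mulr0 subrr !normr0 mulr0.
have th : t + h != t by rewrite -subr_eq0 addrAC subrr add0r.
by have := h1 h2 th x; rewrite [t + h - t]addrAC subrr add0r.
Qed.

Let V0 : V 0 = S.
Proof.
have hS := H1le_cper HS; have [[_ a1 c1 s1] _] := Vs 0.
have iS := int1_cont hS.1; have i0 := L2T_int1 hu0.1; have iv := L2T_int1 (hv (max0 0)).1.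
have [p1 p2] := aeq_coef iS i0 Su0.
have v0' : aeq (v (Num.max 0 0)) u0 by rewrite maxE.
have [p3 p4] := aeq_coef iv i0 v0'.
by apply: coef_eq => // k;
  [rewrite -c1 p3 -p1 (mca_cont k hS.1) | rewrite -s1 p4 -p2 (msa_cont k hS.1)].
Qed.

Lemma solution_unique t : 0 <= t -> aeq (v t) (u t).
Proof.
move=> t0.
suff e x : V t x = u t x.
  have [[_ a1 _ _] _] := Vs t; rewrite (maxE t0) in a1.
  by apply: aeS a1 => x ->; rewrite -e /V (maxE t0).
have [cu pu ue du] := fu.
have [M hM] := jointly_bounded 0 t cV (fun s => (hV s).2).
have B0 : 0 <= B by apply: le_trans (uB 0 (lexx 0)).
have M0 : 0 <= M by apply: le_trans (hM t x _); rewrite ?t0 ?lexx.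
pose N := M + B; have N0 : 0 <= N by rewrite addr_ge0.
(* An arbitrary solution might leave the range where [g] equals [flux]. A second truncation, at
   level [M + B], fits both trajectories on [[0, t]] and gives one Lipschitz field for Gronwall. *)
have [g2 [L2 [cg2 L20 lip2 g2f]]] := trunc_flux N0.
have hbe := cper_beta hb jb; have hc0 := cper_c0 hb jb; have hc1 := cper_c1 hb cdb dvb jb.
have [K K0 hK] := rhs_lipschitz cg2 hbe hc0 hc1 L20 lip2.
pose w s y := V s y - u s y.
pose dw s y := W s y - rhs g (beta_ b jb) (c0_ b jb) (c1_ db jb) (u s) y.
have cw : continuous (fun z : R * R => w z.1 z.2) by rewrite /w; ct.
have := @sup_gronwall R w dw t K 0 (M + B) K0 (lexx 0) _ _ _ _ _ t x.
rewrite mulr0 mul0r t0 lexx => h.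
suff : `|w t x| <= 0 by rewrite normr_le0 subr_eq0 => /eqP.
apply: h => //.
- move=> y; apply: continuous_subspaceT.
  by apply: (ct_comp2 (u := w)) => //; [exact: ct_id | exact: ct_cst].
- move=> s y /andP[s0 _]; exact: (dvB (V_t y s0) (du s y)).
- move=> s N1 /andP[s0 st] wN y; rewrite /dw (W_rhs (ltW s0)).
  have -> : rhs flux (beta_ b jb) (c0_ b jb) (c1_ db jb) (V s) = rhs g2 (beta_ b jb) (c0_ b jb) (c1_ db jb) (V s).
    apply: rhs_ext => z; rewrite g2f //; apply: le_trans (hM s z _) _; last by rewrite /N lerDl.
    by rewrite !ltW.
  have -> : rhs g (beta_ b jb) (c0_ b jb) (c1_ db jb) (u s) = rhs g2 (beta_ b jb) (c0_ b jb) (c1_ db jb) (u s).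
    have us z := uB (t := s) z (ltW s0).
    by apply: rhs_ext => z; rewrite g2f ?gf //; apply: le_trans (us z) _; rewrite /N lerDr.
  have hus : cper (u s) by exact: flow_cper fu.
  exact: ((hK (V s) (u s) N1 (hV s) hus wN).2 y).
- by move=> y; rewrite /w V0 ue subrr normr0.
- move=> s y /andP[s0 st]; apply: le_trans (ler_normB _ _) _; apply: lerD; last exact: uB.
  by apply: hM; rewrite s0.
Qed.

End Uniqueness.
End SolutionUniqueness.

(** * Convergence *)

Section Convergence.
Context {R : realType}.
Notation L := (pi *+ 2 : R).

Lemma grid_cell (h : R) n x : 0 <= x -> x < n%:R * h -> exists i : nat,
  (i < n)%N /\ i%:R * h <= x <= i%:R * h + h.
Proof.
move=> x0; elim: n => [|n IHn]; first by rewrite mul0r; lra.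
move=> xn; have [h1|h1] := ltP x (n%:R * h).
  by have [i [h2 h3]] := IHn h1; exists i; split=> //; exact: ltnW.
exists n; split=> //; rewrite h1 /=; apply: ltW; apply: lt_le_trans xn _.
by rewrite -addn1 natrD mulrDl mul1r.
Qed.

(** Convergence at finitely many grid points, combined with the Holder bound of exponent 1/2 that
    the energy gives within a cell. A mesh of at most [d] keeps the oscillation in a cell below
    [e / 2]. *)
Lemma unif_cvg (u : R -> R -> R) (l E : R) : 0 <= E -> (forall t, 0 <= t -> H1le E (u t)) ->
  (forall x, u t x @[t --> +oo] --> l) ->
  forall e : R, 0 < e -> \forall t \near +oo, forall x, `|u t x - l| <= e.
Proof.
move=> E0 uE ul e e0; have L0 := @period_gt0 R.
pose d := (e / 2) ^+ 2 / (E + 1).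
have e2 : 0 < e / 2 by rewrite divr_gt0.
have d0 : 0 < d by rewrite divr_gt0 ?exprn_gt0 // ltr_wpDl.
pose n := (Num.Def.archi_bound (L / d)).+1; pose h := L / n%:R.
have n0 : 0 < n%:R :> R by rewrite ltr0n.
have h0 : 0 < h by rewrite divr_gt0.
have hd : h <= d.
  rewrite ler_pdivrMr // -ler_pdivrMl // mulrC; apply: ltW.
  apply: lt_le_trans (archi_boundP _) _; first by rewrite divr_ge0 // ltW.
  by rewrite ler_nat.
have nh : n%:R * h = L by rewrite /h mulrC divfK // gt_eqF.
have hL : h <= L by rewrite -nh ler_peMl ?(ltW h0) // ler1n.
have net m : \forall t \near +oo, forall i, (i < m)%N -> `|u t (i%:R * h) - l| <= e / 2.
  elim: m => [|m IHm]; first exact: nearW.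
  have /cvgrPdist_le/(_ _ e2) H := ul (m%:R * h).
  apply: filterS (filterI IHm H) => t [h1 h2] i; rewrite ltnS leq_eqVlt => /orP[/eqP ->|]; last exact: h1.
  by rewrite distrC.
have H0 : \forall t \near +oo, (0 : R) <= t by apply: nbhs_pinfty_ge; exact: num_real.
apply: filterS (filterI H0 (net n)) => t [t0 H] x.
have [k /andP[k0 kL]] := @period_reduce R x.
rewrite -(period_int x k (H1le_cper (uE t t0)).2); move: (x + _) k0 kL => y y0 yL.
rewrite -nh in yL; have [i [i_n /andP[i1 i2]]] := grid_cell y0 yL.
have hol : (u t (i%:R * h) - u t y) ^+ 2 <= (y - i%:R * h) * E.
  by apply: (H1le_holder (uE t t0)); rewrite i1 /=; lra.
have hsq : (u t (i%:R * h) - u t y) ^+ 2 <= (e / 2) ^+ 2.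
  apply: le_trans hol _; apply: (@le_trans _ _ (d * (E + 1))).
    by apply: ler_pM => //; lra.
  by rewrite /d divfK // gt_eqF // ltr_wpDl.
have hab : `|u t (i%:R * h) - u t y| <= e / 2.
  by rewrite -ler_sqr ?nnegrE ?(ltW e2) // real_normK ?num_real.
have -> : u t y - l = (u t (i%:R * h) - l) - (u t (i%:R * h) - u t y) by ring.
by apply: le_trans (ler_normB _ _) _; have := H i i_n; lra.
Qed.

Lemma zr_split (F : int -> R) N M : (N <= M)%N ->
  \sum_(k <- zr M) F k = \sum_(k <- zr N) F k + \sum_(k <- zr M) (if (`|k| <= N)%N then 0 else F k).
Proof.
move=> NM; rewrite (bigID (fun k : int => (`|k| <= N)%N)) /=; congr (_ + _).
  rewrite -big_filter; apply: perm_big; apply: uniq_perm; rewrite ?filter_uniq ?zr_uniq //.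
  by move=> k; rewrite mem_filter !mem_zr; case: leqP => //= kN; rewrite (leq_trans kN NM).
by rewrite big_mkcond; apply: eq_bigr => k _; case: leqP.
Qed.

Lemma sum_head_le (F : int -> R) N M : (forall k, 0 <= F k) ->
  \sum_(k <- zr M) (if (`|k| <= N)%N then F k else 0) <= \sum_(k <- zr N) F k.
Proof.
move=> F0; rewrite -big_mkcond /= -big_filter; apply: sum_le_zr => //.
  by rewrite filter_uniq // zr_uniq.
by move=> k; rewrite mem_filter => /andP[].
Qed.

Lemma sum_zr_mono (F : int -> R) N M : (forall k, 0 <= F k) -> (N <= M)%N ->
  \sum_(k <- zr N) F k <= \sum_(k <- zr M) F k.
Proof.
move=> F0 NM; apply: sum_le_zr => //; first exact: zr_uniq.
by move=> k; rewrite mem_zr => kN; exact: leq_trans kN NM.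
Qed.

Lemma sum_cauchy (F : int -> R) (M e : R) : (forall k, 0 <= F k) ->
  (forall N, \sum_(k <- zr N) F k <= M) -> 0 < e ->
  exists N, forall m, \sum_(k <- zr m) F k - \sum_(k <- zr N) F k <= e.
Proof.
move=> F0 hM e0; pose s N := \sum_(k <- zr N) F k.
have nd : nondecreasing_seq s by move=> n m nm; exact: sum_zr_mono.
have cv : cvgn s by apply: nondecreasing_is_cvgn => //; exists M => _ [n _ <-]; exact: hM.
have /cvgrPdist_le/(_ e e0) [K _ /(_ K (leqnn K)) /= hK] := cv.
exists K => m; have := nondecreasing_cvgn_le nd cv m; rewrite /s in hK *.
by have := le_trans (ler_norm _) hK; lra.
Qed.

(** The decay of the weight [(1 + k^2)^(s - 1)] is what H^s gains over a mere bound in H^1. [Z]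
    solves [Z^(1 - s) = (M + 1) / e]. *)
Lemma powR_tail (s M e : R) : s < 1 -> 0 <= M -> 0 < e ->
  exists N : nat, (1 + N%:R ^+ 2) `^ (s - 1) * M <= e.
Proof.
move=> s1 M0 e0; have r0 : 0 < 1 - s by lra.
pose z := (M + 1) / e; have z0 : 0 < z by rewrite divr_gt0 // ltr_wpDl.
pose Z := z `^ (1 - s)^-1; have Z0 : 0 <= Z by exact: powR_ge0.
exists (Num.Def.archi_bound Z); have := archi_boundP Z0; set N := Num.Def.archi_bound Z => ZN.
have N1 : Z <= 1 + N%:R ^+ 2.
  by have := sqr_ge0 (N%:R - 1 : R); have := ltW ZN; nra.
have X0 : 0 < 1 + N%:R ^+ 2 :> R by rewrite ltr_pwDl // sqr_ge0.
have zX : z <= (1 + N%:R ^+ 2) `^ (1 - s).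
  have -> : z = Z `^ (1 - s) by rewrite /Z -powRrM mulVf ?gt_eqF // powRr1 // ltW.
  by apply: ge0_ler_powR; rewrite ?nnegrE // ltW.
have -> : s - 1 = - (1 - s) by ring.
rewrite powRN mulrC ler_pdivrMr ?powR_gt0 //.
apply: (@le_trans _ _ (e * z)); last by rewrite ler_pM2l.
by rewrite /z mulrC divfK ?gt_eqF // lerDl.
Qed.

Lemma int_sqr_ge (k : int) N : (N < `|k|)%N -> N%:R ^+ 2 <= k%:~R ^+ 2 :> R.
Proof.
move=> kN; rewrite -[leRHS]real_normK ?num_real // -intr_norm -natr_absz.
by apply: lerXn2r; rewrite ?nnegrE // ler_nat ltnW.
Qed.

(** * Strong convergence in H^s and weak convergence in H^1 *)

Section Weighted.
Variables (u : R -> R -> R) (l E : R).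
Hypothesis wE : forall t, 0 <= t -> H1le E (fun x => u t x - l).
Hypothesis wu : forall e : R, 0 < e -> \forall t \near +oo, forall x, `|u t x - l| <= e.

Let w t x := u t x - l.
Let q (k : int) : R := 1 + k%:~R ^+ 2.
Let M2 := E / L.
Let F t k := q k * (ca (w t) k ^+ 2 + sa (w t) k ^+ 2).
Let q0 k : 0 < q k. Proof. exact: q_gt0. Qed.
Let F0 t k : 0 <= F t k. Proof. by rewrite mulr_ge0 ?(ltW (q0 k)) // addr_ge0 ?sqr_ge0. Qed.
Let FM t N : 0 <= t -> \sum_(k <- zr N) F t k <= M2. Proof. by move=> /wE /H1le_coef. Qed.
Let M20 : 0 <= M2.
Proof. by apply: le_trans (FM 0 (lexx 0)); apply: sumr_ge0. Qed.
Let near_ge0 : \forall t \near +oo, (0 : R) <= t.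
Proof. by apply: nbhs_pinfty_ge; exact: num_real. Qed.

(** Frequencies up to [N] are finitely many and small by uniform convergence. Beyond [N] the weight
    of H^s is at most [(1 + N^2)^(s - 1)] times that of H^1, whose sum stays below [M2]. *)
Lemma Hs_cvg s : s < 1 -> Hnorm s (u t - cst l) @[t --> +oo] --> 0%E.
Proof.
move=> s1; apply: cvge0_le => [t|e e0]; first exact: Hnorm_ge0.
have e2 : 0 < e ^+ 2 / 2 by rewrite divr_gt0 // exprn_gt0.
have [N hN] := powR_tail s1 M20 e2; set X : R := 1 + N%:R ^+ 2 in hN.
have X0 : 0 < X by rewrite ltr_pwDl // sqr_ge0.
pose A := \sum_(k <- zr N) q k `^ s.
have A0 : 0 <= A by apply: sumr_ge0 => k _; exact: powR_ge0.
(* The minimum with 1 allows [d^2 <= d], so the low frequencies contribute at most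
   [2 * A * d <= e^2 / 2]. *)
pose d := Num.min 1 (e ^+ 2 / (4 * (A + 1))).
have A1 : 0 < 4 * (A + 1) by rewrite mulr_gt0 // ltr_wpDl.
have d0 : 0 < d by rewrite lt_min ltr01 divr_gt0 // exprn_gt0.
have d1 : d <= 1 by rewrite ge_min lexx.
have dA : d * (4 * (A + 1)) <= e ^+ 2 by rewrite -ler_pdivlMr // ge_min lexx orbT.
apply: filterS (filterI near_ge0 (wu d0)) => t [t0 wd].
have hw' := H1le_cper (wE t0).
rewrite (_ : u t - cst l = w t); last by apply/funext.
apply: Hnorm_le; first exact: ltW.
move=> N'; have cf k := coef_abs_le k hw'.1 wd.
have le_sq (a : R) : `|a| <= d -> a ^+ 2 <= d ^+ 2.
  by move=> ad; rewrite -[a ^+ 2]real_normK ?num_real // lerXn2r ?nnegrE // ltW.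
apply: (@le_trans _ _ (\sum_(k <- zr N')
   ((if (`|k| <= N)%N then q k `^ s * (2 * d ^+ 2) else 0) + X `^ (s - 1) * F t k))).
  apply: ler_sum => k _; rewrite /hw (mca_cont k hw'.1) (msa_cont k hw'.1) -/(q k).
  have c0 : 0 <= ca (w t) k ^+ 2 + sa (w t) k ^+ 2 by rewrite addr_ge0 ?sqr_ge0.
  case: leqP => kN.
    apply: ler_wpDr; first by apply: mulr_ge0; [exact: powR_ge0 | exact: F0].
    apply: ler_wpM2l; first exact: powR_ge0.
    by have [/le_sq h1 /le_sq h2] := cf k; rewrite -/(w t) in h1 h2; lra.
  rewrite add0r /F mulrA ler_wpM2r //.
  have -> : s = (s - 1) + 1 by ring.
  rewrite powRD; last by rewrite (gt_eqF (q0 k)) implybT.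
  rewrite powRr1 ?(ltW (q0 k)) // ler_wpM2r ?(ltW (q0 k)) // addrK.
  have -> : s - 1 = - (1 - s) by ring.
  rewrite !powRN lef_pV2 ?posrE ?powR_gt0 //.
  apply: ge0_ler_powR; rewrite ?nnegrE ?(ltW (q0 k)) ?(ltW X0) //; first by lra.
  by rewrite /X /q lerD2l int_sqr_ge.
rewrite big_split /= -mulr_sumr.
have h1 : \sum_(k <- zr N') (if (`|k| <= N)%N then q k `^ s * (2 * d ^+ 2) else 0) <= A * (2 * d ^+ 2).
  rewrite mulr_suml; apply: sum_head_le => k.
  by rewrite mulr_ge0 ?powR_ge0 // mulr_ge0 ?sqr_ge0.
have h2 : X `^ (s - 1) * \sum_(k <- zr N') F t k <= e ^+ 2 / 2.
  by apply: le_trans hN; rewrite ler_wpM2l ?powR_ge0 // FM.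
have h3 : A * (2 * d ^+ 2) <= e ^+ 2 / 2.
  have : A * d ^+ 2 <= A * d by rewrite ler_wpM2l // expr2 ler_piMr // ltW.
  by move: dA; nra.
lra.
Qed.

Section Functional.
Variable Lf : (R -> R) -> R.
Hypothesis hL : H1_functional Lf.

Let lin (c : R) (f h : R -> R) : H1T f -> H1T h -> Lf (fun x => c * f x + h x) = c * Lf f + Lf h.
Proof. exact: hL.1. Qed.

Let bnd : exists2 C, 0 <= C & forall f M, H1T f -> (Hnorm 1 f <= M%:E)%E -> `|Lf f| <= C * M.
Proof.
have [C hC] := hL.2; exists `|C| => // f M hf hM; rewrite -lee_fin.
apply: le_trans (hC f hf) _; rewrite EFinM; apply: (@le_trans _ _ (`|C|%:E * Hnorm 1 f)%E).
  by apply: lee_wpmul2r; [exact: Hnorm_ge0 | rewrite lee_fin ler_norm].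
by apply: lee_wpmul2l => //; rewrite lee_fin.
Qed.

Let C1_H1T (y dy : R -> R) : periodic y L -> (forall x, is_derive x (1 : R) y (dy x)) ->
  continuous dy -> H1T y.
Proof. by move=> py hy cdy; exact: H1le_H1T (C1_H1le py hy cdy). Qed.

Let hcx k : H1T (cx k : R -> R).
Proof.
apply: (@C1_H1T _ (fun x => - k%:~R * sx k x)); [exact: per_cx | exact: dv_cx |].
by have c := @ct_sx R k; ct.
Qed.

Let hsx k : H1T (sx k : R -> R).
Proof.
apply: (@C1_H1T _ (fun x => k%:~R * cx k x)); [exact: per_sx | exact: dv_sx |].
by have c := @ct_cx R k; ct.
Qed.

Let cst_H1T (c : R) : H1T (fun=> c).
Proof.
have pc : periodic (fun _ : R => c) L by [].
have hc x : is_derive x (1 : R) (fun _ : R => c) 0 by exact: dv_cst.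
have cc : continuous (fun _ : R => 0 : R) by exact: ct_cst.
exact: C1_H1T pc hc cc.
Qed.

Let htp N al be : H1T (tp N al be : R -> R).
Proof.
apply: C1_H1T; [exact: (cper_tp _ _ _).2 | by move=> x; exact: dv_tp | exact: (cper_tp _ _ _).1].
Qed.

Let Lf0 : Lf (fun=> 0) = 0.
Proof.
have := lin 1 (cst_H1T 0) (cst_H1T 0).
rewrite (_ : (fun x : R => 1 * 0 + 0) = (fun=> 0 : R)); last by apply/funext => x; rewrite mulr0 addr0.
by lra.
Qed.

Let al k := Lf (cx k).
Let be k := Lf (sx k).

Let Lf_tp N a b : Lf (tp N a b) = \sum_(k <- zr N) (a k * al k + b k * be k).
Proof.
rewrite /tp.
suff H (s : seq int) : H1T (fun x => \sum_(k <- s) (a k * cx k x + b k * sx k x)) /\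
    Lf (fun x => \sum_(k <- s) (a k * cx k x + b k * sx k x)) = \sum_(k <- s) (a k * al k + b k * be k).
  exact: (H (zr N)).2.
(* Closure of H^1 under combinations goes through continuous representatives, for which [H1le] is
   stable; [Hnorm] does not see the change of representative. *)
have lH (c : R) (f h : R -> R) : H1T f -> H1T h -> H1T (fun x => c * f x + h x).
  move=> hf hh; have [[c1 a1 p1 q1] [E1 H1]] := rep_spec hf; have [[c2 a2 p2 q2] [E2 H2]] := rep_spec hh.
  have l3 := L2T_lin c hf.1 hh.1; split=> //.
  have H3 : H1le (3 * `|c| ^+ 2 * E1) (fun x => c * rep f x).
    have pc : periodic (fun _ : R => c) L by [].
    have hc x : is_derive x (1 : R) (fun _ : R => c) 0 by exact: dv_cst.
    have cc : continuous (fun _ : R => 0 : R) by exact: ct_cst.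
    by apply: (H1le_mul (normr_ge0 c) pc hc cc _ _ H1) => x; rewrite ?normr0.
  have H4 := H1le_add H3 H2; have cr := (H1le_cper H4).1.
  apply: le_lt_trans (ltry (Num.sqrt ((2 * (3 * `|c| ^+ 2 * E1) + 2 * E2) / L))).
  apply: le_trans (H1le_Hnorm H4); rewrite !HnormE lee_sqrt; last first.
    by apply: esum_ge0 => k _; rewrite lee_fin hw_ge0.
  apply: le_esum => k _; rewrite lee_fin le_eqVlt; apply/orP; left; apply/eqP.
  have ae : aeq (fun x => c * f x + h x) (fun x => c * rep f x + rep h x).
    by apply: aeS (aeI a1 a2) => x [-> ->].
  have [m1 m2] := aeq_coef (L2T_int1 l3) (int1_cont cr) ae.
  by rewrite /hw m1 m2.
elim: s => [|k s [IH1 IH2]].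
  rewrite (_ : (fun x => _) = (fun=> 0 : R)); last by apply/funext => x; rewrite big_nil.
  by rewrite Lf0 big_nil; split=> //; exact: cst_H1T.
rewrite (_ : (fun x => \sum_(i <- k :: s) (a i * cx i x + b i * sx i x)) =
   (fun x => a k * cx k x + (b k * sx k x + \sum_(i <- s) (a i * cx i x + b i * sx i x)))); last first.
  by apply/funext => x; rewrite big_cons addrA.
have h1 := lH (b k) _ _ (hsx k) IH1.
split; first exact: lH.
by rewrite (lin _ (hcx k) h1) (lin _ (hsx k) IH1) IH2 big_cons addrA.
Qed.

Let G k : R := (al k ^+ 2 + be k ^+ 2) / q k.
Let G0 k : 0 <= G k. Proof. by rewrite divr_ge0 ?(ltW (q0 k)) // addr_ge0 ?sqr_ge0. Qed.

(** [Lf] is tested on the truncation of its own Riesz representative, with coefficients [al / q] and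
    [be / q]: the value is [S] and the norm at most its square root, whence [S <= C ^+ 2]. *)
Let G_bounded : exists M, forall N, \sum_(k <- zr N) G k <= M.
Proof.
have [C C0 hC] := bnd; exists (C ^+ 2) => N.
pose a k := al k / q k; pose b k := be k / q k.
have qN k : q (- k) = q k by rewrite /q mulrNz sqrrN.
have hs : sym a b.
  move=> k; rewrite /a /b qN; split.
    by congr (_ / _); congr Lf; apply/funext => x; rewrite cxN.
  rewrite -mulNr; congr (_ / _); rewrite /be.
  have -> : sx (- k) = (fun x : R => -1 * sx k x + 0) by apply/funext => x; rewrite sxN; ring.
  by rewrite (lin _ (hsx k) (cst_H1T 0)) Lf0; ring.
set S := \sum_(k <- zr N) G k; have S0 : 0 <= S by apply: sumr_ge0.
have qn k : q k != 0 by rewrite gt_eqF.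
have e1 : Lf (tp N a b) = S.
  by rewrite Lf_tp; apply: eq_bigr => k _; have := qn k; rewrite /a /b /G => h; field.
have hN : (Hnorm 1 (tp N a b) <= (Num.sqrt S)%:E)%E.
  apply: Hnorm_le; first exact: sqrtr_ge0.
  have ctp := (cper_tp N a b).1.
  move=> N'; rewrite sqr_sqrtr //; apply: le_trans (sum_head_le N N' G0); apply: ler_sum => k _.
  rewrite hw1 (mca_cont k ctp) (msa_cont k ctp) ca_tp // sa_tp // mem_zr -/(q k).
  case: ifP => _; last by rewrite expr0n addr0 mulr0.
  by rewrite /a /b /G le_eqVlt; apply/orP; left; apply/eqP; have := qn k; move=> h; field.
have := hC _ _ (htp N a b) hN; rewrite e1 ger0_norm // => hle.
have sq := sqr_sqrtr S0; rewrite -{1}sq in hle; rewrite -sq.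
move: (Num.sqrt S) (sqrtr_ge0 S) hle => r r0 h.
have [->|rn] := eqVneq r 0; first by rewrite expr0n sqr_ge0.
have rp : 0 < r by rewrite lt_neqAle eq_sym rn.
have rC : r <= C by rewrite -(ler_pM2r rp) -expr2.
by rewrite lerXn2r ?nnegrE.
Qed.

Let amgm (r qq a b : R) : 0 < r -> 0 < qq -> `|a * b| <= r / 2 * (qq * a ^+ 2) + (2 * r)^-1 * (b ^+ 2 / qq).
Proof.
move=> r0 qq0.
have t1 : 0 <= r / 2 * (qq * a ^+ 2).
  by apply: mulr_ge0; [apply: divr_ge0 => //; exact: ltW | apply: mulr_ge0; [exact: ltW | exact: sqr_ge0]].
have t2 : 0 <= (2 * r)^-1 * (b ^+ 2 / qq).
  by apply: mulr_ge0; [rewrite invr_ge0 mulr_ge0 // ltW | apply: divr_ge0; [exact: sqr_ge0 | exact: ltW]].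
rewrite -ler_sqr ?nnegrE //; last exact: addr_ge0.
rewrite real_normK ?num_real //.
have -> : (a * b) ^+ 2 = 4 * ((r / 2 * (qq * a ^+ 2)) * ((2 * r)^-1 * (b ^+ 2 / qq))).
  by field; rewrite !gt_eqF.
by move: (_ / _ * (_ * _)) (_^-1 * _) => x y; have := sqr_ge0 (x - y); rewrite !expr2; nra.
Qed.

(* [G] is the summand of the squared dual norm of [Lf]; Young's inequality with the weight [r] makes
   the tail of the expansion of [Lf y] small uniformly in [y]. *)
Let functional_le (y : R -> R) N0 (r d : R) : H1le E y -> 0 < r ->
  (forall m, \sum_(k <- zr m) G k - \sum_(k <- zr N0) G k <= d) ->
  `|Lf y| <= `|\sum_(k <- zr N0) (ca y k * al k + sa y k * be k)| + (r / 2 * M2 + (2 * r)^-1 * d).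
Proof.
move=> Hy r0 hd; have hy := H1le_cper Hy; have hs := sym_coef hy.1.
have [C C0 hC] := bnd; apply/ler_addgt0Pr => e e0.
pose f k := q k * (ca y k ^+ 2 + sa y k ^+ 2).
have f0 k : 0 <= f k by rewrite mulr_ge0 ?(ltW (q0 k)) // addr_ge0 ?sqr_ge0.
pose dl := e / (C + 1); have dl0 : 0 < dl by rewrite divr_gt0 // ltr_wpDl.
have [K hK] := sum_cauchy f0 (fun N => H1le_coef N Hy) (exprn_gt0 2 dl0).
(* Beyond [K] the series of [y] leaves a remainder of H^1 norm at most [dl], on which [Lf] is at
   most [e]. Taking [N >= N0] leaves the head sum intact. *)
pose N := maxn N0 K; pose T := tp N (ca y) (sa y).
have cT : continuous T by exact: (cper_tp _ _ _).1.
have HT := htp N (ca y) (sa y); have Hy1 := H1le_H1T Hy.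
pose z x := -1 * T x + y x.
have cz : continuous z by have c := hy.1; rewrite /z; ct.
have ez : z = (fun x => y x - T x) by apply/funext => x; rewrite /z; ring.
have zN : (Hnorm 1 z <= dl%:E)%E.
  apply: Hnorm_le; first exact: ltW.
  move=> N'; apply: (@le_trans _ _ (\sum_(k <- zr (maxn N' N)) (if (`|k| <= N)%N then 0 else f k))).
    apply: (@le_trans _ _ (\sum_(k <- zr N') (if (`|k| <= N)%N then 0 else f k))); last first.
      by apply: sum_zr_mono; [move=> k; case: ifP | exact: leq_maxl].
    apply: ler_sum => k _; rewrite hw1 (mca_cont k cz) (msa_cont k cz) ez.
    have [-> ->] := coef_sub k hy.1 cT; rewrite ca_tp // sa_tp // mem_zr.
    by case: ifP => _; rewrite ?subrr ?subr0 ?expr0n ?addr0 ?mulr0.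
  have := zr_split f (leq_maxr N' N) => /eqP; rewrite addrC -subr_eq => /eqP <-.
  apply: le_trans (hK (maxn N' N)); rewrite lerD2l lerN2.
  by apply: sum_zr_mono => //; exact: leq_maxr.
have hz : H1T z.
  split; first by apply: L2T_lin; [exact: HT.1 | exact: Hy1.1].
  by apply: le_lt_trans zN _; exact: ltry.
have e1 : Lf y = Lf T + Lf z by rewrite (lin _ HT Hy1); ring.
have z1 : `|Lf z| <= e.
  apply: le_trans (hC z dl hz zN) _; rewrite /dl mulrCA ler_piMr ?(ltW e0) //.
  by rewrite ler_pdivrMr ?ltr_wpDl // mul1r lerDl.
rewrite e1; apply: le_trans (ler_normD _ _) _; apply: lerD => //.
rewrite Lf_tp (zr_split _ (leq_maxl N0 K)) -/N; apply: le_trans (ler_normD _ _) _; rewrite lerD2l.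
apply: le_trans (ler_norm_sum _ _ _) _.
apply: (@le_trans _ _ (\sum_(k <- zr N) (r / 2 * f k + (2 * r)^-1 * (if (`|k| <= N0)%N then 0 else G k)))).
  apply: ler_sum => k _; case: ifP => _; first by rewrite normr0 mulr0 addr0 mulr_ge0 // divr_ge0 // ltW.
  apply: le_trans (ler_normD _ _) _.
  have h1 := amgm (ca y k) (al k) r0 (q0 k); have h2 := amgm (sa y k) (be k) r0 (q0 k).
  by apply: le_trans (lerD h1 h2) _; rewrite /f /G; lra.
rewrite big_split /= -!mulr_sumr; apply: lerD.
  by rewrite ler_wpM2l ?(H1le_coef N Hy) // divr_ge0 // ltW.
rewrite ler_wpM2l ?invr_ge0 ?mulr_ge0 ?(ltW r0) //.
have := zr_split G (leq_maxl N0 K); rewrite -/N => /eqP; rewrite addrC -subr_eq => /eqP <-.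
exact: hd.
Qed.

Lemma functional_cvg : Lf (u t) @[t --> +oo] --> Lf (cst l).
Proof.
apply/cvgrPdist_le => e e0.
have [M hM] := G_bounded.
(* With these choices the energy part [r / 2 * M2] and the dual tail [d / (2 * r)] are each at most
   [e / 4]; so is the head, by uniform convergence with precision [dl]. *)
pose r := e / (2 * (M2 + 1)); have r0 : 0 < r by rewrite divr_gt0 // mulr_gt0 // ltr_wpDl.
pose d := r * e / 2; have d0 : 0 < d by rewrite divr_gt0 // mulr_gt0.
have [N0 hN0] := sum_cauchy G0 hM d0.
pose A := \sum_(k <- zr N0) (`|al k| + `|be k|).
have A0 : 0 <= A by apply: sumr_ge0 => k _; rewrite addr_ge0.
pose dl := e / (4 * (A + 1)); have dl0 : 0 < dl by rewrite divr_gt0 // mulr_gt0 // ltr_wpDl.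
apply: filterS (filterI near_ge0 (wu dl0)) => t [t0 wd].
have Hw := wE t0; have hw' := H1le_cper Hw.
have -> : Lf (u t) = Lf (w t) + Lf (cst l).
  rewrite -[Lf (w t)]mul1r -(lin 1 (H1le_H1T Hw) (cst_H1T l)).
  by congr Lf; apply/funext => x; rewrite /w /=; ring.
rewrite opprD addrCA subrr addr0 normrN; apply: le_trans (functional_le Hw r0 hN0) _.
have h1 : `|\sum_(k <- zr N0) (ca (w t) k * al k + sa (w t) k * be k)| <= e / 4.
  apply: (@le_trans _ _ (dl * A)).
    apply: le_trans (ler_norm_sum _ _ _) _; rewrite mulr_sumr; apply: ler_sum => k _.
    have [c1 c2] := coef_abs_le k hw'.1 wd; rewrite -/(w t) in c1 c2.
    apply: le_trans (ler_normD _ _) _; rewrite [`|ca _ _ * _|]normrM [`|sa _ _ * _|]normrM mulrDr.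
    by apply: lerD; apply: ler_wpM2r.
  rewrite /dl mulrAC ler_pdivrMr ?mulr_gt0 ?ltr_wpDl //.
  by have -> : e / 4 * (4 * (A + 1)) = e * (A + 1) by [field]; rewrite ler_pM2l // lerDl.
have h2 : r / 2 * M2 <= e / 4.
  have -> : r / 2 * M2 = e * M2 / (4 * (M2 + 1)) by rewrite /r; field; rewrite gt_eqF // ltr_wpDl.
  rewrite ler_pdivrMr ?mulr_gt0 ?ltr_wpDl //.
  by have -> : e / 4 * (4 * (M2 + 1)) = e * (M2 + 1) by [field]; rewrite ler_pM2l // lerDl.
have h3 : (2 * r)^-1 * d = e / 4 by rewrite /d; field; rewrite gt_eqF.
by move: h1; rewrite /w h3 => h1; lra.
Qed.

End Functional.
End Weighted.
End Convergence.

Theorem theorem1p3 (R : realType) (a : R -> R) (ha : smoothT a)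
    (a_neq0 : exists x, a x <> 0) (j : 'I_2) (u0 : R -> R) (hu0 : H1T u0) :
  exists u : R -> R -> R,
    [/\ solution j a u0 u,
        forall v, solution j a u0 v -> forall t, 0 <= t -> aeq (v t) (u t),
        weak_cvg_H1 u (cst (limit_mean j u0)) &
        forall s : R, s < 1 ->
          Hnorm s (u t - cst (limit_mean j u0)) @[t --> +oo] --> 0%E].
Proof.
have [db [ddb [hb dvb dvdb cddb]]] := smoothT_sqr ha.
pose b x := a x ^+ 2; have cdb := dv_ct dvdb.
have b0 x : 0 <= b x by exact: sqr_ge0.
have L0 := @period_gt0 R.
pose jb := j == 0 :> nat.
have [M M0 hM] := H1T_Hnorm_fin hu0; have [S [HS u0S hc hs]] := H1T_rep hu0.1 hM.
set E := pi *+ 2 * M ^+ 2 in HS; have E0 : 0 <= E by rewrite mulr_ge0 ?sqr_ge0 // ltW.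
have Su0 : aeq S u0 by apply: aeS u0S => x ->.
have [C C0 HC] := damped_H1 hb cdb dvb b0 jb.
(* By [H1le_sup] the flow never exceeds this number at nonnegative times. The energy bound holds for
   every Lipschitz flux, so truncating at [B] before the flow is constructed is not circular. *)
pose B := Num.sqrt (2 * E); have B0 : 0 <= B by exact: sqrtr_ge0.
have [g [Lg [cg Lg0 lipg gf]]] := trunc_flux B0.
have hbe := cper_beta hb jb; have hc0 := cper_c0 hb jb; have hc1 := cper_c1 hb cdb dvb jb.
have [u fu] := flow_existence cg hbe hc0 hc1 Lg0 lipg (H1le_cper HS).
have [uE dampC obsC] := HC g Lg S u E cg Lg0 lipg HS fu.
have uB t x : 0 <= t -> `|u t x| <= B.
  have E2 : 0 <= 2 * E by apply: mulr_ge0.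
  by move=> t0; rewrite -ler_sqr ?nnegrE // real_normK ?num_real // sqr_sqrtr //; exact: H1le_sup (uE t t0).
pose l := limit_mean j u0.
have lE : l = if jb then 0 else (pi *+ 2)^-1 * intg S 0 (pi *+ 2).
  rewrite /l /limit_mean /jb; case: ifP => // _; congr (_ * _).
  have := hc 0; rewrite /mca /ca => /(mulIf (invr_neq0 (@period_neq0 R))).
  have c1 y : cx 0 y = 1 :> R by rewrite /cx mul0r cos0.
  rewrite (_ : (fun x => u0 x * cx 0 x) = u0); last by apply/funext => x; rewrite c1 mulr1.
  by move=> ->; apply: intg_ext => x; rewrite c1 mulr1.
have ul x : u t x @[t --> +oo] --> l.
  rewrite lE; have [x0 ax0] := a_neq0.
  have bx0 : 0 < b x0 by rewrite lt_neqAle b0 eq_sym expf_eq0 /= andbT; apply/eqP.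
  pose m := b x0 / 2; have m0 : 0 < m by rewrite divr_gt0.
  have /cvgrPdist_le/(_ m m0) /nbhs_ballP[d d0 hd] := hb.1 x0.
  (* Half the width of the arc: the first bound keeps [b] above half of [b x0], the second keeps the
     arc within one period. *)
  pose r := Num.min (d / 2) (pi *+ 2 / 2).
  have r0 : 0 < r by rewrite lt_min !divr_gt0.
  have rd : r <= d / 2 by rewrite ge_min lexx.
  have rL : r <= pi *+ 2 / 2 by rewrite ge_min lexx orbT.
  have bm s : x0 - r <= s <= x0 + r -> m <= b s.
    move=> /andP[s1 s2]; have : ball x0 d s.
      by rewrite /ball /= ltr_norml; apply/andP; move: (d0 : 0 < d) => d0'; split; lra.
    by move=> /hd; rewrite ler_norml => /andP[_]; rewrite -/(b x0) -/(b s) /m; lra.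
  have Cm : C * E <= (C + pi *+ 2 / m) * E by rewrite ler_wpM2r // lerDl divr_ge0 // ltW.
  apply: (@flow_cvg R b db jb g S u Lg B E ((C + pi *+ 2 / m) * E) (x0 - r) (x0 + r) m hb cdb dvb cg Lg0 lipg gf fu uB uE) => //.
  - by move=> t y t0; apply: le_trans (dampC t y t0) Cm.
  - move=> t y z t0 h1 h2 h3; apply: obsC => //; first by rewrite h2 /=; lra.
    by move=> s /andP[s1 s2]; apply: bm; rewrite (le_trans h1 s1) (le_trans s2 h3).
  - by lra.
  - by lra.
have uu := unif_cvg E0 uE ul.
pose E' := 2 * E + 2 * (2 * (pi *+ 2) * `|l| ^+ 2).
have wE t : 0 <= t -> H1le E' (fun x => u t x - l).
  move=> t0; apply: (H1le_add (uE t t0)).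
  have pc : periodic (fun _ : R => - l) (pi *+ 2) by [].
  have hl x : is_derive x (1 : R) (fun _ : R => - l) 0 by exact: dv_cst.
  have cc : continuous (fun _ : R => 0 : R) by exact: ct_cst.
  by apply: (H1le_small (normr_ge0 l) pc hl cc) => x; rewrite ?normrN ?normr0.
exists u; split.
- exact: (flow_solution hb dvb dvdb cddb cg gf fu E0 HS uB Su0).
- move=> v [vt [vC1 veq v0]] t t0.
  exact: (solution_unique hb dvb dvdb cddb gf fu HS hu0 Su0 uB vC1 veq v0 t0).
- by move=> Lf hL; exact: (functional_cvg wE uu hL).
- by move=> s s1; exact: (Hs_cvg wE uu s1).
Qed.
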